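(* Let $X$ and $C$ be independent nonnegative random variables with distribution functions $F$ and $G$, let $(X_i,C_i)$, $i\ge1$, be i.i.d. copies of $(X,C)$, and let $\hat F_n$ be the Kaplan–Meier estimator of $F$ based on the right-censored data $(Z_i,\Delta_i)=(X_i\wedge C_i,1_{\{X_i\le C_i\}})$, $1\le i\le n$. Let $\Lambda$ be the cumulative hazard function of $F$, $\Delta\Lambda(u)=\Lambda(u)-\Lambda(u-)$, and $\overline H(t)=P(X\wedge C\ge t)$. Let $\tau>0$ be such that $H(\tau)=P(X\wedge C\le\tau)<1$. Then $\left\{\frac{\sqrt n}{a(n)}(\hat F_n-F),n\ge1\right\}$ satisfies the large deviation principle in $D[0,\tau]$ with speed $a^2(n)$ and rate function $$I^{KM}(\phi)=\sup_{m\ge1,\ t_1,\dots,t_m\in[0,\tau]}\ \sup_{\alpha_1,\dots,\alpha_m\in\mathbb R}\left\{\sum_{i=1}^m\phi(t_i)\alpha_i-\frac12\sum_{k,j=1}^m\alpha_k\alpha_j\int_{[0,t_k\wedge t_j]}\frac{(1-F(t_k))(1-F(t_j))}{(1-\Delta\Lambda(u))\overline H(u)}\,d\Lambda(u)\right\}.$$ In particular, for any $r>0$, $$\lim_{n\to\infty}\frac1{a^2(n)}\log P\left(\frac{\sqrt n}{a(n)}\sup_{x\in[0,\tau]}|\hat F_n(x)-F(x)|\ge r\right)=-\frac{r^2}{2\sigma_{KM}^2},$$ where $$\sigma_{KM}^2=\sup_{t\in[0,\tau]}(1-F(t))^2\int_{(0,t]}\frac1{(1-\Delta\Lambda(u))\overline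 H(u)}\,d\Lambda(u)$$ (the right-hand side is read as $-\infty$ if $\sigma_{KM}^2=0$).
   Context: $a(n)$ is a sequence of positive reals with $a(n)\to\infty$ and $a(n)/\sqrt n\to0$. $D[0,\tau]$ is the space of right-continuous functions with left limits on $[0,\tau]$ with the uniform norm. Let $\overline F(t)=P(X\ge t)$, $\Lambda(t)=\int_{[0,t]}\frac1{\overline F(s)}dF(s)$, $H_n^{uc}(t)=\frac1n\sum_{i=1}^n1_{\{Z_i\le t,\Delta_i=1\}}$, $\overline H_n(t)=\frac1n\sum_{i=1}^n1_{\{Z_i\ge t\}}$, and $\Lambda_n(t)=\int_{[0,t]}\frac1{\overline H_n(s)}dH_n^{uc}(s)$ (Nelson–Aalen estimator). It is assumed that $F(0)=0$, so that $1-F(t)=\prod_{0<s\le t}(1-d\Lambda(s))$, where $\prod_{0<s\le t}(1-dA(s))$ denotes the product integral, i.e. the limit of $\prod_i\bigl(1-(A(s_i)-A(s_{i-1}))\bigr)$ over partitions $0=s_0<\dots<s_k=t$ with mesh tending to $0$. The Kaplan–Meier estimator is defined by $1-\hat F_n(t)=\prod_{0<s\le t}(1-d\Lambda_n(s))$ (for the step function $\Lambda_n$ this is the finite product of $1-\Delta\Lambda_n(s)$ over the jump points $s\in(0,t]$). Large deviation principle (LDP). For random maps $W_n$ on a probability space with values in a metric space $\mathcal X$, positive $\lambda(n)\to\infty$, and $I:\mathcal X\to[0,\infty]$ with $\{I\le L\}$ compact for all $L\in\mathbb R$ (rate function), $\{W_n\}$ satisfies the LDP with speed $\lambda(n)$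 and rate function $I$ if $\liminf_n\frac1{\lambda(n)}\log P_*(W_n\in U)\ge-\inf_UI$ for every open measurable $U$ and $\limsup_n\frac1{\lambda(n)}\log P^*(W_n\in K)\le-\inf_KI$ for every closed measurable $K$, where $P_*$, $P^*$ are inner and outer probability ($\inf\emptyset=+\infty$, $\log 0=-\infty$). *)

(* Defs.v *)
From HB Require Import structures.
From mathcomp Require Import all_boot all_order all_algebra.
From mathcomp Require Import finmap.
From mathcomp Require Import all_classical all_reals all_analysis.
From mathcomp Require Import measurable_realfun.

Set Implicit Arguments.
Unset Strict Implicit.
Unset Printing Implicit Defensive.

Import Order.TTheory GRing.Theory Num.Theory.
Import numFieldNormedType.Exports.

Local Open Scope classical_set_scope.
Local Open Scope ring_scope.

Section ldp.
Context d (T : measurableType d) (R : realType) (P : probability T R).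
Local Open Scope ereal_scope.

Definition outer_prob (A : set T) : \bar R :=
  ereal_inf [set P B | B in [set B | measurable B /\ A `<=` B]].

Definition inner_prob (A : set T) : \bar R :=
  ereal_sup [set P B | B in [set B | measurable B /\ B `<=` A]].

Definition rate_function (X : metricType R) (I : X -> \bar R) : Prop :=
  (forall x, 0 <= I x) /\ forall L : R, compact [set x | I x <= L%:E].

(* The index n = 0 plays no role: a speed is a sequence (lambda n), n >= 1. *)
Definition speed (lambda : nat -> R) : Prop :=
  (forall n, (0 < n)%N -> (0 < lambda n)%R) /\ lambda n @[n --> \oo] --> +oo%R.

(* Measurability is with respect to the Borel sigma-algebra, so that all the
   open (resp. closed) sets qualify; W n itself need not be measurable. *)
Definition LDP (X : metricType R) (W : nat -> T -> X) (lambda : nat -> R)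
    (I : X -> \bar R) : Prop :=
  [/\ speed lambda, rate_function I,
      forall U : set X, open U ->
        - ereal_inf [set I x | x in U] <=
        limn_einf (fun n =>
          ((lambda n)^-1)%:E * lne (inner_prob (W n @^-1` U)))
    & forall K : set X, closed K ->
        limn_esup (fun n =>
          ((lambda n)^-1)%:E * lne (outer_prob (W n @^-1` K)))
        <= - ereal_inf [set I x | x in K] ].

End ldp.

Section cadlag_space.
Context (R : realType) (tau : R).

Definition cadlag (f : R -> R) : Prop :=
  forall t, 0 <= t <= tau ->
    (t < tau -> f x @[x --> t^'+] --> f t) /\
    (0 < t -> cvg (f x @[x --> t^'-])).

(* A function on [0, tau] is represented by its extension by 0 to R. *)
Definition cadlag0 : {pred R -> R} := fun f =>
  `[< cadlag f /\ forall t, ~~ (0 <= t <= tau) -> f t = 0 >].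

Structure skorokhod := Skorokhod { path_of : R -> R; _ : path_of \in cadlag0 }.

End cadlag_space.

Coercion path_of : skorokhod >-> Funclass.
HB.instance Definition _ (R : realType) (tau : R) :=
  [isSub for @path_of R tau].
HB.instance Definition _ (R : realType) (tau : R) :=
  [Choice of skorokhod tau by <:].

Section skorokhod_module.
Context (R : realType) (tau : R).

Lemma cadlag0_submod_closed : submod_closed (@cadlag0 R tau).
Proof.
split.
  apply/asboolP; split=> // t _; split=> _; first exact: cvg_cst.
  exact: is_cvg_cst.
move=> k f g /asboolP[cf f0] /asboolP[cg g0]; apply/asboolP; split.
  move=> t t01; have [fr fl] := cf _ t01; have [gr gl] := cg _ t01.
  split=> [tt|t0].
    by apply: cvgD; [apply: cvgZl_tmp; exact: fr|exact: gr].
  by apply: is_cvgD; [apply: is_cvgZl_tmp; exact: fl|exact: gl].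
move=> t t01; change (k * f t + g t = 0).
by rewrite f0// g0// addr0 mulr0.
Qed.

HB.instance Definition _ := GRing.isSubmodClosed.Build R (R -> R)
  (@cadlag0 R tau) cadlag0_submod_closed.
HB.instance Definition _ := [SubChoice_isSubLmodule of skorokhod tau by <:].

Lemma skorokhodP (phi : skorokhod tau) :
  cadlag tau phi /\ forall t, ~~ (0 <= t <= tau) -> phi t = 0.
Proof. by case: phi => f /= /asboolP. Qed.

Lemma cadlag_bounded (f : R -> R) : cadlag tau f ->
  exists M, forall t, 0 <= t <= tau -> `|f t| <= M.
Proof.
move=> cf.
have /compact_near_coveringP/near_covering_withinP := @segment_compact R 0 tau.
move=> /(_ R +oo%R (fun M t => `|f t| <= M)) [].
- move=> t /=; rewrite in_itv/= => t01.
  have [fr fl] := cf _ t01.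
  have [Mr Hr] : exists Mr, \forall x \near t^'+, 0 <= x <= tau -> `|f x| <= Mr.
    have [/fr {}fr|tt] := ltP t tau.
      exists (`|f t| + 1).
      have /cvgr_dist_lt/(_ 1 ltr01) := fr; apply: filterS => x fx _.
      rewrite -[f x](subKr (f t)) (le_trans (ler_normB _ _))// lerD2l.
      exact: ltW.
    exists 0; near=> x => /andP[_ xt].
    suff : x <= t by rewrite leNgt; case/negP; near: x; exact: nbhs_right_gt.
    exact: le_trans tt.
  have [Ml Hl] : exists Ml, \forall x \near t^'-, 0 <= x <= tau -> `|f x| <= Ml.
    have [/fl /cvg_ex[l {}fl]|tt] := ltP 0 t.
      exists (`|l| + 1).
      have /cvgr_dist_lt/(_ 1 ltr01) := fl; apply: filterS => x fx _.
      rewrite -[f x](subKr l) (le_trans (ler_normB _ _))// lerD2l.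
      exact: ltW.
    exists 0; near=> x => /andP[x0 _].
    suff : t <= x by rewrite leNgt; case/negP; near: x; exact: nbhs_left_lt.
    exact: le_trans tt _.
  pose M0 := Num.max `|f t| (Num.max Mr Ml).
  exists ([set x | 0 <= x <= tau -> `|f x| <= M0], [set M | M0 <= M]).
    split; last by exists M0; split=> [|M /ltW//]; exact: num_real.
    rewrite /M0; move: Hr Hl; rewrite !near_withinE => Hr Hl.
    near=> x => /= x01; have [xt|xt|->] := ltgtP x t.
    + rewrite !le_max; suff -> : `|f x| <= Ml by rewrite !orbT. move: x01.
      by move: xt; near: x.
    + rewrite !le_max; suff -> : `|f x| <= Mr by rewrite orbT. move: x01.
      by move: xt; near: x.
    + by rewrite !le_max lexx.
  by move=> [x M]/= [xM MM]; rewrite in_itv/= => /xM /le_trans; apply.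
- move=> M [_ HM]; exists (M + 1) => t t01.
  by apply: (HM (M + 1)); [rewrite ltrDl|rewrite /= in_itv].
Unshelve. all: by end_near.
Qed.

Definition unorm (phi : skorokhod tau) : R :=
  sup [set `|phi t| | t in `[0, tau]].

Let bnd (phi : skorokhod tau) : has_ubound [set `|phi t| | t in `[0, tau]].
Proof.
have [M HM] := cadlag_bounded (proj1 (skorokhodP phi)).
by exists M => _ [t /= t01 <-]; apply: HM; rewrite in_itv/= in t01.
Qed.

Let le_unorm (phi : skorokhod tau) t : 0 <= t <= tau -> `|phi t| <= unorm phi.
Proof. by move=> t01; apply: ub_le_sup => //; exists t => //=; rewrite in_itv. Qed.

Let unorm_le (phi : skorokhod tau) M :
  0 <= M -> (forall t, 0 <= t <= tau -> `|phi t| <= M) -> unorm phi <= M.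
Proof.
move=> M0 H; have [tau0|tau0] := leP 0 tau.
  apply: ge_sup; first by exists `|phi 0|, 0 => //=; rewrite in_itv/= lexx.
  by move=> _ [t /= + <-]; rewrite in_itv; exact: H.
rewrite /unorm set_itv_ge ?image_set0 ?sup0// bnd_simp -ltNge//.
Qed.

Let unorm_ge0 (phi : skorokhod tau) : 0 <= unorm phi.
Proof.
have [tau0|tau0] := leP 0 tau.
  by rewrite (le_trans (normr_ge0 (phi 0)))// le_unorm// lexx.
by rewrite /unorm set_itv_ge ?image_set0 ?sup0// bnd_simp -ltNge.
Qed.

Let unormD (phi psi : skorokhod tau) : unorm (phi + psi) <= unorm phi + unorm psi.
Proof.
apply: unorm_le => [|t t01]; first by rewrite addr_ge0.
by rewrite (le_trans (ler_normD _ _))// lerD// le_unorm.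
Qed.

Let unormZ_le (k : R) (phi : skorokhod tau) : unorm (k *: phi) <= `|k| * unorm phi.
Proof.
apply: unorm_le => [|t t01]; first by rewrite mulr_ge0.
by rewrite [leLHS]normrM ler_wpM2l// le_unorm.
Qed.

Let unormZ (k : R) (phi : skorokhod tau) : unorm (k *: phi) = `|k| * unorm phi.
Proof.
apply/eqP; rewrite eq_le unormZ_le/=.
have [->|k0] := eqVneq k 0; first by rewrite normr0 mul0r.
rewrite -ler_pdivlMl ?normr_gt0// -normfV.
by rewrite -{1}[phi](scalerK k0) unormZ_le.
Qed.

Let unorm_eq0 (phi : skorokhod tau) : unorm phi = 0 -> phi = 0.
Proof.
move=> phi0; apply/val_inj/funext => t /=.
have [t01|t01] := boolP (0 <= t <= tau); last by rewrite (skorokhodP phi).2.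
by apply/eqP; rewrite -normr_le0 -phi0 le_unorm.
Qed.

HB.instance Definition _ := Lmodule_isNormed.Build R (skorokhod tau)
  unormD unormZ unorm_eq0.

Let dist (phi psi : skorokhod tau) : R := `|phi - psi|.

Let dist_ge0 phi psi : 0 <= dist phi psi. Proof. exact: normr_ge0. Qed.

Let dist_eq0 phi psi : dist phi psi = 0 -> phi = psi.
Proof. by move/normr0_eq0/eqP; rewrite subr_eq0 => /eqP. Qed.

Let ball_dist phi e : ball phi e = [set psi | dist phi psi < e].
Proof. by rewrite -ball_normE. Qed.

HB.instance Definition _ := PseudoMetric_isMetric.Build R (skorokhod tau)
  dist_ge0 dist_eq0 ball_dist.

Lemma skorokhod_normE (phi : skorokhod tau) :
  `|phi| = sup [set `|phi t| | t in `[0, tau]].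
Proof. by []. Qed.

Lemma restrict_cadlag0 (f : R -> R) : cadlag tau f -> f \_ `[0, tau] \in cadlag0 tau.
Proof.
move=> cf; apply/asboolP; split=> [t t01|t t01]; last first.
  by rewrite patchE ifF//; apply/negbTE; rewrite mem_setE in_itv.
have [fr fl] := cf _ t01; split=> [tt|t0].
  have -> : (f \_ `[0, tau]) t = f t by rewrite patchE mem_setE in_itv/= t01.
  apply: cvg_trans (fr tt); apply: near_eq_cvg; near=> x.
  rewrite patchE mem_setE in_itv ifT//=; apply/andP; split.
    by case/andP: t01 => /le_trans t0 _; apply: t0; near: x; exact: nbhs_right_ge.
  by near: x; exact: nbhs_right_le.
move/cvg_ex: (fl t0) => [l {}fl]; apply/cvg_ex; exists l.
apply: cvg_trans fl; apply: near_eq_cvg; near=> x.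
rewrite patchE mem_setE in_itv ifT//=; apply/andP; split.
  by near: x; exact: nbhs_left_ge.
by case/andP: t01 => _; apply: le_trans; near: x; exact: nbhs_left_le.
Unshelve. all: by end_near.
Qed.

Definition to_skorokhod (f : R -> R) (cf : cadlag tau f) : skorokhod tau :=
  Skorokhod (restrict_cadlag0 cf).

End skorokhod_module.

Section product_integral.
Context (R : realType).

(* The partition 0 = s_0 < s_1 < ... < s_k = t is coded by [:: s_1; ...; s_k];
   the path condition says that its mesh is smaller than e. *)
Definition fine_partition (t e : R) : set (seq R) :=
  [set s | itv_partition 0 t s /\ path (fun x y => y - x < e) 0 s].

Definition mesh_filter (t : R) : set_system (seq R) :=
  filter_from [set e | 0 < e] (fine_partition t).

Definition partition_prod (A : R -> R) (s : seq R) : R :=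
  \prod_(p <- pairmap (fun x y => 1 - (A y - A x)) 0 s) p.

Definition product_integral (A : R -> R) (t : R) : R :=
  lim (partition_prod A s @[s --> mesh_filter t]).

Let pprod (A : R -> R) (x : R) (s : seq R) : R :=
  \prod_(p <- pairmap (fun x y => 1 - (A y - A x)) x s) p.

Let pprod_cons A x y s : pprod A x (y :: s) = (1 - (A y - A x)) * pprod A y s.
Proof. by rewrite /pprod /= big_cons. Qed.

Let pprod_const (A : R -> R) (a b : R) (s : seq R) : itv_partition a b s ->
  (forall x, a <= x <= b -> A x = A a) -> pprod A a s = 1.
Proof.
elim: s a => [|y s IH] a; first by rewrite /pprod big_nil.
move=> ps HA; rewrite pprod_cons.
have ay : a < y by case: ps => /= /andP[].
have pys := itv_partition_cons ps.
have yb := itv_partition_le pys.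
have Ay : A y = A a by rewrite HA// (ltW ay).
rewrite Ay subrr subr0 mul1r; apply: IH => // x /andP[yx xb].
by rewrite Ay HA// xb andbT (le_trans (ltW ay)).
Qed.

Let pprod_cat A x s1 s2 :
  pprod A x (s1 ++ s2) = pprod A x s1 * pprod A (last x s1) s2.
Proof.
elim: s1 x => [|y s IH] x /=; first by rewrite [pprod A x [::]]big_nil mul1r.
by rewrite !pprod_cons IH mulrA.
Qed.

Let shrink (A : R -> R) (e a b c : R) (s : seq R) : a <= b -> b <= c ->
  (forall x, b <= x <= c -> A x = A b) ->
  itv_partition a c s -> path (fun x y => y - x < e) a s ->
  exists s', [/\ itv_partition a b s', path (fun x y => y - x < e) a s' &
    pprod A a s' = pprod A a s].
Proof.
move=> + bc HA; elim: s a => [|y s IH] a ab ps.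
  move=> _; exists [::]; split => //; case: ps => _ /= /eqP ac.
  by split=> //=; rewrite eq_le ab ac bc.
move=> /= /andP[ya ms].
have ay : a < y by case: ps => /= /andP[].
have pys := itv_partition_cons ps.
have yc := itv_partition_le pys.
have [yb|yb] := leP y b.
  have [s' [ps' ms' e']] := IH _ yb pys ms.
  exists (y :: s'); split; rewrite /= ?ya ?pprod_cons ?e'//.
  by case: ps' => p' l'; split; rewrite //= ay p'.
have Ay : A y = A b by rewrite HA// (ltW yb).
have es : pprod A y s = 1.
  apply: (pprod_const pys) => x /andP[yx xc]; rewrite Ay HA// xc andbT.
  exact: le_trans (ltW yb) _.
rewrite pprod_cons es mulr1 Ay.
have [->|ba] := eqVneq b a.
  by exists [::]; split => //; rewrite [LHS]big_nil subrr subr0.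
exists [:: b]; split.
- by apply: itv_partition1; rewrite lt_neqAle eq_sym ba.
- by rewrite /= andbT (lt_trans _ ya)// ltrD2r.
- by rewrite pprod_cons [pprod _ _ [::]]big_nil mulr1.
Qed.

Let fine_ex (e a b : R) : 0 < e -> a <= b ->
  exists s, itv_partition a b s /\ path (fun x y => y - x < e) a s.
Proof.
move=> e0 ab.
have [n] : exists n : nat, b - a <= n%:R * (e / 2).
  exists (Num.truncn ((b - a) / (e / 2))).+1.
  by rewrite -ler_pdivrMr ?divr_gt0// ltW// truncnS_gt.
elim: n a ab => [|n IH] a ab.
  rewrite mul0r subr_le0 => ba; exists [::]; split => //; split => //=.
  by rewrite eq_le ab ba.
move=> abn; have [->|nab] := eqVneq a b; first by exists [::]; split => //; split => /=.
have {nab}ab' : a < b by rewrite lt_neqAle nab.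
have [h|h] := leP (b - a) (e / 2).
  exists [:: b]; split; first exact: itv_partition1.
  by rewrite /= andbT (le_lt_trans h)// gtr_pMr// invf_lt1// ltr1n.
have [||s [ps ms]] := IH (a + e / 2).
- by rewrite -lerBrDl ltW.
- by rewrite opprD addrA lerBlDr (le_trans abn)// -natr1 mulrDl mul1r.
exists (a + e / 2 :: s); split.
  by case: ps => p l; split; rewrite //= ltrDl divr_gt0.
rewrite /= ms andbT addrAC subrr add0r gtr_pMr// invf_lt1// ltr1n//.
Qed.

Lemma product_integral_flat (A : R -> R) (s t : R) : 0 <= s -> s <= t ->
  (forall x, s <= x <= t -> A x = A s) ->
  product_integral A t = product_integral A s.
Proof.
move=> s0 st HA; rewrite /product_integral; congr (lim _).
rewrite predeqE => V; split=> -[e /= e0 eV]; exists e => //= p [pp mp].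
- have [q [pq mq]] := fine_ex e0 st.
  have : V (partition_prod A (p ++ q)).
    apply: eV; split; first exact: itv_partition_cat pp pq.
    by rewrite cat_path mp /=; case: pp => _ /eqP ->.
  rewrite [partition_prod _ _]pprod_cat; case: pp => _ /eqP ->.
  by rewrite (pprod_const pq) ?mulr1.
- have [q [pq mq e']] := shrink s0 st HA pp mp.
  by have : V (partition_prod A q) by [apply: eV]; rewrite /partition_prod [X in V X]e'.
Qed.

End product_integral.

Lemma measurable_inv_nonincreasing (R : realType) (D : set R) (g : R -> R) :
  measurable D -> (forall x, 0 <= g x) -> nonincreasing_fun g ->
  measurable_fun D (fun x => (g x)^-1).
Proof.
move=> mD g0 gni.
apply: (measurability (@RGenCInfty.G R)) => [|/= _ [_] [r] -> <-].
  exact: RGenCInfty.measurableE.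
apply: measurableI => //; apply: is_interval_measurable => s t/=.
rewrite !in_itv/= !andbT => rs rt u /andP[su ut]; rewrite in_itv/= andbT.
have [r0|r0] := leP r 0; first by rewrite (le_trans r0)// invr_ge0.
have gt0 : 0 < g t by rewrite -invr_gt0 (lt_le_trans r0).
have gs0 : 0 < g s by rewrite -invr_gt0 (lt_le_trans r0).
have gu0 : 0 < g u by rewrite (lt_le_trans gt0)// gni.
by rewrite (le_trans rs)// lef_pV2// gni.
Qed.

Section estimators.
Context (R : realType) (n : nat) (z : nat -> R) (delta : nat -> bool).

Definition Hn_uc (t : R) : R :=
  n%:R^-1 * \sum_(i < n) ((z i <= t) && delta i)%:R.

Definition Hn_bar (t : R) : R := n%:R^-1 * \sum_(i < n) (t <= z i)%R%:R.

Let Hn_uc_nd : nondecreasing Hn_uc.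
Proof.
move=> s t st; rewrite ler_wpM2l ?invr_ge0// ler_sum// => i _.
rewrite ler_nat; case: (leP (z i) s) => //= zs.
by rewrite (le_trans zs st).
Qed.

Let near_right (t : R) : \forall x \near t^'+, Hn_uc x = Hn_uc t.
Proof.
have : \forall x \near t^'+, forall i : 'I_n, (z i <= x) = (z i <= t).
  apply: filter_forall => i; have [zt|tz] := leP (z i) t; near=> x.
    by rewrite (le_trans zt)//; near: x; exact: nbhs_right_ge.
  by apply/negbTE; rewrite -ltNge; near: x; exact: nbhs_right_lt.
by apply: filterS => x xE; congr (_ * _); apply: eq_bigr => i _; rewrite xE.
Unshelve. all: by end_near.
Qed.

Let near_left (t : R) : exists l, \forall x \near t^'-, Hn_uc x = l.
Proof.
exists (n%:R^-1 * \sum_(i < n) ((z i < t) && delta i)%:R).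
have : \forall x \near t^'-, forall i : 'I_n, (z i <= x) = (z i < t).
  apply: filter_forall => i; have [zt|tz] := ltP (z i) t.
    by apply: filterS (nbhs_left_ge zt) => x ->.
  by apply: filterS (nbhs_left_lt t) => x xt; rewrite leNgt (lt_le_trans xt tz).
by apply: filterS => x xE; congr (_ * _); apply: eq_bigr => i _; rewrite xE.
Qed.

Let Hn_uc_rc : right_continuous Hn_uc.
Proof.
by move=> t; apply: cvg_near_cst; exact: near_right.
Qed.

HB.instance Definition _ := isCumulative.Build R _ R Hn_uc Hn_uc_nd Hn_uc_rc.

Definition nelson_aalen (t : R) : R :=
  \int[lebesgue_stieltjes_measure Hn_uc]_(s in `[0, t]) (Hn_bar s)^-1.

Definition kaplan_meier (t : R) : R := 1 - product_integral nelson_aalen t.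

Let measurable_Hn_barV (D : set R) : measurable_fun D (fun s => ((Hn_bar s)^-1)%:E).
Proof.
apply/measurable_EFinP/measurable_funTS.
apply: measurable_inv_nonincreasing => [|s|s t st]; first exact: measurableT.
  by rewrite mulr_ge0// ?sumr_ge0 ?invr_ge0.
rewrite ler_wpM2l ?invr_ge0// ler_sum// => i _.
by rewrite ler_nat; case: (leP t (z i)) => // /(le_trans st) ->.
Qed.

Let nelson_aalen_flat (s t : R) : 0 <= s -> s <= t -> Hn_uc s = Hn_uc t ->
  nelson_aalen s = nelson_aalen t.
Proof.
move=> s0 st sE; rewrite /nelson_aalen /Rintegral; congr fine.
have -> : `[0, t]%classic = `[0, s]%classic `|` `]s, t]%classic :> set R.
  by rewrite -itv_bndbnd_setU// ?bnd_simp.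
have N0 : lebesgue_stieltjes_measure Hn_uc `]s, t]%classic = 0%E.
  rewrite /lebesgue_stieltjes_measure /measure_extension/=.
  rewrite measurable_mu_extE/=; last exact: is_ocitv.
  by rewrite wlength_itv_bnd// sE subrr.
rewrite ge0_integral_setU//=; last 3 first.
- exact: measurable_Hn_barV.
- by move=> x _; rewrite lee_fin invr_ge0 mulr_ge0// ?sumr_ge0 ?invr_ge0.
- rewrite disj_set2E; apply/eqP; rewrite -subset0 => x [] /=.
  by rewrite !in_itv/= => /andP[_ xs] /andP[/(le_lt_trans xs)]; rewrite ltxx.
rewrite [X in (_ + X)%E]null_set_integral ?adde0//.
exact: measurable_Hn_barV.
Qed.

Lemma kaplan_meier_flat (s t : R) : 0 <= s -> s <= t -> Hn_uc s = Hn_uc t ->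
  kaplan_meier s = kaplan_meier t.
Proof.
move=> s0 st sE; congr (1 - _); symmetry; apply: product_integral_flat => //.
move=> x /andP[sx xt]; symmetry; apply: nelson_aalen_flat => //.
by apply/eqP; rewrite eq_le Hn_uc_nd//= sE Hn_uc_nd.
Qed.

Lemma cadlag_kaplan_meier (tau : R) : cadlag tau kaplan_meier.
Proof.
move=> t /andP[t0 _]; split=> [_|{}t0].
  apply: cvg_near_cst; near=> x; symmetry; apply: kaplan_meier_flat => //.
  by symmetry; near: x; exact: near_right.
have [l Hl] := near_left t.
apply/cvg_ex; near t^'- => b; exists (kaplan_meier b).
have b0 : 0 < b by near: b; exact: nbhs_left_gt.
have bl : Hn_uc b = l by near: b.
have bt : b < t by near: b; exact: nbhs_left_lt.
apply: cvg_near_cst; near=> x; symmetry; apply: kaplan_meier_flat.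
- exact: ltW.
- by near: x; exact: nbhs_left_ge.
- by rewrite bl; symmetry; near: x.
Unshelve. all: by end_near.
Qed.

End estimators.

Section laws.
Context d (T : measurableType d) (R : realType) (P : probability T R).

Definition df (X : {RV P >-> R}) (t : R) : R := fine (cdf X t).

Definition surv (Y : T -> R) (t : R) : R := fine (P [set w | t <= Y w]).

Lemma cadlag_df (X : {RV P >-> R}) (tau : R) : cadlag tau (df X).
Proof.
have nd : nondecreasing (df X).
  by move=> s t st; rewrite fine_le ?fin_num_measure// cdf_nondecreasing.
move=> t _; split=> _.
  apply: fine_cvg; rewrite fineK ?fin_num_measure//.
  exact: cdf_right_continuous.
apply: nondecreasing_at_left_is_cvgr; near=> x.
  by move=> y z _ _; exact: nd.
exists 1 => _ [y _ <-].
by rewrite -[1]/(fine 1%E) fine_le ?fin_num_measure// cdf_le1.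
Unshelve. all: by end_near.
Qed.

Definition cumulative_hazard (X : {RV P >-> R}) (t : R) : R :=
  \int[distribution P X]_(s in `[0, t]) (surv X s)^-1.

(* The measure d(cumulative_hazard X). It is given by its density 1 / surv X
   because cumulative_hazard X need not be finite on the whole line, see
   hazard_measureE. *)
Definition hazard_measure (X : {RV P >-> R}) (A : set R) : \bar R :=
  (\int[distribution P X]_(s in A) ((surv X s)^-1)%:E)%E.

Lemma surv_ge0 (Y : T -> R) t : 0 <= surv Y t.
Proof. exact: fine_ge0. Qed.

Let msurv (X : {RV P >-> R}) t : measurable [set w | t <= X w].
Proof.
rewrite [X in measurable X](_ : _ = X @^-1` `[t, +oo[); last first.
  by apply/seteqP; split=> w /=; rewrite in_itv/= andbT.
exact: measurable_funPTI.
Qed.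

Lemma surv_nonincreasing (X : {RV P >-> R}) : nonincreasing_fun (surv X).
Proof.
move=> s t st; rewrite fine_le ?fin_num_measure ?le_measure ?inE//.
by move=> w /= /(le_trans st).
Qed.

Let measurable_survV (X : {RV P >-> R}) (D : set R) :
  measurable_fun D (fun s => ((surv X s)^-1)%:E).
Proof.
apply/measurable_EFinP/measurable_funTS; apply: measurable_inv_nonincreasing.
- exact: measurableT.
- exact: surv_ge0.
- exact: surv_nonincreasing.
Qed.

Let survV_ge0 (X : {RV P >-> R}) s : (0 <= ((surv X s)^-1)%:E)%E.
Proof. by rewrite lee_fin invr_ge0 surv_ge0. Qed.

Section hazard_measure.
Variable X : {RV P >-> R}.

Let hazard0 : hazard_measure X set0 = 0%E.
Proof. by rewrite /hazard_measure integral_set0. Qed.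

Let hazard_ge0 A : (0 <= hazard_measure X A)%E.
Proof. by apply: integral_ge0 => s _; exact: survV_ge0. Qed.

Let hazard_sigma_additive : semi_sigma_additive (hazard_measure X).
Proof.
exact: (semi_sigma_additive_nng_induced (@measurable_survV X setT) (survV_ge0 X)).
Qed.

HB.instance Definition _ := isMeasure.Build _ _ _ (hazard_measure X)
  hazard0 hazard_ge0 hazard_sigma_additive.

End hazard_measure.

Lemma hazard_measure0E (X : {RV P >-> R}) (t : R) : 0 < surv X t ->
  hazard_measure X `[0, t]%classic = (cumulative_hazard X t)%:E.
Proof.
move=> t0; rewrite /cumulative_hazard /Rintegral fineK//.
rewrite ge0_fin_numE; last by apply: integral_ge0 => s _; exact: survV_ge0.
have h : (\int[distribution P X]_(s in `[0%R, t]) ((surv X s)^-1)%:E <=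
    \int[distribution P X]_(s in `[0%R, t]) ((surv X t)^-1)%:E)%E.
  apply: ge0_le_integral => //= s; rewrite in_itv/= => /andP[_ st].
  have ts : surv X t <= surv X s by exact: surv_nonincreasing.
  by rewrite lee_fin lef_pV2 ?posrE// (lt_le_trans t0).
apply: (le_lt_trans h).
rewrite integral_cst//= lte_mul_pinfty// ?lee_fin ?invr_ge0 ?surv_ge0//.
by rewrite (le_lt_trans (probability_le1 _ _))// ltry.
Qed.

Lemma hazard_measureE (X : {RV P >-> R}) (s t : R) : 0 <= s -> s <= t ->
  0 < surv X t -> hazard_measure X `]s, t]%classic =
    (cumulative_hazard X t - cumulative_hazard X s)%:E.
Proof.
move=> s0 st t0; rewrite EFinB -!hazard_measure0E//; last first.
  by rewrite (lt_le_trans t0)// surv_nonincreasing.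
have -> : `]s, t]%classic = `[0, t]%classic `\` `[0, s]%classic :> set R.
  apply/seteqP; split=> x /=; rewrite !in_itv/=.
    by move=> /andP[sx ->]; rewrite (le_trans s0 (ltW sx)) leNgt sx.
  by move=> [/andP[-> ->]]/negP; rewrite andbT -ltNge.
rewrite measureD//= ?setIidr//.
  by apply: subset_itvl; rewrite bnd_simp.
by rewrite hazard_measure0E// ltry.
Qed.

Definition independent (X C : {RV P >-> R}) : Prop :=
  forall A B : set R, measurable A -> measurable B ->
    P (X @^-1` A `&` C @^-1` B) = (P (X @^-1` A) * P (C @^-1` B))%E.

Definition mutually_independent d' (T' : measurableType d')
    (Y : nat -> T -> T') : Prop :=
  forall (J : {fset nat}) (E : nat -> set T'), (forall i, measurable (E i)) ->
    fine (P (\bigcap_(i in [set` J]) Y i @^-1` E i)) =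
    \prod_(i <- J) fine (P (Y i @^-1` E i)).

Definition iid_copies d' (T' : measurableType d') (Y : T -> T')
    (Ys : nat -> T -> T') : Prop :=
  mutually_independent Ys /\
  forall i (E : set T'), measurable E -> P (Ys i @^-1` E) = P (Y @^-1` E).

End laws.

Definition jump (R : realType) (f : R -> R) (u : R) : R :=
  f u - lim (f x @[x --> u^'-]).

Section kaplan_meier_deviation.
Context d (T : measurableType d) (R : realType) (P : probability T R).

(* (X_(i+1), C_(i+1)) of the sample is (Xs i, Cs i). *)
Definition censored_km (Xs Cs : nat -> T -> R) (n : nat) (w : T) : R -> R :=
  kaplan_meier n (fun i => Num.min (Xs i w) (Cs i w))
    (fun i => Xs i w <= Cs i w).

Lemma cadlag_censored_km (Xs Cs : nat -> T -> R) (n : nat) (w : T) (tau : R) :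
  cadlag tau (censored_km Xs Cs n w).
Proof. exact: cadlag_kaplan_meier. Qed.

Definition km_deviation (tau : R) (a : nat -> R) (X : {RV P >-> R})
    (Xs Cs : nat -> T -> R) (n : nat) (w : T) : skorokhod tau :=
  (Num.sqrt n%:R / a n) *:
    (to_skorokhod (cadlag_censored_km Xs Cs n w (tau := tau))
     - to_skorokhod (cadlag_df X (tau := tau))).

Section rate.
Context (tau : R) (X C : {RV P >-> R}).

Definition Hbar : R -> R := surv P (fun w => Num.min (X w) (C w)).

Definition km_rate (phi : skorokhod tau) : \bar R :=
  ereal_sup [set e | exists (m : nat) (t alpha : 'I_m -> R),
    [/\ (0 < m)%N, forall i, 0 <= t i <= tau &
     e = (\sum_(i < m) phi (t i) * alpha i
          - 2^-1 * \sum_(k < m) \sum_(j < m) alpha k * alpha j *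
            \int[hazard_measure X]_(u in `[0, Num.min (t k) (t j)])
              ((1 - df X (t k)) * (1 - df X (t j)) /
               ((1 - jump (cumulative_hazard X) u) * Hbar u)))%:E]].

Definition km_sigma2 : R :=
  sup [set (1 - df X t) ^+ 2 *
           \int[hazard_measure X]_(u in `]0, t])
             (1 / ((1 - jump (cumulative_hazard X) u) * Hbar u))
       | t in `[0, tau] ].

End rate.
End kaplan_meier_deviation.

(* Main.v *)
Require Import Defs.
From HB Require Import structures.
From mathcomp Require Import all_boot all_order all_algebra.
From mathcomp Require Import finmap ring lra.
From mathcomp Require Import all_classical all_reals all_analysis.
From mathcomp Require Import measurable_realfun.

Set Implicit Arguments.
Unset Strict Implicit.
Unset Printing Implicit Defensive.

Import Order.TTheory GRing.Theory Num.Theory.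
Import numFieldNormedType.Exports.

Local Open Scope classical_set_scope.
Local Open Scope ring_scope.

(** The centred Kaplan-Meier estimator is, up to errors that are negligible at
    every exponential order, an average of bounded i.i.d. influence functions,
    and the moderate deviations of such averages are those of the Gaussian
    process with the same covariance.

    Gaussian part.  Let S n be processes whose linear combinations have
    exponential moments asymptotic to the Gaussian ones with covariance Gam, and
    let W n be random paths that are exponentially close to S n at each time and
    whose oscillation is exponentially controlled by finite nets.  Then W n
    satisfies the large deviation principle with the rate function
    [gauss_rate Gam], half the squared norm of the reproducing kernel space
    ([gaussian_ldp]).  The lower bound comes from exponential tilting
    ([tilting_lower_bound]), the upper bound from covering a compact cube of
    values at the points of a net by half-spaces ([ldp_upper_set]).  The same two
    bounds give the logarithmic asymptotics of the uniform norm
    ([gaussian_sup_norm]).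

    Expansion of the estimator.  Let S = 1 - F, let Sn be its estimator, H and Hn
    the survival function of the observed times and its empirical version.  The
    Duhamel identity [duhamel] reads
      S(t) - Sn(t) = Sn(t) D(1_{(0,t]} S_- / (Sn Hn)),
    where D(f) is the average over the sample of the martingale score
    1{0 < X <= tau, X <= C} f(X) - \int_{(0, X /\ C]} f dLambda.  Replacing the
    random weight 1 / (Sn Hn) by its limit 1 / (S H) leads to the influence
    functions.  Since D is evaluated on random weights, bounds are needed that
    are uniform over all nondecreasing weights.  By the layer-cake formula they
    reduce to D(1_J S_-) for intervals J, and the difference of two nondecreasing
    weights that are uniformly close reduces to intervals inside the cells of a
    fine partition of the time axis, plus a finite sum of products of small
    factors ([monotone_weight_close]).  The required bounds on intervals are
    maximal inequalities for empirical processes of monotone functions, proved by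
    chaining along a dyadic clock ([uniform_chaining]).  Together they show that
    the remainder is negligible ([km_remainder], [km_linearization]).

    Covariance.  The score has mean zero, and its variance is computed by
    integration by parts ([score_var]); its jump term produces the factor
    1 - Delta Lambda.  Hence the covariance of the influence functions is
    S(s) S(t) \int_{[0, s /\ t]} dLambda / ((1 - Delta Lambda) H), which is the one
    of the statement ([wlev_var], [km_rateE], [km_sigma2E]). *)

(** * Exponentially negligible events *)

Section negligible_events.
Context d (T : measurableType d) (R : realType) (P : probability T R).
Variable lam : nat -> R.
Hypothesis lam_infty : lam n @[n --> \oo] --> +oo.

(** [A n] has probability of exponential order [L] or smaller at speed [lam].
    Only a measurable cover is bounded, because suprema of paths over
    uncountably many times need not be measurable. *)
Definition negl (L : R) (A : nat -> set T) : Prop :=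
  \forall n \near \oo, exists B, [/\ measurable B, A n `<=` B &
    (P B <= (expR (- (L * lam n)))%:E)%E].

Lemma near_lam_ge (M : R) : \forall n \near \oo, M <= lam n.
Proof. by move: M; exact: (cvgry_ge lam_infty). Qed.

Lemma near_lam_mul_ge (del M : R) : 0 < del -> \forall n \near \oo, M <= del * lam n.
Proof.
move=> del0; near=> n; rewrite -ler_pdivrMl//.
by near: n; exact: near_lam_ge.
Unshelve. all: by end_near. Qed.

Lemma negl_le L L' A : L <= L' -> negl L' A -> negl L A.
Proof.
move=> LL' H; near=> n.
have [B [mB AB PB]] : exists B, [/\ measurable B, A n `<=` B &
    (P B <= (expR (- (L' * lam n)))%:E)%E] by near: n; exact: H.
exists B; split=> //; apply: (le_trans PB); rewrite lee_fin ler_expR lerN2.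
by rewrite ler_wpM2r//; near: n; exact: near_lam_ge.
Unshelve. all: by end_near. Qed.

Lemma negl_sub L A A' : (\forall n \near \oo, A n `<=` A' n) ->
  negl L A' -> negl L A.
Proof.
move=> AA'; apply: filterS2 AA' => n AA' [B [mB AB PB]].
by exists B; split=> //; exact: subset_trans AB.
Qed.

(** The number of sets is a constant factor, which any loss [del] in the
    exponential order absorbs. *)
Lemma negl_exists L del (I : finType) (A : I -> nat -> set T) : 0 < del ->
  (forall i, negl (L + del) (A i)) -> negl L (fun n => [set w | exists i, A i n w]).
Proof.
move=> del0 H; near=> n.
have Kn : #|I|%:R <= expR (del * lam n).
  rewrite (le_trans _ (expR_ge1Dx _))// -lerBlDl.
  by near: n; exact: near_lam_mul_ge.
have /choice[B HB] : forall i, exists B, [/\ measurable B, A i n `<=` B &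
    (P B <= (expR (- ((L + del) * lam n)))%:E)%E].
  by near: n; apply: filter_forall => i; exact: H.
exists (\big[setU/set0]_(i <- enum I) B i); split.
- by apply: bigsetU_measurable => i _; have [] := HB i.
- move=> w [i Aw]; rewrite -bigcup_seq; exists i; first by rewrite /= mem_enum.
  by have [_ + _] := HB i; exact.
- suff h : (P (\big[setU/set0]_(i <- enum I) B i) <=
      (#|I|%:R * expR (- ((L + del) * lam n)))%:E)%E.
    apply: (le_trans h); rewrite lee_fin.
    have -> : expR (- (L * lam n)) =
        expR (del * lam n) * expR (- ((L + del) * lam n)).
      by rewrite -expRD; congr expR; ring.
    by rewrite ler_wpM2r ?expR_ge0.
  rewrite cardE; elim: (enum I) => [|i s IH] /=.
    by rewrite big_nil measure0 mul0r.
  rewrite big_cons (le_trans (measureU2 _ _ _))//.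
  + by have [] := HB i.
  + by apply: bigsetU_measurable => j _; have [] := HB j.
  rewrite -natr1 mulrDl mul1r addrC EFinD leeD//.
  by have [] := HB i.
Unshelve. all: by end_near. Qed.

Lemma neglU L del A A' : 0 < del -> negl (L + del) A -> negl (L + del) A' ->
  negl L (fun n => A n `|` A' n).
Proof.
move=> del0 HA HA'.
have := @negl_exists L del bool (fun b => if b then A else A') del0.
move=> /(_ _)/negl_sub; apply; last by case.
by near=> n => w [Aw|Aw]; [exists true|exists false].
Unshelve. all: by end_near. Qed.

(** What is left after the removal is at least half of the probability, and the
    loss [del] absorbs this factor. *)
Lemma not_negl_setD (I0 L : R) (A : nat -> set T) (N : nat -> set T) :
  I0 < L -> (forall n, measurable (A n)) ->
  (\forall n \near \oo, ((expR (- (I0 * lam n)))%:E <= P (A n))%E) ->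
  negl L N ->
  forall e, 0 < e -> \forall n \near \oo, exists B, [/\ measurable B,
    B `<=` A n `\` N n & ((expR (- ((I0 + e) * lam n)))%:E <= P B)%E].
Proof.
move=> I0L mA HA HN e e0; near=> n.
have [B [mB NB PB]] : exists B, [/\ measurable B, N n `<=` B &
    (P B <= (expR (- (L * lam n)))%:E)%E] by near: n; exact: HN.
exists (A n `\` B); split.
- exact: measurableD.
- by move=> w [Aw nBw]; split=> // /NB.
have PAn : ((expR (- (I0 * lam n)))%:E <= P (A n))%E by near: n; exact: HA.
have half x : 1 <= x -> expR (- x) <= 2^-1 :> R.
  move=> x1; rewrite expRN lef_pV2 ?posrE ?expR_gt0//.
  by rewrite (le_trans _ (expR_ge1Dx _))//; lra.
have h1 : expR (- ((L - I0) * lam n)) <= 2^-1.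
  by apply: half; near: n; apply: near_lam_mul_ge; rewrite subr_gt0.
have h2 : expR (- (e * lam n)) <= 2^-1.
  by apply: half; near: n; exact: near_lam_mul_ge.
have key : expR (- ((I0 + e) * lam n)) <=
    expR (- (I0 * lam n)) - expR (- (L * lam n)).
  have -> : expR (- ((I0 + e) * lam n)) =
      expR (- (I0 * lam n)) * expR (- (e * lam n)).
    by rewrite -expRD; congr expR; ring.
  have -> : expR (- (L * lam n)) =
      expR (- (I0 * lam n)) * expR (- ((L - I0) * lam n)).
    by rewrite -expRD; congr expR; ring.
  have := expR_gt0 (- (I0 * lam n)); nra.
rewrite (@le_trans _ _ (P (A n) - P B)%E)//.
  rewrite -(@fineK _ (P (A n))) ?fin_num_measure// -(@fineK _ (P B)) ?fin_num_measure//.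
  rewrite lee_fin (le_trans key)// lerB// -lee_fin ?fineK ?fin_num_measure//.
rewrite leeBlDr ?fin_num_measure//.
rewrite (le_trans _ (measureU2 _ (measurableD (mA n) mB) mB))//.
apply: le_measure; rewrite ?inE//; first by apply: measurableU => //; exact: measurableD.
by move=> w Aw; have [Bw|nBw] := pselect (B w); [right|left].
Unshelve. all: by end_near. Qed.

End negligible_events.

Section ldp_criteria.
Context d (T : measurableType d) (R : realType) (P : probability T R).
Variable lam : nat -> R.
Hypothesis lam_gt0 : forall n, (0 < n)%N -> 0 < lam n.

Lemma limn_esup_le (u : (\bar R)^nat) (l : \bar R) :
  (\forall n \near \oo, (u n <= l)%E) -> (limn_esup u <= l)%E.
Proof.
move=> H; have -> : limn_esup u = ereal_inf
  [set ereal_sup [set u n | n in V] | V in \oo] by [].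
apply: (@le_trans _ _ (ereal_sup [set u n | n in [set n | u n <= l]%E])).
  by apply: ereal_inf_lbound; exists [set n | u n <= l]%E.
by apply: ge_ereal_sup => _ [n /= un <-].
Qed.

Lemma limn_einf_ge (u : (\bar R)^nat) (l : \bar R) :
  (\forall n \near \oo, (l <= u n)%E) -> (l <= limn_einf u)%E.
Proof.
move=> H; rewrite /limn_einf leeNr; apply: limn_esup_le.
by apply: filterS H => n; rewrite leeN2.
Qed.

Lemma le_by_reals (x v : \bar R) :
  (forall L : R, (L%:E < v)%E -> (L%:E <= x)%E) -> (v <= x)%E.
Proof.
case: v => [v||] H; last by rewrite leNye.
- apply/lee_subgt0Pr => e e0; rewrite -EFinB; apply: H.
  by rewrite lte_fin ltrBlDr ltrDl.
- case: x H => [x||] // H; first by have := H (x + 1) (ltry _); rewrite lee_fin gerDl ler10.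
  by have := H 0 (ltry _).
Qed.

Lemma lne_le_expR (x : \bar R) (y : R) :
  (0 <= x)%E -> (x <= (expR y)%:E)%E -> (lne x <= y%:E)%E.
Proof.
move=> x0 xy; have -> : y%:E = lne (expR y)%:E by rewrite lne_EFin ?expR_gt0// expRK.
by rewrite lee_lne// in_itv/= ?x0 leey// lee_fin expR_ge0.
Qed.

Lemma lne_ge_expR (x : \bar R) (y : R) :
  ((expR y)%:E <= x)%E -> (y%:E <= lne x)%E.
Proof.
move=> xy; have -> : y%:E = lne (expR y)%:E by rewrite lne_EFin ?expR_gt0// expRK.
rewrite lee_lne// in_itv/= leey andbT ?lee_fin ?expR_ge0//.
by apply: le_trans xy; rewrite lee_fin expR_ge0.
Qed.

Lemma scaled_lne_le n (x : \bar R) (L : R) : (0 < n)%N -> (0 <= x)%E ->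
  (x <= (expR (- (L * lam n)))%:E)%E ->
  (((lam n)^-1)%:E * lne x <= (- L)%:E)%E.
Proof.
move=> n0 x0 /(lne_le_expR x0) h.
have l0 := lam_gt0 n0.
rewrite (le_trans (lee_wpmul2l _ h)) ?lee_fin ?invr_ge0 ?(ltW l0)//.
by rewrite mulrN mulrC mulfK// lt0r_neq0.
Qed.

Lemma scaled_lne_ge n (x : \bar R) (L : R) : (0 < n)%N ->
  ((expR (- (L * lam n)))%:E <= x)%E ->
  ((- L)%:E <= ((lam n)^-1)%:E * lne x)%E.
Proof.
move=> n0 /lne_ge_expR h.
have l0 := lam_gt0 n0.
rewrite (le_trans _ (lee_wpmul2l _ h)) ?lee_fin ?invr_ge0 ?(ltW l0)//.
by rewrite mulrN mulrC mulfK// lt0r_neq0.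
Qed.

Lemma limsup_scaled_lne_le (v : \bar R) (x : nat -> \bar R) :
  (forall n, (0 <= x n)%E) ->
  (forall L : R, (L%:E < v)%E ->
    \forall n \near \oo, (x n <= (expR (- (L * lam n)))%:E)%E) ->
  (limn_esup (fun n => ((lam n)^-1)%:E * lne (x n)) <= - v)%E.
Proof.
move=> x0 H; rewrite leeNr; apply: le_by_reals => L Lv.
rewrite leeNr -EFinN; apply: limn_esup_le; near=> n; apply: scaled_lne_le => //.
  by near: n; exists 1%N.
by near: n; exact: H.
Unshelve. all: by end_near. Qed.

Lemma liminf_scaled_lne_ge (v : \bar R) (x : nat -> \bar R) :
  (forall L : R, (v < L%:E)%E ->
    \forall n \near \oo, ((expR (- (L * lam n)))%:E <= x n)%E) ->
  (- v <= limn_einf (fun n => ((lam n)^-1)%:E * lne (x n)))%E.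
Proof.
move=> H; apply: le_by_reals => L Lv.
apply: limn_einf_ge; near=> n; rewrite -[L]opprK; apply: scaled_lne_ge => //.
  by near: n; exists 1%N.
by near: n; apply: H; rewrite EFinN lteNr.
Unshelve. all: by end_near. Qed.

Lemma outer_prob_ge0 (A : set T) : (0 <= outer_prob P A)%E.
Proof. by apply: le_ereal_inf_tmp => _ [B _ <-]; exact: measure_ge0. Qed.

Lemma outer_prob_le (A B : set T) : measurable B -> A `<=` B ->
  (outer_prob P A <= P B)%E.
Proof. by move=> mB AB; apply: ereal_inf_lbound; exists B. Qed.

Lemma inner_prob_ge (A B : set T) : measurable B -> B `<=` A ->
  (P B <= inner_prob P A)%E.
Proof. by move=> mB AB; apply: ereal_sup_ubound; exists B. Qed.

End ldp_criteria.

(** * Linear and quadratic forms of point masses *)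

Section quadratic_forms.
Context (R : realType).
Implicit Types (f : R -> R) (Gam : R -> R -> R) (l : seq (R * R)).

(** A finite signed measure on the time axis is coded by the list of its atoms
    (weight, location); [lev f l] integrates [f] against it. *)
Definition lev f l := \sum_(p <- l) p.1 * f p.2.

Definition qf Gam l l' :=
  \sum_(p <- l) \sum_(q <- l') p.1 * q.1 * Gam p.2 q.2.

Definition scl (c : R) l := [seq (c * p.1, p.2) | p <- l].

Definition times_in (tau : R) l := all (fun p => 0 <= p.2 <= tau) l.

Definition fam k (p : 'I_k -> R) (al : 'I_k -> R) :=
  [seq (al i, p i) | i <- enum 'I_k].

Lemma lev_cat f l1 l2 : lev f (l1 ++ l2) = lev f l1 + lev f l2.
Proof. exact: big_cat. Qed.

Lemma lev_scl f c l : lev f (scl c l) = c * lev f l.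
Proof.
by rewrite /lev big_map mulr_sumr; apply: eq_bigr => i _; rewrite mulrA.
Qed.

Lemma lev_fam f k (p al : 'I_k -> R) : lev f (fam p al) = \sum_i al i * f (p i).
Proof. by rewrite /lev big_map big_enum. Qed.

Lemma lev1 f a t : lev f [:: (a, t)] = a * f t.
Proof. by rewrite /lev big_seq1. Qed.

Lemma qf_lev Gam l l' : qf Gam l l' = lev (fun t => lev (Gam t) l') l.
Proof.
apply: eq_bigr => p _; rewrite mulr_sumr; apply: eq_bigr => q _.
by rewrite mulrA.
Qed.

Lemma qf_catl Gam l1 l2 l : qf Gam (l1 ++ l2) l = qf Gam l1 l + qf Gam l2 l.
Proof. by rewrite !qf_lev lev_cat. Qed.

Lemma qf_scll Gam c l l' : qf Gam (scl c l) l' = c * qf Gam l l'.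
Proof. by rewrite !qf_lev lev_scl. Qed.

Lemma qf_catr Gam l1 l2 l : qf Gam l (l1 ++ l2) = qf Gam l l1 + qf Gam l l2.
Proof. by rewrite -big_split; apply: eq_bigr => p _; rewrite big_cat. Qed.

Lemma qf_sclr Gam c l l' : qf Gam l (scl c l') = c * qf Gam l l'.
Proof.
rewrite mulr_sumr; apply: eq_bigr => p _; rewrite big_map mulr_sumr.
by apply: eq_bigr => q _ /=; ring.
Qed.

Lemma qf1l Gam a t l : qf Gam [:: (a, t)] l = a * lev (Gam t) l.
Proof. by rewrite qf_lev lev1. Qed.

Lemma qf11 Gam a t b s : qf Gam [:: (a, t)] [:: (b, s)] = a * b * Gam t s.
Proof. by rewrite qf1l lev1 mulrA. Qed.

Lemma qf_fam Gam k (p al be : 'I_k -> R) :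
  qf Gam (fam p al) (fam p be) = \sum_i \sum_j al i * be j * Gam (p i) (p j).
Proof.
by rewrite /qf big_map big_enum; apply: eq_bigr => i _; rewrite big_map big_enum.
Qed.

Lemma times_in_cat tau l1 l2 :
  times_in tau (l1 ++ l2) = times_in tau l1 && times_in tau l2.
Proof. exact: all_cat. Qed.

Lemma times_in_scl tau c l : times_in tau (scl c l) = times_in tau l.
Proof. by rewrite /times_in all_map. Qed.

Lemma times_in_fam tau k (p al : 'I_k -> R) :
  (forall i, 0 <= p i <= tau) -> times_in tau (fam p al).
Proof. by move=> H; rewrite /times_in all_map; apply/allP => i _ /=. Qed.

Lemma qf_sym Gam tau l l' :
  (forall s t, 0 <= s <= tau -> 0 <= t <= tau -> Gam s t = Gam t s) ->
  times_in tau l -> times_in tau l' -> qf Gam l l' = qf Gam l' l.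
Proof.
move=> H /allP al /allP al'; rewrite /qf exchange_big /= [LHS]big_seq [RHS]big_seq.
apply: eq_bigr => p pl; rewrite [LHS]big_seq [RHS]big_seq; apply: eq_bigr => q ql.
by rewrite (H p.2 q.2) ?(mulrC q.1)//; [exact: al'|exact: al].
Qed.

Lemma linear_bounded0 (s L : R) : (forall c, c * s <= L) -> s = 0.
Proof.
move=> H; apply/eqP/negP => /negP s0.
have := H ((L + 1) / s); rewrite mulfVK//; lra.
Qed.

Lemma quadratic_bound (s Q L : R) : 0 <= Q ->
  (forall c, c * s - 2^-1 * (c * (c * Q)) <= L) -> s ^+ 2 <= 2 * L * Q.
Proof.
move=> Q0 H; have [Qe|Qn] := eqVneq Q 0.
  have -> : s = 0 by apply: (@linear_bounded0 _ L) => c; have := H c; rewrite Qe; lra.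
  by rewrite Qe expr0n mulr0.
have Qp : 0 < Q by rewrite lt_neqAle eq_sym Qn.
have := H (s / Q).
have -> : s / Q * s - 2^-1 * (s / Q * (s / Q * Q)) = 2^-1 * s ^+ 2 / Q by field.
rewrite ler_pdivrMr// => h; lra.
Qed.

End quadratic_forms.

Section cadlag_limits.
Context (R : realType) (tau : R).

Lemma near_right_in (t : R) : 0 <= t < tau -> \forall x \near t^'+, 0 <= x <= tau.
Proof.
move=> /andP[t0 tt]; near=> x; apply/andP; split.
  by rewrite (le_trans t0)//; near: x; exact: nbhs_right_ge.
by near: x; exact: nbhs_right_le.
Unshelve. all: by end_near. Qed.

Lemma near_left_in (t : R) : 0 < t <= tau -> \forall x \near t^'-, 0 <= x <= tau.
Proof.
move=> /andP[t0 tt]; near=> x; apply/andP; split.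
  by near: x; exact: nbhs_left_ge.
by rewrite (le_trans _ tt)//; near: x; exact: nbhs_left_le.
Unshelve. all: by end_near. Qed.

Lemma uniform_limit_cadlag (f : R -> R) :
  (forall e, 0 < e -> exists2 g, cadlag tau g &
    forall t, 0 <= t <= tau -> `|g t - f t| <= e) -> cadlag tau f.
Proof.
move=> H t t01; split=> [tt|t0].
  have t01' : 0 <= t < tau by case/andP: t01 => -> _.
  apply/cvgrPdist_le => e e0; have e3 : 0 < e / 3 by rewrite divr_gt0.
  have [g cg gf] := H _ e3.
  have /cvgrPdist_le/(_ _ e3) gt := (cg t t01).1 tt.
  near=> x.
  have x01 : 0 <= x <= tau by near: x; exact: near_right_in.
  have h1 : `|g t - g x| <= e / 3 by near: x; exact: gt.
  have := gf _ x01; have := gf _ t01; move: h1; rewrite !ler_norml.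
  by move=> /andP[? ?] /andP[? ?] /andP[? ?]; apply/andP; split; lra.
have t01' : 0 < t <= tau by case/andP: t01 => _ ->; rewrite t0.
apply/cauchy_cvgP/cauchyP => e e0; have e3 : 0 < e / 3 by rewrite divr_gt0.
have [g cg gf] := H _ e3.
have /cvg_ex[l gl] := (cg t t01).2 t0.
move/cvgrPdist_le/(_ _ e3) : gl => gl.
exists l; rewrite /= !near_simpl; near=> x.
rewrite /ball/= (@le_lt_trans _ _ (e / 3 + e / 3))//; last lra.
have x01 : 0 <= x <= tau by near: x; exact: near_left_in.
have h1 : `|l - g x| <= e / 3 by near: x; exact: gl.
have := gf _ x01; move: h1; rewrite !ler_norml.
by move=> /andP[? ?] /andP[? ?]; apply/andP; split; lra.
Unshelve. all: by end_near. Qed.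

Lemma cadlagD f g : cadlag tau f -> cadlag tau g -> cadlag tau (f \+ g : R -> R).
Proof.
move=> cf cg t t01; have [fr fl] := cf _ t01; have [gr gl] := cg _ t01.
by split=> h; [apply: cvgD; auto|apply: is_cvgD; auto].
Qed.

Lemma cadlagM f g : cadlag tau f -> cadlag tau g -> cadlag tau (f \* g : R -> R).
Proof.
move=> cf cg t t01; have [fr fl] := cf _ t01; have [gr gl] := cg _ t01.
by split=> h; [apply: cvgM; auto|apply: is_cvgM; auto].
Qed.

Lemma cadlag_cst (c : R) : cadlag tau (fun=> c).
Proof. by move=> t _; split=> _; [exact: cvg_cst|exact: is_cvg_cst]. Qed.

Lemma to_skorokhodE (f : R -> R) (cf : cadlag tau f) t : 0 <= t <= tau ->
  to_skorokhod cf t = f t.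
Proof. by move=> t01; rewrite /= patchE ifT// mem_setE in_itv. Qed.

Lemma le_skorokhod_norm (phi : skorokhod tau) t : 0 <= t <= tau -> `|phi t| <= `|phi|.
Proof.
move=> t01; rewrite skorokhod_normE; apply: ub_le_sup; last first.
  by exists t => //=; rewrite in_itv.
have [M HM] := cadlag_bounded (proj1 (skorokhodP phi)).
by exists M => _ [s /= s01 <-]; apply: HM; rewrite in_itv/= in s01.
Qed.

Lemma skorokhod_norm_le (phi : skorokhod tau) M : 0 <= M ->
  (forall t, 0 <= t <= tau -> `|phi t| <= M) -> `|phi| <= M.
Proof.
move=> M0 H; rewrite skorokhod_normE; have [tau0|tau0] := leP 0 tau.
  apply: ge_sup; first by exists `|phi 0|, 0 => //=; rewrite in_itv/= lexx.
  by move=> _ [t /= + <-]; rewrite in_itv; exact: H.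
rewrite set_itv_ge ?image_set0 ?sup0// bnd_simp -ltNge//.
Qed.

End cadlag_limits.

(** * The Gaussian rate function *)

Section gaussian_rate.
Context (R : realType) (tau : R) (Gam : R -> R -> R).

Definition gauss_rate (phi : skorokhod tau) : \bar R :=
  ereal_sup [set (lev phi l - 2^-1 * qf Gam l l)%:E | l in [set l | times_in tau l]].

(** The squared distance of two time points in the Gaussian metric. *)
Definition gdist (s t : R) := Gam s s - 2 * Gam s t + Gam t t.

Definition gauss_net k (p : 'I_k -> R) (pi : R -> 'I_k) (e : R) : Prop :=
  (forall j, 0 <= p j <= tau) /\
  forall t, 0 <= t <= tau -> gdist t (p (pi t)) <= e ^+ 2.

Hypothesis Gam_sym : forall s t, 0 <= s <= tau -> 0 <= t <= tau -> Gam s t = Gam t s.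
Hypothesis Gam_psd : forall l, times_in tau l -> 0 <= qf Gam l l.
Hypothesis Gam_cadlag : forall s, 0 <= s <= tau -> cadlag tau (Gam^~ s).
Hypothesis Gam_net : forall e, 0 < e -> exists k (p : 'I_k -> R) pi, gauss_net p pi e.

Lemma gauss_rate_ge0 phi : (0 <= gauss_rate phi)%E.
Proof.
apply: ereal_sup_ubound; exists [::] => //.
by rewrite /lev /qf !big_nil mulr0 subr0.
Qed.

Lemma gauss_rate_leP phi (L : R) : (gauss_rate phi <= L%:E)%E <->
  (forall l, times_in tau l -> lev phi l - 2^-1 * qf Gam l l <= L).
Proof.
split=> [H l tl|H].
  by rewrite -lee_fin (le_trans _ H)//; apply: ereal_sup_ubound; exists l.
by apply: ge_ereal_sup => _ [l /= tl <-]; rewrite lee_fin; exact: H.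
Qed.

(** Optimizing a linear form minus its quadratic penalty over all dilations of
    the form is the Cauchy-Schwarz inequality of the reproducing kernel space. *)
Lemma gauss_rate_le_quad phi (L : R) l : (gauss_rate phi <= L%:E)%E ->
  times_in tau l -> (lev phi l) ^+ 2 <= 2 * L * qf Gam l l.
Proof.
move=> /gauss_rate_leP H tl; apply: quadratic_bound => [|c]; first exact: Gam_psd.
by have := H (scl c l); rewrite times_in_scl lev_scl qf_scll qf_sclr; exact.
Qed.

Lemma gdistE s t : 0 <= s <= tau -> 0 <= t <= tau ->
  qf Gam [:: (1, s); (-1, t)] [:: (1, s); (-1, t)] = gdist s t.
Proof.
move=> hs ht; rewrite -cat1s qf_catl !qf_catr !qf11 (Gam_sym ht hs) /gdist; ring.
Qed.

(** The common modulus of continuity, in the Gaussian metric, of the paths of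
    bounded rate; it makes the sublevel sets compact. *)
Lemma gauss_rate_osc phi (L e s t : R) : 0 <= L -> 0 <= e ->
  (gauss_rate phi <= L%:E)%E ->
  0 <= s <= tau -> 0 <= t <= tau -> gdist s t <= e ^+ 2 ->
  `|phi s - phi t| <= Num.sqrt (2 * L) * e.
Proof.
move=> L0 e0 HL hs ht hd.
have := gauss_rate_le_quad HL (l := [:: (1, s); (-1, t)]).
rewrite gdistE// /times_in /= hs ht /lev !big_cons big_nil /= => /(_ isT) h.
have -> : phi s - phi t = 1 * phi s + (-1 * phi t + 0) by ring.
rewrite -(ler_pXn2r (_ : (0 < 2)%N)) ?nnegrE ?mulr_ge0 ?sqrtr_ge0//.
rewrite exprMn sqr_sqrtr ?mulr_ge0// real_normK ?num_real// (le_trans h)//.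
by rewrite ler_wpM2l ?mulr_ge0.
Qed.

Lemma lev_close (f g : R -> R) (e : R) l : times_in tau l ->
  (forall t, 0 <= t <= tau -> `|f t - g t| <= e) ->
  `|lev f l - lev g l| <= (\sum_(p <- l) `|p.1|) * e.
Proof.
move=> /allP tl H; rewrite /lev -sumrB mulr_suml (le_trans (ler_norm_sum _ _ _))//.
rewrite big_seq [leRHS]big_seq; apply: ler_sum => p pl.
by rewrite -mulrBr normrM ler_wpM2l// H// tl.
Qed.

Lemma sum_norm_ge0 (l : seq (R * R)) : 0 <= \sum_(p <- l) `|p.1|.
Proof. by apply: sumr_ge0. Qed.

Lemma ultra_bounded_lim U (F : set_system U) (FU : UltraFilter F) (f : U -> R) (M : R) :
  F [set u | `|f u| <= M] -> exists a, forall e, 0 < e -> F [set u | `|f u - a| <= e].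
Proof.
move=> FM; have FP := @ultra_proper _ _ FU.
have [|a [_ ca]] := @segment_compact R (- M) M (f @ F) _.
  by apply: (@filterS _ F _ _ _ _ FM) => u /=; rewrite in_itv/= ler_norml.
exists a => e e0.
have [//|FN] := in_ultra_setVsetC [set u | `|f u - a| <= e] FU.
have [|y [/= ye]] := ca [set y | ~ `|y - a| <= e] (ball a e) _ (nbhsx_ballx _ _ e0).
  exact: FN.
by rewrite /ball/= distrC => /ltW /ye.
Qed.

(** An ultrafilter on a sublevel set converges pointwise, since the values are
    bounded; by the common modulus of [gauss_rate_osc] the convergence at the
    finitely many points of a net is uniform. *)
Lemma gauss_rate_compact (L : R) : compact [set phi | (gauss_rate phi <= L%:E)%E].
Proof.
have [L0|L0] := ltP L 0.
  rewrite (_ : [set _ | _] = set0); first exact: compact0.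
  rewrite -subset0 => phi /= /(le_trans (gauss_rate_ge0 _)).
  by rewrite lee_fin leNgt L0.
rewrite compact_ultra /= => F FU FA; have FP := @ultra_proper _ _ FU.
set A := [set phi | _] in FA.
have limt t : exists a, 0 <= t <= tau -> forall e, 0 < e ->
    F [set phi : skorokhod tau | `|phi t - a| <= e].
  have [ht|ht] := boolP (0 <= t <= tau); last by exists 0.
  have [|a Ha] := @ultra_bounded_lim _ F FU (fun phi => phi t)
      (Num.sqrt (2 * L * Gam t t)); last by exists a.
  apply: filterS FA => phi Aphi.
  have := gauss_rate_le_quad Aphi (l := [:: (1, t)]).
  rewrite qf11 lev1 !mul1r /times_in /= ht => /(_ isT).
  by rewrite -sqrtr_sqr => h; exact: ler_wsqrtr.
have {limt}[f Hf] := choice limt.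
have unif e : 0 < e ->
    F [set phi : skorokhod tau | forall t, 0 <= t <= tau -> `|phi t - f t| <= e].
  move=> e0; have s0 : 0 < Num.sqrt (2 * L) + 1 by rewrite ltr_pwDr// sqrtr_ge0.
  have e3 : 0 < e / 3 by rewrite divr_gt0.
  have [k [p [pi [pin pinet]]]] := Gam_net (divr_gt0 e3 s0).
  have osc (phi : skorokhod tau) t : A phi -> 0 <= t <= tau ->
      `|phi t - phi (p (pi t))| <= e / 3.
    move=> Aphi ht; have h := gauss_rate_osc L0 (ltW (divr_gt0 e3 s0)) Aphi ht
      (pin (pi t)) (pinet _ ht).
    apply: (le_trans h); rewrite mulrC -mulrA ler_piMr// ?(ltW e3)//.
    by rewrite mulrC ler_pdivrMr// mul1r lerDl.
  have oscf t : 0 <= t <= tau -> `|f t - f (p (pi t))| <= e / 3.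
    move=> ht; apply/ler_addgt0Pr => z z0.
    have z2 : 0 < z / 2 by rewrite divr_gt0.
    have [phi [[Aphi h1] h2]] := filter_ex (filterI (filterI FA (Hf _ ht _ z2))
      (Hf _ (pin (pi t)) _ z2)).
    have := osc _ _ Aphi ht; move: h1 h2; rewrite /= !ler_norml.
    by move=> /andP[? ?] /andP[? ?] /andP[? ?]; apply/andP; split; lra.
  have Fp : F [set phi : skorokhod tau | forall j, `|phi (p j) - f (p j)| <= e / 3].
    by apply: filter_forall => j; exact: Hf.
  apply: filterS2 FA Fp => phi Aphi hp t ht.
  have := osc _ _ Aphi ht; have := oscf _ ht; have := hp (pi t).
  rewrite !ler_norml.
  by move=> /andP[? ?] /andP[? ?] /andP[? ?]; apply/andP; split; lra.
have cf : cadlag tau f.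
  apply: uniform_limit_cadlag => e e0.
  have [phi Hphi] := filter_ex (unif e e0).
  by exists phi => //; exact: (skorokhodP phi).1.
pose psi := to_skorokhod cf.
have psiE t : 0 <= t <= tau -> psi t = f t by exact: to_skorokhodE.
exists psi; split; last first.
  suff : id @ F --> psi by [].
  apply/cvgrPdist_le => e e0; apply: filterS (unif e e0) => phi Hphi.
  apply: skorokhod_norm_le => [|t ht]; first exact: ltW.
  by rewrite /= -normrN opprB -[X in X - _]/(phi t) -[X in _ - X]/(psi t) psiE// Hphi.
apply/gauss_rate_leP => l tl; apply/ler_addgt0Pr => z z0.
pose s := \sum_(p <- l) `|p.1|.
have s1 : 0 < s + 1 by rewrite ltr_wpDl// sum_norm_ge0.
have [phi [Aphi Hphi]] := filter_ex (filterI FA (unif _ (divr_gt0 z0 s1))).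
have := (gauss_rate_leP phi L).1 Aphi l tl.
have : `|lev psi l - lev phi l| <= s * (z / (s + 1)).
  by apply: lev_close => // t ht; rewrite psiE// distrC Hphi.
have : s * (z / (s + 1)) <= z.
  by rewrite mulrCA ler_piMr ?(ltW z0)// ler_pdivrMr// mul1r lerDl.
rewrite ler_norml => ? /andP[? ?]; lra.
Qed.

Lemma lev_kernel_cadlag l : times_in tau l -> cadlag tau (fun t => lev (Gam t) l).
Proof.
elim: l => [|[a s] l IH] /=.
  move=> _; rewrite (_ : (fun t => _) = fun=> 0); first exact: cadlag_cst.
  by apply/funext => t; rewrite /lev big_nil.
move=> /andP[hs /IH cl].
rewrite (_ : (fun t => _) = ((fun=> a) \* Gam^~ s) \+ (fun t => lev (Gam t) l)).
  by apply: cadlagD => //; apply: cadlagM; [exact: cadlag_cst|exact: Gam_cadlag].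
by apply/funext => t; rewrite /lev big_cons.
Qed.

(** The elements of the reproducing kernel space with a finite expansion; their
    rate is half their squared norm, by completing the square. *)
Lemma gauss_rate_kernel l : times_in tau l -> exists phi : skorokhod tau,
  (forall t, 0 <= t <= tau -> phi t = lev (Gam t) l) /\
  (gauss_rate phi <= (2^-1 * qf Gam l l)%:E)%E.
Proof.
move=> tl; exists (to_skorokhod (lev_kernel_cadlag tl)); split.
  by move=> t ht; rewrite to_skorokhodE.
apply/gauss_rate_leP => l' tl'.
have -> : lev (to_skorokhod (lev_kernel_cadlag tl)) l' = qf Gam l' l.
  rewrite qf_lev /lev [LHS]big_seq [RHS]big_seq; apply: eq_bigr => p pl.
  by rewrite to_skorokhodE//; exact: (allP tl').
have := Gam_psd (l := l ++ scl (-1) l').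
rewrite times_in_cat times_in_scl tl tl' => /(_ isT).
rewrite qf_catl !qf_catr qf_scll !qf_sclr !qf_scll (qf_sym Gam_sym tl tl'); lra.
Qed.

(** If the penalized linear forms are bounded on the point values [x], then [x]
    annihilates the kernel of the covariance matrix, hence lies in its image. *)
Lemma gauss_interpolation k (p x : 'I_k -> R) (L : R) :
  (forall i, 0 <= p i <= tau) ->
  (forall al : 'I_k -> R, \sum_i al i * x i - 2^-1 * qf Gam (fam p al) (fam p al) <= L) ->
  exists be : 'I_k -> R, (forall i, x i = lev (Gam (p i)) (fam p be)) /\
    2^-1 * qf Gam (fam p be) (fam p be) <= L.
Proof.
move=> pin H.
pose G : 'M[R]_k := \matrix_(i, j) Gam (p i) (p j).
pose v : 'rV[R]_k := \row_i x i.
have : (v <= G)%MS.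
  rewrite submxE; apply/eqP/matrixP => i j; rewrite (ord1 i) mxE [RHS]mxE.
  apply: (@linear_bounded0 _ _ L) => c.
  have := H (fun m => c * cokermx G m j).
  have -> : qf Gam (fam p (fun m => c * cokermx G m j))
      (fam p (fun m => c * cokermx G m j)) = 0.
    rewrite qf_fam big1// => m _.
    have : (G *m cokermx G) m j = 0 by rewrite mulmx_coker [LHS]mxE.
    rewrite [LHS]mxE => Gc0.
    transitivity (c * c * cokermx G m j * \sum_m' G m m' * cokermx G m' j).
      by rewrite mulr_sumr; apply: eq_bigr => m' _; rewrite [G _ _]mxE; ring.
    by rewrite Gc0 mulr0.
  rewrite mulr0 subr0; apply: le_trans; rewrite mulr_sumr le_eqVlt; apply/orP; left.
  by apply/eqP; apply: eq_bigr => m _; rewrite [v _ _]mxE; ring.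
move=> /submxP[b vb]; pose be i := b ord0 i.
have xE i : x i = lev (Gam (p i)) (fam p be).
  have : v ord0 i = (b *m G) ord0 i by rewrite vb.
  rewrite !mxE => ->; rewrite lev_fam; apply: eq_bigr => j _; rewrite mxE.
  by congr (_ * _); apply: Gam_sym.
exists be; split=> //; have := H be.
have -> : \sum_i be i * x i = qf Gam (fam p be) (fam p be).
  by rewrite qf_lev lev_fam; apply: eq_bigr => i _; rewrite xE.
lra.
Qed.

End gaussian_rate.

(** * Moderate deviations from Gaussian exponential moments *)

Section exponential_tilting.
Context d (T : measurableType d) (R : realType) (P : probability T R).
Local Open Scope ereal_scope.

Lemma ge0_integral_subset_bigsetU (I : eqType) (s : seq I) (A : I -> set T) (D : set T)
    (f : T -> \bar R) :
  (forall i, measurable (A i)) -> measurable D -> measurable_fun setT f ->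
  (forall w, 0 <= f w) -> D `<=` [set w | exists2 i, i \in s & A i w] ->
  \int[P]_(w in D) f w <= \sum_(i <- s) \int[P]_(w in A i) f w.
Proof.
move=> mA + mf f0; elim: s D => [|i s IH] D mD.
  move=> D0; have -> : D = set0 by rewrite -subset0 => w /D0[].
  by rewrite integral_set0 big_nil.
move=> DA; rewrite big_cons.
have -> : D = (D `&` A i) `|` (D `\` A i) by rewrite setUIDK.
rewrite ge0_integral_setU//.
- apply: leeD.
    apply: ge0_subset_integral => //; first exact: measurableI.
    exact: measurable_funTS.
  apply: IH; first exact: measurableD.
  move=> w [/DA[j]]; rewrite inE => /predU1P[->//|js Aj _].
  by exists j.
- exact: measurableI.
- exact: measurableD.
- exact: measurable_funTS.
- by rewrite disj_set2E setDE setIACA setICr !setI0.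
Qed.

(** Markov's inequality for an exponential, under an exponentially tilted
    measure. *)
Lemma tilted_markov (A : set T) (Y Z : T -> R) (x : R) : measurable A ->
  measurable_fun setT Y -> measurable_fun setT Z ->
  (forall w, A w -> (x <= Z w)%R) ->
  \int[P]_(w in A) (expR (Y w))%:E <=
    (expR (- x))%:E * \int[P]_w (expR (Y w + Z w))%:E.
Proof.
move=> mA mY mZ H.
have mYZ : measurable_fun setT (fun w => (expR (Y w + Z w))%:E).
  by apply/measurable_EFinP; apply: measurableT_comp => //; exact: measurable_funD.
rewrite -ge0_integralZl_EFin ?expR_ge0//.
apply: (@le_trans _ _ (\int[P]_(w in A) ((expR (- x))%:E * (expR (Y w + Z w))%:E))).
  apply: ge0_le_integral => //.
  - apply: measurable_funTS; apply/measurable_EFinP.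
    exact: measurableT_comp.
  - apply: measurable_funTS; exact: measurable_funeM.
  - move=> w Aw; rewrite lee_fin -expRD ler_expR; have := H w Aw; lra.
apply: ge0_subset_integral => //; exact: measurable_funeM.
Qed.

End exponential_tilting.

Section gaussian_ldp.
Context d (T : measurableType d) (R : realType) (P : probability T R).
Variables (tau : R) (Gam : R -> R -> R) (lam : nat -> R).
Variables (S : nat -> R -> T -> R) (W : nat -> T -> skorokhod tau).

Hypothesis lam_gt0 : forall n, (0 < n)%N -> 0 < lam n.
Hypothesis lam_infty : lam n @[n --> \oo] --> +oo.
Hypothesis Gam_sym : forall s t, 0 <= s <= tau -> 0 <= t <= tau -> Gam s t = Gam t s.
Hypothesis Gam_psd : forall l, times_in tau l -> 0 <= qf Gam l l.
Hypothesis Gam_cadlag : forall s, 0 <= s <= tau -> cadlag tau (Gam^~ s).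
Hypothesis S_meas : forall n t, 0 <= t <= tau -> measurable_fun setT (S n t).

Let E n l := (\int[P]_w (expR (lam n * lev (fun t => S n t w) l))%:E)%E.

Hypothesis S_mgf : forall l, times_in tau l -> forall e, 0 < e ->
  \forall n \near \oo,
    ((expR (lam n * (2^-1 * qf Gam l l - e)))%:E <= E n l <=
     (expR (lam n * (2^-1 * qf Gam l l + e)))%:E)%E.

Lemma lev_meas n l : times_in tau l ->
  measurable_fun setT (fun w => lev (fun t => S n t w) l).
Proof.
elim: l => [_|[a t] l IH /= /andP[ht hl]].
  by rewrite (_ : (fun _ => _) = fun=> 0)//; apply/funext => w; rewrite /lev big_nil.
rewrite (_ : (fun _ => _) = fun w => a * S n t w + lev (fun t => S n t w) l).
  apply: measurable_funD; last exact: IH.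
  by apply: measurable_funM => //; exact: S_meas.
by apply/funext => w; rewrite /lev big_cons.
Qed.

Lemma half_le_expR (e : R) : 0 < e -> \forall n \near \oo, expR (- (e * lam n)) <= 2^-1.
Proof.
move=> e0; near=> n; rewrite expRN lef_pV2 ?posrE ?expR_gt0//.
rewrite (le_trans _ (expR_ge1Dx _))// -lerBlDl.
by near: n; apply: near_lam_mul_ge => //.
Unshelve. all: by end_near. Qed.

(** The exponential Chebyshev inequality for a linear form of [S]. *)
Lemma chernoff_negl l x e (A : nat -> set T) : times_in tau l -> 0 < e ->
  (forall n w, A n w -> x <= lev (fun t => S n t w) l) ->
  negl P lam (x - 2^-1 * qf Gam l l - e) A.
Proof.
move=> tl e0 H; near=> n.
have l0 : 0 <= lam n by near: n; exact: near_lam_ge.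
have mL := lev_meas n tl.
have mB : measurable [set w | x <= lev (fun t => S n t w) l].
  by rewrite -[X in measurable X]setTI; apply: measurable_fun_le.
exists [set w | x <= lev (fun t => S n t w) l]; split=> //; first exact: H.
have := @tilted_markov _ _ _ P _ (cst 0) (fun w => lam n * lev (fun t => S n t w) l)
  (lam n * x) mB (measurable_cst _).
rewrite /= expR0 integral_cst//= mul1e => h.
apply: (le_trans (h _ _)).
- by apply: measurable_funM.
- by move=> w /= Bw; rewrite ler_wpM2l.
under eq_integral do rewrite add0r.
have : (E n l <= (expR (lam n * (2^-1 * qf Gam l l + e)))%:E)%E.
  have : ((expR (lam n * (2^-1 * qf Gam l l - e)))%:E <= E n l <=
     (expR (lam n * (2^-1 * qf Gam l l + e)))%:E)%E.
    by near: n; exact: S_mgf.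
  by case/andP.
move=> hE; apply: (le_trans (lee_wpmul2l _ hE)); first by rewrite lee_fin expR_ge0.
rewrite lee_fin -expRD ler_expR; lra.
Unshelve. all: by end_near. Qed.

(** Lower bound for the finite-dimensional laws. Under the law tilted by the
    linear form [l] the exponential rates are those of a Gaussian with mean
    [lev (Gam t) l] at time [t], so this mean is asymptotically the typical
    value; the tilt itself costs [qf Gam l l / 2]. *)
Lemma tilting_lower_bound k (p be : 'I_k -> R) (x : 'I_k -> R) (eps del : R) :
  (forall j, 0 <= p j <= tau) -> (forall j, x j = lev (Gam (p j)) (fam p be)) ->
  0 < eps -> 0 < del ->
  \forall n \near \oo,
    ((expR (- ((2^-1 * qf Gam (fam p be) (fam p be) + del) * lam n)))%:E <=
      P [set w | forall j, (`|S n (p j) w - x j| <= eps)%R])%E.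
Proof.
move=> pin xE eps0 del0; set l := fam p be.
have tl : times_in tau l by exact: times_in_fam.
set q := qf Gam l l.
have pj1 j c : times_in tau [:: (c, p j)] by rewrite /times_in /= pin.
have Gjj j : 0 <= Gam (p j) (p j).
  by have := Gam_psd (pj1 j 1); rewrite qf11 !mul1r.
pose sb := \sum_j `|be j|.
have sb0 : 0 <= sb by apply: sumr_ge0.
pose e1 := Num.min eps (del / (4 * (sb + 1))).
have e10 : 0 < e1 by rewrite lt_min eps0 divr_gt0// mulr_gt0// ltr_wpDl.
pose B := 1 + \sum_j Gam (p j) (p j).
have B1 : 1 <= B by rewrite lerDl sumr_ge0.
have B0 : 0 < B by apply: lt_le_trans B1.
have GB j : Gam (p j) (p j) <= B.
  rewrite /B (bigD1 j)//= addrCA lerDl addr_ge0// sumr_ge0//.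
pose th := e1 / B.
have th0 : 0 < th by rewrite divr_gt0.
pose ka := th * e1 / 8.
have ka0 : 0 < ka by rewrite divr_gt0// mulr_gt0.
pose dl := Num.min ka (del / 4).
have dl0 : 0 < dl by rewrite lt_min ka0 divr_gt0.
have dlka : dl <= ka by rewrite ge_min lexx.
have dldel : dl <= del / 4 by rewrite ge_min lexx orbT.
pose sg (b : bool) : R := if b then 1 else -1.
have sg2 b : sg b * sg b = 1 by case: b; rewrite /sg; ring.
(* [A n] is the target event and [Aj n i] the event that one coordinate leaves
   the tube on one side.  A further tilt [th] towards that side shows that the
   tilted mass of [Aj n i] is smaller than the total one by a factor
   [expR (- 2 * ka * lam n)]. *)
pose A n := [set w | forall j, `|S n (p j) w - x j| <= e1].
pose Aj n (i : bool * 'I_k) := [set w | e1 <= sg i.1 * (S n (p i.2) w - x i.2)].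
pose ll (i : bool * 'I_k) := l ++ [:: (sg i.1 * th, p i.2)].
have tll i : times_in tau (ll i) by rewrite times_in_cat tl pj1.
have qll i : 2^-1 * qf Gam (ll i) (ll i) =
    2^-1 * q + sg i.1 * th * x i.2 + 2^-1 * (th * th) * Gam (p i.2) (p i.2).
  rewrite qf_catl !qf_catr (qf_sym Gam_sym tl (pj1 i.2 _)) qf1l -xE qf11 -/q.
  have -> : sg i.1 * th * (sg i.1 * th) = th * th.
    by rewrite mulrACA sg2 mul1r.
  lra.
near=> n.
have l0 : 0 <= lam n by near: n; exact: near_lam_ge.
have mS j : measurable_fun setT (fun w => S n (p j) w - x j).
  by apply: measurable_funB => //; exact: S_meas.
have mA : measurable (A n).
  rewrite [X in measurable X](_ : _ = \bigcap_(j in [set: 'I_k])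
      [set w | `|S n (p j) w - x j| <= e1]).
    apply: fin_bigcap_measurable; first exact: finite_finset.
    move=> j _; rewrite -[X in measurable X]setTI.
    by apply: measurable_fun_le => //; apply: measurableT_comp.
  by apply/seteqP; split=> w; [move=> h j _; exact: h|move=> h j; exact: (h j I)].
have mAj i : measurable (Aj n i).
  rewrite -[X in measurable X]setTI; apply: measurable_fun_le => //.
  by apply: measurable_funM.
pose f w := (expR (lam n * lev (fun t => S n t w) l))%:E.
have mlev l' : times_in tau l' ->
    measurable_fun setT (fun w => lam n * lev (fun t => S n t w) l').
  by move=> tl'; apply: measurable_funM => //; exact: lev_meas.
have mf : measurable_fun setT f.
  by apply/measurable_EFinP; apply: measurableT_comp => //; exact: mlev.
have f0 w : (0 <= f w)%E by rewrite lee_fin expR_ge0.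
have Elow : ((expR (lam n * (2^-1 * q - dl)))%:E <= \int[P]_w f w)%E.
  have : ((expR (lam n * (2^-1 * qf Gam l l - dl)))%:E <= E n l <=
     (expR (lam n * (2^-1 * qf Gam l l + dl)))%:E)%E by near: n; exact: S_mgf.
  by case/andP.
have Eup i : (\int[P]_(w in Aj n i) f w <=
    (expR (lam n * (2^-1 * q - 3 * ka)))%:E)%E.
  have := @tilted_markov _ _ _ P (Aj n i)
    (fun w => lam n * lev (fun t => S n t w) l)
    (fun w => lam n * (sg i.1 * th * S n (p i.2) w))
    (lam n * (th * e1 + sg i.1 * th * x i.2)) (mAj i) (mlev _ tl).
  move=> h; apply: (le_trans (h _ _)).
  - apply: measurable_funM => //; apply: measurable_funM => //.
    exact: S_meas.
  - move=> w /= Aw; rewrite ler_wpM2l//.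
    have := ler_wpM2l (ltW th0) Aw; lra.
  have -> : (\int[P]_w (expR (lam n * lev (fun t => S n t w) l +
      lam n * (sg i.1 * th * S n (p i.2) w)))%:E = E n (ll i))%E.
    apply: eq_integral => w _; congr (expR _)%:E.
    by rewrite lev_cat lev1 mulrDr.
  have : ((expR (lam n * (2^-1 * qf Gam (ll i) (ll i) - dl)))%:E <= E n (ll i) <=
     (expR (lam n * (2^-1 * qf Gam (ll i) (ll i) + dl)))%:E)%E.
    move: (i); near: n; apply: filter_forall => i'; exact: S_mgf.
  case/andP => _ hE; apply: (le_trans (lee_wpmul2l _ hE)).
    by rewrite lee_fin expR_ge0.
  rewrite -EFinM lee_fin -expRD ler_expR qll -mulrN -mulrDr ler_wpM2l//.
  have h1 : th * th * Gam (p i.2) (p i.2) <= th * e1.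
    rewrite -mulrA ler_wpM2l ?(ltW th0)// /th.
    by rewrite mulrAC ler_pdivrMr// ler_wpM2l// ltW.
  have h2 : 8 * ka = th * e1 by rewrite /ka; field.
  lra.
have cover : ~` A n `<=` [set w | exists2 i, i \in enum {: bool * 'I_k} & Aj n i w].
  move=> w /existsNP[j /negP]; rewrite -ltNge ltr_normr => /orP[h|h].
    by exists (true, j); rewrite ?mem_enum// /Aj/= mul1r ltW.
  by exists (false, j); rewrite ?mem_enum// /Aj/= mulN1r ltW.
have hsum : (\int[P]_w f w <= \int[P]_(w in A n) f w +
    ((2 * k%:R) * expR (lam n * (2^-1 * q - 3 * ka)))%:E)%E.
  rewrite -(setUv (A n)) ge0_integral_setU//; last 3 first.
  - exact: measurableC.
  - by rewrite setUv; exact: mf.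
  - by rewrite disj_set2E setICr.
  apply: leeD => //.
  apply: (le_trans (ge0_integral_subset_bigsetU P mAj (measurableC mA) mf f0 cover)).
  apply: (@le_trans _ _ (\sum_(i <- enum {: bool * 'I_k})
    (expR (lam n * (2^-1 * q - 3 * ka)))%:E)%E).
    by apply: lee_sum => i _.
  rewrite sumEFin lee_fin big_const_seq count_predT -cardE card_prod card_bool card_ord.
  by rewrite iter_addr_0 -[leLHS]mulr_natl natrM.
have hA : (\int[P]_(w in A n) f w <=
    (expR (lam n * (q + del / 4)))%:E * P (A n))%E.
  rewrite -integral_cst//; apply: ge0_le_integral => //.
  - exact: measurable_funTS.
  - move=> w Aw; rewrite lee_fin ler_expR ler_wpM2l// lev_fam.
    have -> : q = \sum_j be j * x j.
      by rewrite /q qf_lev lev_fam; apply: eq_bigr => j _; rewrite xE.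
    rewrite -lerBlDl -sumrB (le_trans (ler_norm _))// (le_trans (ler_norm_sum _ _ _))//.
    apply: (@le_trans _ _ (\sum_j `|be j| * e1)).
      by apply: ler_sum => j _; rewrite -mulrBr normrM ler_wpM2l// Aw.
    rewrite -mulr_suml -/sb (@le_trans _ _ (sb * (del / (4 * (sb + 1)))))//.
      by rewrite ler_wpM2l// ge_min lexx orbT.
    rewrite mulrA ler_pdivrMr ?mulr_gt0 ?ltr_wpDl//.
    have -> : del / 4 * (4 * (sb + 1)) = sb * del + del by field.
    by rewrite lerDl ltW.
have Akey : ((expR (lam n * (2^-1 * q - dl)))%:E <=
    (expR (lam n * (q + del / 4)) * fine (P (A n)) +
     2 * k%:R * expR (lam n * (2^-1 * q - 3 * ka)))%:E)%E.
  apply: (le_trans Elow); apply: (le_trans hsum); rewrite EFinD leeD//.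
  by rewrite EFinM fineK ?fin_num_measure.
rewrite lee_fin in Akey.
have h1 : expR (- (del / 2 * lam n)) <= 2^-1.
  by near: n; apply: half_le_expR; rewrite divr_gt0.
have h2 : 4 * k%:R <= expR (2 * ka * lam n).
  rewrite (le_trans _ (expR_ge1Dx _))// -lerBlDl.
  by near: n; apply: near_lam_mul_ge => //; rewrite mulr_gt0.
set X := expR (lam n * (2^-1 * q - dl)) in Akey.
have X0 : 0 < X by exact: expR_gt0.
have h3 : 2 * k%:R * expR (lam n * (2^-1 * q - 3 * ka)) <= 2^-1 * X.
  apply: (@le_trans _ _ (2 * k%:R * (X * expR (- (2 * ka * lam n))))).
    rewrite ler_wpM2l// -expRD ler_expR.
    have := ler_wpM2l l0 dlka; lra.
  rewrite expRN; have := expR_gt0 (2 * ka * lam n) => E0.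
  rewrite mulrA ler_pdivrMr//; nra.
have h4 : expR (lam n * (q + del / 4)) * expR (- ((2^-1 * q + del) * lam n)) <= 2^-1 * X.
  rewrite -expRD (@le_trans _ _ (expR (- (del / 2 * lam n)) * X))//.
    rewrite -expRD ler_expR; have := ler_wpM2l l0 dldel; lra.
  by rewrite ler_wpM2r// ltW.
have h5 : expR (- ((2^-1 * q + del) * lam n)) <= fine (P (A n)).
  have E0 := expR_gt0 (lam n * (q + del / 4)).
  by rewrite -(ler_pM2l E0) (le_trans h4)//; lra.
apply: (@le_trans _ _ (P (A n))).
  by rewrite -[P (A n)]fineK ?fin_num_measure// lee_fin.
apply: le_measure; rewrite ?inE//.
  rewrite [X in measurable X](_ : _ = \bigcap_(j in [set: 'I_k])
      [set w | `|S n (p j) w - x j| <= eps]).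
    apply: fin_bigcap_measurable; first exact: finite_finset.
    move=> j _; rewrite -[X in measurable X]setTI.
    by apply: measurable_fun_le => //; apply: measurableT_comp.
  by apply/seteqP; split=> w; [move=> h j _; exact: h|move=> h j; exact: (h j I)].
by move=> w Aw j; rewrite (le_trans (Aw j))// ge_min lexx.
Unshelve. all: by end_near. Qed.

Hypothesis W_net : forall e L, 0 < e -> exists k (p : 'I_k -> R) (pi : R -> 'I_k),
  gauss_net tau Gam p pi e /\
  negl P lam L (fun n => [set w | exists t, 0 <= t <= tau /\
    e < `|W n w t - W n w (p (pi t))|]).
Hypothesis W_S : forall t e L, 0 <= t <= tau -> 0 < e ->
  negl P lam L (fun n => [set w | e < `|W n w t - S n t w|]).

Let Gam_net e : 0 < e -> exists k (p : 'I_k -> R) pi, gauss_net tau Gam p pi e.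
Proof. by move=> /(W_net 0)[k [p [pi []]]]; exists k, p, pi. Qed.

Lemma small_multiple (c e : R) : 0 <= c -> 0 < e -> exists2 e', 0 < e' <= e & c * e' <= e.
Proof.
move=> c0 e0; exists (e / (c + 1)).
  by rewrite divr_gt0 ?ltr_wpDl// ler_pdivrMr ?ltr_wpDl// ler_peMr ?lerDr// ltW.
by rewrite mulrA ler_pdivrMr ?ltr_wpDl//; nra.
Qed.

Lemma W_S_negl k (p : 'I_k -> R) e L : (forall j, 0 <= p j <= tau) -> 0 < e ->
  negl P lam L (fun n => [set w | exists j, e < `|W n w (p j) - S n (p j) w|]).
Proof. by move=> pin e0; apply: (negl_exists lam_infty ltr01) => j; exact: W_S. Qed.

(** A uniform neighbourhood of a path of finite rate contains the event that
    [S] is close to the path at the points of a net, apart from negligible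
    events: between these points both the path and [W] oscillate little. *)
Lemma ldp_lower_point (U : set (skorokhod tau)) phi (I0 del : R) : open U -> U phi ->
  0 <= I0 -> (gauss_rate Gam phi <= I0%:E)%E -> 0 < del ->
  \forall n \near \oo, exists B, [/\ measurable B, B `<=` W n @^-1` U &
    ((expR (- ((I0 + del) * lam n)))%:E <= P B)%E].
Proof.
move=> oU Uphi I00 HI del0.
have /nbhs_ballP[r /= r0 rU] : nbhs phi U by exact: open_nbhs_nbhs.
have r5 : 0 < r / 5 by rewrite divr_gt0.
have [e /andP[e0 er] se] := small_multiple (sqrtr_ge0 (2 * I0)) r5.
have [k [p [pi [[pin pinet] osc]]]] := W_net (I0 + del + 1 + 1) e0.
have [be [xE qbe]] : exists be : 'I_k -> R,
    (forall i, phi (p i) = lev (Gam (p i)) (fam p be)) /\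
    2^-1 * qf Gam (fam p be) (fam p be) <= I0.
  apply: (gauss_interpolation Gam_sym pin) => al.
  have := (gauss_rate_leP Gam phi I0).1 HI (fam p al) (times_in_fam al pin).
  by rewrite lev_fam.
have del2 : 0 < del / 2 by rewrite divr_gt0.
have Alow := tilting_lower_bound pin xE r5 del2.
pose A n := [set w | forall j, `|S n (p j) w - phi (p j)| <= r / 5].
pose N n := [set w | exists t, 0 <= t <= tau /\ e < `|W n w t - W n w (p (pi t))|]
  `|` [set w | exists j, r / 5 < `|W n w (p j) - S n (p j) w|].
have HN : negl P lam (I0 + del + 1) N.
  by apply: (neglU lam_infty ltr01) => //; exact: W_S_negl.
have mA n : measurable (A n).
  rewrite [X in measurable X](_ : _ = \bigcap_(j in [set: 'I_k])
      [set w | `|S n (p j) w - phi (p j)| <= r / 5]).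
    apply: fin_bigcap_measurable; first exact: finite_finset.
    move=> j _; rewrite -[X in measurable X]setTI.
    apply: measurable_fun_le => //; apply: measurableT_comp => //.
    by apply: measurable_funB => //; exact: S_meas.
  by apply/seteqP; split=> w; [move=> h j _; exact: h|move=> h j; exact: (h j I)].
have HA : \forall n \near \oo, ((expR (- ((I0 + del / 2) * lam n)))%:E <= P (A n))%E.
  near=> n; have l0 : 0 <= lam n by near: n; exact: near_lam_ge.
  have : ((expR (- ((2^-1 * qf Gam (fam p be) (fam p be) + del / 2) * lam n)))%:E <=
    P (A n))%E by near: n; exact: Alow.
  apply: le_trans; rewrite lee_fin ler_expR lerN2 ler_wpM2r// lerD2r//.
have Id : I0 + del / 2 < I0 + del + 1 by lra.
have := not_negl_setD lam_infty Id mA HA HN del2; apply: filterS.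
move=> n [B [mB BA PB]]; exists B; split=> //; last first.
  by move: PB; have -> : I0 + del / 2 + del / 2 = I0 + del by field.
move=> w /BA[Aw Nw]; apply: rU; rewrite /= -ball_normE /=.
apply: (@le_lt_trans _ _ (4 * (r / 5))); last lra.
apply: skorokhod_norm_le => [|t ht]; first lra.
rewrite -[X in `|X|]/(phi t - W n w t).
have h1 : `|W n w t - W n w (p (pi t))| <= r / 5.
  rewrite (le_trans _ er)// leNgt; apply/negP => h; apply: Nw; left.
  by exists t.
have h2 : `|W n w (p (pi t)) - S n (p (pi t)) w| <= r / 5.
  by rewrite leNgt; apply/negP => h; apply: Nw; right; exists (pi t).
have h3 := Aw (pi t).
have h4 : `|phi t - phi (p (pi t))| <= r / 5.
  apply: le_trans se; apply: (gauss_rate_osc Gam_sym Gam_psd) => //.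
    exact: ltW.
  exact: pinet.
move: h1 h2 h3 h4; rewrite !ler_norml.
by move=> /andP[? ?] /andP[? ?] /andP[? ?] /andP[? ?]; apply/andP; split; lra.
Unshelve. all: by end_near. Qed.

Lemma compact_closed_separated (C K : set (skorokhod tau)) : compact C -> closed K ->
  C `&` K = set0 -> exists2 r, 0 < r & forall phi psi, C phi -> K psi -> r <= `|phi - psi|.
Proof.
move=> /compact_near_coveringP Cc Kc CK.
have : \forall r \near 0^'+, C `<=` (fun phi => forall psi, K psi -> r <= `|phi - psi|).
  apply: Cc => phi Cphi.
  have /nbhs_ballP[r /= r0 rK] : nbhs phi (~` K).
    apply: open_nbhs_nbhs; split; first exact: closed_openC.
    by move=> Kphi; have : (C `&` K) phi by []; rewrite CK.
  exists (ball phi (r / 2), [set x | x <= r / 2]); first split => /=.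
  - by apply: nbhsx_ballx; rewrite divr_gt0.
  - by apply: nbhs_right_le; rewrite divr_gt0.
  move=> [phi' x] /= [phi'b xr] psi Kpsi; rewrite leNgt; apply/negP => h.
  apply: (rK psi) => //; rewrite -ball_normE /=.
  move: phi'b; rewrite -ball_normE /= => phi'b.
  have -> : phi - psi = (phi - phi') + (phi' - psi) by rewrite addrA subrK.
  rewrite (le_lt_trans (ler_normD _ _))//; lra.
move=> near0.
have near0' : \forall r \near (0:R)^'+, 0 < r by exact: nbhs_right_gt.
by have [r [r0 Hr]] := filter_ex (filterI near0' near0); exists r => // phi psi /Hr; exact.
Qed.

Lemma negl0 L : negl P lam L (fun=> set0).
Proof.
near=> n; exists set0; split=> //.
by rewrite measure0 lee_fin expR_ge0.
Unshelve. all: by end_near. Qed.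

Lemma open_half_space k (al : 'I_k -> R) (c : R) :
  open [set y : 'rV[R]_k | c < \sum_i al i * y ord0 i].
Proof.
rewrite openE => y /= cy; apply/nbhs_ballP.
pose s := \sum_i `|al i|.
have s0 : 0 <= s by exact: sumr_ge0.
have s1 : 0 < s + 1 by rewrite ltr_wpDl.
have e0 : 0 < (\sum_i al i * y ord0 i - c) / (s + 1).
  by rewrite divr_gt0// subr_gt0.
exists ((\sum_i al i * y ord0 i - c) / (s + 1)) => //= z yz.
set e := _ / _ in e0 yz.
have : `|\sum_i al i * y ord0 i - \sum_i al i * z ord0 i| <= s * e.
  rewrite -sumrB (le_trans (ler_norm_sum _ _ _))// mulr_suml.
  apply: ler_sum => i _; rewrite -mulrBr normrM ler_wpM2l//.
  by apply: ltW; exact: (yz.2 ord0 i).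
have : s * e + e = \sum_i al i * y ord0 i - c.
  by rewrite -[X in _ + X]mul1r -mulrDl mulrC mulfVK// gt_eqF.
rewrite ler_norml => h1 /andP[h2 h3] /=; lra.
Qed.

(** The image of a closed set under the projection to the points of a net is
    bounded away from the sublevel set of the rate; a compact cube of values is
    covered by half-spaces on which an exponential Chebyshev inequality works
    and by open sets that the projection of the closed set avoids. *)
Lemma ldp_upper_set (K : set (skorokhod tau)) (L del : R) : closed K -> 0 <= L ->
  (forall phi, K phi -> (L%:E < gauss_rate Gam phi)%E) -> 0 < del ->
  negl P lam (L - 4 * del) (fun n => W n @^-1` K).
Proof.
move=> cK L0 HK del0.
have cC : compact [set phi | (gauss_rate (tau := tau) Gam phi <= L%:E)%E].
  exact: gauss_rate_compact.
have [|r r0 sep] := compact_closed_separated cC cK.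
  by rewrite -subset0 => phi /= [h1 /HK]; rewrite ltNge h1.
have r8 : 0 < r / 8 by rewrite divr_gt0.
have [e /andP[e0 er] se] := small_multiple (sqrtr_ge0 (2 * L)) r8.
have [k [p [pi [[pin pinet] osc]]]] := W_net (L + 2) e0.
have pj1 j c : times_in tau [:: (c, p j)] by rewrite /times_in /= pin.
have Gjj j : 0 <= Gam (p j) (p j).
  by have := Gam_psd (pj1 j 1); rewrite qf11 !mul1r.
pose Mb := L + 3 + \sum_j Gam (p j) (p j).
have GB j : L + 3 <= Mb - 2^-1 * Gam (p j) (p j).
  rewrite /Mb (bigD1 j)//=; have := Gjj j.
  have : 0 <= \sum_(i < k | i != j) Gam (p i) (p i) by exact: sumr_ge0.
  lra.
pose vec n w : 'rV[R]_k := \row_j S n (p j) w.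
pose C0 := [set v : 'rV[R]_k | forall i, `[- Mb, Mb]%classic (v ord0 i)].
have cC0 : compact C0.
  apply: (@rV_compact _ _ (fun=> `[- Mb, Mb]%classic)).
  by move=> _; apply: segment_compact.
(* the values at the points of the net of those paths of [K] that oscillate
   little along the net, up to [r / 8] *)
pose Z := [set v : 'rV[R]_k | exists2 psi, K psi &
  (forall t, 0 <= t <= tau -> `|psi t - psi (p (pi t))| <= r / 8) /\
  (forall j, `|v ord0 j - psi (p j)| <= r / 8)].
pose half (al : 'I_k -> R) : set 'rV[R]_k :=
  [set y | L + 2^-1 * qf Gam (fam p al) (fam p al) < \sum_i al i * y ord0 i].
(* a value that no half-space excludes is interpolated by a path of rate at most
   [L], from which [K] is at distance [r] *)
have HVo v : exists Vo, [/\ open Vo, Vo v &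
    (exists al, Vo = half al) \/ Vo `&` Z = set0].
  have [[al Hal]|Hal] := pselect (exists al : 'I_k -> R,
      L + 2^-1 * qf Gam (fam p al) (fam p al) < \sum_i al i * v ord0 i).
    by exists (half al); split=> //; [exact: open_half_space|left; exists al].
  exists (ball v (r / 8))°; split; first exact: open_interior.
    exact: nbhsx_ballx.
  right; rewrite -subset0 => y [/interior_subset yb [psi Kpsi [psi_osc ypsi]]].
  have [al|be [vE qbe]] := @gauss_interpolation _ tau Gam Gam_sym _ p
      (fun i => v ord0 i) L pin.
    by rewrite lerBlDr leNgt; apply/negP => h; apply: Hal; exists al.
  have tb := times_in_fam be pin.
  have [phi [phiE rphi]] := gauss_rate_kernel Gam_sym Gam_psd Gam_cadlag tb.
  have rphiL : (gauss_rate Gam phi <= L%:E)%E by rewrite (le_trans rphi)// lee_fin.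
  have := sep phi psi rphiL Kpsi; rewrite leNgt => /negP; apply.
  apply: (@le_lt_trans _ _ (4 * (r / 8))); last lra.
  apply: skorokhod_norm_le => [|t ht]; first lra.
  rewrite -[X in `|X|]/(phi t - psi t).
  have h1 : `|phi t - phi (p (pi t))| <= r / 8.
    apply: le_trans se; apply: (gauss_rate_osc Gam_sym Gam_psd) => //.
      exact: ltW.
    exact: pinet.
  have h2 := psi_osc _ ht; have h3 := ypsi (pi t).
  have h4 : `|v ord0 (pi t) - y ord0 (pi t)| <= r / 8.
    by apply: ltW; exact: (yb.2 ord0 (pi t)).
  move: h1 h2 h3 h4; rewrite phiE// phiE// -vE !ler_norml.
  by move=> /andP[? ?] /andP[? ?] /andP[? ?] /andP[? ?]; apply/andP; split; lra.
have {HVo}[Vo HVo] := choice HVo.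
move: cC0; rewrite compact_cover => /(_ _ C0 Vo) [||D' _ covD].
- by move=> v _; have [] := HVo v.
- by move=> v C0v; exists v => //; have [] := HVo v.
pose N1 n := [set w | exists t, 0 <= t <= tau /\ e < `|W n w t - W n w (p (pi t))|].
pose N2 n := [set w | exists j, r / 8 < `|W n w (p j) - S n (p j) w|].
pose N3 n := [set w | exists j, Mb < `|S n (p j) w|].
pose H (v : D') n := [set w | Vo (fsval v) (vec n w) /\ exists al, Vo (fsval v) = half al].
have nN1 : negl P lam (L + 2) N1 by [].
have nN2 : negl P lam (L + 2) N2 by exact: W_S_negl.
have nN3 : negl P lam L N3.
  apply: (negl_exists lam_infty ltr01) => j.
  have nsg (b : bool) : negl P lam (L + 1 + 1)
      (fun n => [set w | Mb < (if b then 1 else -1) * S n (p j) w]).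
    have := @chernoff_negl [:: (if b then 1 else -1, p j)] Mb 1
      (fun n => [set w | Mb < (if b then 1 else -1) * S n (p j) w]) (pj1 j _) ltr01.
    move=> /(_ _)/(negl_le lam_infty); apply.
      by rewrite qf11; have := GB j; case: b; lra.
    by move=> n w /=; rewrite lev1 => /ltW.
  have := @negl_exists _ _ _ P lam lam_infty (L + 1) 1 bool
    (fun b n => [set w | Mb < (if b then 1 else -1) * S n (p j) w]) ltr01 nsg.
  apply: negl_sub; near=> n; move=> w /=; rewrite ltr_normr => /orP[h|h].
    by exists true; rewrite mul1r.
  by exists false; rewrite mulN1r.
have nH v : negl P lam (L - del) (H v).
  have [[al Oal]|nO] := pselect (exists al, Vo (fsval v) = half al); last first.
    by apply: negl_sub (negl0 _); near=> n; move=> w [_ /nO].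
  pose l := fam p al; have tl : times_in tau l by exact: times_in_fam.
  have := @chernoff_negl l (L + 2^-1 * qf Gam l l) del (H v) tl del0.
  have -> : L + 2^-1 * qf Gam l l - 2^-1 * qf Gam l l - del = L - del by ring.
  apply => n w [+ _]; rewrite Oal /half/= => h.
  rewrite lev_fam (le_trans (ltW h))// le_eqVlt; apply/orP; left.
  by apply/eqP/eq_bigr => i _; rewrite mxE.
have nH' : negl P lam (L - del - del) (fun n => [set w | exists v, H v n w]).
  by apply: (negl_exists lam_infty del0) => v; rewrite subrK; exact: nH.
have nall : negl P lam (L - 4 * del)
    (fun n => ((N1 n `|` N2 n) `|` N3 n) `|` [set w | exists v, H v n w]).
  apply: (neglU lam_infty del0); last by apply: (negl_le lam_infty) nH'; lra.
  apply: (neglU lam_infty del0); last by apply: (negl_le lam_infty) nN3; lra.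
  by apply: (neglU lam_infty del0); [apply: (negl_le lam_infty) nN1|
    apply: (negl_le lam_infty) nN2]; lra.
apply: negl_sub nall; near=> n => w /= Kw.
have [h1|h1] := pselect (N1 n w); first by do 3 left.
have [h2|h2] := pselect (N2 n w); first by do 2 left; right.
have [h3|h3] := pselect (N3 n w); first by left; right.
right.
have C0v : C0 (vec n w).
  move=> i; rewrite /= in_itv/= -ler_norml mxE leNgt; apply/negP => h.
  by apply: h3; exists i.
have Zv : Z (vec n w).
  exists (W n w) => //; split=> [t ht|j].
    rewrite (le_trans _ er)// leNgt; apply/negP => h; apply: h1.
    by exists t.
  rewrite mxE distrC leNgt; apply/negP => h; apply: h2; by exists j.
have [v /= vD' Ov] := covD _ C0v.
exists [` vD' ]%fset; split=> //=.
have [_ _ [//|OZ]] := HVo v.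
by have : (Vo v `&` Z) (vec n w) by []; rewrite OZ.
Unshelve. all: by end_near. Qed.
Lemma real_between (L : R) (v : \bar R) : (L%:E < v)%E ->
  exists2 L', L < L' & (L'%:E < v)%E.
Proof.
case: v => [v||]// Lv; last by exists (L + 1); rewrite ?ltrDl ?ltry.
by rewrite lte_fin in Lv; exists ((L + v) / 2); rewrite ?lte_fin; lra.
Qed.

Lemma ldp_upper_le (K : set (skorokhod tau)) (L : R) (v : \bar R) : closed K ->
  (forall phi, K phi -> (v <= gauss_rate Gam phi)%E) -> (L%:E < v)%E ->
  negl P lam L (fun n => W n @^-1` K).
Proof.
move=> cK HK Lv; have [L0|L0] := leP 0 L; last first.
  near=> n; exists setT; split=> //.
  rewrite probability_setT lee_fin -expR0 ler_expR -mulNr mulr_ge0//.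
    by rewrite oppr_ge0 ltW.
  by near: n; exact: near_lam_ge.
have [L' LL' L'v] := real_between Lv.
have -> : L = L' - 4 * ((L' - L) / 4) by field.
apply: ldp_upper_set => //; first by rewrite (le_trans L0)// ltW.
- by move=> phi /HK; exact: lt_le_trans.
- by rewrite divr_gt0// subr_gt0.
Unshelve. all: by end_near. Qed.

Theorem gaussian_ldp : LDP P W lam (gauss_rate Gam).
Proof.
split.
- by split.
- split; first exact: gauss_rate_ge0.
  by move=> L; exact: gauss_rate_compact.
- move=> U oU; apply: (liminf_scaled_lne_ge lam_gt0) => L.
  move=> /ereal_inf_lt[_ [phi Uphi <-] phiL].
  have r0 := gauss_rate_ge0 Gam phi.
  pose I0 := fine (gauss_rate Gam phi).
  have fI : gauss_rate Gam phi = I0%:E.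
    by rewrite fineK// ge0_fin_numE// (lt_trans phiL)// ltry.
  have I00 : 0 <= I0 by rewrite -lee_fin -fI.
  have IL : I0 < L by rewrite -lte_fin -fI.
  have del0 : 0 < L - I0 by rewrite subr_gt0.
  have := @ldp_lower_point U phi I0 (L - I0) oU Uphi I00 _ del0.
  rewrite fI => /(_ (lexx _)); apply: filterS => n [B [mB BU PB]].
  rewrite (_ : L = I0 + (L - I0)); last by ring.
  by rewrite (le_trans PB)// inner_prob_ge.
- move=> K cK; apply: (limsup_scaled_lne_le lam_gt0) => [n|L Lv].
    exact: outer_prob_ge0.
  have := ldp_upper_le cK _ Lv; move=> /(_ _)/filterS; apply; last first.
    by move=> phi Kphi; apply: ereal_inf_lbound; exists phi.
  move=> n [B [mB WB PB]]; rewrite (le_trans _ PB)//; exact: outer_prob_le.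
Qed.

Lemma cvg_scaled_lne (x : nat -> \bar R) (l : \bar R) :
  (forall n, (0 <= x n)%E) ->
  (forall L : R, (L%:E < l)%E ->
    \forall n \near \oo, (x n <= (expR (- (L * lam n)))%:E)%E) ->
  (forall L : R, (l < L%:E)%E ->
    \forall n \near \oo, ((expR (- (L * lam n)))%:E <= x n)%E) ->
  l != -oo%E ->
  (((lam n)^-1)%:E * lne (x n))%E @[n --> \oo] --> (- l)%E.
Proof.
move=> x0 Hu Hl lN.
have up L : (L%:E < l)%E -> \forall n \near \oo,
    ((((lam n)^-1)%:E * lne (x n))%E <= (- L)%:E)%E.
  move=> Ll; near=> n; apply: (scaled_lne_le lam_gt0) => //.
    by near: n; exists 1%N.
  by near: n; exact: Hu.
have dn L : (l < L%:E)%E -> \forall n \near \oo,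
    ((- L)%:E <= ((lam n)^-1)%:E * lne (x n))%E.
  move=> Ll; near=> n; apply: (scaled_lne_ge lam_gt0) => //.
    by near: n; exists 1%N.
  by near: n; exact: Hl.
case: l lN {Hu Hl} up dn => [l||]// _ up dn.
  rewrite -EFinN; apply/fine_cvgP; split.
    near=> n; rewrite fin_numElt; apply/andP; split.
      apply: (@lt_le_trans _ _ (- (l + 1))%:E); first exact: ltNyr.
      by near: n; apply: dn; rewrite lte_fin ltrDl.
    apply: (@le_lt_trans _ _ (- (l - 1))%:E); last exact: ltry.
    by near: n; apply: up; rewrite lte_fin gtrBl.
  apply/cvgrPdist_le => e e0; near=> n.
  have h1 : ((- (l + e))%:E <= ((lam n)^-1)%:E * lne (x n))%E.
    by near: n; apply: dn; rewrite lte_fin ltrDl.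
  have h2 : (((lam n)^-1)%:E * lne (x n) <= (- (l - e))%:E)%E.
    by near: n; apply: up; rewrite lte_fin gtrBl.
  move: h1 h2; rewrite /=; case: (_ * _)%E => [y||]//=.
  by rewrite !lee_fin ler_distlC => h1 h2; apply/andP; split; lra.
apply/cvgeNyPle => A; have := up (- A) (ltry _); apply: filterS => n.
by rewrite opprK.
Unshelve. all: by end_near. Qed.

(** The rate of the uniform norm: on the sublevel [L] of the rate a point value
    is at most the square root of [2 * L * Gam t t], and the covariance kernel
    at [t] attains this value. *)
Lemma gaussian_sup_norm (B r : R) : 0 <= tau ->
  (forall t, 0 <= t <= tau -> Gam t t <= B) -> 0 < r ->
  (forall n, measurable [set w | r <= `|W n w|]) ->
  let s2 := sup [set Gam t t | t in `[0, tau]] in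
  (((lam n)^-1)%:E * lne (P [set w | r <= `|W n w|]%R))%E @[n --> \oo] -->
  (if s2 == 0 then -oo%E else (- (r ^+ 2 / (2 * s2)))%:E).
Proof.
move=> tau0 HB r0 mr s2.
have Gtt t : 0 <= t <= tau -> 0 <= Gam t t.
  by move=> ht; have := @Gam_psd [:: (1, t)]; rewrite qf11 !mul1r /times_in/= ht; exact.
have Gs2 t : 0 <= t <= tau -> Gam t t <= s2.
  move=> ht; apply: ub_le_sup; last by exists t => //=; rewrite in_itv.
  by exists B => _ [s /= + <-]; rewrite in_itv/=; exact: HB.
have s20 : 0 <= s2 by rewrite (le_trans (Gtt 0 _))// ?Gs2// lexx.
pose v : \bar R := if s2 == 0 then +oo%E else (r ^+ 2 / (2 * s2))%:E.
have -> : (if s2 == 0 then -oo%E else (- (r ^+ 2 / (2 * s2)))%:E) = (- v)%E.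
  by rewrite /v; case: ifP.
pose K := [set phi : skorokhod tau | r <= `|phi|].
have cK : closed K.
  have -> : K = (fun phi : skorokhod tau => `|phi|) @^-1` [set x | r <= x] by [].
  apply: closed_comp; last exact: closed_ge.
  by move=> phi _; exact: norm_continuous.
have HK phi : K phi -> (v <= gauss_rate Gam phi)%E.
  move=> Kphi; apply: le_by_reals => L Lv; rewrite leNgt; apply/negP => phiL.
  have bnd : `|phi| <= Num.sqrt (2 * L * s2).
    apply: skorokhod_norm_le => [|t ht]; first exact: sqrtr_ge0.
    have := gauss_rate_le_quad Gam_psd (ltW phiL) (l := [:: (1, t)]).
    rewrite lev1 qf11 !mul1r /times_in/= ht => /(_ isT) h.
    rewrite -sqrtr_sqr; apply: ler_wsqrtr; rewrite (le_trans h)// ler_wpM2l ?Gs2//.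
    by rewrite mulr_ge0// -lee_fin (le_trans (gauss_rate_ge0 Gam phi))// ltW.
  have : r <= Num.sqrt (2 * L * s2) by exact: le_trans bnd.
  move: Lv; rewrite /v; case: ifPn => [/eqP ->|s2n].
    by rewrite mulr0 sqrtr0 leNgt r0.
  have s2p : 0 < s2 by rewrite lt_neqAle eq_sym s2n.
  rewrite lte_fin ltr_pdivlMr ?mulr_gt0// => h.
  have L0 : 0 <= L by rewrite -lee_fin (le_trans (gauss_rate_ge0 Gam phi))// ltW.
  rewrite -(ler_pXn2r (_ : (0 < 2)%N)) ?nnegrE ?sqrtr_ge0 ?(ltW r0)//.
  rewrite sqr_sqrtr ?mulr_ge0// leNgt => /negP; apply; lra.
apply: (@cvg_scaled_lne (fun n => P [set w | r <= `|W n w|])) => //.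
- move=> L Lv; have := ldp_upper_le cK HK Lv; apply: filterS => n [A [mA KA PA]].
  by rewrite (le_trans _ PA)//; apply: le_measure; rewrite ?inE.
- move=> L; rewrite /v; case: ifPn => // s2n; rewrite lte_fin => vL.
  have s2p : 0 < s2 by rewrite lt_neqAle eq_sym s2n.
  have L0 : 0 < L by apply: le_lt_trans vL; rewrite divr_ge0 ?sqr_ge0 ?mulr_ge0.
  have L2 : 0 < 2 * L by rewrite mulr_gt0.
  have [_ [t /= + <-] rt] : exists2 y, [set Gam t t | t in `[0, tau]] y & r ^+ 2 / (2 * L) < y.
    apply: sup_gt; first by exists (Gam 0 0), 0 => //=; rewrite in_itv/= lexx.
    by rewrite -/s2 ltr_pdivrMr//; move: vL; rewrite ltr_pdivrMr ?mulr_gt0//; lra.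
  rewrite in_itv/= => ht; set g := Gam t t in rt.
  have g0 : 0 < g by apply: le_lt_trans rt; rewrite divr_ge0 ?sqr_ge0 ?ltW.
  rewrite ltr_pdivrMr// in rt.
  have rs : r < Num.sqrt (2 * L * g).
    rewrite -(ltr_pXn2r (_ : (0 < 2)%N)) ?nnegrE ?sqrtr_ge0 ?(ltW r0)//.
    by rewrite sqr_sqrtr ?mulr_ge0 ?ltW//; lra.
  pose r' := (r + Num.sqrt (2 * L * g)) / 2.
  have rr' : r < r' by rewrite /r'; lra.
  have r's : r' < Num.sqrt (2 * L * g) by rewrite /r'; lra.
  have r'2 : r' ^+ 2 < 2 * L * g.
    rewrite -[ltRHS]sqr_sqrtr ?mulr_ge0 ?ltW// ltr_pXn2r// nnegrE ?sqrtr_ge0//.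
    by rewrite ltW// (lt_trans r0).
  have tin : times_in tau [:: (r' / g, t)] by rewrite /times_in/= ht.
  have [phi [phiE rphi]] := gauss_rate_kernel Gam_sym Gam_psd Gam_cadlag tin.
  have {phiE} phit : phi t = r' by rewrite phiE// lev1 mulfVK// gt_eqF.
  pose I0 := 2^-1 * (r' ^+ 2 / g).
  have I0E : 2^-1 * qf Gam [:: (r' / g, t)] [:: (r' / g, t)] = I0.
    by rewrite qf11 -/g /I0; field; rewrite gt_eqF.
  have {}rphi : (gauss_rate Gam phi <= I0%:E)%E by rewrite -I0E; exact: rphi.
  have IL : I0 < L by rewrite /I0 mulrA ltr_pdivrMr//; lra.
  have I00 : 0 <= I0 by rewrite mulr_ge0// divr_ge0 ?sqr_ge0 ?(ltW g0).
  pose U := [set phi : skorokhod tau | r < `|phi|].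
  have oU : open U.
    have -> : U = (fun phi : skorokhod tau => `|phi|) @^-1` [set x | r < x] by [].
    by apply: open_comp; [move=> psi _; exact: norm_continuous|exact: open_gt].
  have Uphi : U phi.
    rewrite /U/= (lt_le_trans rr')// -phit.
    by rewrite (le_trans (ler_norm _))// le_skorokhod_norm.
  have dL : 0 < L - I0 by rewrite subr_gt0.
  have := ldp_lower_point oU Uphi I00 rphi dL; apply: filterS => n [A [mA AU PA]].
  rewrite (_ : L = I0 + (L - I0)); last by ring.
  rewrite (le_trans PA)//; apply: le_measure; rewrite ?inE//.
  by move=> w /AU /ltW.
- by rewrite /v; case: ifP.
Qed.

End gaussian_ldp.

(** * Integration of bounded measurable functions *)

Section bounded_measurable.
Context d (T : measurableType d) (R : realType).
Implicit Types (f g : T -> R).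

(** Bounded measurable functions: integrals of them against finite measures are
    additive and pass to bounded pointwise limits without further conditions. *)
Definition bdm f := measurable_fun setT f /\ exists M, forall x, `|f x| <= M.

Lemma bdm_cst c : bdm (fun=> c).
Proof. by split; [exact: measurable_cst|exists `|c|]. Qed.

Lemma bdmD f g : bdm f -> bdm g -> bdm (fun x => f x + g x).
Proof.
move=> [mf [M fM]] [mg [N gN]]; split; first exact: measurable_funD.
by exists (M + N) => x; rewrite (le_trans (ler_normD _ _))// lerD.
Qed.

Lemma bdmM f g : bdm f -> bdm g -> bdm (fun x => f x * g x).
Proof.
move=> [mf [M fM]] [mg [N gN]]; split; first exact: measurable_funM.
by exists (M * N) => x; rewrite normrM ler_pM.
Qed.

Lemma bdmZ c f : bdm f -> bdm (fun x => c * f x).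
Proof. by move=> bf; apply: bdmM => //; exact: bdm_cst. Qed.

Lemma bdmN f : bdm f -> bdm (fun x => - f x).
Proof.
move=> bf; rewrite (_ : (fun _ => _) = fun x => -1 * f x); first exact: bdmZ.
by apply/funext => x; rewrite mulN1r.
Qed.

Lemma bdmB f g : bdm f -> bdm g -> bdm (fun x => f x - g x).
Proof. by move=> bf bg; apply: bdmD => //; exact: bdmN. Qed.

Lemma bdm_sum I (s : seq I) (F : I -> T -> R) :
  (forall i, bdm (F i)) -> bdm (fun x => \sum_(i <- s) F i x).
Proof.
move=> bF; elim: s => [|i s IH].
  rewrite (_ : (fun _ => _) = fun=> 0); first exact: bdm_cst.
  by apply/funext => x; rewrite big_nil.
rewrite (_ : (fun _ => _) = fun x => F i x + \sum_(i <- s) F i x); first exact: bdmD.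
by apply/funext => x; rewrite big_cons.
Qed.

Lemma bdm_indic (A : set T) : measurable A -> bdm (\1_A : T -> R).
Proof.
move=> mA; split; first exact: measurable_indic.
by exists 1 => x; rewrite indicE; case: (_ \in _); rewrite ?normr1// normr0.
Qed.

Lemma bdm_pred (p : pred T) : measurable [set x | p x] -> bdm (fun x => (p x)%:R : R).
Proof.
move=> /bdm_indic; rewrite (_ : \1__ = fun x => (p x)%:R)//.
by apply/funext => x; rewrite indicE mem_setE.
Qed.

Lemma bdm_meas f : bdm f -> measurable_fun setT f. Proof. by case. Qed.

Lemma bdm_bounded f (M : R) : measurable_fun setT f -> (forall x, `|f x| <= M) -> bdm f.
Proof. by move=> mf fM; split=> //; exists M. Qed.

Lemma bdm_expR f : bdm f -> bdm (fun x => expR (f x)).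
Proof.
move=> [mf [M fM]]; split; first exact: measurableT_comp.
exists (expR M) => x; rewrite ger0_norm ?expR_ge0// ler_expR.
exact: le_trans (ler_norm _) (fM x).
Qed.

End bounded_measurable.

Lemma bdm_comp d (T : measurableType d) d' (T' : measurableType d') (R : realType)
    (g : T -> T') (f : T' -> R) :
  bdm f -> measurable_fun setT g -> bdm (fun x => f (g x)).
Proof.
move=> [mf [M fM]] mg; split; first exact: measurableT_comp.
by exists M => x.
Qed.

Section bounded_integral.
Context d (T : measurableType d) (R : realType).
Variable mu : {finite_measure set T -> \bar R}.
Implicit Types (f g : T -> R).

Lemma bdm_integrable f : bdm f -> mu.-integrable setT (EFin \o f).
Proof.
move=> [mf [M fM]]; apply: measurable_bounded_integrable => //.
  by rewrite ltey_eq fin_num_measure.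
exists M; split; first exact: num_real.
by move=> N MN x _ /=; rewrite (le_trans (fM x))// ltW.
Qed.

Lemma bintE f : bdm f -> (\int[mu]_x (f x)%:E)%E = (\int[mu]_x f x)%:E.
Proof.
by move=> bf; rewrite /Rintegral fineK//; exact: integrable_fin_num (bdm_integrable bf).
Qed.

Lemma bintD f g : bdm f -> bdm g ->
  \int[mu]_x (f x + g x) = \int[mu]_x f x + \int[mu]_x g x.
Proof. by move=> bf bg; rewrite RintegralD//; exact: bdm_integrable. Qed.

Lemma bintB f g : bdm f -> bdm g ->
  \int[mu]_x (f x - g x) = \int[mu]_x f x - \int[mu]_x g x.
Proof. by move=> bf bg; rewrite RintegralB//; exact: bdm_integrable. Qed.

Lemma bintZ c f : bdm f -> \int[mu]_x (c * f x) = c * \int[mu]_x f x.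
Proof. by move=> bf; rewrite RintegralZl//; exact: bdm_integrable. Qed.

Lemma bint_sum I (s : seq I) (F : I -> T -> R) : (forall i, bdm (F i)) ->
  \int[mu]_x (\sum_(i <- s) F i x) = \sum_(i <- s) \int[mu]_x F i x.
Proof.
move=> bF; elim: s => [|i s IH].
  rewrite big_nil (@eq_Rintegral _ _ _ mu _ (fun=> 0)); last first.
    by move=> x _; rewrite big_nil.
  by rewrite Rintegral_cst// mul0r.
rewrite big_cons -IH -bintD//; last exact: bdm_sum.
by apply: eq_Rintegral => x _; rewrite big_cons.
Qed.

Lemma le_bint f g : bdm f -> bdm g -> (forall x, f x <= g x) ->
  \int[mu]_x f x <= \int[mu]_x g x.
Proof. by move=> bf bg fg; apply: le_Rintegral => //; exact: bdm_integrable. Qed.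

Lemma bint_ge0 f : (forall x, 0 <= f x) -> 0 <= \int[mu]_x f x.
Proof. by move=> f0; exact: Rintegral_ge0. Qed.

Lemma bint_cst c : \int[mu]_x c = c * fine (mu setT).
Proof. by rewrite Rintegral_cst. Qed.

Lemma bint_indic (A : set T) : measurable A -> \int[mu]_x (\1_A x) = fine (mu A).
Proof. by move=> mA; rewrite /Rintegral integral_indic// setIT. Qed.

Lemma le_normr_bint f M : bdm f -> (forall x, `|f x| <= M) ->
  `|\int[mu]_x f x| <= M * fine (mu setT).
Proof.
move=> bf fM; rewrite (le_trans (le_normr_Rintegral _ _))//.
  exact: bdm_integrable.
rewrite -bint_cst; apply: le_bint => //; last exact: bdm_cst.
have [mf [N fN]] := bf; split; first exact: measurableT_comp.
by exists N => x; rewrite normr_id.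
Qed.

Lemma cvg_bint (f_ : nat -> T -> R) f (M : R) :
  (forall n, measurable_fun setT (f_ n)) -> (forall n x, `|f_ n x| <= M) ->
  (forall x, f_ n x @[n --> \oo] --> f x) ->
  bdm f /\ \int[mu]_x f_ n x @[n --> \oo] --> \int[mu]_x f x.
Proof.
move=> mf_ f_M f_f.
have mf : measurable_fun setT f.
  by apply: measurable_fun_cvg => // x _; exact: f_f.
have fM x : `|f x| <= M.
  have /(@cvg_lim _) <- // : `|f_ n x| @[n --> \oo] --> `|f x|.
    by apply: cvg_norm; exact: f_f.
  apply: limr_le; first by apply: is_cvg_norm; apply/cvg_ex; exists (f x); exact: f_f.
  by apply: nearW => n; exact: f_M.
have bf : bdm f by split=> //; exists M.
split=> //; apply: fine_cvg; rewrite -/(Rintegral _ _ _) -(bintE bf).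
apply: (@dominated_cvg _ _ _ mu setT measurableT (fun n x => (f_ n x)%:E)
  (fun x => (f x)%:E) (fun=> M%:E)) => //.
- by move=> n; apply/measurable_EFinP.
- by move=> x _; apply: cvg_EFin; [exact: nearW|exact: f_f].
- exact: (@bdm_integrable (fun=> M) (@bdm_cst _ T R M)).
- by move=> n x _; rewrite lee_fin.
Qed.

End bounded_integral.

Lemma pint_cst d (T : measurableType d) (R : realType) (P : probability T R) (c : R) :
  \int[P]_x c = c.
Proof.
rewrite Rintegral_cst// -[RHS]mulr1; congr (_ * _).
by transitivity (fine (1%:E : \bar R)) => //; congr fine; exact: probability_setT.
Qed.

Lemma measurable_le_set d (T : measurableType d) (R : realType) (f g : T -> R) :
  measurable_fun setT f -> measurable_fun setT g -> measurable [set x | f x <= g x].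
Proof.
by move=> mf mg; rewrite -[X in measurable X]setTI; exact: measurable_fun_le.
Qed.

Lemma measurable_lt_set d (T : measurableType d) (R : realType) (f g : T -> R) :
  measurable_fun setT f -> measurable_fun setT g -> measurable [set x | f x < g x].
Proof.
move=> mf mg; rewrite (_ : [set x | _] = ~` [set x | g x <= f x]).
  by apply: measurableC; exact: measurable_le_set.
by apply/seteqP; split=> x /=; rewrite ltNge => /negP.
Qed.

(** * Products of independent copies *)

Section layers.
Context (R : realType).

(** The layer-cake approximation of a number [y] of [0, B] by a multiple of
    [B / K.+1]; on functions it is a combination of indicators of upper level
    sets. *)
Definition layer (B : R) (K : nat) (y : R) : R :=
  \sum_(l < K.+1) B / K.+1%:R * (l.+1%:R * (B / K.+1%:R) <= y)%R%:R.

Lemma sum_ord_lt (m K : nat) : (m <= K)%N -> \sum_(l < K) (l < m)%N%:R = m%:R :> R.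
Proof.
move=> mK; rewrite -natr_sum; congr (_%:R).
by rewrite -big_mkcond/= -(big_ord_widen _ (fun=> 1%N))// sum1_card card_ord.
Qed.

Lemma layer_bounds (B : R) (K : nat) (y : R) : 0 < B -> 0 <= y <= B ->
  layer B K y <= y <= layer B K y + B / K.+1%:R.
Proof.
move=> B0 /andP[y0 yB]; set c := B / K.+1%:R.
have c0 : 0 < c by rewrite divr_gt0.
have yc : 0 <= y / c by rewrite divr_ge0// ltW.
have -> : layer B K y = c * (Num.truncn (y / c))%:R.
  rewrite /layer -mulr_sumr; congr (_ * _).
  rewrite -(@sum_ord_lt _ K.+1); last first.
    rewrite -(@ler_nat R); have /andP[h _] := truncn_itv yc.
    rewrite (le_trans h)// ler_pdivrMr// /c mulrC divfK//.
  by apply: eq_bigr => l _; rewrite truncn_gt_nat ler_pdivlMr.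
have /andP[h1 h2] := truncn_itv yc.
rewrite mulrC -ler_pdivlMr// h1 /= -[X in _ + X]mul1r -mulrDl natr1.
by rewrite -ler_pdivrMr// ltW.
Qed.

Lemma layer_ge0 (B : R) (K : nat) (y : R) : 0 < B -> 0 <= layer B K y.
Proof.
move=> B0; apply: sumr_ge0 => l _; apply: mulr_ge0 => //.
by rewrite divr_ge0// ltW.
Qed.

Lemma cvg_layer (B y : R) : 0 < B -> 0 <= y <= B ->
  layer B K y @[K --> \oo] --> y.
Proof.
move=> B0 yB; apply/cvgrPdist_le => e e0.
have : (B * harmonic K) @[K --> \oo] --> B * 0 by apply: cvgMl_tmp; exact: cvg_harmonic.
rewrite mulr0 => /cvgrPdist_le/(_ e e0); apply: filterS => K.
rewrite sub0r normrN ger0_norm; last by rewrite mulr_ge0 ?harmonic_ge0// ltW.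
have /andP[h1 h2] := layer_bounds K B0 yB.
rewrite ger0_norm ?subr_ge0// => h3; rewrite lerBlDl (le_trans h2)// lerD2l.
exact: h3.
Qed.

End layers.

Lemma cvg_prod_ord (R : realType) n (f_ : 'I_n -> nat -> R) (a : 'I_n -> R) :
  (forall i, f_ i K @[K --> \oo] --> a i) ->
  (\prod_(i < n) f_ i K) @[K --> \oo] --> \prod_(i < n) a i.
Proof.
elim: n f_ a => [|n IH] f_ a H.
  rewrite big_ord0 (_ : (fun _ => _) = fun=> 1); first exact: cvg_cst.
  by apply/funext => K; rewrite big_ord0.
rewrite big_ord_recl.
rewrite (_ : (fun _ => _) = (f_ ord0) \* (fun K => \prod_(i < n) f_ (lift ord0 i) K)).
  by apply: cvgM => //; apply: IH.
by apply/funext => K; rewrite big_ord_recl.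
Qed.

Section iid_products.
Context d (T : measurableType d) (R : realType) (P : probability T R).
Context d' (U : measurableType d') (Y : T -> U) (Ys : nat -> T -> U).
Hypothesis mY : measurable_fun setT Y.
Hypothesis mYs : forall i, measurable_fun setT (Ys i).
Hypothesis iidY : iid_copies P Y Ys.

Lemma bdm_prod n (F : 'I_n -> T -> R) : (forall i, bdm (F i)) ->
  bdm (fun w => \prod_(i < n) F i w).
Proof.
elim: n F => [|n IH] F H.
  rewrite (_ : (fun _ => _) = fun=> 1); first exact: bdm_cst.
  by apply/funext => w; rewrite big_ord0.
rewrite (_ : (fun _ => _) = fun w => F ord0 w * \prod_(i < n) F (lift ord0 i) w).
  by apply: bdmM => //; apply: IH.
by apply/funext => w; rewrite big_ord_recl.
Qed.

Lemma iid_indic n (E : 'I_n -> set U) : (forall i, measurable (E i)) ->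
  \int[P]_w (\prod_(i < n) (\1_(E i) (Ys i w) : R)) =
  \prod_(i < n) \int[P]_w (\1_(E i) (Y w)).
Proof.
move=> mE.
pose E' m := if (insub m : option 'I_n) is Some i then E i else setT.
have E'E (i : 'I_n) : E' i = E i by rewrite /E' valK.
have mE' m : measurable (E' m) by rewrite /E'; case: insub.
pose J := [fset x in iota 0 n]%fset.
have pJ : perm_eq J (iota 0 n).
  by apply: uniq_perm; [exact: fset_uniq|exact: iota_uniq|move=> x; rewrite !inE].
have [ind law] := iidY.
have := ind J E' mE'.
have iotaE : iota 0 n = index_iota 0 n by rewrite /index_iota subn0.
rewrite (perm_big _ pJ)/= iotaE big_mkord => h.
transitivity (fine (P (\bigcap_(i in [set` J]) Ys i @^-1` E' i))).
  rewrite -bint_indic; last first.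
    apply: fin_bigcap_measurable; first exact: finite_fset.
    by move=> i _; rewrite -[X in measurable X]setTI; exact: mYs.
  apply: eq_Rintegral => w _; rewrite indicE.
  have [hw|hw] := pselect ((\bigcap_(i in [set` J]) Ys i @^-1` E' i) w).
    rewrite mem_set// big1// => i _; rewrite indicE mem_set// -E'E.
    by apply: hw; rewrite /= !inE mem_iota /=.
  rewrite memNset//; apply/eqP; rewrite prodf_seq_eq0; apply/hasP.
  have [i hi] : exists i : 'I_n, ~ E i (Ys i w).
    apply: contrapT => /forallNP hE; apply: hw => m /=; rewrite !inE mem_iota /= => mn.
    have := hE (Ordinal mn); rewrite -E'E => /contrapT; exact.
  by exists i; rewrite ?mem_index_enum//= indicE memNset.
rewrite h; apply: eq_bigr => i _; rewrite law// E'E -bint_indic//.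
by rewrite -[X in measurable X]setTI; exact: mY.
Qed.

(** Independence is given for events only; [f] is the bounded limit of its
    layers, which are combinations of indicators of level sets. *)
Lemma iid_product n (f : U -> R) (B : R) : measurable_fun setT f ->
  (forall u, 0 <= f u <= B) ->
  \int[P]_w (\prod_(i < n) f (Ys i w)) = (\int[P]_w f (Y w)) ^+ n.
Proof.
move=> mf fB0.
wlog B0 : B fB0 / 0 < B.
  move=> H; apply: (H (`|B| + 1)); last by rewrite ltr_wpDl.
  move=> u; have /andP[-> fB] := fB0 u.
  by rewrite (le_trans fB)// (le_trans (ler_norm _))// lerDl.
pose Lv K (l : 'I_K.+1) := [set u | l.+1%:R * (B / K.+1%:R) <= f u].
have mLv K l : measurable (@Lv K l).
  by rewrite -[X in measurable X]setTI; apply: measurable_fun_le.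
have layE K u : layer B K (f u) = \sum_(l < K.+1) B / K.+1%:R * \1_(@Lv K l) u.
  by apply: eq_bigr => l _; rewrite indicE mem_setE.
have blay K : bdm (fun u => layer B K (f u)).
  rewrite (_ : (fun _ => _) = fun u => \sum_(l < K.+1) B / K.+1%:R * \1_(@Lv K l) u).
    by apply: bdm_sum => l; apply: bdmZ; exact: bdm_indic.
  by apply/funext => u; exact: layE.
have layB K u : `|layer B K (f u)| <= B.
  rewrite ger0_norm ?layer_ge0//; have /andP[+ _] := layer_bounds K B0 (fB0 u).
  by move=> /le_trans; apply; have /andP[] := fB0 u.
have key K : \int[P]_w (\prod_(i < n) layer B K (f (Ys i w))) =
    (\int[P]_w layer B K (f (Y w))) ^+ n.
  have bI (l : 'I_K.+1) i : bdm (fun w => \1_(@Lv K l) (Ys i w) : R).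
    exact: bdm_comp (bdm_indic R (mLv K l)) (mYs i).
  have bIY (l : 'I_K.+1) : bdm (fun w => \1_(@Lv K l) (Y w) : R).
    exact: bdm_comp (bdm_indic R (mLv K l)) mY.
  transitivity (\int[P]_w (\sum_(g : {ffun 'I_n -> 'I_K.+1})
      (B / K.+1%:R) ^+ n * \prod_(i < n) \1_(@Lv K (g i)) (Ys i w))).
    apply: eq_Rintegral => w _; under eq_bigr do rewrite layE.
    rewrite bigA_distr_bigA; apply: eq_bigr => g _ /=.
    by rewrite big_split/= prodr_const card_ord.
  rewrite bint_sum; last by move=> g; apply: bdmZ; apply: bdm_prod.
  transitivity (\sum_(g : {ffun 'I_n -> 'I_K.+1}) \prod_(i < n)
      (B / K.+1%:R * \int[P]_w \1_(@Lv K (g i)) (Y w))).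
    apply: eq_bigr => g _; rewrite bintZ; last exact: bdm_prod.
    by rewrite iid_indic// big_split/= prodr_const card_ord.
  rewrite -(bigA_distr_bigA (fun _ l => B / K.+1%:R * \int[P]_w \1_(@Lv K l) (Y w))).
  rewrite prodr_const card_ord; congr (_ ^+ n).
  under [RHS]eq_Rintegral do rewrite layE.
  rewrite bint_sum; last by move=> l; exact: bdmZ.
  by apply: eq_bigr => l _; rewrite bintZ.
have c1 : \int[P]_w (\prod_(i < n) layer B K (f (Ys i w))) @[K --> \oo] -->
    \int[P]_w (\prod_(i < n) f (Ys i w)).
  have [|||//] := @cvg_bint _ _ _ P (fun K w => \prod_(i < n) layer B K (f (Ys i w)))
    (fun w => \prod_(i < n) f (Ys i w)) (B ^+ n).
  - by move=> K; apply: bdm_meas; apply: bdm_prod => i; exact: bdm_comp (blay K) (mYs i).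
  - move=> K w; rewrite normr_prod -[in leRHS](card_ord n) -prodr_const.
    by apply: ler_prod => i _; rewrite layB normr_ge0.
  - by move=> w; apply: cvg_prod_ord => i; exact: cvg_layer.
have c2 : \int[P]_w layer B K (f (Y w)) @[K --> \oo] --> \int[P]_w f (Y w).
  have [|||//] := @cvg_bint _ _ _ P (fun K w => layer B K (f (Y w)))
    (fun w => f (Y w)) B.
  - by move=> K; apply: bdm_meas; exact: bdm_comp (blay K) mY.
  - by move=> K w; exact: layB.
  - by move=> w; exact: cvg_layer.
have c3 := cvg_comp _ _ c2 (@exprn_continuous R n _).
have E : (fun K => \int[P]_w (\prod_(i < n) layer B K (f (Ys i w)))) =
    (fun x : R => x ^+ n) \o (fun K => \int[P]_w layer B K (f (Y w))).
  by apply/funext => K; exact: key.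
rewrite E in c1.
exact: (cvg_unique _ c1 c3).
Qed.

End iid_products.

(** * Exponential moments of centred sums *)

Section exponential_bounds.
Context (R : realType).

Lemma expR_le_quad (x : R) : `|x| <= 2^-1 -> expR x <= 1 + x + 2 * x ^+ 2.
Proof.
rewrite ler_norml => /andP[h1 h2].
have := expR_ge1Dx (- x); rewrite expRN => h.
have x1 : 0 < 1 - x by lra.
have h3 : expR x <= (1 - x)^-1.
  by rewrite -[expR x]invrK lef_pV2 ?posrE ?invr_gt0 ?expR_gt0.
apply: (le_trans h3); rewrite -[leLHS]mul1r ler_pdivrMr//.
have : (1 + x + 2 * x ^+ 2) * (1 - x) = 1 + x ^+ 2 * (1 - 2 * x) by ring.
move=> ->; rewrite lerDl mulr_ge0 ?sqr_ge0//; lra.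
Qed.

Let cubic (c x : R) := expR x - (1 + x + 2^-1 * x ^+ 2 + c * x ^+ 3).

Let is_derive_cubic (c x : R) :
  is_derive x (1 : R) (cubic c) (expR x - (1 + x + 3 * c * x ^+ 2)).
Proof.
rewrite /cubic.
apply: is_derive_eq.
have sc (a b : R) : a *: (b : R^o) = a * b by [].
by rewrite !sc; field.
Qed.

Let cubic_mono (s c x y : R) : (forall z, `|z| <= 2^-1 ->
    0 <= s * (expR z - (1 + z + 3 * c * z ^+ 2))) ->
  - 2^-1 <= x -> x <= y -> y <= 2^-1 -> s * cubic c x <= s * cubic c y.
Proof.
move=> H hx xy hy.
have der z : is_derive z (1:R) (fun z => (- s) *: (cubic c z : R^o))
    ((- s) *: (expR z - (1 + z + 3 * c * z ^+ 2) : R^o)).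
  have H1 := is_derive_cubic c z; exact: is_deriveZ.
rewrite -lerN2 -!mulNr.
apply: (@ler0_derive1_nincr _ (fun z => (- s) *: (cubic c z : R^o)) (- 2^-1) 2^-1) => //.
- move=> z; rewrite in_itv/= => /andP[z1 z2].
  rewrite derive1E (@derive_val _ _ _ _ _ _ _ (der z)).
  by rewrite /GRing.scale/= mulNr oppr_le0 H// ler_norml (ltW z1) (ltW z2).
- apply: continuous_subspaceT => z.
  apply: differentiable_continuous; apply/derivable1_diffP.
  exact: (@ex_derive _ _ _ _ _ _ _ (der z)).
Qed.

Lemma expR_taylor2 (x : R) : `|x| <= 2^-1 ->
  `|expR x - (1 + x + 2^-1 * x ^+ 2)| <= `|x| ^+ 3.
Proof.
move=> hx; have := hx; rewrite ler_norml => /andP[h1 h2].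
have c0 c : cubic c 0 = 0 by rewrite /cubic expR0 !expr0n /=; ring.
have dn (z : R) : `|z| <= 2^-1 -> 0 <= 1 * (expR z - (1 + z + 3 * -1 * z ^+ 2)).
  by move=> _; have := expR_ge1Dx z; have := sqr_ge0 z; lra.
have up (z : R) : `|z| <= 2^-1 -> 0 <= -1 * (expR z - (1 + z + 3 * 1 * z ^+ 2)).
  by move=> hz; have := expR_le_quad hz; have := sqr_ge0 z; lra.
have half0 : - 2^-1 <= (0:R) by rewrite oppr_le0.
have half1 : (0:R) <= 2^-1 by [].
have [x0|x0] := leP 0 x.
  have := cubic_mono dn half0 x0 h2; have := cubic_mono up half0 x0 h2.
  rewrite !c0 /cubic (ger0_norm x0) ler_norml => h3 h4; apply/andP; split; lra.
have := cubic_mono dn h1 (ltW x0) half1; have := cubic_mono up h1 (ltW x0) half1.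
have -> : `|x| ^+ 3 = - x ^+ 3 by rewrite ltr0_norm//; ring.
rewrite !c0 /cubic ler_norml => h3 h4; apply/andP; split; lra.
Qed.

End exponential_bounds.

Section iid_exponential_moments.
Context d (T : measurableType d) (R : realType) (P : probability T R).
Context d' (U : measurableType d') (Y : T -> U) (Ys : nat -> T -> U).
Hypothesis mY : measurable_fun setT Y.
Hypothesis mYs : forall i, measurable_fun setT (Ys i).
Hypothesis iidY : iid_copies P Y Ys.

Lemma iid_mgf n (h : U -> R) (th : R) : bdm h ->
  \int[P]_w expR (th * \sum_(i < n) h (Ys i w)) =
  (\int[P]_w expR (th * h (Y w))) ^+ n.
Proof.
move=> bh; have [mh [M hM]] := bh.
rewrite -(@iid_product _ _ _ P _ _ Y Ys mY mYs iidY n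
  (fun u => expR (th * h u)) (expR (`|th| * M))).
- by apply: eq_Rintegral => w _; rewrite mulr_sumr expR_sum.
- exact: bdm_meas (bdm_expR (bdmZ th bh)).
- move=> u; rewrite expR_ge0 ler_expR (le_trans (ler_norm _))// normrM.
  by rewrite ler_wpM2l.
Qed.

Lemma bdm_sum_iid n (h : U -> R) : bdm h -> bdm (fun w => \sum_(i < n) h (Ys i w)).
Proof. by move=> bh; apply: bdm_sum => i; exact: bdm_comp bh (mYs i). Qed.

Lemma bernstein n (h : U -> R) (v th x : R) : bdm h -> (forall u, `|h u| <= 1) ->
  \int[P]_w h (Y w) = 0 -> \int[P]_w (h (Y w)) ^+ 2 <= v -> 0 <= th <= 2^-1 ->
  (P [set w | x <= \sum_(i < n) h (Ys i w)]%R <=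
    (expR (- (th * x) + n%:R * (2 * th ^+ 2 * v)))%:E)%E.
Proof.
move=> bh h1 h0 hv /andP[th0 th1].
have bS := bdm_sum_iid n bh.
have bhY : bdm (fun w => h (Y w)) by exact: bdm_comp bh mY.
have mA : measurable [set w | x <= \sum_(i < n) h (Ys i w)].
  by rewrite -[X in measurable X]setTI; apply: measurable_fun_le => //; exact: bdm_meas.
have := @tilted_markov _ _ _ P _ (cst 0) (fun w => th * \sum_(i < n) h (Ys i w))
  (th * x) mA (measurable_cst _) (bdm_meas (bdmZ th bS)).
rewrite /= expR0 integral_cst//= mul1e => H; apply: (le_trans (H _)).
  by move=> w /= Aw; rewrite ler_wpM2l.
under eq_integral do rewrite add0r.
rewrite bintE; last by apply: bdm_expR; exact: bdmZ.
rewrite iid_mgf// -EFinM lee_fin expRD ler_wpM2l ?expR_ge0//.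
rewrite expRM_natl; apply: lerXn2r; rewrite ?nnegrE ?expR_ge0//.
  by apply: bint_ge0 => w; exact: expR_ge0.
apply: (@le_trans _ _ (1 + 2 * th ^+ 2 * v)); last exact: expR_ge1Dx.
have bsq : bdm (fun w => h (Y w) ^+ 2).
  by rewrite (_ : (fun _ => _) = fun w => h (Y w) * h (Y w)); [exact: bdmM|].
apply: (@le_trans _ _ (\int[P]_w ((1 + th * h (Y w)) + 2 * th ^+ 2 * h (Y w) ^+ 2))).
  apply: le_bint.
  - by apply: bdm_expR; exact: bdmZ.
  - apply: bdmD; last exact: bdmZ.
    by apply: bdmD; [exact: bdm_cst|exact: bdmZ].
  - move=> w; rewrite -mulrA -exprMn; apply: expR_le_quad.
    rewrite normrM (ger0_norm th0); apply: le_trans th1.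
    by rewrite ler_piMr.
rewrite bintD; last 2 first.
- by apply: bdmD; [exact: bdm_cst|exact: bdmZ].
- exact: bdmZ.
rewrite bintD; last 2 first; [exact: bdm_cst|exact: bdmZ|].
rewrite !bintZ// h0 mulr0 addr0 pint_cst lerD2l.
by rewrite ler_wpM2l// mulr_ge0// sqr_ge0.
Qed.

Lemma bernstein_two_sided n (h : U -> R) (v y : R) : bdm h -> (forall u, `|h u| <= 1) ->
  \int[P]_w h (Y w) = 0 -> \int[P]_w (h (Y w)) ^+ 2 <= v -> 0 < v -> 0 < y <= 2 * v ->
  (P [set w | n%:R * y <= `|\sum_(i < n) h (Ys i w)| ]%R <=
    (2 * expR (- (n%:R * (y ^+ 2 / (8 * v)))))%:E)%E.
Proof.
move=> bh h1 h0 hv v0 /andP[y0 y2].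
pose th := y / (4 * v).
have th0 : 0 <= th by rewrite divr_ge0 ?mulr_ge0// ltW.
have th1 : th <= 2^-1 by rewrite ler_pdivrMr ?mulr_gt0//; lra.
have thE : - (th * (n%:R * y)) + n%:R * (2 * th ^+ 2 * v) =
    - (n%:R * (y ^+ 2 / (8 * v))).
  by rewrite /th; field; rewrite gt_eqF.
have th01 : 0 <= th <= 2^-1 by rewrite th0.
have hN : \int[P]_w - h (Y w) = 0.
  under eq_Rintegral do rewrite -mulN1r.
  by rewrite bintZ ?h0 ?mulr0//; exact: bdm_comp bh mY.
have hNv : \int[P]_w (- h (Y w)) ^+ 2 <= v by under eq_Rintegral do rewrite sqrrN.
have hN1 u : `|- h u| <= 1 by rewrite normrN.
have b1 := bernstein n (n%:R * y) bh h1 h0 hv th01.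
have b2 := bernstein n (n%:R * y) (bdmN bh) hN1 hN hNv th01.
rewrite thE in b1 b2.
have bS := bdm_sum_iid n bh; have bNS := bdm_sum_iid n (bdmN bh).
have m1 : measurable [set w | n%:R * y <= \sum_(i < n) h (Ys i w)].
  by rewrite -[X in measurable X]setTI; apply: measurable_fun_le => //; exact: bdm_meas.
have m2 : measurable [set w | n%:R * y <= \sum_(i < n) - h (Ys i w)].
  by rewrite -[X in measurable X]setTI; apply: measurable_fun_le => //; exact: bdm_meas.
have m3 : measurable [set w | n%:R * y <= `|\sum_(i < n) h (Ys i w)|].
  rewrite -[X in measurable X]setTI; apply: measurable_fun_le => //.
  by apply: measurableT_comp => //; exact: bdm_meas.
rewrite -[2]/(1 + 1) mulrDl mul1r EFinD; apply: le_trans (leeD b1 b2).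
apply: le_trans (measureU2 _ m1 m2); apply: le_measure; rewrite ?inE//.
  exact: measurableU.
move=> w /=; rewrite ler_normr => /orP[hw|hw]; [by left|right].
by rewrite /= sumrN.
Qed.

(** By the second order Taylor bound with cubic remainder, the exponential
    moment of one summand is [1 + b n ^ 2 * s / 2] up to an error of smaller order
    than [b n ^ 2]. *)
Lemma mgf_asymptotics (h : U -> R) (s : R) (b : nat -> R) : bdm h ->
  \int[P]_w h (Y w) = 0 -> \int[P]_w (h (Y w)) ^+ 2 = s ->
  (\forall n \near \oo, 0 < b n) -> b n @[n --> \oo] --> 0 ->
  forall e, 0 < e -> \forall n \near \oo,
    ((expR (n%:R * b n ^+ 2 * (2^-1 * s - e)))%:E <=
      \int[P]_w (expR (b n * \sum_(i < n) h (Ys i w)))%:E <=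
     (expR (n%:R * b n ^+ 2 * (2^-1 * s + e)))%:E)%E.
Proof.
move=> bh h0 hs b0 b_0 e e0.
have [_ [M0 hM0]] := bh.
pose M := `|M0| + 1.
have M1 : 0 < M by rewrite ltr_wpDl.
have hM u : `|h u| <= M by rewrite (le_trans (hM0 u))// (le_trans (ler_norm _))// lerDl.
pose q := 2^-1 * s - e.
have q1 : 0 < `|q| + 1 by rewrite ltr_wpDl.
have q2 : 0 < 2 * q ^+ 2 + 1 by rewrite ltr_wpDl// mulr_ge0// sqr_ge0.
have small (c : R) : 0 < c -> \forall n \near \oo, b n <= c.
  move=> c0; have /cvgrPdist_le/(_ c c0) := b_0; apply: filterS => n.
  by rewrite sub0r normrN => /(le_trans (ler_norm _)).
near=> n.
have bn0 : 0 < b n by near: n.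
have bM : b n * M <= 2^-1.
  rewrite -ler_pdivlMr//; near: n; apply: small; rewrite divr_gt0//.
have bM3 : b n * M ^+ 3 <= e / 2.
  rewrite -ler_pdivlMr ?exprn_gt0//; near: n; apply: small.
  by rewrite !divr_gt0// exprn_gt0.
have b1 : b n <= 1 by near: n; exact: small.
have bq : b n * `|q| <= 2^-1.
  apply: (@le_trans _ _ (b n * (`|q| + 1))); first by rewrite ler_wpM2l ?(ltW bn0)// lerDl.
  by rewrite -ler_pdivlMr//; near: n; apply: small; rewrite divr_gt0.
have bq2 : b n * (2 * q ^+ 2) <= e / 2.
  apply: (@le_trans _ _ (b n * (2 * q ^+ 2 + 1))).
    by rewrite ler_wpM2l ?(ltW bn0)// lerDl.
  by rewrite -ler_pdivlMr//; near: n; apply: small; do ?apply: divr_gt0.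
set c := b n in bn0 bM bM3 b1 bq bq2 *.
have bhY : bdm (fun w => h (Y w)) by exact: bdm_comp bh mY.
have bsq : bdm (fun w => h (Y w) ^+ 2).
  by rewrite (_ : (fun _ => _) = fun w => h (Y w) * h (Y w)); [exact: bdmM|].
have bE : bdm (fun w => expR (c * h (Y w))) by apply: bdm_expR; exact: bdmZ.
have bpol k : bdm (fun w => (k + c * h (Y w)) + 2^-1 * c ^+ 2 * h (Y w) ^+ 2).
  apply: bdmD; last exact: bdmZ.
  by apply: bdmD; [exact: bdm_cst|exact: bdmZ].
have ipol k : \int[P]_w ((k + c * h (Y w)) + 2^-1 * c ^+ 2 * h (Y w) ^+ 2) =
    k + 2^-1 * c ^+ 2 * s.
  rewrite bintD; last 2 first.
  - by apply: bdmD; [exact: bdm_cst|exact: bdmZ].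
  - exact: bdmZ.
  rewrite bintD; last 2 first; [exact: bdm_cst|exact: bdmZ|].
  by rewrite !bintZ// h0 mulr0 addr0 pint_cst hs.
set I := \int[P]_w expR (c * h (Y w)).
have tay w : `|expR (c * h (Y w)) - (1 + c * h (Y w) + 2^-1 * c ^+ 2 * h (Y w) ^+ 2)|
    <= c ^+ 3 * M ^+ 3.
  have hc : `|c * h (Y w)| <= c * M.
    by rewrite normrM (gtr0_norm bn0) ler_wpM2l// ltW.
  have := @expR_taylor2 _ (c * h (Y w)) (le_trans hc bM).
  rewrite exprMn mulrA => /le_trans; apply.
  by rewrite -exprMn lerXn2r// nnegrE// mulr_ge0// ltW.
have Iup : I <= (1 + c ^+ 3 * M ^+ 3) + 2^-1 * c ^+ 2 * s.
  rewrite -ipol; apply: le_bint => // w.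
  by have := tay w; rewrite ler_norml => /andP[_]; lra.
have Idn : (1 - c ^+ 3 * M ^+ 3) + 2^-1 * c ^+ 2 * s <= I.
  rewrite -ipol; apply: le_bint => // w.
  by have := tay w; rewrite ler_norml => /andP[+ _]; lra.
have c2 : 0 < c ^+ 2 by rewrite exprn_gt0.
have cM : c ^+ 3 * M ^+ 3 <= c ^+ 2 * (e / 2).
  by rewrite (_ : c ^+ 3 * M ^+ 3 = c ^+ 2 * (c * M ^+ 3)); [rewrite ler_pM2l|ring].
rewrite bintE; last by apply: bdm_expR; apply: bdmZ; exact: bdm_sum_iid.
have I0 : 0 <= I by apply: bint_ge0 => w; exact: expR_ge0.
rewrite iid_mgf// -/I !lee_fin -!mulrA !expRM_natl.
have cq : `|c ^+ 2 * q| <= 2^-1.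
  rewrite normrM (gtr0_norm c2) expr2 -mulrA (le_trans _ bq)//.
  by rewrite ler_piMl// mulr_ge0// ltW.
apply/andP; split; apply: lerXn2r; rewrite ?nnegrE ?expR_ge0//.
  rewrite mulrA -expr2; apply: le_trans Idn; apply: (le_trans (expR_le_quad cq)).
  have : (c ^+ 2 * q) ^+ 2 * 2 <= c ^+ 2 * (e / 2).
    rewrite (_ : _ * 2 = c ^+ 2 * (c * (c * (2 * q ^+ 2)))); last by ring.
    rewrite ler_pM2l// (le_trans _ bq2)// ler_piMl//.
    by rewrite mulr_ge0 ?(ltW bn0)// mulr_ge0// sqr_ge0.
  rewrite /q; lra.
rewrite mulrA -expr2; apply: (le_trans Iup); apply: le_trans (expR_ge1Dx _).
have : 0 <= c ^+ 2 * (e / 2) by rewrite mulr_ge0 ?(ltW c2)// divr_ge0// ltW.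
lra.
Unshelve. all: by end_near. Qed.

End iid_exponential_moments.

(** * Chaining for empirical processes of monotone functions *)

Section chaining.
Context d (T : measurableType d) (R : realType) (P : probability T R).
Context d' (U : measurableType d') (Y : T -> U) (Ys : nat -> T -> U).
Hypothesis mY : measurable_fun setT Y.
Hypothesis mYs : forall i, measurable_fun setT (Ys i).
Hypothesis iidY : iid_copies P Y Ys.

Variables (Th : R -> U -> R) (mn m : R -> R).
Hypothesis Th_meas : forall t, measurable_fun setT (Th t).
Hypothesis Th01 : forall t u, 0 <= Th t u <= 1.
Hypothesis Th_mono : forall u s t, s <= t -> Th s u <= Th t u.
Hypothesis Th_rc : forall u t, Th x u @[x --> t^'+] --> Th t u.
Hypothesis mnE : forall t, \int[P]_w Th t (Y w) = mn t.
Hypothesis mn_rc : forall t : R, mn x @[x --> t^'+] --> mn t.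
Hypothesis m01 : forall t, 0 <= m t < 1.
Hypothesis m_mono : forall s t, s <= t -> m s <= m t.
Hypothesis m_rc : forall t : R, m x @[x --> t^'+] --> m t.
Hypothesis mn_m : forall s t, s <= t -> mn t - mn s <= m t - m s.

Definition dev n t w := n%:R^-1 * \sum_(i < n) Th t (Ys i w) - mn t.

(** The clock value [m t] truncated to [k] binary digits; a cell of level [k] is
    a set of times with the same index. *)
Definition cell k t := Num.truncn (2 ^+ k * m t).

Let Th_bdm t : bdm (Th t).
Proof.
split; first exact: Th_meas.
by exists 1 => u; have /andP[h1 h2] := Th01 t u; rewrite ger0_norm.
Qed.

Let bdm_dev n t : bdm (dev n t).
Proof.
apply: bdmB; last exact: bdm_cst.
by apply: bdmZ; exact: (bdm_sum_iid mYs n (Th_bdm t)).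
Qed.

Let mn_mono s t : s <= t -> mn s <= mn t.
Proof.
move=> st; rewrite -!mnE; apply: le_bint => [||w]; last exact: Th_mono.
- exact: bdm_comp (Th_bdm s) mY.
- exact: bdm_comp (Th_bdm t) mY.
Qed.

Let mn01 t : 0 <= mn t <= 1.
Proof.
rewrite -mnE; apply/andP; split.
  by apply: bint_ge0 => w; have /andP[] := Th01 t (Y w).
rewrite -[leRHS](pint_cst P 1); apply: le_bint => [||w].
- exact: bdm_comp (Th_bdm t) mY.
- exact: bdm_cst.
- by have /andP[] := Th01 t (Y w).
Qed.

(** An increment of a monotone function with values in [0, 1] has a variance
    bounded by the increment of its mean, hence by that of the clock. *)
Lemma dev_incr_tail n s t v y : (0 < n)%N -> `|m t - m s| <= v -> 0 < v ->
  0 < y <= 2 * v ->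
  (P [set w | y < `|dev n t w - dev n s w|]%R <=
    (2 * expR (- (n%:R * (y ^+ 2 / (8 * v)))))%:E)%E.
Proof.
wlog st : s t / s <= t.
  move=> H n0 hm v0 hy; have [st|/ltW ts] := leP s t; first exact: H.
  by under eq_set do rewrite distrC; apply: H => //; rewrite distrC.
move=> n0 hm v0 hy; have n1 : 0 < n%:R :> R by rewrite ltr0n.
pose h u := (Th t u - Th s u) - (mn t - mn s).
have bT : bdm (fun u => Th t u - Th s u) by apply: bdmB.
have bh : bdm h by apply: bdmB => //; exact: bdm_cst.
have dT u : 0 <= Th t u - Th s u <= 1.
  have := Th01 t u; have := Th01 s u; have := Th_mono u st.
  by move=> ? /andP[? ?] /andP[? ?]; apply/andP; split; lra.
have dmn : 0 <= mn t - mn s <= 1.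
  have := mn01 t; have := mn01 s; have := mn_mono st.
  by move=> ? /andP[? ?] /andP[? ?]; apply/andP; split; lra.
have h1 u : `|h u| <= 1.
  rewrite ler_norml /h; have := dT u; have := dmn.
  by move=> /andP[? ?] /andP[? ?]; apply/andP; split; lra.
have bTY r : bdm (fun w => Th r (Y w)) by exact: bdm_comp (Th_bdm r) mY.
have bTTY : bdm (fun w => Th t (Y w) - Th s (Y w)) by apply: bdmB.
have iT : \int[P]_w (Th t (Y w) - Th s (Y w)) = mn t - mn s by rewrite bintB// !mnE.
have h0 : \int[P]_w h (Y w) = 0.
  by rewrite /h bintB ?pint_cst ?iT ?subrr//; exact: bdm_cst.
have hv : \int[P]_w (h (Y w)) ^+ 2 <= v.
  set c := mn t - mn s in iT dmn.
  have bsq : bdm (fun w => (Th t (Y w) - Th s (Y w)) - (2 * c * (Th t (Y w) - Th s (Y w)) - c ^+ 2)).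
    by apply: bdmB => //; apply: bdmB; [exact: bdmZ|exact: bdm_cst].
  have bhY : bdm (fun w => h (Y w)) by exact: bdm_comp bh mY.
  apply: (@le_trans _ _ (\int[P]_w ((Th t (Y w) - Th s (Y w)) -
      (2 * c * (Th t (Y w) - Th s (Y w)) - c ^+ 2)))).
    apply: le_bint => [||w] //.
      by rewrite (_ : (fun _ => _) = fun w => h (Y w) * h (Y w)); [exact: bdmM|].
    rewrite /h -/c; have /andP[a1 a2] := dT (Y w); nra.
  rewrite bintB//; last by apply: bdmB; [exact: bdmZ|exact: bdm_cst].
  rewrite iT bintB; [|exact: bdmZ|exact: bdm_cst].
  rewrite bintZ// pint_cst iT; apply: le_trans (le_trans (ler_norm _) hm).
  have := mn_m st; rewrite -/c; have := sqr_ge0 c; lra.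
apply: le_trans (bernstein_two_sided mY mYs iidY n bh h1 h0 hv v0 hy).
apply: le_measure; rewrite ?inE//.
- apply: measurable_lt_set => //.
  by apply: measurableT_comp => //; apply: bdm_meas; apply: bdmB.
- apply: measurable_le_set => //.
  by apply: measurableT_comp => //; apply: bdm_meas; exact: (bdm_sum_iid mYs n bh).
move=> w /= /ltW hw.
have -> : \sum_(i < n) h (Ys i w) = n%:R * (dev n t w - dev n s w).
  rewrite /dev /h sumrB sumrB sumr_const card_ord -[_ *+ n]mulr_natl.
  by field; rewrite gt_eqF.
by rewrite normrM ger0_norm// ler_wpM2l.
Qed.

Lemma cell_lt k t : (cell k t < 2 ^ k)%N.
Proof.
have /andP[m0 m1] := m01 t.
rewrite truncn_lt_nat ?mulr_ge0 ?exprn_ge0// natrX -[ltRHS]mulr1.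
by rewrite ltr_pM2l// exprn_gt0.
Qed.

Lemma cell_half k t : cell k t = (cell k.+1 t)./2.
Proof.
have /andP[m0 m1] := m01 t.
have h0 : 0 <= 2 ^+ k.+1 * m t by rewrite mulr_ge0 ?exprn_ge0.
have /andP[h1 h2] := truncn_itv h0.
apply: truncn_def; rewrite -/(cell k.+1 t) in h1 h2 *.
set c := cell k.+1 t in h1 h2 *.
have e : 2 ^+ k.+1 * m t = 2 * (2 ^+ k * m t) by rewrite exprS mulrA.
rewrite e in h1 h2.
have c1 : 2 * (c./2)%:R <= c%:R :> R.
  by rewrite -natrM ler_nat -[X in (_ <= X)%N]odd_double_half mul2n leq_addl.
have c2 : c%:R <= 2 * (c./2)%:R + 1 :> R.
  rewrite -natrM natr1 ler_nat -[X in (X <= _)%N]odd_double_half mul2n -add1n.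
  by rewrite leq_add2r leq_b1.
rewrite -[c.+1%:R]natr1 in h2; rewrite -[(c./2).+1%:R]natr1.
apply/andP; split; lra.
Qed.

Lemma cell_dist k s t : cell k s = cell k t -> `|m t - m s| <= 2 ^- k.
Proof.
move=> e; have /andP[ms0 _] := m01 s; have /andP[mt0 _] := m01 t.
have k0 : 0 < 2 ^+ k :> R by rewrite exprn_gt0.
have /andP[s1 s2] := truncn_itv (mulr_ge0 (ltW k0) ms0).
have /andP[t1 t2] := truncn_itv (mulr_ge0 (ltW k0) mt0).
rewrite -/(cell k s) e in s1 s2; rewrite -/(cell k t) in t1 t2.
rewrite -[leRHS]mul1r ler_pdivlMr// -[X in _ * X](gtr0_norm k0) -normrM mulrBl.
rewrite -[_.+1%:R]natr1 in s2; rewrite -[_.+1%:R]natr1 in t2.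
rewrite ler_norml; apply/andP; split; lra.
Qed.

Lemma geometric_half N : \sum_(i < N) 2^-1 ^+ i <= 2 :> R.
Proof.
suff -> : \sum_(i < N) 2^-1 ^+ i = 2 - 2 * 2^-1 ^+ N :> R.
  by rewrite gerBl mulr_ge0// exprn_ge0// invr_ge0.
elim: N => [|N IH]; first by rewrite big_ord0 expr0 mulr1 subrr.
by rewrite big_ord_recr /= IH exprS; field.
Qed.

Lemma bernoulli_98 i : 1 + i%:R / 8 <= (9 / 8) ^+ i :> R.
Proof.
elim: i => [|i IH]; first by rewrite mul0r addr0 expr0.
rewrite exprS -[i.+1%:R]natr1; have : 0 <= i%:R :> R by [].
have : (9/8) * (1 + i%:R / 8) <= (9/8) * (9/8) ^+ i :> R by rewrite ler_wpM2l.
lra.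
Qed.

Let avg_mono n s t w : s <= t ->
  n%:R^-1 * \sum_(i < n) Th s (Ys i w) <= n%:R^-1 * \sum_(i < n) Th t (Ys i w).
Proof. by move=> st; rewrite ler_wpM2l ?invr_ge0// ler_sum// => i _; exact: Th_mono. Qed.

(** The bracketing inequality that stops the chain: between two times the
    deviation cannot exceed that of the end points by more than the increment
    of the mean, which is smaller than the clock. *)
Let dev_bracket n lo hi s t w : lo <= s <= hi -> lo <= t <= hi ->
  `|dev n t w - dev n s w| <= `|dev n hi w - dev n lo w| + (m hi - m lo).
Proof.
move=> hs ht; wlog st : s t hs ht / s <= t.
  move=> H; have [st|/ltW ts] := leP s t; first exact: H.
  by rewrite distrC; exact: H.
case/andP: hs => h1 h2; case/andP: ht => h3 h4.
have a1 := avg_mono n w st; have a2 := avg_mono n w h1; have a3 := avg_mono n w h4.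
have b1 := mn_mono st; have b2 := mn_mono h1; have b3 := mn_mono h4.
have c1 := mn_m (le_trans h1 h2).
have c2 := ler_norm (dev n hi w - dev n lo w).
have c3 := normr_ge0 (dev n hi w - dev n lo w).
rewrite ler_norml; move: c2 c3; rewrite /dev => c2 c3; apply/andP; split; lra.
Qed.

Section finitely_many_times.
Variables (n N k : nat) (r : 'I_N.+1 -> R) (c eps : R).
Hypotheses (n0 : (0 < n)%N) (c0 : 0 < c) (eps0 : 0 < eps).
Hypothesis c_small : eps / 8 * c < 2 ^- k.

Let la := n%:R * c ^+ 2.
Let G := (eps / 16) ^+ 2 * 2 ^+ k / 8.
Hypothesis la_large : expR (- (la * G / 8)) <= 4^-1.

Let idx j cc : 'I_N.+1 := odflt ord0 [pick i | cell j (r i) == cc].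

Let idxP j i : cell j (r (idx j (cell j (r i)))) = cell j (r i).
Proof.
rewrite /idx; case: pickP => [i' /eqP//|/(_ i)]; by rewrite eqxx.
Qed.

Let occ j cc := [exists i, cell j (r i) == cc].

Let occP j i : occ j (cell j (r i)). Proof. by apply/existsP; exists i. Qed.

Lemma last_level : exists I, eps / 16 * c < 2 ^- (k + I) /\ 2 ^- (k + I) <= eps / 8 * c.
Proof.
have ec : 0 < eps / 8 * c by rewrite mulr_gt0// divr_gt0.
have [I0 HI0] : exists I, (2 ^- (k + I) <= eps / 8 * c :> R).
  exists (Num.truncn (eps / 8 * c)^-1).
  rewrite -[leRHS]invrK lef_pV2 ?posrE ?invr_gt0 ?exprn_gt0//.
  have ic : 0 <= (eps / 8 * c)^-1 by rewrite invr_ge0 ltW.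
  have /andP[_ /ltW h] := truncn_itv ic; apply: (le_trans h).
  set K := Num.truncn _; rewrite -natrX ler_nat (leq_trans (ltn_expl K (_ : 1 < 2)%N))//.
  by rewrite leq_exp2l// leq_addl.
have [I HI Imin] := ex_minnP (P := fun I => (2 ^- (k + I) <= eps / 8 * c :> R)) (ex_intro _ I0 HI0).
exists I; split=> //; case: I HI Imin => [|I] HI Imin.
  by move: HI; rewrite addn0 leNgt c_small.
have : ~~ (2 ^- (k + I) <= eps / 8 * c :> R).
  by apply/negP => /Imin; rewrite ltnn.
rewrite -ltNge addnS exprS invfM; lra.
Qed.

(** At level [k + i] the increments are compared with the threshold [ei i],
    which decays like [(3/4)^i], while their variance decays like [2^-i]; the
    exponents therefore grow like [(9/8)^i] and dominate the number of cells.  The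
    chain stops where the clock length of a cell is of the order of [eps * c], and
    monotonicity brackets the remaining increment. *)
Lemma finite_chaining :
  (P [set w | exists i j, cell k (r i) = cell k (r j) /\
      (eps * c < `|dev n (r i) w - dev n (r j) w|)%R] <=
    (2 ^+ k.+3 * expR (- (la * G)))%:E)%E.
Proof.
have [I [I16 I8]] := last_level.
have c43 : (3 / 4 : R) <= 1 by lra.
have lev_le i : (i <= I)%N -> (2:R) ^- (k + I) <= 2 ^- (k + i).
  move=> iI; rewrite lef_pV2 ?posrE ?exprn_gt0//.
  by rewrite -!natrX ler_nat leq_exp2l// leq_add2l.
pose ei i : R := eps / 16 * (3 / 4) ^+ i.
have ei0 i : 0 < ei i by rewrite mulr_gt0 ?divr_gt0// exprn_gt0// divr_gt0.
pose K := (k + I)%N.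
pose hi cc := [arg max_(i > idx K cc | cell K (r i) == cc) r i]%O.
pose lo cc := [arg min_(i < idx K cc | cell K (r i) == cc) r i]%O.
have hiP i : cell K (r (hi (cell K (r i)))) = cell K (r i) /\
    forall j, cell K (r j) = cell K (r i) -> r j <= r (hi (cell K (r i))).
  rewrite /hi; case: arg_maxP; first by rewrite idxP.
  by move=> i' /eqP e H; split=> // j /eqP; exact: H.
have loP i : cell K (r (lo (cell K (r i)))) = cell K (r i) /\
    forall j, cell K (r j) = cell K (r i) -> r (lo (cell K (r i))) <= r j.
  rewrite /lo; case: arg_minP; first by rewrite idxP.
  by move=> i' /eqP e H; split=> // j /eqP; exact: H.
(* for [i < I] a pair joins representatives of two consecutive levels, for
   [i = I] it joins the extreme times of a cell *)
pose pp i cc := if (i < I)%N then r (idx (k + i).+1 cc) else r (hi cc).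
pose qq i cc := if (i < I)%N then r (idx (k + i) cc./2) else r (lo cc).
pose gg i cc := if (i < I)%N then occ (k + i).+1 cc else occ K cc.
have pq i cc : (i <= I)%N -> gg i cc -> cell (k + i) (pp i cc) = cell (k + i) (qq i cc).
  rewrite leq_eqVlt /gg /pp /qq => /orP[/eqP ->|iI]; rewrite ?ltnn ?iI.
    by move=> /existsP[j /eqP <-]; rewrite (hiP j).1 (loP j).1.
  by move=> /existsP[j /eqP <-]; rewrite cell_half idxP -cell_half idxP.
pose A i cc := if gg i cc then
    [set w | ei i * c < `|dev n (pp i cc) w - dev n (qq i cc) w|] else set0.
have mA i cc : measurable (A i cc).
  rewrite /A; case: ifP => // _; apply: measurable_lt_set => //.
  by apply: measurableT_comp => //; apply: bdm_meas; exact: bdmB.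
pose Bad := \big[setU/set0]_(i < I.+1) \big[setU/set0]_(cc < 2 ^ (k + i).+1) A i cc.
have mBi i : measurable (\big[setU/set0]_(cc < 2 ^ (k + i).+1) A i cc).
  exact: bigsetU_measurable.
have la0 : 0 <= la by rewrite mulr_ge0// sqr_ge0.
have G0 : 0 <= G by rewrite divr_ge0// mulr_ge0 ?sqr_ge0// exprn_ge0.
have PA i cc : (i <= I)%N ->
    (P (A i cc) <= (2 * (expR (- (la * G)) * expR (- (la * G / 8)) ^+ i))%:E)%E.
  move=> iI; rewrite /A; case: ifP => gi; last first.
    by rewrite measure0 lee_fin !mulr_ge0// ?exprn_ge0// expR_ge0.
  have v0 : 0 < (2:R) ^- (k + i) by rewrite invr_gt0 exprn_gt0.
  have y0 : 0 < ei i * c by rewrite mulr_gt0.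
  have y2 : ei i * c <= 2 * 2 ^- (k + i).
    have e1 : ei i <= eps / 16.
      rewrite /ei ler_piMr ?divr_ge0 ?(ltW eps0)// exprn_ile1// divr_ge0//.
    have e2 : ei i * c <= eps / 16 * c by rewrite ler_wpM2r// ltW.
    have := lev_le _ iI; lra.
  have hy : 0 < ei i * c <= 2 * 2 ^- (k + i) by rewrite y0.
  apply: (le_trans (dev_incr_tail n0 (cell_dist (esym (pq _ _ iI gi))) v0 hy)).
  rewrite lee_fin ler_pM2l// -expRM_natl -expRD ler_expR.
  have -> : n%:R * ((ei i * c) ^+ 2 / (8 * 2 ^- (k + i))) = la * G * (9 / 8) ^+ i.
    rewrite /la /G /ei exprD.
    have -> : (9 / 8 : R) ^+ i = ((3 / 4) ^+ i) ^+ 2 * 2 ^+ i.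
      by rewrite -exprM mulnC exprM -exprMn; congr (_ ^+ _); field.
    by field; rewrite !expf_neq0.
  have := ler_wpM2l (mulr_ge0 la0 G0) (bernoulli_98 i); lra.
have PBi i : (i <= I)%N -> (P (\big[setU/set0]_(cc < 2 ^ (k + i).+1) A i cc) <=
    (2 ^+ k.+2 * expR (- (la * G)) * 2^-1 ^+ i)%:E)%E.
  move=> iI; apply: (le_trans (Boole_inequality _ _)) => //.
  apply: (@le_trans _ _ (\sum_(cc < 2 ^ (k + i).+1)
      (2 * (expR (- (la * G)) * expR (- (la * G / 8)) ^+ i))%:E)%E).
    by apply: lee_sum => cc _; exact: PA.
  rewrite sumEFin lee_fin sumr_const card_ord -[leLHS]mulr_natl natrX.
  have e2 : expR (- (la * G / 8)) ^+ i <= 4^-1 ^+ i.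
    by rewrite lerXn2r ?nnegrE ?expR_ge0// invr_ge0.
  have -> : 2^-1 ^+ i = 2 ^+ i * 4^-1 ^+ i :> R.
    by rewrite -exprMn; congr (_ ^+ _); field.
  have -> : 2 ^+ (k + i).+1 * (2 * (expR (- (la * G)) * expR (- (la * G / 8)) ^+ i)) =
    (2 ^+ k.+2 * expR (- (la * G)) * 2 ^+ i) * expR (- (la * G / 8)) ^+ i.
    by rewrite !exprS exprD; ring.
  by rewrite [leRHS]mulrA ler_wpM2l// !mulr_ge0 ?exprn_ge0// expR_ge0.
have PBad : (P Bad <= (2 ^+ k.+3 * expR (- (la * G)))%:E)%E.
  have := @Boole_inequality _ _ _ P
    (fun i => \big[setU/set0]_(cc < 2 ^ (k + i).+1) A i cc) I.+1.
  move=> /(_ (fun i _ => mBi i)) h; apply: (le_trans h).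
  apply: (@le_trans _ _ (\sum_(i < I.+1)
      (2 ^+ k.+2 * expR (- (la * G)) * 2^-1 ^+ i)%:E)%E).
    by apply: lee_sum => i _; apply: PBi; rewrite -ltnS.
  rewrite sumEFin lee_fin -mulr_sumr [leRHS](_ : _ = 2 ^+ k.+2 * expR (- (la * G)) * 2).
    by rewrite ler_wpM2l ?geometric_half// mulr_ge0 ?exprn_ge0// expR_ge0.
  by rewrite (exprS _ k.+2); ring.
apply: le_trans PBad; apply: le_measure; rewrite ?inE.
- rewrite (_ : [set w | _] = \bigcup_(i in [set: 'I_N.+1])
     \bigcup_(j in [set j | cell k (r i) = cell k (r j)])
       [set w | eps * c < `|dev n (r i) w - dev n (r j) w|]); last first.
    apply/seteqP; split=> w; first by move=> [i [j [h1 h2]]]; exists i => //; exists j.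
    by move=> [i _ [j h1 h2]]; exists i, j.
  apply: fin_bigcup_measurable; first exact: finite_finset.
  move=> i _; apply: fin_bigcup_measurable; first exact: finite_finset.
  move=> j _; apply: measurable_lt_set => //.
  by apply: measurableT_comp => //; apply: bdm_meas; exact: bdmB.
- exact: bigsetU_measurable.
move=> w; apply: contraPP => nBad.
have good i cc : (i <= I)%N -> (cc < 2 ^ (k + i).+1)%N -> gg i cc ->
    `|dev n (pp i cc) w - dev n (qq i cc) w| <= ei i * c.
  move=> iI cI gi; rewrite leNgt; apply/negP => h; apply: nBad.
  rewrite /Bad -(bigcup_mkord _ (fun i => \big[setU/set0]_(cc < 2 ^ (k + i).+1) A i cc)).
  exists i => //=; rewrite -(bigcup_mkord _ (A i)).
  by exists cc => //=; rewrite /A gi.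
have chain i l : (l <= I)%N ->
    `|dev n (r (idx (k + l) (cell (k + l) (r i)))) w - dev n (r (idx k (cell k (r i)))) w|
    <= eps / 4 * (1 - (3 / 4) ^+ l) * c.
  elim: l => [|l IH] lI.
    by rewrite addn0 subrr normr0 expr0 subrr mulr0 mul0r.
  have := good l (cell (k + l).+1 (r i)) (ltnW lI) (cell_lt _ _).
  rewrite /gg /pp /qq lI -cell_half => /(_ (occP _ _)) h.
  have := IH (ltnW lI); rewrite addnS => h'.
  have -> : eps / 4 * (1 - (3 / 4) ^+ l.+1) * c =
    ei l * c + eps / 4 * (1 - (3 / 4) ^+ l) * c by rewrite /ei exprS; field.
  move: h h'; rewrite !ler_norml => /andP[? ?] /andP[? ?]; apply/andP; split; lra.
have close i : `|dev n (r i) w - dev n (r (idx k (cell k (r i)))) w| <= 3 / 8 * (eps * c).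
  have h1 := chain i I (leqnn I).
  have := good I (cell K (r i)) (leqnn I).
  rewrite /gg /pp /qq ltnn => h2.
  have {}h2 := h2 (leq_trans (cell_lt K (r i)) (leq_pexp2l (isT : 0 < 2)%N (leqnSn _))) (occP _ _).
  have [hc hm] := hiP i; have [lc lm] := loP i.
  have ic := idxP K i.
  have h3 : `|dev n (r i) w - dev n (r (idx K (cell K (r i)))) w| <=
      ei I * c + 2 ^- K.
    apply: (le_trans (@dev_bracket n (r (lo (cell K (r i)))) (r (hi (cell K (r i)))) _ _ w _ _)).
    - by rewrite lm// hm.
    - by rewrite lm// hm.
    rewrite lerD// (le_trans (ler_norm _))//; apply: cell_dist.
    by rewrite hc lc.
  have h4 : eps / 4 * (1 - (3 / 4) ^+ I) * c + ei I * c <= eps / 4 * c.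
    rewrite -mulrDl ler_wpM2r ?(ltW c0)// /ei.
    have q0 : 0 <= (3 / 4 : R) ^+ I by rewrite exprn_ge0// divr_ge0.
    have := mulr_ge0 (ltW eps0) q0; lra.
  move: h1 h3; rewrite -/K !ler_norml => /andP[? ?] /andP[? ?].
  by apply/andP; split; lra.
move=> [i [j [eij]]]; have := close i; have := close j; rewrite eij.
have := mulr_gt0 eps0 c0.
rewrite !ler_norml ltr_normr => ? /andP[? ?] /andP[? ?] /orP[?|?]; lra.
Qed.

End finitely_many_times.

Definition rat_enum (i : nat) : R :=
  if choice.unpickle i is Some q then ratr (q : rat) else 0.

Lemma rat_enum_dense (x e : R) : 0 < e -> exists i, x < rat_enum i < x + e.
Proof.
move=> e0; have xe : x < x + e by rewrite ltrDl.
have [q] := rat_in_itvoo xe; rewrite in_itv/= => hq.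
by exists (choice.pickle q); rewrite /rat_enum choice.pickleK.
Qed.

Lemma near_right_rat (x : R) (A : set R) : (\forall y \near x^'+, A y) ->
  exists i, A (rat_enum i).
Proof.
move=> [e /= e0 He]; have [i /andP[h1 h2]] := rat_enum_dense x e0.
by exists i; apply: He => //=; rewrite ltr_distlC h2 andbT (lt_trans _ h1)// gtrBl.
Qed.

Let dev_rc n w t : dev n x w @[x --> t^'+] --> dev n t w.
Proof.
apply: cvgB; last exact: mn_rc.
apply: cvgMl_tmp.
by apply: cvg_big => [|i _]; [exact: add_continuous|exact: Th_rc].
Qed.

Let cell_rc k t : \forall x \near t^'+, cell k x = cell k t.
Proof.
have /andP[m0 _] := m01 t.
have k0 : 0 < 2 ^+ k :> R by rewrite exprn_gt0.
have h0 : 0 <= 2 ^+ k * m t by rewrite mulr_ge0// ltW.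
have /andP[h1 h2] := truncn_itv h0.
have : \forall x \near t^'+, m x < (Num.truncn (2 ^+ k * m t)).+1%:R / 2 ^+ k.
  by apply: (cvgr_lt (m t)); [exact: m_rc|rewrite ltr_pdivlMr// mulrC].
apply: filterS2 (nbhs_right_ge t) => x tx mx; apply: truncn_def.
rewrite (le_trans h1) ?ler_pM2l ?m_mono//=.
by rewrite mulrC -ltr_pdivlMr.
Qed.

Variables (b lam : nat -> R).
Hypothesis b_gt0 : forall n, (0 < n)%N -> 0 < b n.
Hypothesis b_0 : b n @[n --> \oo] --> 0.
Hypothesis lamE : forall n, lam n = n%:R * b n ^+ 2.
Hypothesis lam_infty : lam n @[n --> \oo] --> +oo.

(** The number of cells of a level only enters through a constant factor, while
    the exponential rate grows with the level. *)
Theorem uniform_chaining k (eps L : R) : 0 < eps -> 0 <= L ->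
  L + 1 <= (eps / 16) ^+ 2 * 2 ^+ k / 8 ->
  negl P lam L (fun n => [set w | exists s t, cell k s = cell k t /\
    eps * b n < `|dev n s w - dev n t w|]).
Proof.
move=> eps0 L0 epsL; pose G := (eps / 16) ^+ 2 * 2 ^+ k / 8.
have GL : L + 1 <= G by [].
have G0 : 0 < G by apply: lt_le_trans GL; rewrite ltr_wpDl.
have k0 : 0 < 2 ^+ k :> R by rewrite exprn_gt0.
have e8 : 0 < 2 ^- k / (eps / 8) by rewrite divr_gt0 ?invr_gt0// divr_gt0.
near=> n.
have n0 : (0 < n)%N by near: n; exists 1%N.
have bn0 := b_gt0 n0.
have bn : eps / 8 * b n < 2 ^- k.
  rewrite mulrC -ltr_pdivlMr ?divr_gt0//.
  by near: n; apply: (cvgr_lt 0).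
have la4 : expR (- (lam n * G / 8)) <= 4^-1.
  rewrite expRN lef_pV2 ?posrE ?expR_gt0//.
  rewrite (le_trans _ (expR_ge1Dx _))//.
  have : 3 / (G / 8) <= lam n by near: n; exact: near_lam_ge.
  by rewrite ler_pdivrMr ?divr_gt0//; lra.
have la1 : 2 ^+ k.+3 <= expR (lam n).
  rewrite (le_trans _ (expR_ge1Dx _))// -lerBlDl.
  by near: n; exact: near_lam_ge.
have la0 : 0 <= lam n by near: n; exact: near_lam_ge.
pose B N := [set w | exists i j : 'I_N.+1, cell k (rat_enum i) = cell k (rat_enum j) /\
  eps * b n < `|dev n (rat_enum i) w - dev n (rat_enum j) w|].
have mB N : measurable (B N).
  rewrite (_ : B N = \bigcup_(i in [set: 'I_N.+1])
     \bigcup_(j in [set j : 'I_N.+1 | cell k (rat_enum i) = cell k (rat_enum j)])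
       [set w | eps * b n < `|dev n (rat_enum i) w - dev n (rat_enum j) w|]); last first.
    apply/seteqP; split=> w; first by move=> [i [j [h1 h2]]]; exists i => //; exists j.
    by move=> [i _ [j h1 h2]]; exists i, j.
  apply: fin_bigcup_measurable; first exact: finite_finset.
  move=> i _; apply: fin_bigcup_measurable; first exact: finite_finset.
  move=> j _; apply: measurable_lt_set => //.
  by apply: measurableT_comp => //; apply: bdm_meas; exact: bdmB.
have PB N : (P (B N) <= (expR (- (L * lam n)))%:E)%E.
  have := @finite_chaining n N k (fun i : 'I_N.+1 => rat_enum i) (b n) eps n0 bn0 eps0 bn.
  rewrite -lamE => /(_ la4) h; apply: (le_trans h); rewrite lee_fin.
  apply: (@le_trans _ _ (expR (lam n) * expR (- (lam n * G)))).
    by rewrite ler_wpM2r// expR_ge0.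
  rewrite -expRD ler_expR; have := ler_wpM2l la0 GL; lra.
have mUB : measurable (\bigcup_N B N) by exact: bigcupT_measurable.
exists (\bigcup_N B N); split=> //.
- move=> w [s [t [est hst]]].
  have ns := cell_rc k s; have nt := cell_rc k t.
  have : \forall x \near s^'+, eps * b n < `|dev n x w - dev n t w|.
    apply: (cvgr_gt `|dev n s w - dev n t w|) => //.
    by apply: cvg_norm; apply: cvgB; [exact: dev_rc|exact: cvg_cst].
  move=> /(filterI ns)/near_right_rat[i [ci hi]].
  have : \forall x \near t^'+, eps * b n < `|dev n (rat_enum i) w - dev n x w|.
    apply: (cvgr_gt `|dev n (rat_enum i) w - dev n t w|) => //.
    by apply: cvg_norm; apply: cvgB; [exact: cvg_cst|exact: dev_rc].
  move=> /(filterI nt)/near_right_rat[j [cj hj]].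
  have iN : (i < (maxn i j).+1)%N by rewrite ltnS leq_maxl.
  have jN : (j < (maxn i j).+1)%N by rewrite ltnS leq_maxr.
  exists (maxn i j) => //; exists (Ordinal iN), (Ordinal jN) => /=.
  by rewrite ci cj.
- have ndB : nondecreasing_seq B.
    move=> N1 N2 N12; apply/subsetPset => w [i [j [h1 h2]]].
    have NN : (N1.+1 <= N2.+1)%N by [].
    by exists (widen_ord NN i), (widen_ord NN j).
  have c := nondecreasing_cvg_mu (mu := P) mB mUB ndB.
  rewrite -(cvg_lim _ c)//; apply: lime_le; first by apply/cvg_ex; eexists; exact: c.
  by apply: nearW => N; exact: PB.
Unshelve. all: by end_near. Qed.

End chaining.

(** * Bounded Fubini and independent pairs *)

Section bounded_fubini.
Context d1 d2 (T1 : measurableType d1) (T2 : measurableType d2) (R : realType).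
Variables (m1 : {finite_measure set T1 -> \bar R}) (m2 : {finite_measure set T2 -> \bar R}).

Lemma bdm_xsection (h : T1 * T2 -> R) x : bdm h -> bdm (fun y => h (x, y)).
Proof. by move=> bh; apply: (bdm_comp bh); exact: measurable_pair1. Qed.

Lemma bdm_ysection (h : T1 * T2 -> R) y : bdm h -> bdm (fun x => h (x, y)).
Proof. by move=> bh; apply: (bdm_comp bh); exact: measurable_pair2. Qed.

Lemma bdm_int2 (h : T1 * T2 -> R) : bdm h -> bdm (fun x => \int[m2]_y h (x, y)).
Proof.
move=> bh; have [mh [M hM]] := bh; split; last first.
  exists (M * fine (m2 setT)) => x.
  by apply: le_normr_bint => [|y]; [exact: bdm_xsection|exact: hM].
pose h' z := h z + M.
have bh' : bdm h' by apply: bdmD => //; exact: bdm_cst.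
have h'0 z : (0 <= (h' z)%:E)%E.
  by rewrite lee_fin /h' -lerBlDr sub0r; have := hM z; rewrite ler_norml => /andP[].
have mF : measurable_fun setT (fubini_F m2 (EFin \o h')).
  apply: measurable_fun_fubini_tonelli_F => //.
  by apply/measurable_EFinP; exact: bdm_meas.
have mF' : measurable_fun setT (fun x => \int[m2]_y h' (x, y)).
  apply/measurable_EFinP; apply: eq_measurable_fun mF => x _ /=.
  by rewrite /fubini_F /= bintE//; exact: bdm_xsection.
rewrite (_ : (fun _ => _) = fun x => \int[m2]_y h' (x, y) - M * fine (m2 setT)).
  by apply: measurable_funB.
apply/funext => x; rewrite bintD; [|exact: bdm_xsection|exact: bdm_cst].
by rewrite bint_cst addrK.
Qed.

Lemma bdm_pair_swap (h : T1 * T2 -> R) : bdm h -> bdm (fun z : T2 * T1 => h (z.2, z.1)).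
Proof.
move=> bh; apply: (bdm_comp bh).
by apply: measurable_fun_pair; [exact: measurable_snd|exact: measurable_fst].
Qed.

End bounded_fubini.

Lemma bint_swap d1 d2 (T1 : measurableType d1) (T2 : measurableType d2) (R : realType)
    (m1 : {finite_measure set T1 -> \bar R}) (m2 : {finite_measure set T2 -> \bar R})
    (h : T1 * T2 -> R) : bdm h ->
  \int[m1]_x (\int[m2]_y h (x, y)) = \int[m2]_y (\int[m1]_x h (x, y)).
Proof.
move=> bh; have [mh [M hM]] := bh.
pose h' z := h z + M.
have bh' : bdm h' by apply: bdmD => //; exact: bdm_cst.
have h'0 z : (0 <= (h' z)%:E)%E.
  by rewrite lee_fin /h' -lerBlDr sub0r; have := hM z; rewrite ler_norml => /andP[].
have b2 : bdm (fun y => \int[m1]_x h (x, y)) := bdm_int2 m1 (bdm_pair_swap bh).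
have b1 := bdm_int2 m2 bh.
have b2' : bdm (fun y => \int[m1]_x h' (x, y)) := bdm_int2 m1 (bdm_pair_swap bh').
have b1' := bdm_int2 m2 bh'.
have := @sfinite_Fubini _ _ _ _ _ m1 m2 (EFin \o h') h'0.
move=> /(_ _) E; have {E} : (\int[m1]_x \int[m2]_y (h' (x, y))%:E)%E =
    (\int[m2]_y \int[m1]_x (h' (x, y))%:E)%E.
  by apply: E; apply/measurable_EFinP; exact: bdm_meas.
under eq_integral => x _ do rewrite (bintE m2 (bdm_xsection x bh')).
under [in X in _ = X]eq_integral => y _ do rewrite (bintE m1 (bdm_ysection y bh')).
rewrite !bintE// => -[].
under eq_Rintegral => x _ do
  rewrite (bintD m2 (bdm_xsection x bh) (bdm_cst _ M)) bint_cst.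
under [in X in _ = X]eq_Rintegral => y _ do
  rewrite (bintD m1 (bdm_ysection y bh) (bdm_cst _ M)) bint_cst.
rewrite !bintD ?bint_cst//; try exact: bdm_cst.
move=> E; apply: (addIr (M * fine (m2 setT) * fine (m1 setT))); rewrite E.
by rewrite mulrAC.
Qed.

Section independent_pair.
Context d (T : measurableType d) (R : realType) (P : probability T R).
Variables (X C : {RV P >-> R}).
Hypothesis XC : independent X C.

Let mpair : measurable_fun setT (fun w => (X w, C w)).
Proof. by apply: measurable_fun_pair. Qed.

Lemma bint_distribution (f : R -> R) : bdm f ->
  \int[distribution P X]_x f x = \int[P]_w f (X w).
Proof.
move=> bf; congr fine; rewrite integral_distribution//.
  by apply/measurable_EFinP; exact: bdm_meas.
have bfX : bdm (fun w => f (X w)) by exact: (bdm_comp bf).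
exact: (bdm_integrable P bfX).
Qed.

Lemma bint_independent (h : R * R -> R) : bdm h ->
  \int[P]_w h (X w, C w) =
  \int[distribution P X]_x (\int[distribution P C]_c h (x, c)).
Proof.
move=> bh; have [mh [M hM]] := bh.
pose h' z := h z + M.
have bh' : bdm h' by apply: bdmD => //; exact: bdm_cst.
have h'0 z : (0 <= (h' z)%:E)%E.
  by rewrite lee_fin /h' -lerBlDr sub0r; have := hM z; rewrite ler_norml => /andP[].
have mh' : measurable_fun setT (EFin \o h').
  by apply/measurable_EFinP; exact: bdm_meas.
have bhXC : bdm (fun w => h (X w, C w)) by exact: (bdm_comp bh mpair).
have bhXC' : bdm (fun w => h' (X w, C w)) by exact: (bdm_comp bh' mpair).
have E1 : (\int[P]_w (h' (X w, C w))%:E =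
    \int[distribution P X \x distribution P C]_z (h' z)%:E)%E.
  rewrite (@eq_measure_integral _ _ _ setT (pushforward P (fun w => (X w, C w)))).
    by rewrite ge0_integral_pushforward// => z _; exact: h'0.
  move=> A mA _.
  apply: (@product_measure_unique _ _ _ _ _ _ _ (pushforward P (fun w => (X w, C w)))) => //.
rewrite fubini_tonelli1// /fubini_F in E1.
have b1 := bdm_int2 (distribution P C) bh.
have b1' := bdm_int2 (distribution P C) bh'.
move: E1; rewrite bintE//.
under [in X in _ = X]eq_integral => x _ do
  rewrite /= (bintE (distribution P C) (bdm_xsection x bh')).
rewrite bintE// => -[].
rewrite bintD ?pint_cst//; last exact: bdm_cst.
under [in X in _ = X]eq_Rintegral => x _ do
  rewrite (bintD (distribution P C) (bdm_xsection x bh) (bdm_cst _ M)) pint_cst.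
by rewrite bintD ?pint_cst//; [exact: addIr|exact: bdm_cst].
Qed.

End independent_pair.

(** * The censored observation and its martingale score *)

Lemma bdm_le_fun d (T : measurableType d) (R : realType) (f g : T -> R) :
  measurable_fun setT f -> measurable_fun setT g ->
  bdm (fun x => (f x <= g x)%R%:R : R).
Proof. by move=> mf mg; apply: bdm_pred; exact: measurable_le_set. Qed.

Lemma nonincreasing_measurable_fun (R : realType) (f : R -> R) :
  nonincreasing_fun f -> measurable_fun setT f.
Proof.
move=> nf; rewrite (_ : f = \- (\- f)); last by apply/funext => x /=; rewrite opprK.
apply: measurableT_comp => //; apply: nondecreasing_measurable => // x y xy.
by rewrite lerN2 nf.
Qed.

Section censored_model.
Context d (T : measurableType d) (R : realType) (P : probability T R).
Variables (X C : {RV P >-> R}) (tau : R).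
Hypothesis XC : independent X C.
Hypothesis Htau : (P [set w | (Num.min (X w) (C w) <= tau)%R] < 1)%E.

Definition muX := distribution P X.
Definition surv_after (u : R) : R := 1 - df X u.
(** The mass of the law of [X] at [u], see [atomE]. *)
Definition atom (u : R) : R := surv P X u - surv_after u.
Definition in_window (u : R) : R := (0 < u <= tau)%R%:R.
(** The density of the hazard measure on (0, tau] with respect to the law of
    [X]. *)
Definition hazard_density (u : R) : R := in_window u * (surv P X u)^-1.
(** The integral of [f] against the hazard measure up to [z]: the compensator of
    a failure counted with weight [f]. *)
Definition compensate (f : R -> R) (z : R) : R := \int[muX]_v (f v * hazard_density v * (v <= z)%R%:R).
(** The martingale of a censored observation [z] = (failure, censoring),
    integrated against the weight [f]. *)
Definition score (f : R -> R) (z : R * R) : R :=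
  in_window z.1 * (z.1 <= z.2)%R%:R * f z.1 - compensate f (Num.min z.1 z.2).
(** A positive lower bound on [0, tau] of every survival function that occurs in
    a denominator. *)
Definition tail_mass : R := fine (P [set w | tau < Num.min (X w) (C w)]).

Let mX : measurable_fun setT X. Proof. by []. Qed.
Let mC : measurable_fun setT C. Proof. by []. Qed.

Let mZ : measurable_fun setT (fun w => Num.min (X w) (C w)).
Proof. exact: measurable_minr. Qed.

Let mpair : measurable_fun setT (fun w => (X w, C w)).
Proof. exact: measurable_fun_pair. Qed.

Let mge (f : T -> R) u : measurable_fun setT f -> measurable [set w | u <= f w].
Proof. by move=> mf; exact: measurable_le_set. Qed.

Let mgt (f : T -> R) u : measurable_fun setT f -> measurable [set w | u < f w].
Proof. by move=> mf; exact: measurable_lt_set. Qed.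

Let fineP_le (A B : set T) : measurable A -> measurable B -> A `<=` B ->
  fine (P A) <= fine (P B).
Proof.
move=> mA mB AB; apply: fine_le; rewrite ?fin_num_measure//.
by apply: le_measure; rewrite ?inE.
Qed.

Let dfE u : df X u = fine (P [set w | X w <= u]).
Proof. by []. Qed.

Lemma surv_afterE u : surv_after u = fine (P [set w | u < X w]).
Proof.
rewrite /surv_after dfE (_ : [set w | u < X w] = ~` [set w | X w <= u]); last first.
  by apply/seteqP; split=> w /=; rewrite ltNge => /negP.
rewrite probability_setC ?fineB ?fin_num_measure//; exact: measurable_le_set.
Qed.

Lemma atomE u : atom u = fine (muX [set u]).
Proof.
rewrite /atom surv_afterE; apply/eqP; rewrite subr_eq; apply/eqP.
rewrite /surv (_ : [set w | u <= X w] = X @^-1` [set u] `|` [set w | u < X w]).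
  rewrite measureU ?fineD ?fin_num_measure//.
  - exact: mgt.
  - exact: mgt.
  - by rewrite -subset0 => w [/= ->]; rewrite ltxx.
apply/seteqP; split=> w /=; first by rewrite le_eqVlt => /predU1P[->|]; [left|right].
by move=> [->|/ltW].
Qed.

Lemma atom_ge0 u : 0 <= atom u. Proof. by rewrite atomE fine_ge0. Qed.

Lemma surv_after_ge0 u : 0 <= surv_after u. Proof. by rewrite surv_afterE fine_ge0. Qed.

Lemma surv_after_le1 u : surv_after u <= 1.
Proof. by rewrite /surv_after gerBl dfE fine_ge0. Qed.

Lemma surv_after_nonincreasing : nonincreasing_fun surv_after.
Proof.
move=> s t st; rewrite !surv_afterE; apply: fineP_le; [exact: mgt|exact: mgt|].
by move=> w /=; exact: le_lt_trans.
Qed.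

Lemma surv_le1 (Y : {RV P >-> R}) u : surv P Y u <= 1.
Proof.
rewrite -[1]/(fine 1%E); apply: fine_le; rewrite ?fin_num_measure//.
  exact: mge.
by apply: probability_le1; exact: mge.
Qed.

Lemma tail_mass_gt0 : 0 < tail_mass.
Proof.
have mA : measurable [set w | Num.min (X w) (C w) <= tau] by exact: measurable_le_set.
rewrite /tail_mass (_ : [set w | _] = ~` [set w | Num.min (X w) (C w) <= tau]); last first.
  by apply/seteqP; split=> w /=; rewrite ltNge => /negP.
rewrite probability_setC// fineB ?fin_num_measure// subr_gt0.
by rewrite -[ltRHS]/(fine 1%E) fine_lt// fin_num_measure.
Qed.

Lemma HbarE u : Hbar X C u = surv P X u * surv P C u.
Proof.
rewrite /Hbar /surv -fineM ?fin_num_measure//; [|exact: mge|exact: mge].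
have := XC (measurable_itv `[u, +oo[) (measurable_itv `[u, +oo[).
have pE (Y : {RV P >-> R}) : Y @^-1` `[u, +oo[ = [set w | u <= Y w].
  by apply/seteqP; split=> w /=; rewrite in_itv/= andbT.
rewrite !pE => <-; congr (fine (P _)).
by apply/seteqP; split=> w /=; rewrite le_min => /andP.
Qed.

Lemma tail_mass_surv_after u : u <= tau -> tail_mass <= surv_after u.
Proof.
move=> ut; rewrite surv_afterE; apply: fineP_le; [exact: mgt|exact: mgt|].
by move=> w /=; rewrite lt_min => /andP[/(le_lt_trans ut)].
Qed.

Lemma tail_mass_Hbar u : u <= tau -> tail_mass <= Hbar X C u.
Proof.
move=> ut; apply: fineP_le; [exact: mgt|exact: mge|].
by move=> w /= /ltW; exact: le_trans.
Qed.

Lemma surv_after_surv u : surv_after u <= surv P X u.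
Proof. by rewrite -subr_ge0; exact: atom_ge0. Qed.

Lemma tail_mass_surv u : u <= tau -> tail_mass <= surv P X u.
Proof. by move=> /tail_mass_surv_after/le_trans; apply; exact: surv_after_surv. Qed.

Lemma tail_mass_le1 : tail_mass <= 1.
Proof. by rewrite (le_trans (tail_mass_surv_after (lexx _)))// surv_after_le1. Qed.

Lemma in_window01 u : 0 <= in_window u <= 1.
Proof. by rewrite /in_window ler0n lern1 leq_b1. Qed.

Lemma hazard_density_ge0 u : 0 <= hazard_density u.
Proof.
by rewrite mulr_ge0 ?invr_ge0 ?surv_ge0//; have /andP[] := in_window01 u.
Qed.

Lemma hazard_density_le u : hazard_density u <= tail_mass^-1.
Proof.
rewrite /hazard_density /in_window; have [/andP[_ ut]|_] := boolP (0 < u <= tau).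
  by rewrite mul1r lef_pV2 ?posrE ?tail_mass_gt0 ?tail_mass_surv// (lt_le_trans tail_mass_gt0)// tail_mass_surv.
by rewrite mul0r invr_ge0 ltW// tail_mass_gt0.
Qed.

Lemma bdm_in_window : bdm in_window.
Proof.
apply: bdm_pred.
rewrite (_ : [set x | _] = `]0, tau]%classic); first exact: measurable_itv.
by apply/seteqP; split=> x /=; rewrite in_itv.
Qed.

Lemma bdm_nonincreasing (f : R -> R) : nonincreasing_fun f -> (forall x, 0 <= f x <= 1) ->
  bdm f.
Proof.
move=> nf f01; apply: (@bdm_bounded _ _ _ _ 1); first exact: nonincreasing_measurable_fun.
by move=> x; have /andP[h1 h2] := f01 x; rewrite ger0_norm.
Qed.

Lemma bdm_survX : bdm (surv P X).
Proof.
apply: bdm_nonincreasing; first exact: surv_nonincreasing.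
by move=> x; rewrite surv_ge0 surv_le1.
Qed.

Lemma bdm_survC : bdm (surv P C).
Proof.
apply: bdm_nonincreasing; first exact: surv_nonincreasing.
by move=> x; rewrite surv_ge0 surv_le1.
Qed.

Lemma bdm_surv_after : bdm surv_after.
Proof.
apply: bdm_nonincreasing; first exact: surv_after_nonincreasing.
by move=> x; rewrite surv_after_ge0 surv_after_le1.
Qed.

Lemma bdm_atom : bdm atom. Proof. by apply: bdmB; [exact: bdm_survX|exact: bdm_surv_after]. Qed.

Lemma bdm_hazard_density : bdm hazard_density.
Proof.
apply: (@bdm_bounded _ _ _ _ tail_mass^-1); last first.
  by move=> x; rewrite ger0_norm ?hazard_density_ge0// hazard_density_le.
apply: measurable_funM; first exact: bdm_meas bdm_in_window.
apply: measurable_inv_nonincreasing => //; first exact: surv_ge0.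
exact: surv_nonincreasing.
Qed.

Lemma bdm_le_pair : bdm (fun z : R * R => (z.2 <= z.1)%R%:R : R).
Proof.
by apply: bdm_le_fun; [exact: measurable_snd|exact: measurable_fst].
Qed.

Lemma bdm_fst (f : R -> R) : bdm f -> bdm (fun z : R * R => f z.1).
Proof. by move=> bf; apply: (bdm_comp bf); exact: measurable_fst. Qed.

Lemma bdm_snd (f : R -> R) : bdm f -> bdm (fun z : R * R => f z.2).
Proof. by move=> bf; apply: (bdm_comp bf); exact: measurable_snd. Qed.

Lemma bdm_le_cst z : bdm (fun v : R => (v <= z)%R%:R : R).
Proof. by apply: bdm_le_fun. Qed.

Lemma bdm_ge_cst z : bdm (fun v : R => (z <= v)%R%:R : R).
Proof. by apply: bdm_le_fun. Qed.

Lemma bdm_compensate f : bdm f -> bdm (compensate f).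
Proof.
move=> bf.
apply: (bdm_int2 muX (h := fun z : R * R => f z.2 * hazard_density z.2 * (z.2 <= z.1)%R%:R)).
apply: bdmM; last exact: bdm_le_pair.
by apply: bdmM; apply: bdm_snd => //; exact: bdm_hazard_density.
Qed.

Let bdm_Phi_int f z : bdm f -> bdm (fun v => f v * hazard_density v * (v <= z)%R%:R).
Proof.
by move=> bf; apply: bdmM; [apply: bdmM => //; exact: bdm_hazard_density|exact: bdm_le_cst].
Qed.

Lemma compensateD f g z : bdm f -> bdm g -> compensate (fun v => f v + g v) z = compensate f z + compensate g z.
Proof.
move=> bf bg; rewrite /compensate -bintD; [|exact: bdm_Phi_int|exact: bdm_Phi_int].
by apply: eq_Rintegral => v _; ring.
Qed.

Lemma compensateZ c f z : bdm f -> compensate (fun v => c * f v) z = c * compensate f z.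
Proof.
move=> bf; rewrite /compensate -bintZ; last exact: bdm_Phi_int.
by apply: eq_Rintegral => v _; ring.
Qed.

Lemma bdm_score f : bdm f -> bdm (score f).
Proof.
move=> bf; apply: bdmB.
  apply: bdmM; last exact: bdm_fst.
  apply: bdmM; first exact: (bdm_fst bdm_in_window).
  by apply: bdm_le_fun; [exact: measurable_fst|exact: measurable_snd].
apply: (bdm_comp (bdm_compensate bf)).
by apply: measurable_minr; [exact: measurable_fst|exact: measurable_snd].
Qed.

Lemma int_le_atom v : \int[muX]_u ((u <= v)%R%:R * (v <= u)%R%:R) = atom v.
Proof.
rewrite atomE -bint_indic//; apply: eq_Rintegral => u _.
rewrite indicE -natrM mulnb -eq_le; congr (_%:R).
by case: eqP => [->|uv]; [rewrite mem_set|rewrite memNset].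
Qed.

(** With [compensate_mean] this makes the score centred: independence turns the
    indicator that [X] is not censored into the factor [surv P C]. *)
Lemma failure_mean f : bdm f ->
  \int[P]_w (in_window (X w) * (X w <= C w)%R%:R * f (X w)) =
  \int[muX]_x (in_window x * f x * surv P C x).
Proof.
move=> bf; rewrite (bint_independent XC
  (h := fun z : R * R => in_window z.1 * (z.1 <= z.2)%R%:R * f z.1)); last first.
  apply: bdmM; last exact: bdm_fst.
  apply: bdmM; first exact: (bdm_fst bdm_in_window).
  by apply: bdm_le_fun; [exact: measurable_fst|exact: measurable_snd].
apply: eq_Rintegral => x _ /=.
rewrite (_ : (fun _ => _) = fun c => in_window x * f x * (x <= c)%R%:R); last first.
  by apply/funext => c; rewrite mulrAC.
rewrite bintZ; last exact: bdm_ge_cst.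
congr (_ * _); rewrite (_ : (fun _ => _) = \1_`[x, +oo[%classic); last first.
  by apply/funext => c; rewrite indicE mem_setE in_itv/= andbT.
rewrite bint_indic// /surv /distribution /pushforward; congr (fine (P _)).
by apply/seteqP; split=> w /=; rewrite in_itv/= andbT.
Qed.

Lemma hazard_density_surv v : hazard_density v * surv P X v = in_window v.
Proof.
rewrite /hazard_density /in_window; have [/andP[_ vt]|_] := boolP (0 < v <= tau); last by rewrite !mul0r.
by rewrite mul1r mulVf// gt_eqF// (lt_le_trans tail_mass_gt0)// tail_mass_surv.
Qed.

Lemma compensate_mean f : bdm f ->
  \int[P]_w compensate f (Num.min (X w) (C w)) = \int[muX]_x (in_window x * f x * surv P C x).
Proof.
move=> bf.
have bh : bdm (fun z : T * R =>
    f z.2 * hazard_density z.2 * (z.2 <= Num.min (X z.1) (C z.1))%R%:R).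
  apply: bdmM.
    apply: bdmM; first by apply: (bdm_comp bf); exact: measurable_snd.
    by apply: (bdm_comp bdm_hazard_density); exact: measurable_snd.
  apply: bdm_le_fun; first exact: measurable_snd.
  by apply: (measurableT_comp mZ); exact: measurable_fst.
rewrite /compensate (bint_swap P muX bh); apply: eq_Rintegral => v _ /=.
rewrite bintZ; last by apply: bdm_le_fun.
have -> : \int[P]_w ((v <= Num.min (X w) (C w))%R%:R : R) = Hbar X C v.
  rewrite /Hbar /surv -bint_indic; last exact: mge.
  by apply: eq_Rintegral => w _; rewrite indicE mem_setE.
by rewrite HbarE -(hazard_density_surv v); ring.
Qed.

Lemma score_mean f : bdm f -> \int[P]_w score f (X w, C w) = 0.
Proof.
move=> bf; rewrite /score bintB ?failure_mean ?compensate_mean ?subrr//=.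
  apply: bdmM; last by apply: (bdm_comp bf).
  by apply: bdmM; [exact: (bdm_comp bdm_in_window)|exact: bdm_le_fun].
exact: (bdm_comp (bdm_compensate bf)).
Qed.

End censored_model.

(** * Measures given by a density *)

Section density.
Import HBNNSimple.
Context d (T : measurableType d) (R : realType).
Variables (mu nu : {measure set T -> \bar R}) (k : T -> R).
Hypothesis mk : measurable_fun setT k.
Hypothesis k0 : forall x, 0 <= k x.
Hypothesis nuE : forall A, measurable A -> nu A = (\int[mu]_(x in A) (k x)%:E)%E.
Local Open Scope ereal_scope.

Let mEk (E : set T) : measurable_fun E (EFin \o k).
Proof. by apply/measurable_funTS/measurable_EFinP. Qed.

Let density_nnsfun (E : set T) (h : {nnsfun T >-> R}) : measurable E ->
  \int[nu]_(x in E) (h x)%:E = \int[mu]_(x in E) ((h x)%:E * (k x)%:E).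
Proof.
move=> mE.
have mh y : measurable (h @^-1` [set y]) by exact: measurable_sfunP.
have mind y : measurable_fun E (fun x => (y * \1_(h @^-1` [set y]) x)%:E).
  apply/measurable_funTS/measurable_EFinP.
  by apply: measurable_funM => //; exact: measurable_indic.
transitivity (\int[nu]_(x in E) (\sum_(y \in range h) (y * \1_(h @^-1` [set y]) x)%:E)).
  by apply: eq_integral => x _; rewrite fimfunE -fsumEFin.
rewrite ge0_integral_fsum//; last by move=> y x _; exact: nnfun_muleindic_ge0.
transitivity (\int[mu]_(x in E)
    (\sum_(y \in range h) (y * \1_(h @^-1` [set y]) x)%:E * (k x)%:E)); last first.
  apply: eq_integral => x _.
  rewrite -ge0_mule_fsuml => [|y]; last exact: nnfun_muleindic_ge0.
  by rewrite fsumEFin// -fimfunE.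
rewrite ge0_integral_fsum//; last 2 first.
- by move=> y; apply: emeasurable_funM.
- move=> y x _; apply: mule_ge0; last by rewrite lee_fin.
  exact: nnfun_muleindic_ge0.
apply: eq_fsbigr => y; rewrite inE => -[x0 _ <-].
have hx0 : (0 <= h x0)%R by exact: fun_ge0.
under eq_integral do rewrite EFinM.
rewrite ge0_integralZl//; last first.
  by apply/measurable_funTS/measurable_EFinP; exact: measurable_indic.
under [in X in _ = X]eq_integral do rewrite EFinM -muleA.
rewrite ge0_integralZl//; last 2 first.
- apply: emeasurable_funM => //.
  by apply/measurable_funTS/measurable_EFinP; exact: measurable_indic.
- by move=> x _; rewrite mule_ge0 ?lee_fin.
congr (_ * _); rewrite integral_indic// nuE; last exact: measurableI.
under [in X in _ = X]eq_integral do rewrite muleC.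
rewrite setIC integral_mkcondr; apply: eq_integral => x _.
by rewrite epatch_indic.
Qed.

(** The change of measure formula for a measure given by a density: both sides
    are continuous along monotone limits and agree on simple functions. *)
Lemma ge0_integral_density (E : set T) (f : T -> R) : measurable E ->
  measurable_fun setT f -> (forall x, 0 <= f x)%R ->
  \int[nu]_(x in E) (f x)%:E = \int[mu]_(x in E) ((f x)%:E * (k x)%:E).
Proof.
move=> mE mf f0.
have mEf : measurable_fun E (EFin \o f) by apply/measurable_funTS/measurable_EFinP.
pose h := nnsfun_approx mE mEf.
have fE x : E x -> (h n x)%:E @[n --> \oo] --> (f x)%:E.
  by move=> Ex; apply: (cvg_nnsfun_approx mE mEf) => // y _; rewrite lee_fin.
have ndh x a b : (a <= b)%N -> ((h a x)%:E <= (h b x)%:E).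
  by move=> ab; rewrite lee_fin; exact/lefP/nd_nnsfun_approx.
have c1 : \int[nu]_(x in E) (h n x)%:E @[n --> \oo] --> \int[nu]_(x in E) (f x)%:E.
  have -> : \int[nu]_(x in E) (f x)%:E = \int[nu]_(x in E) limn (fun n => (h n x)%:E).
    by apply: eq_integral => x; rewrite inE => /fE/cvg_lim ->.
  apply: cvg_monotone_convergence => //.
  - by move=> n; apply/measurable_funTS/measurable_EFinP.
  - by move=> n x _; rewrite lee_fin.
  - by move=> x _ a b; exact: ndh.
have c2 : \int[mu]_(x in E) ((h n x)%:E * (k x)%:E) @[n --> \oo] -->
    \int[mu]_(x in E) ((f x)%:E * (k x)%:E).
  have -> : \int[mu]_(x in E) ((f x)%:E * (k x)%:E) =
      \int[mu]_(x in E) limn (fun n => (h n x)%:E * (k x)%:E).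
    apply: eq_integral => x; rewrite inE => Ex; apply/esym/cvg_lim => //.
    by apply: cvgeZr => //; exact: fE.
  apply: cvg_monotone_convergence => //.
  - move=> n; apply: emeasurable_funM => //.
    by apply/measurable_funTS/measurable_EFinP.
  - by move=> n x _; rewrite mule_ge0 ?lee_fin.
  - by move=> x _ a b ab; rewrite lee_wpmul2r ?lee_fin// -lee_fin ndh.
have E12 : (fun n => \int[nu]_(x in E) (h n x)%:E) =
    (fun n => \int[mu]_(x in E) ((h n x)%:E * (k x)%:E)).
  by apply/funext => n; exact: density_nnsfun.
rewrite E12 in c1.
exact: (cvg_unique _ c1 c2).
Qed.
End density.

(** * The variance of a score *)

Section score_variance.
Context d (T : measurableType d) (R : realType) (P : probability T R).
Variables (X C : {RV P >-> R}) (tau : R).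
Hypothesis XC : independent X C.
Hypothesis Htau : (P [set w | (Num.min (X w) (C w) <= tau)%R] < 1)%E.
Notation muX := (muX X).
Notation surv_after := (surv_after X).
Notation atom := (atom X).
Notation in_window := (in_window tau).
Notation hazard_density := (hazard_density X tau).
Notation compensate := (compensate X tau).
Notation score := (score X tau).
Notation H := (Hbar X C).
Notation tail_mass := (tail_mass X C tau).

Let t0 : 0 < tail_mass := tail_mass_gt0 Htau.
Let bhaz : bdm hazard_density := bdm_hazard_density Htau.

(** Integration by parts: the square of the indefinite integral [compensate f] is twice
    the integral of [compensate f] against its increments, minus the squared jumps. *)
Lemma compensate_sq f z : bdm f ->
  compensate f z ^+ 2 = compensate (fun v => 2 * (f v * compensate f v) - f v ^+ 2 * hazard_density v * atom v) z.
Proof.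
move=> bf; pose g v := f v * hazard_density v * (v <= z)%R%:R.
have bg : bdm g.
  by apply: bdmM; [exact: bdmM|exact: bdm_le_cst].
have ba := bdm_atom X.
have bPhi : bdm (compensate f) by exact: (bdm_compensate Htau).
pose A := \int[muX]_v (\int[muX]_u (g v * g u * (u <= v)%R%:R)).
have bA : bdm (fun q : R * R => g q.1 * g q.2 * (q.2 <= q.1)%R%:R).
  apply: bdmM; last exact: bdm_le_pair.
  by apply: bdmM; [exact: bdm_fst|exact: bdm_snd].
have bA' : bdm (fun q : R * R => g q.1 * g q.2 * (q.1 <= q.2)%R%:R).
  apply: bdmM; last by apply: bdm_le_fun; [exact: measurable_fst|exact: measurable_snd].
  by apply: bdmM; [exact: bdm_fst|exact: bdm_snd].
have Aswap : A = \int[muX]_v (\int[muX]_u (g v * g u * (v <= u)%R%:R)).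
  rewrite /A (bint_swap muX muX bA); apply: eq_Rintegral => v _.
  by apply: eq_Rintegral => u _ /=; rewrite (mulrC (g u)).
have bg2 : bdm (fun v => g v ^+ 2 * atom v).
  by apply: bdmM => //; rewrite (_ : (fun _ => _) = fun v => g v * g v); [exact: bdmM|].
have b1 := bdm_int2 muX bA; have b2 := bdm_int2 muX bA'.
have AA : A + A = \int[muX]_v (g v * compensate f z + g v ^+ 2 * atom v).
  rewrite {2}Aswap /A -(bintD muX b1 b2); apply: eq_Rintegral => v _.
  have c1 := bdm_xsection v bA; have c2 := bdm_xsection v bA'.
  rewrite /= -(bintD muX c1 c2).
  have -> : compensate f z = \int[muX]_u g u by [].
  rewrite -(bintZ muX (g v) bg) -(int_le_atom X v).
  have bat : bdm (fun u : R => (u <= v)%R%:R * (v <= u)%R%:R : R).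
    by apply: bdmM; [exact: bdm_le_cst|exact: bdm_ge_cst].
  rewrite -(bintZ muX _ bat) -bintD; [|exact: bdmZ|exact: bdmZ].
  apply: eq_Rintegral => u _ /=.
  have [uv|vu|->] := ltgtP u v; rewrite /=; ring.
have Ag : A = \int[muX]_v (f v * compensate f v * hazard_density v * (v <= z)%R%:R).
  apply: eq_Rintegral => v _.
  rewrite (_ : (fun _ => _) = fun u => g v * (g u * (u <= v)%R%:R)); last first.
    by apply/funext => u; rewrite mulrA.
  rewrite bintZ; last by apply: bdmM => //; exact: bdm_le_cst.
  rewrite /g; have [vz|vz] := leP v z; last by rewrite !mulr0 mul0r.
  rewrite !mulr1 [RHS]mulrAC; congr (_ * _); apply: eq_Rintegral => u _.
  have [uv|uv] := leP u v; last by rewrite !mulr0.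
  by rewrite (le_trans uv vz) !mulr1.
have bfP : bdm (fun v => f v * compensate f v * hazard_density v * (v <= z)%R%:R).
  by apply: bdmM; [apply: bdmM => //; exact: bdmM|exact: bdm_le_cst].
have -> : compensate (fun v => 2 * (f v * compensate f v) - f v ^+ 2 * hazard_density v * atom v) z =
    2 * A - \int[muX]_v (g v ^+ 2 * atom v).
  rewrite Ag -bintZ// -bintB//; last exact: bdmZ.
  apply: eq_Rintegral => v _; rewrite /g.
  by case: (v <= z)%R => /=; ring.
rewrite (_ : 2 * A = A + A); last by ring.
rewrite AA bintD//; last by apply: bdmM => //; exact: bdm_cst.
by rewrite addrK RintegralZr//; exact: (bdm_integrable muX bg).
Qed.

(** In the expansion of the square the mixed term cancels the first term of
    [compensate_sq]; the mean of the squared failure and the jump term remain. *)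
Lemma score_var f : bdm f ->
  \int[P]_w (score f (X w, C w) ^+ 2) =
  \int[muX]_x (in_window x * f x ^+ 2 * surv P C x * (1 - hazard_density x * atom x)).
Proof.
move=> bf.
have bPhi : bdm (compensate f) by exact: (bdm_compensate Htau).
have ba := bdm_atom X.
have bff : bdm (fun x => f x ^+ 2).
  by rewrite (_ : (fun _ => _) = fun v => f v * f v); [exact: bdmM|].
have bfP : bdm (fun x => f x * compensate f x) by exact: bdmM.
pose f2 v := 2 * (f v * compensate f v) - f v ^+ 2 * hazard_density v * atom v.
have bf2 : bdm f2.
  by apply: bdmB; [exact: bdmZ|apply: bdmM => //; exact: bdmM].
have mC : measurable_fun setT C by [].
have mX : measurable_fun setT X by [].
have mZ : measurable_fun setT (fun w => Num.min (X w) (C w)) by exact: measurable_minr.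
have bI h : bdm h -> bdm (fun w => in_window (X w) * (X w <= C w)%R%:R * h (X w)).
  move=> bh; apply: bdmM; last exact: (bdm_comp bh mX).
  by apply: bdmM; [exact: (bdm_comp (bdm_in_window tau) mX)|exact: bdm_le_fun].
have bP2 : bdm (fun w => compensate f2 (Num.min (X w) (C w))).
  exact: (bdm_comp (bdm_compensate Htau bf2) mZ).
transitivity (\int[P]_w (in_window (X w) * (X w <= C w)%R%:R * f (X w) ^+ 2 -
   2 * (in_window (X w) * (X w <= C w)%R%:R * (f (X w) * compensate f (X w))) +
   compensate f2 (Num.min (X w) (C w)))).
  apply: eq_Rintegral => w _; rewrite /score /= -/(compensate f _).
  have e1 : in_window (X w) * in_window (X w) = in_window (X w).
    by rewrite /in_window; case: (_ && _); rewrite ?mulr1 ?mulr0.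
  rewrite -(compensate_sq _ bf); have [xc|xc] := leP (X w) (C w).
    by rewrite !mulr1 -[X in X * f _ ^+ 2]e1; ring.
  by rewrite !(mulr0, mul0r) sub0r sqrrN subr0 add0r.
have i1 := bI _ bff; have i2 := bI _ bfP.
rewrite (bintD P (bdmB i1 (bdmZ 2 i2)) bP2) (bintB P i1 (bdmZ 2 i2)) (bintZ P 2 i2).
rewrite (failure_mean _ XC bff) (failure_mean _ XC bfP) (compensate_mean XC Htau bf2).
have bS : bdm (surv P C) by exact: bdm_survC.
have bIS h : bdm h -> bdm (fun x => in_window x * h x * surv P C x).
  by move=> bh; apply: bdmM => //; apply: bdmM => //; exact: bdm_in_window.
have j1 := bIS _ bff; have j2 := bIS _ bfP; have j3 := bIS _ bf2.
rewrite -(bintZ muX 2 j2) -(bintB muX j1 (bdmZ 2 j2)).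
rewrite -(bintD muX (bdmB j1 (bdmZ 2 j2)) j3).
by apply: eq_Rintegral => x _; rewrite /f2; ring.
Qed.

End score_variance.

(** * The asymptotic covariance *)

Section cumulative_integrals.
Context (R : realType) (mu : {finite_measure set R -> \bar R}) (h : R -> R).
Hypothesis bh : bdm h.

Let bdm_le z : bdm (fun v : R => h v * (v <= z)%R%:R).
Proof. by apply: bdmM => //; exact: bdm_le_cst. Qed.

Lemma cum_right_continuous (t : R) :
  \int[mu]_v (h v * (v <= x)%R%:R) @[x --> t^'+] --> \int[mu]_v (h v * (v <= t)%R%:R).
Proof.
have [_ [M hM]] := bh.
apply/cvg_at_rightP => u [ut uc].
have [|||//] := @cvg_bint _ _ _ mu (fun n v => h v * (v <= u n)%R%:R)
  (fun v => h v * (v <= t)%R%:R) M.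
- by move=> n; exact: bdm_meas (bdm_le _).
- move=> n v; rewrite normrM; case: (v <= u n); rewrite ?normr1 ?mulr1//.
  by rewrite normr0 mulr0 (le_trans _ (hM v)).
- move=> v; have [vt|tv] := leP v t.
    apply: cvg_near_cst; apply: nearW => n.
    by rewrite (le_trans vt)// ltW// ut.
  apply: cvg_near_cst; have : \forall n \near \oo, u n < v by exact: (cvgr_lt t uc v tv).
  by apply: filterS => n un; rewrite leNgt un.
Qed.

Lemma cum_left_limit (t : R) :
  \int[mu]_v (h v * (v <= x)%R%:R) @[x --> t^'-] --> \int[mu]_v (h v * (v < t)%R%:R).
Proof.
have [_ [M hM]] := bh.
apply/cvg_at_leftP => u [ut uc].
have [|||//] := @cvg_bint _ _ _ mu (fun n v => h v * (v <= u n)%R%:R)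
  (fun v => h v * (v < t)%R%:R) M.
- by move=> n; exact: bdm_meas (bdm_le _).
- move=> n v; rewrite normrM; case: (v <= u n); rewrite ?normr1 ?mulr1//.
  by rewrite normr0 mulr0 (le_trans _ (hM v)).
- move=> v; have [vt|tv] := ltP v t.
    apply: cvg_near_cst; have : \forall n \near \oo, v < u n by exact: (cvgr_gt t uc v vt).
    by apply: filterS => n un; rewrite ltW.
  apply: cvg_near_cst; apply: nearW => n.
  by rewrite leNgt (lt_le_trans (ut n)).
Qed.

Lemma cum_nondecreasing (s t : R) : (forall v, 0 <= h v) -> s <= t ->
  \int[mu]_v (h v * (v <= s)%R%:R) <= \int[mu]_v (h v * (v <= t)%R%:R).
Proof.
move=> h0 st; apply: le_bint => // v; rewrite ler_wpM2l// ler_nat.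
by case: (leP v s) => // /le_trans -> //.
Qed.

End cumulative_integrals.

Section covariance.
Context d (T : measurableType d) (R : realType) (P : probability T R).
Variables (X C : {RV P >-> R}) (tau : R).
Hypothesis XC : independent X C.
Hypothesis Htau : (P [set w | (Num.min (X w) (C w) <= tau)%R] < 1)%E.
Notation muX := (muX X).
Notation surv_after := (surv_after X).
Notation atom := (atom X).
Notation in_window := (in_window tau).
Notation hazard_density := (hazard_density X tau).
Notation compensate := (compensate X tau).
Notation score := (score X tau).
Notation H := (Hbar X C).
Notation tail_mass := (tail_mass X C tau).

(** The density of [dLambda / ((1 - Delta Lambda) H)] with respect to the law of
    [X]: the factor [1 - Delta Lambda] is the ratio of [surv_after X] and
    [surv P X]. *)
Definition var_density (u : R) : R := in_window u * (surv_after u * H u)^-1.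
Definition score_weight (u : R) : R := in_window u * (surv P X u / (surv_after u * H u)).
Definition var_fun (t : R) : R := \int[muX]_u (var_density u * (u <= t)%R%:R).
Definition km_cov (s t : R) : R := surv_after s * surv_after t * var_fun (Num.min s t).
Definition hazard_fun (t : R) : R := compensate (fun=> 1) t.
(** The influence function of the estimator at time [t]. *)
Definition influence (t : R) (z : R * R) : R := score (fun u => surv_after t * ((u <= t)%R%:R * score_weight u)) z.

Let t0 : 0 < tail_mass := tail_mass_gt0 Htau.

Lemma surv_after_Hbar_gt0 u : u <= tau -> 0 < surv_after u * H u.
Proof.
move=> ut; rewrite mulr_gt0// (lt_le_trans t0)//.
  exact: tail_mass_surv_after.
exact: tail_mass_Hbar.
Qed.

Lemma Hbar_le1 u : H u <= 1.
Proof. by rewrite HbarE// -[1]mulr1 ler_pM ?surv_ge0// surv_le1. Qed.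

Lemma Hbar_nonincreasing : nonincreasing_fun H.
Proof. by move=> s t st; rewrite !HbarE// ler_pM ?surv_ge0// surv_nonincreasing. Qed.

Lemma in_window_neq0 u : in_window u != 0 -> 0 < u <= tau.
Proof. by rewrite /in_window; case: (_ && _) => //; rewrite eqxx. Qed.

Lemma var_density_ge0 u : 0 <= var_density u.
Proof.
have /andP[i0 _] := in_window01 tau u.
by rewrite mulr_ge0// invr_ge0 mulr_ge0 ?surv_after_ge0 ?surv_ge0.
Qed.

Lemma score_weight_ge0 u : 0 <= score_weight u.
Proof.
have /andP[i0 _] := in_window01 tau u.
by rewrite mulr_ge0// divr_ge0 ?surv_ge0// mulr_ge0 ?surv_after_ge0 ?surv_ge0.
Qed.

Lemma var_densityE u : var_density u = hazard_density u * (surv P X u / (surv_after u * H u)).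
Proof.
rewrite /var_density /hazard_density; have [->|/in_window_neq0/andP[u0 ut]] := eqVneq (in_window u) 0.
  by rewrite !mul0r.
have su : 0 < surv P X u by rewrite (lt_le_trans t0)// tail_mass_surv.
by rewrite -mulrA; congr (_ * _); rewrite mulrA mulVf ?mul1r// gt_eqF.
Qed.

Lemma ratio_le u : u <= tau -> surv P X u / (surv_after u * H u) <= tail_mass^-1 ^+ 2.
Proof.
move=> ut; have h1 := tail_mass_surv_after X C ut; have h2 := tail_mass_Hbar X C ut.
rewrite ler_pdivrMr ?surv_after_Hbar_gt0// exprVn (le_trans (surv_le1 X u))//.
by rewrite mulrC ler_pdivlMr ?exprn_gt0// mul1r expr2 ler_pM// ltW.
Qed.

Lemma var_density_le u : var_density u <= tail_mass^-1 ^+ 2 * hazard_density u.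
Proof.
rewrite var_densityE mulrC; have [iu|/in_window_neq0/andP[u0 ut]] := eqVneq (in_window u) 0.
  by rewrite /hazard_density iu mul0r !mulr0.
by rewrite ler_wpM2r ?hazard_density_ge0// ratio_le.
Qed.

Lemma score_weight_le u : score_weight u <= tail_mass^-1 ^+ 2.
Proof.
rewrite /score_weight; have [->|h] := eqVneq (in_window u) 0.
  by rewrite mul0r exprn_ge0// invr_ge0 ltW.
have /andP[u0 ut] := in_window_neq0 h.
have -> : in_window u = 1 by rewrite /in_window u0 ut.
by rewrite mul1r ratio_le.
Qed.

Let m_inv_surv_after_Hbar : measurable_fun setT (fun u => (surv_after u * H u)^-1).
Proof.
apply: measurable_inv_nonincreasing => //.
  by move=> x; rewrite mulr_ge0 ?surv_after_ge0 ?surv_ge0.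
by move=> s t st; rewrite ler_pM ?surv_after_ge0 ?surv_ge0// ?surv_after_nonincreasing// Hbar_nonincreasing.
Qed.

Lemma bdm_score_weight : bdm score_weight.
Proof.
apply: (@bdm_bounded _ _ _ _ (tail_mass^-1 ^+ 2)); last first.
  by move=> u; rewrite ger0_norm ?score_weight_ge0 ?score_weight_le.
apply: measurable_funM; first exact: bdm_meas (bdm_in_window tau).
by apply: measurable_funM => //; exact: bdm_meas (bdm_survX X).
Qed.

Lemma bdm_var_density : bdm var_density.
Proof.
apply: (@bdm_bounded _ _ _ _ (tail_mass^-1 ^+ 2 * tail_mass^-1)); last first.
  move=> u; rewrite ger0_norm ?var_density_ge0// (le_trans (var_density_le u))//.
  by rewrite ler_wpM2l ?exprn_ge0 ?invr_ge0 ?(ltW t0)// hazard_density_le.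
apply: measurable_funM; first exact: bdm_meas (bdm_in_window tau).
exact: m_inv_surv_after_Hbar.
Qed.

Let bdm_kle t : bdm (fun u : R => var_density u * (u <= t)%R%:R).
Proof. by apply: bdmM; [exact: bdm_var_density|exact: bdm_le_cst]. Qed.

Lemma qf_km_covE l l' : qf km_cov l l' =
  \int[muX]_u (var_density u * (lev (fun t => surv_after t * (u <= t)%R%:R) l *
                        lev (fun t => surv_after t * (u <= t)%R%:R) l')).
Proof.
have bt (p q : R * R) : bdm (fun u => p.1 * q.1 * (surv_after p.2 * surv_after q.2) *
    (var_density u * (u <= Num.min p.2 q.2)%R%:R)) by apply: bdmZ.
transitivity (\int[muX]_u (\sum_(p <- l) \sum_(q <- l')
    (p.1 * q.1 * (surv_after p.2 * surv_after q.2) * (var_density u * (u <= Num.min p.2 q.2)%R%:R)))).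
  rewrite bint_sum; last by move=> p; exact: bdm_sum.
  apply: eq_bigr => p _; rewrite bint_sum//; apply: eq_bigr => q _.
  by rewrite bintZ// /km_cov /var_fun; ring.
apply: eq_Rintegral => u _; rewrite /lev mulr_suml mulr_sumr.
apply: eq_bigr => p _; rewrite !mulr_sumr; apply: eq_bigr => q _.
by rewrite le_min; case: (u <= p.2); case: (u <= q.2) => /=; ring.
Qed.

Lemma km_cov_sym s t : km_cov s t = km_cov t s.
Proof. by rewrite /km_cov minC (mulrC (surv_after s)). Qed.

Lemma km_cov_psd l : 0 <= qf km_cov l l.
Proof.
by rewrite qf_km_covE; apply: bint_ge0 => u; rewrite mulr_ge0 ?var_density_ge0// -expr2 sqr_ge0.
Qed.

Lemma scoreD f g z : bdm f -> bdm g ->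
  score (fun u => f u + g u) z = score f z + score g z.
Proof. by move=> bf bg; rewrite /score (compensateD Htau)//; ring. Qed.

Lemma scoreZ c f z : bdm f -> score (fun u => c * f u) z = c * score f z.
Proof. by move=> bf; rewrite /score (compensateZ Htau)//; ring. Qed.

Lemma score0 z : score (fun=> 0) z = 0.
Proof.
rewrite (_ : (fun=> 0) = fun u : R => 0 * 1); last by apply/funext => u; rewrite mul0r.
by rewrite scoreZ ?mul0r//; exact: bdm_cst.
Qed.

Lemma bdm_influence_weight t : bdm (fun u : R => surv_after t * ((u <= t)%R%:R * score_weight u)).
Proof. by apply: bdmZ; apply: bdmM; [exact: bdm_le_cst|exact: bdm_score_weight]. Qed.

(** The weight whose score is the combination [l] of influence functions. *)
Definition wlev l (u : R) : R := lev (fun t => surv_after t * ((u <= t)%R%:R * score_weight u)) l.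

Lemma bdm_wlev l : bdm (wlev l).
Proof.
by apply: bdm_sum => p; apply: bdmZ; exact: bdm_influence_weight.
Qed.

Lemma influence_lev l z : lev (fun t => influence t z) l = score (wlev l) z.
Proof.
elim: l => [|[a t] l IH].
  rewrite (_ : wlev [::] = fun=> 0) ?score0 ?/lev ?big_nil//.
  by apply/funext => u; rewrite /wlev /lev big_nil.
rewrite (_ : wlev _ = fun u : R => a * (surv_after t * ((u <= t)%R%:R * score_weight u)) + wlev l u).
  rewrite scoreD; [|by apply: bdmZ; exact: bdm_influence_weight|exact: bdm_wlev].
  by rewrite scoreZ ?/lev ?big_cons -?IH//; exact: bdm_influence_weight.
by apply/funext => u; rewrite /wlev /lev big_cons.
Qed.

Lemma one_hazard_density_atom u : 0 < u <= tau -> 1 - hazard_density u * atom u = surv_after u / surv P X u.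
Proof.
move=> /andP[u0 ut]; rewrite /hazard_density /in_window u0 ut /= mul1r /atom.
have su : 0 < surv P X u by rewrite (lt_le_trans t0)// tail_mass_surv.
by field; rewrite gt_eqF.
Qed.

(** The variance of a linear combination of the influence processes; the factor
    [1 - hazard_density * atom] of [score_var] turns one of the two weights into [var_density]. *)
Lemma wlev_var l : \int[P]_w (score (wlev l) (X w, C w) ^+ 2) = qf km_cov l l.
Proof.
rewrite (score_var XC Htau (bdm_wlev l)) qf_km_covE; apply: eq_Rintegral => u _.
have wE : wlev l u = lev (fun t => surv_after t * (u <= t)%R%:R) l * score_weight u.
  by rewrite /wlev /lev mulr_suml; apply: eq_bigr => p _; ring.
rewrite wE /var_density; have [->|h] := eqVneq (in_window u) 0; first by rewrite !mul0r.
have hu := in_window_neq0 h; have /andP[u0 ut] := hu.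
rewrite one_hazard_density_atom// /score_weight; have -> : in_window u = 1 by rewrite /in_window u0 ut.
have sX : 0 < surv P X u by rewrite (lt_le_trans t0)// tail_mass_surv.
have pX : 0 < surv_after u by rewrite (lt_le_trans t0)// tail_mass_surv_after.
have hH : 0 < H u by rewrite (lt_le_trans t0)// tail_mass_Hbar.
rewrite HbarE// in hH *.
have sC : 0 < surv P C u by move: hH; rewrite pmulr_rgt0.
by field; rewrite !gt_eqF.
Qed.

Lemma var_fun_ge0 t : 0 <= var_fun t.
Proof. by apply: bint_ge0 => u; rewrite mulr_ge0 ?var_density_ge0. Qed.

Lemma var_fun_nondecreasing s t : s <= t -> var_fun s <= var_fun t.
Proof. by move=> st; apply: cum_nondecreasing => //; [exact: bdm_var_density|exact: var_density_ge0]. Qed.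

Let bdm_hle t : bdm (fun u : R => hazard_density u * (u <= t)%R%:R).
Proof. by apply: bdmM; [exact: (bdm_hazard_density Htau)|exact: bdm_le_cst]. Qed.

Lemma hazard_funE t : hazard_fun t = \int[muX]_u (hazard_density u * (u <= t)%R%:R).
Proof. by apply: eq_Rintegral => u _; rewrite mul1r. Qed.

Lemma hazard_fun_le t : hazard_fun t <= tail_mass^-1.
Proof.
rewrite hazard_funE -[leRHS](pint_cst muX); apply: le_bint => //; first exact: bdm_cst.
move=> u; apply: le_trans (hazard_density_le Htau u).
by rewrite ler_piMr ?hazard_density_ge0// lern1 leq_b1.
Qed.

Lemma hazard_fun_nondecreasing s t : s <= t -> hazard_fun s <= hazard_fun t.
Proof.
move=> st; rewrite !hazard_funE; apply: cum_nondecreasing => //; first exact: (bdm_hazard_density Htau).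
exact: hazard_density_ge0.
Qed.

Lemma var_fun_le t : var_fun t <= tail_mass^-1 ^+ 2 * hazard_fun t.
Proof.
rewrite hazard_funE -bintZ//; apply: le_bint => //; first exact: bdmZ.
by move=> u; rewrite mulrA ler_wpM2r// var_density_le.
Qed.

Lemma var_fun_incr s t : s <= t -> var_fun t - var_fun s <= tail_mass^-1 ^+ 2 * (hazard_fun t - hazard_fun s).
Proof.
move=> st; rewrite !hazard_funE /var_fun -!bintB// -bintZ; last exact: bdmB.
apply: le_bint; [exact: bdmB|by apply: bdmZ; exact: bdmB|].
move=> u; rewrite -!mulrBr mulrA ler_wpM2r ?var_density_le// subr_ge0 ler_nat.
by case: (leP u s) => // us; rewrite (le_trans us st).
Qed.

Lemma surv_after_incr s t : 0 <= s -> s <= t -> t <= tau -> surv_after s - surv_after t <= hazard_fun t - hazard_fun s.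
Proof.
move=> s0 st tt.
have bI r : bdm (fun u : R => (u <= r)%R%:R : R) by exact: bdm_le_cst.
have prE r : surv_after r = 1 - \int[muX]_u (u <= r)%R%:R.
  congr (1 - _); rewrite (_ : (fun _ => _) = \1_`]-oo, r]%classic).
    by rewrite bint_indic.
  by apply/funext => u; rewrite indicE mem_setE in_itv.
have -> : surv_after s - surv_after t = \int[muX]_u (u <= t)%R%:R - \int[muX]_u (u <= s)%R%:R.
  by rewrite !prE; ring.
rewrite -bintB// !hazard_funE -bintB//.
apply: le_bint; [exact: bdmB|exact: bdmB|].
move=> u; have [us|us] := leP u s; first by rewrite (le_trans us st) !subrr.
rewrite /= mulr0 !subr0; have [ut|ut] := leP u t; last by rewrite mulr0.
rewrite mulr1 /hazard_density /in_window (le_lt_trans s0 us) (le_trans ut tt) /= mul1r.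
have su : 0 < surv P X u by rewrite (lt_le_trans t0)// tail_mass_surv// (le_trans ut).
by rewrite -[1]invr1 lef_pV2 ?posrE// surv_le1.
Qed.

End covariance.

(** * The rate function and the variance constant *)

Section rate_identification.
Context d (T : measurableType d) (R : realType) (P : probability T R).
Variables (X C : {RV P >-> R}) (tau : R).
Hypothesis tau_ge0 : 0 <= tau.
Hypothesis XC : independent X C.
Hypothesis F0 : df X 0 = 0.
Hypothesis Htau : (P [set w | (Num.min (X w) (C w) <= tau)%R] < 1)%E.
Notation muX := (muX X).
Notation surv_after := (surv_after X).
Notation atom := (atom X).
Notation in_window := (in_window tau).
Notation hazard_density := (hazard_density X tau).
Notation H := (Hbar X C).
Notation tail_mass := (tail_mass X C tau).
Notation var_density := (var_density X C tau).
Notation var_fun := (var_fun X C tau).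
Notation km_cov := (km_cov X C tau).
Notation hazard_fun := (hazard_fun X tau).

Let t0 : 0 < tail_mass := tail_mass_gt0 Htau.

Lemma surv_after0 : surv_after 0 = 1. Proof. by rewrite /surv_after F0 subr0. Qed.

Lemma surv0 : surv P X 0 = 1.
Proof. by apply/le_anti; rewrite surv_le1 -surv_after0 surv_after_surv. Qed.

(** Since F(0) = 0 the law of [X] does not charge 0, where the window (0, tau]
    and the interval [0, tau] of the rate function differ. *)
Lemma bint_off0 (f g : R -> R) : bdm g -> (forall u, u != 0 -> f u = g u) ->
  \int[muX]_u f u = \int[muX]_u g u.
Proof.
move=> bg fg; have b1 : bdm (\1_[set (0 : R)] : R -> R) by exact: bdm_indic.
rewrite (_ : f = fun u => g u + (f 0 - g 0) * \1_[set 0] u); last first.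
  apply/funext => u; rewrite indicE; have [->|u0] := eqVneq u 0.
    by rewrite mem_set// mulr1 addrC subrK.
  by rewrite memNset/= ?mulr0 ?addr0 ?fg// => /eqP; rewrite (negbTE u0).
rewrite bintD//; last exact: bdmZ.
rewrite bintZ// bint_indic// (_ : fine (muX _) = 0) ?mulr0 ?addr0//.
by rewrite -atomE /atom surv0 surv_after0 subrr.
Qed.

Lemma cumulative_hazardE t : t <= tau -> cumulative_hazard X t = hazard_fun t.
Proof.
move=> tt; rewrite hazard_funE// /cumulative_hazard Rintegral_mkcond.
apply: bint_off0 => [|u u0].
  by apply: bdmM; [exact: (bdm_hazard_density Htau)|exact: bdm_le_cst].
rewrite patchE mem_setE in_itv /= /hazard_density /in_window lt_neqAle eq_sym u0 /=.
case: (leP 0 u) => /= [u_ge0|_]; last by rewrite !mul0r.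
case: (leP u t) => ut; last by rewrite mulr0.
by rewrite (le_trans ut tt) mul1r mulr1.
Qed.

Lemma jump_cumulative_hazard u : u <= tau ->
  jump (cumulative_hazard X) u = hazard_density u * atom u.
Proof.
move=> ut; have bh := bdm_hazard_density Htau.
have bl : bdm (fun v : R => (v <= u)%R%:R : R) by exact: bdm_le_cst.
have bl' : bdm (fun v : R => (v < u)%R%:R : R).
  by apply: bdm_pred; exact: measurable_lt_set.
rewrite /jump cumulative_hazardE//.
have -> : lim (cumulative_hazard X x @[x --> u^'-]) =
    \int[muX]_v (hazard_density v * (v < u)%R%:R).
  apply: cvg_lim => //; have := @cum_left_limit _ muX _ bh u; apply: cvg_trans.
  apply: near_eq_cvg; near=> x.
  have xu : x < u by near: x; exact: nbhs_left_lt.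
  by rewrite cumulative_hazardE ?(le_trans (ltW xu))// hazard_funE.
rewrite hazard_funE// -bintB; [|exact: bdmM|exact: bdmM].
rewrite -(int_le_atom X u) -bintZ; last first.
  by apply: bdmM => //; exact: bdm_ge_cst.
apply: eq_Rintegral => v _; have [vu|uv|->] := ltgtP v u.
- by rewrite mulr1 subrr !mulr0.
- by rewrite mul0r !mulr0 subrr.
- by rewrite !mulr1 mulr0 subr0.
Unshelve. all: by end_near. Qed.

Lemma one_jumpE u : 0 <= u <= tau ->
  1 - jump (cumulative_hazard X) u = surv_after u / surv P X u.
Proof.
move=> /andP[u0 ut]; rewrite jump_cumulative_hazard//.
have [u0'|u0'] := eqVneq u 0.
  by rewrite u0' surv0 surv_after0 /hazard_density /in_window ltxx !mul0r subr0 divr1.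
by apply: (one_hazard_density_atom Htau); rewrite lt_neqAle eq_sym u0' u0.
Qed.

Lemma hazard_integral (c : R) (E : set R) : 0 <= c -> measurable E ->
  E `<=` `[0, tau]%classic ->
  \int[hazard_measure X]_(u in E) (c / ((1 - jump (cumulative_hazard X) u) * H u)) =
  c * \int[muX]_u (var_density u * \1_E u).
Proof.
move=> c0 mE Et.
pose g u := (0 <= u <= tau)%R%:R * (surv P X u / (surv_after u * H u)).
have mI : measurable_fun setT (fun u : R => (0 <= u <= tau)%R%:R : R).
  rewrite (_ : (fun _ => _) = \1_`[0, tau]%classic); last first.
    by apply/funext => u; rewrite indicE mem_setE in_itv.
  exact: measurable_indic.
have mk : measurable_fun setT (fun u => (surv P X u)^-1).
  apply: measurable_inv_nonincreasing => //; first exact: surv_ge0.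
  exact: surv_nonincreasing.
have mg : measurable_fun setT g.
  apply: measurable_funM => //; apply: measurable_funM.
    exact: bdm_meas (bdm_survX X).
  apply: measurable_inv_nonincreasing => //.
    by move=> x; rewrite mulr_ge0 ?surv_after_ge0 ?surv_ge0.
  move=> s t st; rewrite ler_pM ?surv_after_ge0 ?surv_ge0// ?surv_after_nonincreasing//.
  exact: Hbar_nonincreasing.
have g0 u : 0 <= g u by rewrite mulr_ge0// divr_ge0 ?mulr_ge0 ?surv_after_ge0 ?surv_ge0.
have -> : \int[hazard_measure X]_(u in E)
    (c / ((1 - jump (cumulative_hazard X) u) * H u)) =
    \int[hazard_measure X]_(u in E) (c * g u).
  apply: eq_Rintegral => u /set_mem/Et /=; rewrite in_itv /= => u01.
  rewrite one_jumpE// /g u01 mul1r invfM invfM invrK; congr (_ * _).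
  by rewrite invfM mulrA (mulrC (surv _ _ _)).
rewrite /Rintegral.
rewrite (@ge0_integral_density _ _ _ muX (hazard_measure X) _ mk)//; last first.
- by move=> x; rewrite mulr_ge0.
- exact: measurable_funM.
- by move=> x; rewrite invr_ge0 surv_ge0.
transitivity (\int[muX]_(u in E) (c * g u * (surv P X u)^-1)) => //.
rewrite Rintegral_mkcond -bintZ; last first.
  by apply: bdmM; [exact: bdm_var_density|exact: bdm_indic].
apply: bint_off0 => [|u u0].
  by apply: bdmZ; apply: bdmM; [exact: bdm_var_density|exact: bdm_indic].
rewrite patchE indicE; case: ifPn => [/set_mem/Et|_]; last by rewrite !mulr0.
rewrite /= in_itv /= mulr1 => u01; rewrite var_densityE// /hazard_density /in_window lt_neqAle eq_sym u0.
by rewrite u01 /g u01; ring.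
Qed.

Lemma hazard_integral_le (c m : R) : 0 <= c -> m <= tau ->
  \int[hazard_measure X]_(u in `[0, m])
    (c / ((1 - jump (cumulative_hazard X) u) * H u)) = c * var_fun m.
Proof.
move=> c0 mt; rewrite hazard_integral//; last by apply: subset_itvl; rewrite bnd_simp.
congr (_ * _); apply: eq_Rintegral => u _; rewrite indicE mem_setE in_itv /=.
rewrite /var_density /in_window; case: (ltP 0 u) => /= [u0|_]; last by rewrite !mul0r.
by rewrite (ltW u0).
Qed.

Lemma hazard_integral_lt_le (c m : R) : 0 <= c -> m <= tau ->
  \int[hazard_measure X]_(u in `]0, m])
    (c / ((1 - jump (cumulative_hazard X) u) * H u)) = c * var_fun m.
Proof.
move=> c0 mt; rewrite hazard_integral//; last first.
  by apply: subset_itvScc; rewrite bnd_simp.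
congr (_ * _); apply: eq_Rintegral => u _; rewrite indicE mem_setE in_itv /=.
by rewrite /var_density /in_window; case: (ltP 0 u) => /= [u0|_]; last by rewrite !mul0r.
Qed.

Lemma km_sigma2E : km_sigma2 tau X C = sup [set km_cov t t | t in `[0, tau]].
Proof.
rewrite /km_sigma2; congr sup; apply: eq_imagel => t /=; rewrite in_itv /= => /andP[_ tt].
by rewrite hazard_integral_lt_le// mul1r /km_cov minxx -expr2.
Qed.

Let quadE m (t al : 'I_m -> R) : (forall i, 0 <= t i <= tau) ->
  \sum_(k < m) \sum_(j < m) al k * al j *
    \int[hazard_measure X]_(u in `[0, Num.min (t k) (t j)])
      ((1 - df X (t k)) * (1 - df X (t j)) /
        ((1 - jump (cumulative_hazard X) u) * H u)) =
  qf km_cov (fam t al) (fam t al).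
Proof.
move=> tt; rewrite qf_fam; apply: eq_bigr => k _; apply: eq_bigr => j _.
rewrite hazard_integral_le// ?mulr_ge0 ?surv_after_ge0//.
by rewrite ge_min; have /andP[_ ->] := tt k.
Qed.

Lemma km_rateE (phi : skorokhod tau) : km_rate X C phi = gauss_rate km_cov phi.
Proof.
apply/eqP; rewrite eq_le; apply/andP; split.
  apply: ge_ereal_sup => _ [m [t [al [m0 tt ->]]]]; apply: ereal_sup_ubound.
  exists (fam t al); first exact: times_in_fam.
  rewrite lev_fam quadE//; congr (_ - _)%:E.
  by apply: eq_bigr => i _; rewrite mulrC.
apply: ge_ereal_sup => _ [l lt <-]; apply: ereal_sup_ubound.
(* the extra atom of weight 0 makes the family nonempty *)
pose l' := (0, 0) :: l : seq (R * R).
pose al (i : 'I_(size l').-1.+1) := (nth (0, 0) l' i).1.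
pose t (i : 'I_(size l').-1.+1) := (nth (0, 0) l' i).2.
have lE : fam t al = l'.
  rewrite /fam /al /t -[RHS](mkseq_nth (0, 0)) /mkseq -val_enum_ord -map_comp.
  by apply: eq_map => i /=; case: (nth _ _ _).
have lt' : forall i, 0 <= t i <= tau.
  move=> i; have /allP := lt => lt0; rewrite /t.
  have : nth (0, 0) l' i \in l' by rewrite mem_nth.
  by rewrite inE => /predU1P[->|/lt0//]; rewrite lexx.
exists (size l').-1.+1, t, al; split => //.
rewrite quadE// lE; congr (_ - 2^-1 * _)%:E; last first.
  have z : [:: (0, 0)] = scl 0 [:: (0, 0)] :> seq (R * R) by rewrite /scl /= mulr0.
  by rewrite -[l']cat1s qf_catl !qf_catr z !qf_scll !qf_sclr !mul0r !add0r.
rewrite (eq_bigr (fun i => al i * phi (t i))); last by move=> i _; rewrite mulrC.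
by rewrite -lev_fam lE /lev big_cons mul0r add0r.
Qed.

Lemma km_cov_diag_le t : 0 <= t -> km_cov t t <= tail_mass^-1 ^+ 2 * tail_mass^-1.
Proof.
move=> t_ge0; rewrite /km_cov minxx -[leRHS]mul1r.
rewrite ler_pM ?mulr_ge0 ?surv_after_ge0 ?var_fun_ge0//.
  by rewrite -[1]mulr1 ler_pM ?surv_after_ge0 ?surv_after_le1.
by rewrite (le_trans (var_fun_le XC Htau t))// ler_wpM2l ?hazard_fun_le// exprn_ge0// invr_ge0 ltW.
Qed.

Lemma gdist_le s t : 0 <= s -> s <= t -> t <= tau ->
  gdist km_cov t s <= 2 * (tail_mass^-1 ^+ 2 * tail_mass^-1) * (hazard_fun t - hazard_fun s).
Proof.
move=> s0 st tt; have i0 : 0 <= tail_mass^-1 by rewrite invr_ge0 ltW.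
have L0 : 0 <= hazard_fun t - hazard_fun s by rewrite subr_ge0 (hazard_fun_nondecreasing Htau).
have i1 : 1 <= tail_mass^-1 by rewrite invr_ge1 ?posrE ?unitfE ?gt_eqF// tail_mass_le1.
have -> : gdist km_cov t s = surv_after t ^+ 2 * (var_fun t - var_fun s) + (surv_after s - surv_after t) ^+ 2 * var_fun s.
  by rewrite /gdist /km_cov !minxx (min_r st); ring.
have k0 : 0 <= tail_mass^-1 ^+ 2 := exprn_ge0 2 i0.
have h1 : surv_after t ^+ 2 * (var_fun t - var_fun s) <= tail_mass^-1 ^+ 2 * tail_mass^-1 * (hazard_fun t - hazard_fun s).
  apply: (le_trans (y := var_fun t - var_fun s)).
    by rewrite ler_piMl ?subr_ge0 ?var_fun_nondecreasing// expr_le1 ?surv_after_ge0 ?surv_after_le1.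
  rewrite (le_trans (var_fun_incr XC Htau st))// ler_wpM2r// ler_peMr//.
have h2 : (surv_after s - surv_after t) ^+ 2 * var_fun s <= tail_mass^-1 ^+ 2 * tail_mass^-1 * (hazard_fun t - hazard_fun s).
  rewrite mulrC ler_pM ?var_fun_ge0 ?sqr_ge0//.
    by rewrite (le_trans (var_fun_le XC Htau s))// ler_wpM2l ?hazard_fun_le.
  have p0 : 0 <= surv_after s - surv_after t by rewrite subr_ge0 surv_after_nonincreasing.
  apply: le_trans (surv_after_incr Htau s0 st tt); rewrite expr2 ler_piMr//.
  by rewrite lerBlDr (le_trans (surv_after_le1 X s))// lerDl surv_after_ge0.
by rewrite -mulrA mulr_natl mulr2n lerD.
Qed.

Let var_fun_min_cadlag s : cadlag tau (fun t => var_fun (Num.min t s)).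
Proof.
have bk := bdm_var_density XC Htau; move=> t t01; split=> [_|_].
  have [st|ts] := leP s t.
    apply: cvg_near_cst; near=> x; congr var_fun; rewrite min_r//.
    by rewrite (le_trans st)//; near: x; exact: nbhs_right_ge.
  have := @cum_right_continuous _ muX _ bk t.
  apply: cvg_trans; apply: near_eq_cvg; near=> x; rewrite min_l//.
  by near: x; exact: nbhs_right_le.
have [ts|st] := leP t s.
  apply/cvg_ex; eexists; have := @cum_left_limit _ muX _ bk t.
  apply: cvg_trans; apply: near_eq_cvg; near=> x; rewrite min_l//.
  by rewrite (le_trans _ ts)//; near: x; exact: nbhs_left_le.
apply/cvg_ex; exists (var_fun s); apply: cvg_near_cst; near=> x; congr var_fun; rewrite min_r//.
by near: x; exact: nbhs_left_ge.
Unshelve. all: by end_near. Qed.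

Lemma cadlag_surv_after : cadlag tau surv_after.
Proof.
move=> t t01; have [dr dl] := cadlag_df X t01; split=> [tt|t_gt0].
  by apply: cvgB; [exact: cvg_cst|exact: dr].
by apply: is_cvgB; [exact: is_cvg_cst|exact: dl].
Qed.

Lemma km_cov_cadlag s : cadlag tau (km_cov^~ s).
Proof.
rewrite (_ : km_cov^~ s = surv_after \* (cst (surv_after s) \* (fun t => var_fun (Num.min t s)))).
  by apply: cadlagM cadlag_surv_after _; apply: cadlagM (var_fun_min_cadlag s); exact: cadlag_cst.
by apply/funext => t /=; rewrite /km_cov mulrA.
Qed.

End rate_identification.

(** * The empirical hazard, jump products and partitions *)

Section empirical_hazard.
Context (R : realType) (n : nat) (z : nat -> R) (delta : nat -> bool).
Notation Hb := (Hn_bar n z).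
Notation NA := (nelson_aalen n z delta).

Lemma Hn_bar_ge0 t : 0 <= Hb t.
Proof. by rewrite mulr_ge0 ?invr_ge0// sumr_ge0. Qed.

Lemma Hn_bar_nonincreasing : nonincreasing_fun Hb.
Proof.
move=> s t st; rewrite ler_wpM2l ?invr_ge0// ler_sum// => i _.
by rewrite ler_nat; case: (leP t (z i)) => // /(le_trans st) ->.
Qed.

Let wt i : 0 <= n%:R^-1 * (delta i)%:R :> R.
Proof. by rewrite mulr_ge0 ?invr_ge0. Qed.

Let point_mass : {measure set (measurableTypeR R) -> \bar R} :=
  @msum _ (measurableTypeR R) R
    (fun i => @mscale _ (measurableTypeR R) R (NngNum (wt i)) (@dirac _ (measurableTypeR R) (z i) R)) n.

Let point_massE A : measurable A ->
  lebesgue_stieltjes_measure (Hn_uc n z delta) A = point_mass A.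
Proof.
apply: lebesgue_stieltjes_measure_unique => _ [[a b] ab <-].
rewrite /lebesgue_stieltjes_measure /measure_extension measurable_mu_extE; last first.
  by exists (a, b).
rewrite /=; have [{}ab|ba] := leP a b; last first.
  by rewrite set_itv_ge ?bnd_simp -?leNgt ?(ltW ba)// !measure0.
rewrite wlength_itv_bnd// /point_mass /= /msum.
rewrite (eq_bigr (fun i : 'I_n =>
    (n%:R^-1 * (delta i)%:R * (a < z i <= b)%R%:R)%:E)); last first.
  move=> i _; transitivity ((n%:R^-1 * (delta i)%:R)%:E * (\d_(z i) : set R -> \bar R) `]a, b]%classic)%E => //.
  by rewrite diracE mem_setE in_itv EFinM.
rewrite /Hn_uc -mulrBr -sumrB mulr_sumr sumEFin; congr (_%:E).
apply: eq_bigr => i _; rewrite -mulrA; congr (_ * _).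
case: (delta i); rewrite ?andbT ?andbF ?subrr ?mul0r// mul1r.
have [za|az] := leP (z i) a; first by rewrite (le_trans za ab) subrr.
by rewrite subr0.
Qed.

(** The Lebesgue-Stieltjes measure of the empirical distribution of the observed
    failures is a sum of point masses. *)
Lemma nelson_aalenE t :
  NA t = n%:R^-1 * \sum_(i < n) ((0 <= z i <= t)%R && delta i)%:R / Hb (z i).
Proof.
have mH : measurable_fun setT (fun s => ((Hb s)^-1)%:E).
  apply/measurable_EFinP; apply: measurable_inv_nonincreasing => //.
    exact: Hn_bar_ge0.
  exact: Hn_bar_nonincreasing.
have H0 s : (0 <= ((Hb s)^-1)%:E)%E by rewrite lee_fin invr_ge0 Hn_bar_ge0.
rewrite /nelson_aalen /Rintegral (eq_measure_integral point_mass); last first.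
  by move=> A mA _; exact: point_massE.
rewrite ge0_integral_measure_sum//; last exact: measurable_funTS.
under eq_bigr => i _.
  rewrite ge0_integral_mscale//; last exact: measurable_funTS.
  rewrite integral_dirac//; last exact: measurable_funTS.
  rewrite diracE -!EFinM; over.
rewrite sumEFin /= mulr_sumr; apply: eq_bigr => i _.
rewrite mem_setE in_itv /=; case: (delta i); rewrite ?andbT ?andbF; last by rewrite mulr0 !mul0r mulr0.
by rewrite mulr1.
Qed.

End empirical_hazard.

Section jump_products.
Context (R : realType).
Implicit Types (s : seq R) (h : R -> R).

Lemma positive_lower_bound s : all (fun x => 0 < x) s ->
  exists2 e, 0 < e & forall x, x \in s -> e <= x.
Proof.
elim: s => [_|y s IH /= /andP[y0 /IH[e e0 He]]]; first by exists 1.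
exists (Num.min e y); first by rewrite lt_min e0.
move=> x; rewrite inE => /predU1P[->|/He ex]; rewrite ge_min ?lexx ?orbT//.
by rewrite ex.
Qed.

Lemma seq_gap s : exists2 e, 0 < e &
  forall u v, u \in s -> v \in s -> u != v -> e <= `|u - v|.
Proof.
have [|e e0 He] := @positive_lower_bound
    [seq x <- [seq `|u - v| | u <- s, v <- s] | 0 < x].
  exact: filter_all.
exists e => // u v us vs uv; apply: He; rewrite mem_filter normr_gt0 subr_eq0 uv /=.
by apply/allpairsP; exists (u, v).
Qed.

Lemma one_jump_prod s (Q : pred R) h : uniq s ->
  (forall u v, u \in s -> v \in s -> Q u -> Q v -> u = v) ->
  1 - \sum_(u <- s | Q u) h u = \prod_(u <- s | Q u) (1 - h u).
Proof.
elim: s => [_ _|u s IH /= /andP[us us'] H]; first by rewrite !big_nil subr0.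
rewrite !big_cons; case: ifPn => [Qu|_]; last first.
  by apply: IH => // a b sa sb; apply: H; rewrite inE ?sa ?sb orbT.
have Qs v : v \in s -> Q v = false.
  move=> vs; apply/negP => Qv; move: us; rewrite (H u v) ?vs//.
    by rewrite inE eqxx.
  by rewrite inE vs orbT.
rewrite !big1_seq ?addr0 ?mulr1//.
  by move=> v /andP[Qv /Qs]; rewrite Qv.
by move=> v /andP[Qv /Qs]; rewrite Qv.
Qed.

(** The discrete form of d(1/S) = - dS / (S S_-): with [S = \prod (1 - h)], the
    increment of 1/S at a jump [u] is [h u / S u]. *)
Lemma inverse_prod s h : sorted <%R s -> (forall u, u \in s -> 1 - h u != 0) ->
  (\prod_(u <- s) (1 - h u))^-1 =
  1 + \sum_(u <- s) h u / \prod_(v <- s | v <= u) (1 - h v).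
Proof.
elim/last_ind: s => [_ _|s x IH srt nz]; first by rewrite !big_nil invr1 addr0.
have lt_x u : u \in s -> u < x.
  move=> us; have := srt; rewrite (sorted_pairwise lt_trans) -cats1 pairwise_cat.
  by move=> /and3P[/allrelP/(_ u x us)]; rewrite inE eqxx => ->.
have srt' : sorted <%R s by move: srt; rewrite -cats1 => /cat_sorted2[].
have nz' u : u \in s -> 1 - h u != 0 by move=> us; rewrite nz// mem_rcons inE us orbT.
have nx : 1 - h x != 0 by rewrite nz// mem_rcons inE eqxx.
have np : \prod_(u <- s) (1 - h u) != 0.
  by rewrite prodf_seq_neq0; apply/allP => u /nz' ->.
rewrite -cats1 !big_cat !big_seq1 /=.
have -> : \sum_(u <- s) h u / \prod_(v <- s ++ [:: x] | v <= u) (1 - h v) =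
    (\prod_(u <- s) (1 - h u))^-1 - 1.
  rewrite IH// addrAC subrr add0r; apply: eq_big_seq => u us.
  by rewrite big_cat /= big_cons big_nil leNgt lt_x//= mulr1.
have -> : \prod_(v <- s ++ [:: x] | v <= x) (1 - h v) =
    \prod_(v <- s) (1 - h v) * (1 - h x).
  rewrite big_cat /= big_cons big_nil lexx mulr1; congr (_ * _).
  rewrite big_mkcond; apply: eq_big_seq => v vs.
  by rewrite (ltW (lt_x _ vs)).
by field; rewrite nx np.
Qed.

End jump_products.

Section fine_partitions.
Context (R : realType).

Lemma fine_partition_neq0 (t e : R) : 0 <= t -> 0 < e -> fine_partition t e !=set0.
Proof.
move=> t0 e0; have e20 : 0 < e / 2 by rewrite divr_gt0.
have e2e : e / 2 < e by rewrite gtr_pMr// invf_lt1// ltr1n.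
have : exists k : nat, t <= k%:R * (e / 2).
  by exists (Num.truncn (t / (e / 2))).+1; rewrite -ler_pdivrMr// ltW// truncnS_gt.
case=> k; elim: k t t0 => [t t0|k IH t t0 tk].
  rewrite mul0r => t0'; exists [::]; split => //; split => //=.
  by rewrite eq_le t0 t0'.
have [te|et] := leP t (e / 2); last first.
  have [||s [ps ms]] := IH (t - e / 2).
  - by rewrite subr_ge0 ltW.
  - by rewrite lerBlDr (le_trans tk)// -[_.+1%:R]natr1 mulrDl mul1r.
  exists (s ++ [:: t]); split.
    apply: itv_partition_cat ps _; apply: itv_partition1.
    by rewrite ltrBlDr ltrDl.
  rewrite cat_path ms /=; case: ps => _ /eqP ->.
  by rewrite opprB addrC subrK e2e.
have [->|t0'] := eqVneq t 0; first by exists [::]; split => //; split => /=.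
exists [:: t]; split; first by apply: itv_partition1; rewrite lt_neqAle eq_sym t0'.
by rewrite /= subr0 andbT (le_lt_trans te).
Qed.

Lemma mesh_filter_proper (t : R) : 0 <= t -> ProperFilter (mesh_filter t).
Proof.
move=> t0; apply: filter_from_proper; last by move=> e /= e0; exact: fine_partition_neq0.
apply: filter_from_filter; first by exists 1 => /=.
move=> e e' /= e0 e'0; exists (Num.min e e'); first by rewrite /= lt_min e0.
move=> s [ps ms]; split; split=> //; apply: sub_path ms => x y.
  by rewrite lt_min => /andP[].
by rewrite lt_min => /andP[].
Qed.

End fine_partitions.

(** * The Kaplan-Meier estimator as a finite product *)

Section kaplan_meier_product.
Context (R : realType) (n : nat) (z : nat -> R) (delta : nat -> bool).
Notation Hb := (Hn_bar n z).
Notation NA := (nelson_aalen n z delta).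

Definition failures (u : R) : R := n%:R^-1 * \sum_(i < n) ((z i == u) && delta i)%:R.
Definition at_risk_after (u : R) : R := n%:R^-1 * \sum_(i < n) (u < z i)%R%:R.
Definition hazard_jump (u : R) : R := failures u / Hb u.
Definition jumps : seq R :=
  sort <=%R (undup [seq z i | i <- iota 0 n & delta i]).
Definition Sn (t : R) : R := 1 - kaplan_meier n z delta t.

Lemma jumps_uniq : uniq jumps. Proof. by rewrite sort_uniq undup_uniq. Qed.

Lemma jumps_sorted : sorted <%R jumps.
Proof. by rewrite lt_sorted_uniq_le jumps_uniq sort_le_sorted. Qed.

Lemma mem_jumps (i : 'I_n) : delta i -> z i \in jumps.
Proof.
move=> di; rewrite mem_sort mem_undup; apply: map_f.
by rewrite mem_filter di mem_iota /= add0n ltn_ord.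
Qed.

Lemma sum_jumps (Q : pred R) (g : R -> R) :
  \sum_(u <- jumps | Q u) failures u * g u =
  n%:R^-1 * \sum_(i < n) (Q (z i) && delta i)%:R * g (z i).
Proof.
transitivity (\sum_(i < n) \sum_(u <- jumps | Q u)
    n%:R^-1 * (((z i == u) && delta i)%:R * g u)).
  rewrite exchange_big /=; apply: eq_bigr => u _.
  by rewrite /failures -mulrA mulr_suml mulr_sumr.
rewrite mulr_sumr; apply: eq_bigr => i _; rewrite -mulr_sumr; congr (_ * _).
case: (boolP (delta i)) => [di|_]; last first.
  by rewrite andbF mul0r big1// => u _; rewrite andbF mul0r.
rewrite big_mkcond (bigD1_seq (z i)) ?mem_jumps ?jumps_uniq//= big1 ?addr0.
  by rewrite eqxx; case: (Q (z i)); rewrite ?mul0r.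
by move=> u uz; rewrite eq_sym (negbTE uz) mul0r; case: ifP.
Qed.

Lemma nelson_aalen_incr s t : 0 <= s -> s <= t ->
  NA t - NA s = \sum_(u <- jumps | s < u <= t) hazard_jump u.
Proof.
move=> s0 st; rewrite sum_jumps !nelson_aalenE -mulrBr -sumrB; congr (_ * _).
apply: eq_bigr => i _; rewrite -mulrBl; congr (_ / _).
case: (delta i); rewrite ?andbF ?subrr// !andbT.
have [zs|sz] := leP (z i) s; first by rewrite (le_trans zs st) andbT subrr.
by rewrite andbF subr0 (le_trans s0 (ltW sz)).
Qed.

(** When the mesh is smaller than every gap between two jumps, an interval of
    the partition contains at most one jump and the product over the partition
    is exact. *)
Lemma partition_prod_jumps (e a b : R) (s : seq R) :
  (forall u v, u \in jumps -> v \in jumps -> u != v -> e <= `|u - v|) ->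
  0 <= a -> itv_partition a b s -> path (fun x y => y - x < e) a s ->
  \prod_(p <- pairmap (fun x y => 1 - (NA y - NA x)) a s) p =
  \prod_(u <- jumps | a < u <= b) (1 - hazard_jump u).
Proof.
move=> He; elim: s a => [|y s IH] a a0 ps.
  move=> _; case: ps => _ /= /eqP ab; rewrite big_nil big1_seq// => u.
  by rewrite ab => /andP[/andP[bu ub]]; have := lt_le_trans bu ub; rewrite ltxx.
move=> /= /andP[ya ms]; have ay : a < y by case: ps => /= /andP[].
have pys := itv_partition_cons ps; have yb := itv_partition_le pys.
rewrite big_cons IH//; last by rewrite (le_trans a0)// ltW.
rewrite nelson_aalen_incr//; last exact: ltW.
rewrite one_jump_prod ?jumps_uniq//; last first.
  move=> u v uU vU /andP[au uy] /andP[av vy]; apply/eqP/negP => /negP uv.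
  have := He _ _ uU vU uv; apply/negP; rewrite -ltNge (le_lt_trans _ ya)//.
  by rewrite ler_norml; apply/andP; split; lra.
rewrite big_mkcond [in X in _ * X]big_mkcond -big_split/= [RHS]big_mkcond /=.
apply: eq_bigr => u _; have [uy|yu] := leP u y.
  by rewrite andbT /= mulr1 (le_trans uy yb) andbT.
by rewrite andbF mul1r (lt_trans ay yu).
Qed.

Lemma kaplan_meier_prod t : 0 <= t ->
  Sn t = \prod_(u <- jumps | 0 < u <= t) (1 - hazard_jump u).
Proof.
move=> t0; rewrite /Sn /kaplan_meier opprB addrC subrK /product_integral.
have FF := mesh_filter_proper t0; have [e e0 He] := seq_gap jumps.
apply: cvg_lim => //; apply: cvg_near_cst; exists e => // s [ps ms].
exact: (partition_prod_jumps He).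
Qed.

Lemma failures_le u : failures u <= Hb u - at_risk_after u.
Proof.
rewrite /failures /Hn_bar /at_risk_after -mulrBr -sumrB ler_wpM2l ?invr_ge0//.
apply: ler_sum => i _; case: ltgtP => _ /=; rewrite ?subrr ?subr0 ?lern1 ?leq_b1//.
Qed.

Lemma failures_ge0 u : 0 <= failures u.
Proof. by rewrite mulr_ge0 ?invr_ge0 ?sumr_ge0. Qed.

Lemma at_risk_after_ge0 u : 0 <= at_risk_after u.
Proof. by rewrite mulr_ge0 ?invr_ge0 ?sumr_ge0. Qed.

Lemma at_risk_after_le u v : u <= v -> at_risk_after v <= at_risk_after u.
Proof.
move=> uv; rewrite ler_wpM2l ?invr_ge0// ler_sum// => i _.
by rewrite ler_nat; case: (ltP v (z i)) => // /(le_lt_trans uv) ->.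
Qed.

Lemma Hn_bar_at_risk u v : u < v -> Hb v <= at_risk_after u.
Proof.
move=> uv; rewrite ler_wpM2l ?invr_ge0// ler_sum// => i _.
by rewrite ler_nat; case: (leP v (z i)) => // /(lt_le_trans uv) ->.
Qed.

Lemma at_risk_after_Hn_bar u : at_risk_after u <= Hb u.
Proof.
rewrite ler_wpM2l ?invr_ge0// ler_sum// => i _.
by rewrite ler_nat; case: (ltP u (z i)) => // /ltW ->.
Qed.

Lemma one_hazard_jump_ge u : 0 < Hb u -> at_risk_after u / Hb u <= 1 - hazard_jump u.
Proof.
move=> H0; rewrite ler_pdivrMr// mulrBl mul1r divfK ?gt_eqF//.
by have := failures_le u; lra.
Qed.

Lemma Hn_bar_le1 u : Hb u <= 1.
Proof.
have [->|n0] := posnP n; first by rewrite /Hn_bar big_ord0 mulr0.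
rewrite /Hn_bar -[leRHS](mulVf (_ : n%:R != 0)) ?pnatr_eq0 ?lt0n_neq0//.
rewrite ler_wpM2l ?invr_ge0// (le_trans (y := \sum_(i < n) 1))//.
  by apply: ler_sum => i _; rewrite lern1 leq_b1.
by rewrite sumr_const card_ord.
Qed.

Lemma jump_at_risk u : u \in jumps -> 0 < Hb u.
Proof.
rewrite mem_sort mem_undup => /mapP[i]; rewrite mem_filter mem_iota add0n /=.
move=> /andP[_ ni] ->; have n0 : (0 < n)%N by rewrite (leq_ltn_trans _ ni).
rewrite mulr_gt0 ?invr_gt0 ?ltr0n// (bigD1 (Ordinal ni))//= lexx ltr_wpDr ?sumr_ge0//.
Qed.

Let prod_ge s y : sorted <%R s -> {subset s <= jumps} -> all (< y) s ->
  Hb y <= \prod_(u <- s) (1 - hazard_jump u).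
Proof.
elim/last_ind: s y => [y _ _ _|s x IH y].
  by rewrite big_nil Hn_bar_le1.
rewrite -cats1 all_cat /= andbT => srt sub /andP[_ xy].
have lt_x : all (< x) s.
  by move: srt; rewrite (sorted_pairwise lt_trans) pairwise_cat allrel1r => /andP[].
have srt' : sorted <%R s by move: srt => /cat_sorted2[].
have xJ : x \in jumps by apply: sub; rewrite mem_cat inE eqxx orbT.
have Hx := jump_at_risk xJ.
rewrite big_cat big_seq1 /=; apply: (le_trans (Hn_bar_at_risk xy)).
rewrite -[leLHS](divfK (lt0r_neq0 Hx)) mulrC ler_pM ?at_risk_after_ge0 ?Hn_bar_ge0//.
- by rewrite divr_ge0 ?at_risk_after_ge0 ?Hn_bar_ge0.
- by apply: IH => // u us; apply: sub; rewrite mem_cat us.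
- exact: one_hazard_jump_ge.
Qed.

Let before t := [seq u <- jumps | 0 < u <= t].

Let before_sorted t : sorted <%R (before t).
Proof. by rewrite sorted_filter ?jumps_sorted//; exact: lt_trans. Qed.

(** Without censoring the factors telescope to the proportion of observations
    that survive [t]; each factor can only increase when some of the exits are
    censored. *)
Lemma Sn_ge t : 0 <= t -> at_risk_after t <= Sn t.
Proof.
move=> t0; rewrite kaplan_meier_prod// -big_filter -/(before t).
have : {subset before t <= jumps} by move=> u; rewrite mem_filter => /andP[].
have : all (<= t) (before t).
  by apply/allP => u; rewrite mem_filter => /andP[/andP[]].
have := before_sorted t; case/lastP: (before t) => [|s x] srt st sub.
  by rewrite big_nil (le_trans (at_risk_after_Hn_bar _))// Hn_bar_le1.
have xJ : x \in jumps by apply: sub; rewrite mem_rcons inE eqxx.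
have xt : x <= t by move/allP: st; apply; rewrite mem_rcons inE eqxx.
have Hx := jump_at_risk xJ; apply: (le_trans (at_risk_after_le xt)).
rewrite -cats1 big_cat big_seq1 /= -[leLHS](divfK (lt0r_neq0 Hx)) mulrC.
move: srt; rewrite -cats1 => srt.
rewrite ler_pM ?at_risk_after_ge0 ?Hn_bar_ge0//.
- by rewrite divr_ge0 ?at_risk_after_ge0 ?Hn_bar_ge0.
- apply: prod_ge.
  + by move: srt => /cat_sorted2[].
  + by move=> u us; apply: sub; rewrite mem_rcons inE us orbT.
  + by move: srt; rewrite (sorted_pairwise lt_trans) pairwise_cat allrel1r => /andP[].
- exact: one_hazard_jump_ge.
Qed.

Lemma one_hazard_jump_ge0 u : u \in jumps -> 0 <= 1 - hazard_jump u <= 1.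
Proof.
move=> /jump_at_risk Hu; rewrite gerBl divr_ge0 ?failures_ge0 ?Hn_bar_ge0// andbT.
by apply: le_trans (one_hazard_jump_ge Hu); rewrite divr_ge0 ?at_risk_after_ge0 ?Hn_bar_ge0.
Qed.

Lemma Sn_le1 t : 0 <= t -> Sn t <= 1.
Proof.
move=> t0; rewrite kaplan_meier_prod// big_seq_cond.
by apply: prodr_ile1 => u /andP[/one_hazard_jump_ge0].
Qed.

(** [inverse_prod] with the jumps resolved into the observations that cause
    them, so that ties need no special treatment later. *)
Lemma Sn_inverse t : 0 <= t -> 0 < at_risk_after t ->
  (Sn t)^-1 = 1 + n%:R^-1 * \sum_(i < n)
    ((0 < z i <= t)%R && delta i)%:R * ((Hb (z i))^-1 * (Sn (z i))^-1).
Proof.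
move=> t0 at0; rewrite -(sum_jumps (fun u => 0 < u <= t) (fun u => (Hb u)^-1 * (Sn u)^-1)).
rewrite kaplan_meier_prod// -big_filter -/(before t) inverse_prod//; last first.
  move=> u; rewrite mem_filter => /andP[/andP[u0 ut] uJ]; have Hu := jump_at_risk uJ.
  rewrite gt_eqF// (lt_le_trans _ (one_hazard_jump_ge Hu))// divr_gt0//.
  exact: lt_le_trans (at_risk_after_le ut).
congr (_ + _); rewrite -[RHS]big_filter -/(before t); apply: eq_big_seq => u.
rewrite mem_filter => /andP[/andP[u0 ut] _]; rewrite mulrA; congr (_ / _).
rewrite kaplan_meier_prod ?(ltW u0)// big_filter_cond; apply: eq_bigl => v.
have [vu|_] := leP v u; last by rewrite !andbF.
by rewrite !andbT (le_trans vu ut) andbT.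
Qed.

End kaplan_meier_product.

(** * Measurability of the estimator *)

Lemma measurable_inv_ge0 d (T : measurableType d) (R : realType) (g : T -> R) :
  measurable_fun setT g -> (forall x, 0 <= g x) -> measurable_fun setT (fun x => (g x)^-1).
Proof.
move=> mg g0; rewrite (_ : (fun x => _) = (fun x => g x `^ (-1))).
  by apply: (measurableT_comp (measurable_powR _)).
by apply/funext => x; rewrite powR_inv1.
Qed.

Section norm_measurability.
Context d (T : measurableType d) (R : realType) (tau : R).
Hypothesis tau_ge0 : 0 <= tau.

(** Right-continuity reduces the supremum norm to the rational times and the
    end point. *)
Lemma measurable_skorokhod_norm (phi : T -> skorokhod tau) :
  (forall t, 0 <= t <= tau -> measurable_fun setT (fun w => phi w t)) ->
  measurable_fun setT (fun w => `|phi w| : R).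
Proof.
move=> mphi; pose q k : R := if 0 <= rat_enum R k <= tau then rat_enum R k else tau.
have q01 k : 0 <= q k <= tau by rewrite /q; case: ifP => //; rewrite tau_ge0 lexx.
have ub w : has_ubound (range (fun k => `|phi w (q k)|)).
  by exists `|phi w| => _ [k _ <-]; exact: le_skorokhod_norm.
rewrite (_ : (fun w => _) = fun w => sups (fun k => `|phi w (q k)|) 0).
  apply: measurable_fun_sups => [w _|k]; first exact: ub.
  by apply: measurableT_comp => //; exact: mphi.
apply/funext => w; set M := sups _ 0.
have qM k : `|phi w (q k)| <= M.
  by apply: ub_le_sup; [exact/has_ubound_sdrop/ub|exists k].
apply/eqP; rewrite eq_le; apply/andP; split; last first.
  apply: ge_sup; first by exists `|phi w (q 0)|, 0%N.
  by move=> _ [k _ <-]; exact: le_skorokhod_norm.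
apply: skorokhod_norm_le => [|t t01]; first exact: le_trans (qM 0%N).
have /andP[t0 tt] := t01; rewrite leNgt; apply/negP => Mt.
move: tt; rewrite le_eqVlt => /predU1P[tE|tt].
  have [k /andP[tk _]] := rat_enum_dense tau (@ltr01 R).
  have qk : q k = t by rewrite /q (leNgt _ tau) tk andbF tE.
  by have := qM k; rewrite qk leNgt Mt.
have [rc _] := (skorokhodP (phi w)).1 _ t01.
have Mx : \forall x \near t^'+, M < `|phi w x|.
  exact: (cvgr_gt _ (cvg_norm (rc tt)) _ Mt).
have tin : 0 <= t < tau by rewrite t0 tt.
have [k [Mk k01]] := near_right_rat (filterI Mx (near_right_in tin)).
by have := qM k; rewrite /q k01 leNgt Mk.
Qed.

End norm_measurability.

Section km_measurability.
Context d (T : measurableType d) (R : realType) (P : probability T R).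
Variables (Xs Cs : nat -> {RV P >-> R}).

Let Z i w : R := Num.min (Xs i w) (Cs i w).

Let mZ i : measurable_fun setT (Z i).
Proof. exact: measurable_minr. Qed.

Let m_indic (b : T -> bool) : measurable [set w | b w] ->
  measurable_fun setT (fun w => (b w)%:R : R).
Proof. by move=> mb; exact: bdm_meas (bdm_pred _ mb). Qed.

Lemma measurable_nelson_aalen n t : measurable_fun setT (fun w =>
  nelson_aalen n (Z^~ w) (fun i => Xs i w <= Cs i w) t).
Proof.
rewrite (_ : (fun w => _) = fun w => n%:R^-1 * \sum_(i < n)
    ((0 <= Z i w)%R%:R * (Z i w <= t)%R%:R * (Xs i w <= Cs i w)%R%:R) *
      (Hn_bar n (Z^~ w) (Z i w))^-1); last first.
  apply/funext => w; rewrite nelson_aalenE; congr (_ * _); apply: eq_bigr => i _.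
  by rewrite -!natrM !mulnb.
apply: measurable_funM => //; apply: measurable_sum => i.
apply: measurable_funM; last first.
  apply: measurable_inv_ge0 => [|w]; last exact: Hn_bar_ge0.
  apply: measurable_funM => //; apply: measurable_sum => j.
  by apply: m_indic; exact: measurable_le_set.
apply: measurable_funM; last by apply: m_indic; exact: measurable_le_set.
by apply: measurable_funM; apply: m_indic; exact: measurable_le_set.
Qed.

(** The product integral is the limit along one sequence of partitions that does
    not depend on the sample point. *)
Lemma measurable_censored_km n t : 0 <= t ->
  measurable_fun setT (fun w => censored_km Xs Cs n w t).
Proof.
move=> t0; pose A w := nelson_aalen n (Z^~ w) (fun i => Xs i w <= Cs i w).
have /choice[p fp] (k : nat) : exists s, fine_partition t (k.+1%:R^-1 : R) s.
  by apply: fine_partition_neq0 => //; rewrite invr_gt0.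
have mp (s : seq R) (a : R) : measurable_fun setT (fun w =>
    \prod_(x <- pairmap (fun x y => 1 - (A w y - A w x)) a s) x).
  elim: s a => [|y s IH] a /=.
    by under eq_fun do rewrite big_nil; exact: measurable_cst.
  under eq_fun do rewrite big_cons; apply: measurable_funM; last exact: IH.
  apply: measurable_funB => //.
  by apply: measurable_funB; exact: measurable_nelson_aalen.
have -> : (fun w => censored_km Xs Cs n w t) =
    fun w => 1 - Sn n (Z^~ w) (fun i => Xs i w <= Cs i w) t.
  by apply/funext => w; rewrite /Sn opprB addrC subrK.
apply: measurable_funB => //.
apply: (@measurable_fun_cvg _ _ _ _ (fun k w => partition_prod (A w) (p k))).
  by move=> k; exact: mp.
move=> w _; apply: cvg_near_cst; have [e e0 He] := seq_gap (jumps n (Z^~ w)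
  (fun i => Xs i w <= Cs i w)).
have := near_infty_natSinv_lt (PosNum e0); apply: filterS => k /= ke.
have [ps ms] := fp k; rewrite kaplan_meier_prod//.
apply: (partition_prod_jumps He) => //; apply: sub_path ms => x y /lt_trans; exact.
Qed.

End km_measurability.

(** * Functionals of monotone weights *)

Definition convex_set (R : realType) (J : set R) : Prop :=
  forall a b c : R, J a -> J c -> a <= b <= c -> J b.

(** When [J] contains its infimum, the left ends of the approximating intervals
    must lie outside [J]; the point [p] keeps them inside [Q]. *)
Lemma convex_set_approx (R : realType) (J Q : set R) (p r : R) :
  convex_set J -> convex_set Q -> J `<=` Q -> J !=set0 -> Q p ->
  (forall v, J v -> p < v <= r) ->
  exists s t : nat -> R, [/\ forall k, Q (s k), forall k, Q (t k) &
    forall v, \forall k \near \oo, (s k < v <= t k) = (v \in J)].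
Proof.
move=> cJ cQ JQ J0 Qp Jp.
have hlb : has_lbound J by exists p => v /Jp /andP[/ltW].
have hub : has_ubound J by exists r => v /Jp /andP[].
have hi : has_inf J by []. have hs : has_sup J by [].
have k0 k : 0 < k.+1%:R^-1 :> R by rewrite invr_gt0.
have [s [Qs sP]] : exists s : nat -> R, (forall k, Q (s k)) /\
    ((J (inf J) /\ forall k, s k = Num.max p (inf J - k.+1%:R^-1)) \/
     (~ J (inf J) /\ forall k, J (s k) /\ s k < inf J + k.+1%:R^-1)).
  have [Ji|nJi] := pselect (J (inf J)).
    exists (fun k => Num.max p (inf J - k.+1%:R^-1)); split; last by left.
    move=> k; apply: (cQ p _ _ Qp (JQ _ Ji)); rewrite le_max lexx /= ge_max.
    by have /andP[/ltW -> _] := Jp _ Ji; rewrite gerBl ltW.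
  have /choice[s sJ] k : exists x, J x /\ x < inf J + k.+1%:R^-1.
    by have [x Jx hx] := inf_adherent (k0 k) hi; exists x.
  by exists s; split; [move=> k; apply: JQ; have [] := sJ k|right].
have [t [Jt tP]] : exists t : nat -> R, (forall k, J (t k)) /\
    ((forall k, t k = sup J) \/ (~ J (sup J) /\ forall k, sup J - k.+1%:R^-1 < t k)).
  have [Js|nJs] := pselect (J (sup J)); first by exists (fun=> sup J); split => //; left.
  have /choice[t tJ] k : exists x, J x /\ sup J - k.+1%:R^-1 < x.
    by have [x Jx hx] := sup_adherent (k0 k) hs; exists x.
  by exists t; split; [move=> k; have [] := tJ k|right; split => // k; have [] := tJ k].
exists s, t; split => // [k|v]; first exact: JQ.
have small (x : R) : 0 < x -> \forall k \near \oo, k.+1%:R^-1 < x :> R.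
  by move=> x0; have := near_infty_natSinv_lt (PosNum x0); apply: filterS => k.
have [Jv|nJv] := pselect (J v).
  rewrite mem_set//; have sv : \forall k \near \oo, s k < v.
    case: sP => [[Ji sE]|[nJi sJ]].
      apply: nearW => k; rewrite sE gt_max; have /andP[-> _] := Jp _ Jv.
      by rewrite /= (lt_le_trans (y := inf J)) ?gtrBl//; exact: ge_inf.
    have iv : inf J < v.
      rewrite lt_neqAle ge_inf// andbT; apply/eqP => e; apply: nJi; by rewrite e.
    have h0 : 0 < v - inf J by rewrite subr_gt0.
    apply: filterS (small _ h0) => k hk; have [_ h] := sJ k.
    by rewrite (lt_trans h)// -ltrBrDl.
  have vt : \forall k \near \oo, v <= t k.
    case: tP => [tE|[nJs tJ]]; first by apply: nearW => k; rewrite tE ub_le_sup.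
    have vs : v < sup J.
      rewrite lt_neqAle ub_le_sup// andbT; apply/eqP => e; apply: nJs; by rewrite -e.
    have h0 : 0 < sup J - v by rewrite subr_gt0.
    apply: filterS (small _ h0) => k hk; rewrite ltW// (lt_trans _ (tJ k))//.
    by rewrite ltrBrDr -ltrBrDl.
  by apply: filterS2 sv vt => k -> ->.
rewrite memNset//; case: sP => [[Ji sE]|[nJi sJ]]; last first.
  apply: nearW => k; apply/negbTE/negP => /andP[/ltW h1 h2]; apply: nJv.
  by apply: (cJ _ _ _ (sJ k).1 (Jt k)); rewrite h1.
have [iv|vi] := leP (inf J) v.
  apply: nearW => k; apply/negbTE/negP => /andP[_ h2]; apply: nJv.
  by apply: (cJ _ _ _ Ji (Jt k)); rewrite iv.
have h0 : 0 < inf J - v by rewrite subr_gt0.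
apply: filterS (small _ h0) => k hk; apply/negbTE; rewrite negb_and -leNgt sE le_max.
by apply/orP; left; apply/orP; right; rewrite lerBrDr -lerBrDl ltW.
Qed.

Section bounded_functional.
Context (R : realType) (D : (R -> R) -> R).
Hypothesis DD : forall f g, bdm f -> bdm g -> D (fun v => f v + g v) = D f + D g.
Hypothesis DZ : forall c f, bdm f -> D (fun v => c * f v) = c * D f.
Hypothesis Dcvg : forall (f_ : nat -> R -> R) f B, (forall k, bdm (f_ k)) ->
  (forall k v, `|f_ k v| <= B) -> (forall v, f_ k v @[k --> \oo] --> f v) ->
  D (f_ k) @[k --> \oo] --> D f.

Definition ray (t v : R) : R := (v <= t)%R%:R.

Let bray t : bdm (ray t). Proof. exact: bdm_le_cst. Qed.

Let D0 : D (fun=> 0) = 0.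
Proof.
rewrite -[RHS](mul0r (D (ray 0))) -DZ//.
by congr D; apply/funext => v; rewrite mul0r.
Qed.

Let DB f g : bdm f -> bdm g -> D (fun v => f v - g v) = D f - D g.
Proof.
move=> bf bg; rewrite -mulN1r -DZ// -DD//; last exact: bdmZ.
by congr D; apply/funext => v; rewrite mulN1r.
Qed.

Let Dsum I (s : seq I) (F : I -> R -> R) : (forall i, bdm (F i)) ->
  D (fun v => \sum_(i <- s) F i v) = \sum_(i <- s) D (F i).
Proof.
move=> bF; elim: s => [|i s IH].
  by rewrite big_nil -[RHS]D0; congr D; apply/funext => v; rewrite big_nil.
rewrite big_cons -IH -DD//; last exact: bdm_sum.
by congr D; apply/funext => v; rewrite big_cons.
Qed.

(** The indicator of a convex set is a bounded limit of differences of rays with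
    end points in [Q], on which the oscillation is at most [e]. *)
Lemma functional_convex_le (J Q : set R) (p r e : R) : 0 <= e ->
  convex_set J -> convex_set Q -> J `<=` Q -> (J !=set0 -> Q p) ->
  (forall v, J v -> p < v <= r) ->
  (forall s t, Q s -> Q t -> `|D (ray t) - D (ray s)| <= e) ->
  `|D (fun v => (v \in J)%:R)| <= e.
Proof.
move=> e0 cJ cQ JQ Qp Jp osc.
have [J0|/set0P J1] := eqVneq J set0.
  rewrite (_ : (fun v => _) = fun=> 0) ?D0 ?normr0//.
  by apply/funext => v; rewrite J0 in_set0.
have [s [t [Qs Qt st]]] := convex_set_approx cJ cQ JQ J1 (Qp J1) Jp.
pose f k v : R := (s k < v <= t k)%R%:R.
have fE k : f k = if s k <= t k then fun v => ray (t k) v - ray (s k) v else fun=> 0.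
  apply/funext => v; rewrite /f /ray ltNge; case: (leP (s k) (t k)) => st'.
    case: (leP v (s k)) => vs /=; last by rewrite subr0.
    by rewrite (le_trans vs st') subrr.
  by case: (leP v (s k)) => //= sv; rewrite leNgt (lt_trans st' sv).
have bf k : bdm (f k).
  by rewrite fE; case: ifP => _; [exact: bdmB|exact: bdm_cst].
have fle k : `|D (f k)| <= e.
  by rewrite fE; case: ifP => _; [rewrite DB// osc|rewrite D0 normr0].
have : D (f k) @[k --> \oo] --> D (fun v => (v \in J)%:R).
  apply: (@Dcvg _ _ 1) => // [k v|v].
    by rewrite ger0_norm// lern1 leq_b1.
  by apply: cvg_near_cst; apply: filterS (st v) => k; rewrite /f => ->.
move/cvg_norm/cvgr_to_le; apply; exact: nearW.
Qed.

(** The layer-cake formula for [f] and [f']: the two indicators of a level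
    differ by the indicator of the layer between them. *)
Lemma layer_le (f f' : R -> R) (B e : R) : 0 < B -> 0 <= e -> bdm f -> bdm f' ->
  (forall v, 0 <= f' v <= f v) -> (forall v, f v <= B) ->
  (forall y, 0 < y -> `|D (fun v => (f' v < y <= f v)%R%:R)| <= e) ->
  `|D f - D f'| <= B * e.
Proof.
move=> B0 e0 bf bf' f'f fB lev.
have bl (h : R -> R) y : bdm h -> bdm (fun v => (y <= h v)%R%:R : R).
  by move=> bh; apply: bdm_pred; apply: measurable_le_set => //; exact: bdm_meas.
have blay (h : R -> R) K : bdm h -> bdm (fun v => layer B K (h v)).
  by move=> bh; apply: bdm_sum => l; apply: bdmZ; exact: bl.
have cl (h : R -> R) : bdm h -> (forall v, 0 <= h v <= B) ->
    D (fun v => layer B K (h v)) @[K --> \oo] --> D h.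
  move=> bh h0B; apply: (@Dcvg _ _ B) => [K|K v|v]; first exact: blay.
    rewrite ger0_norm ?layer_ge0//.
    by have /andP[/le_trans h1 _] := layer_bounds K B0 (h0B v); apply: h1; have /andP[] := h0B v.
  exact: cvg_layer.
have f0B v : 0 <= f v <= B by have /andP[h1 h2] := f'f v; rewrite (le_trans h1 h2) fB.
have f'0B v : 0 <= f' v <= B by have /andP[-> h2] := f'f v; rewrite (le_trans h2).
have : D (fun v => layer B K (f v)) - D (fun v => layer B K (f' v)) @[K --> \oo]
    --> D f - D f' by apply: cvgB; exact: cl.
move/cvg_norm/cvgr_to_le; apply.
apply: nearW => K; set c := B / K.+1%:R.
have c0 : 0 < c by rewrite divr_gt0.
have -> : D (fun v => layer B K (f v)) - D (fun v => layer B K (f' v)) =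
    \sum_(l < K.+1) c * D (fun v => (f' v < l.+1%:R * c <= f v)%R%:R).
  rewrite /layer !Dsum -?sumrB; last 2 first.
  - by move=> l; apply: bdmZ; exact: bl.
  - by move=> l; apply: bdmZ; exact: bl.
  apply: eq_bigr => l _; rewrite !DZ -?mulrBr -?DB//; try exact: bl.
  congr (_ * D _); apply/funext => v; rewrite -/c.
  have [ff|ff] := leP (l.+1%:R * c) (f' v); last by rewrite subr0.
  by have /andP[_ /(le_trans ff) ->] := f'f v; rewrite subrr.
apply: (le_trans (ler_norm_sum _ _ _)).
have -> : B * e = \sum_(l < K.+1) c * e.
  by rewrite sumr_const card_ord -mulr_natl mulrA /c mulrCA divff ?mulr1// pnatr_eq0.
apply: ler_sum => l _; rewrite normrM gtr0_norm// ler_wpM2l ?(ltW c0)//.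
by apply: lev; rewrite mulr_gt0.
Qed.

Section oscillation.
Variables (m : R -> R) (tau e e0 : R) (k : nat).
Hypothesis m01 : forall t, 0 <= m t < 1.
Hypothesis m_mono : forall s t, s <= t -> m s <= m t.
Hypothesis m_rc : forall t, m x @[x --> t^'+] --> m t.
Hypothesis e_ge0 : 0 <= e.
Hypothesis e0_ge0 : 0 <= e0.
Hypothesis D_cell : forall s t, cell m k s = cell m k t -> `|D (ray t) - D (ray s)| <= e.
Hypothesis D_all : forall s t, `|D (ray t) - D (ray s)| <= e0.
Notation c := (cell m k).

Let cell_mono s t : s <= t -> (c s <= c t)%N.
Proof. by move=> st; rewrite /cell le_truncn// ler_wpM2l ?m_mono// exprn_ge0. Qed.

Lemma cell_left_end : exists p : nat -> R, forall v, 0 <= v <= tau ->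
  0 <= p (c v) <= v /\ c (p (c v)) = c v.
Proof.
have /choice[p pP] (j : nat) : exists x, forall v, 0 <= v <= tau -> c v = j ->
    0 <= x <= v /\ c x = j.
  pose A := [set v | 0 <= v <= tau /\ c v = j].
  have [A0|/eqP A0] := eqVneq A set0.
    by exists 0 => v v01 cv; have : A v by []; rewrite A0.
  have hA : has_inf A by split; [exact/set0P/eqP|exists 0 => v [/andP[]]].
  exists (inf A) => v v01 cv.
  have Av : A v by [].
  have iv : inf A <= v by apply: ge_inf => //; exact: hA.2.
  have i0 : 0 <= inf A by apply: lb_le_inf => [|x [/andP[]]//]; exact: hA.1.
  split; first by rewrite i0.
  apply/eqP; rewrite eqn_leq -{1}cv cell_mono//=.
  rewrite /cell truncn_ge_nat; last by rewrite mulr_ge0 ?exprn_ge0//; have /andP[] := m01 (inf A).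
  have : 2 ^+ k * m x @[x --> (inf A)^'+] --> 2 ^+ k * m (inf A).
    by apply: cvgMl_tmp; exact: m_rc.
  move/cvgr_to_ge; apply; near=> x.
  have ix : 0 < x - inf A by rewrite subr_gt0; near: x; exact: nbhs_right_gt.
  have [y [y01 cy] yx] := inf_adherent ix hA.
  have {}yx : y <= x by rewrite ltW// (lt_le_trans yx)// addrC subrK.
  rewrite -truncn_ge_nat; last by rewrite mulr_ge0 ?exprn_ge0//; have /andP[] := m01 x.
  by rewrite -cy; exact: cell_mono.
by exists p => v v01; have [] := pP (c v) v v01 erefl.
Unshelve. all: by end_near. Qed.

Definition monotone_weight (f : R -> R) (B : R) : Prop :=
  [/\ bdm f, forall v, 0 <= f v <= B, forall v, ~~ (0 < v <= tau) -> f v = 0 &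
      forall s t, 0 <= s -> s <= t -> t <= tau -> f s <= f t].

Let bray_mul t f : bdm f -> bdm (fun v => ray t v * f v).
Proof. by move=> bf; exact: bdmM. Qed.

Let ray_level t (f : R -> R) (y v : R) : 0 < y -> (y <= ray t v * f v) = (v <= t) && (y <= f v).
Proof.
by move=> y0; rewrite /ray; case: (v <= t) => /=; rewrite ?mul1r// mul0r leNgt y0.
Qed.

(** The level sets of a nondecreasing weight, cut at [t], are convex. *)
Lemma monotone_weight_le (f : R -> R) (B t : R) : 0 < B -> monotone_weight f B ->
  `|D (fun v => ray t v * f v)| <= B * e0.
Proof.
move=> B0 [bf f0B fI fm]; rewrite -[X in `|X|]subr0 -D0.
apply: layer_le => //.
- exact: bray_mul.
- exact: bdm_cst.
- by move=> v; rewrite lexx mulr_ge0//; have /andP[] := f0B v.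
- move=> v; have /andP[h0 hB] := f0B v; apply: le_trans hB.
  by rewrite ler_piMl// lern1 leq_b1.
move=> y y0; pose J := [set v | 0 < v <= tau /\ v <= t /\ y <= f v].
have -> : (fun v => (0 < y <= ray t v * f v)%R%:R : R) = fun v => (v \in J)%:R.
  apply/funext => v; rewrite y0 /= ray_level//; congr (nat_of_bool _)%:R.
  apply/idP/idP => [/andP[vt yf]|/set_mem[_ [-> ->]]//].
  rewrite mem_set//; split=> //; apply/negPn/negP => /fI f0.
  by move: yf; rewrite f0 leNgt y0.
apply: (@functional_convex_le J setT 0 tau) => //.
- move=> a b c' [/andP[a0 _] [_ ya]] [/andP[_ ct'] [ct _]] /andP[ab bc].
  split; first by rewrite (lt_le_trans a0 ab) (le_trans bc).
  split; first exact: le_trans ct.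
  by rewrite (le_trans ya)// fm ?(ltW a0)// (le_trans bc).
- by move=> v [].
Qed.

Lemma monotone_weight_osc (f : R -> R) (B s t : R) : 0 < B -> monotone_weight f B ->
  s <= t -> c s = c t ->
  `|D (fun v => ray t v * f v) - D (fun v => ray s v * f v)| <= B * e.
Proof.
move=> B0 [bf f0B fI fm] st cst.
have f0 v : 0 <= f v by have /andP[] := f0B v.
have rst v : ray s v <= ray t v.
  by rewrite ler_nat; case: (leP v s) => // /le_trans ->.
apply: layer_le => //.
- exact: bray_mul.
- exact: bray_mul.
- by move=> v; rewrite mulr_ge0//= ler_wpM2r.
- move=> v; have /andP[h0 hB] := f0B v; apply: le_trans hB.
  by rewrite ler_piMl// lern1 leq_b1.
move=> y y0; pose J := [set v | (0 < v <= tau) && (s < v <= t) && (y <= f v)].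
have -> : (fun v => (ray s v * f v < y <= ray t v * f v)%R%:R : R) = fun v => (v \in J)%:R.
  apply/funext => v; rewrite ltNge !ray_level//; congr (nat_of_bool _)%:R.
  apply/idP/idP.
    move=> /andP[h1 /andP[vt yf]]; move: h1; rewrite yf andbT -ltNge => sv.
    rewrite mem_set//= /J/= sv vt yf !andbT; apply/negPn/negP => /fI fv0.
    by move: yf; rewrite fv0 leNgt y0.
  by move=> /set_mem/andP[/andP[_ /andP[sv ->]] ->]; rewrite andbT leNgt sv.
apply: (@functional_convex_le J [set v | c v = c s] s tau) => //.
- move=> a b c' /andP[/andP[/andP[a0 _] /andP[sa _]] ya].
  move=> /andP[/andP[/andP[_ ct'] /andP[_ ct]] _] /andP[ab bc]; apply/andP; split.
    by rewrite (lt_le_trans a0 ab) (le_trans bc ct') (lt_le_trans sa ab) (le_trans bc ct).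
  by rewrite (le_trans ya)// fm ?(ltW a0)// (le_trans bc).
- move=> a b c' /= ca cc /andP[ab bc]; apply/eqP.
  by rewrite eqn_leq -{1}cc -ca !cell_mono.
- move=> v /andP[/andP[_ /andP[sv vt]] _]; apply/eqP.
  by rewrite /= eqn_leq {1}cst !cell_mono// ltW.
- by move=> v /andP[/andP[/andP[_ ->] /andP[-> _]] _].
- by move=> u v /= cu cv; apply: D_cell; rewrite cu.
Qed.

Section left_ends.
Variable p : nat -> R.
Hypothesis pP : forall v, 0 <= v <= tau -> 0 <= p (c v) <= v /\ c (p (c v)) = c v.

(** The step function with, on every cell, the value of [f] at its left end. *)
Definition cellwise (f : R -> R) (v : R) : R := in_window tau v * f (p (c v)).

Let bcell j : bdm (fun v => (c v == j)%:R : R).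
Proof.
have ic : is_interval [set v | c v == j].
  move=> x y /= /eqP cx /eqP cy z /andP[xz zy]; apply/eqP/anti_leq.
  by rewrite -{1}cy -cx !cell_mono.
by apply: bdm_pred; exact: is_interval_measurable ic.
Qed.

Let cellwiseE f v : cellwise f v =
  \sum_(j < 2 ^ k) f (p j) * (in_window tau v * (c v == j)%:R).
Proof.
rewrite /cellwise (bigD1 (Ordinal (cell_lt m01 k v)))//= eqxx mulr1 big1 ?addr0.
  by rewrite mulrC.
move=> j jv; rewrite (_ : c v == j = false) ?mulr0//.
by apply/negbTE; apply: contraNneq jv => h; apply/eqP/val_inj.
Qed.

Lemma bdm_cellwise f : bdm (cellwise f).
Proof.
rewrite (_ : cellwise f = fun v => \sum_(j < 2 ^ k) f (p j) * (in_window tau v * (c v == j)%:R)).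
  by apply: bdm_sum => j; apply: bdmZ; apply: bdmM => //; exact: bdm_in_window.
by apply/funext => v; rewrite cellwiseE.
Qed.

(** For a monotone weight the layer between [cellwise f] and [f] at a given
    height meets a single cell, because the left end of any later cell is
    already above that height. *)
Lemma cellwise_le (f : R -> R) (B t : R) : 0 < B -> monotone_weight f B ->
  `|D (fun v => ray t v * f v) - D (fun v => ray t v * cellwise f v)| <= B * e.
Proof.
move=> B0 [bf f0B fI fm].
have cf v : 0 < v <= tau -> cellwise f v = f (p (c v)) /\ f (p (c v)) <= f v.
  move=> v0t; rewrite /cellwise /in_window v0t mul1r; split => //.
  have /andP[/ltW v0 vt] := v0t; have [|/andP[p0 pv] _] := pP (v := v); first by rewrite v0.
  exact: fm.
have cf0 v : 0 <= cellwise f v.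
  by rewrite mulr_ge0//; have /andP[] := f0B (p (c v)).
have cff v : cellwise f v <= f v.
  have [v0|v0] := boolP (0 < v <= tau); first by have [-> ] := cf v v0.
  by rewrite /cellwise /in_window (negbTE v0) mul0r; have /andP[] := f0B v.
apply: layer_le => //.
- exact: bray_mul.
- by apply: bray_mul; exact: bdm_cellwise.
- by move=> v; rewrite mulr_ge0//= ler_wpM2l.
- move=> v; have /andP[h0 hB] := f0B v; apply: le_trans hB.
  by rewrite ler_piMl// lern1 leq_b1.
move=> y y0.
pose J := [set v | 0 < v <= tau /\ v <= t /\ f (p (c v)) < y <= f v].
have -> : (fun v => (ray t v * cellwise f v < y <= ray t v * f v)%R%:R : R) =
    fun v => (v \in J)%:R.
  apply/funext => v; rewrite ltNge !ray_level//.
  congr (nat_of_bool _)%:R; apply/idP/idP.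
    move=> /andP[h1 /andP[vt yf]]; move: h1; rewrite vt /= -ltNge => h1.
    have v0 : 0 < v <= tau.
      by apply/negPn/negP => /fI f0; move: yf; rewrite f0 leNgt y0.
    by rewrite mem_set//; split=> //; split=> //; have [<- _] := cf v v0; rewrite h1.
  move=> /set_mem[v0 [vt /andP[h1 h2]]]; rewrite vt h2 /= -ltNge.
  by have [-> _] := cf v v0; rewrite h1.
have Jcell u v : J u -> J v -> u <= v -> c u = c v.
  move=> [u0 [_ /andP[_ yu]]] [v0 [_ /andP[pv _]]] uv; apply/eqP.
  rewrite eqn_leq cell_mono//= leqNgt; apply/negP => cuv.
  have /andP[/ltW v0' vt] := v0; have [|/andP[p0 pv'] cp] := pP (v := v).
    by rewrite v0'.
  have up : u <= p (c v).
    rewrite leNgt; apply/negP => /ltW/cell_mono; rewrite cp leqNgt => /negP; exact.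
  have /andP[/ltW u0' _] := u0.
  have := fm _ _ u0' up (le_trans pv' vt); rewrite leNgt => /negP; apply.
  exact: lt_le_trans yu.
have [J0|/set0P[u Ju]] := eqVneq J set0.
  rewrite (_ : (fun v => _) = fun=> 0) ?D0 ?normr0//.
  by apply/funext => v; rewrite J0 in_set0.
have cu v : J v -> c v = c u.
  by move=> Jv; have [vu|/ltW uv] := leP v u; [exact: Jcell|exact/esym/Jcell].
have [u0 _] := Ju; have u01 : 0 <= u <= tau by have /andP[/ltW -> ->] := u0.
apply: (@functional_convex_le J [set v | c v = c u] (p (c u)) tau) => //.
- move=> a b c' Ja Jc /andP[ab bc]; have cac := Jcell _ _ Ja Jc (le_trans ab bc).
  have cab : c b = c a.
    by apply/eqP; rewrite eqn_leq (cell_mono ab) cac cell_mono.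
  move: Ja Jc => [/andP[a0 _] [_ /andP[pa ya]]] [/andP[_ ct'] [ct _]].
  split; first by rewrite (lt_le_trans a0 ab) (le_trans bc).
  split; first exact: le_trans ct.
  by rewrite cab pa (le_trans ya)// fm ?(ltW a0)// (le_trans bc).
- move=> a b c' /= ca cc /andP[ab bc]; apply/eqP.
  by rewrite eqn_leq -{1}cc -ca !cell_mono.
- by move=> _; have [] := pP u01.
- move=> v Jv; have [v0 [_ /andP[h1 h2]]] := Jv; have /andP[/ltW v0' vt] := v0.
  rewrite vt andbT -(cu _ Jv); have [|/andP[_ pv] _] := pP (v := v); first by rewrite v0'.
  by rewrite lt_neqAle pv andbT; apply/eqP => pE; move: h1; rewrite pE ltNge h2.
- by move=> s t' /= cs ct'; apply: D_cell; rewrite cs.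
Qed.

Lemma cellwise_close (f h : R -> R) (zeta t : R) : 0 <= zeta ->
  (forall v, 0 <= v <= tau -> `|f v - h v| <= zeta) ->
  `|D (fun v => ray t v * cellwise f v) - D (fun v => ray t v * cellwise h v)|
    <= 2 ^+ k * zeta * e0.
Proof.
move=> z0 fh; pose cl j v : R := ray t v * (in_window tau v * (c v == j)%:R).
have bcl j : bdm (cl j) by apply: bray_mul; apply: bdmM => //; exact: bdm_in_window.
rewrite -DB; [|by apply: bray_mul; exact: bdm_cellwise|by apply: bray_mul; exact: bdm_cellwise].
have -> : (fun v => ray t v * cellwise f v - ray t v * cellwise h v) =
    fun v => \sum_(j < 2 ^ k) (f (p j) - h (p j)) * cl j v.
  apply/funext => v; rewrite !cellwiseE !mulr_sumr -sumrB; apply: eq_bigr => j _.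
  by rewrite /cl; ring.
rewrite Dsum; last by move=> j; exact: bdmZ.
apply: (le_trans (ler_norm_sum _ _ _)).
have -> : 2 ^+ k * zeta * e0 = \sum_(j < 2 ^ k) zeta * e0.
  by rewrite sumr_const card_ord -[RHS]mulr_natl natrX mulrA.
apply: ler_sum => j _; rewrite DZ// normrM.
pose J := [set v | (0 < v <= tau) && (v <= t) && (c v == j)].
have clE : cl j = fun v => (v \in J)%:R.
  apply/funext => v; rewrite /cl /ray /in_window -!natrM !mulnb; congr (nat_of_bool _)%:R.
  by apply/idP/idP => [/and3P[h1 h2 h3]|/set_mem/andP[/andP[-> ->] ->]//]; rewrite mem_set// /J/= h2 h1 h3.
have [J0|/set0P[u /andP[/andP[u0 _] /eqP cu]]] := eqVneq J set0.
  rewrite clE (_ : (fun v => _) = fun=> 0); last by apply/funext => v; rewrite J0 in_set0.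
  by rewrite D0 normr0 mulr0 mulr_ge0.
apply: ler_pM => //.
  apply: fh; rewrite -cu; have /andP[/ltW u0' ut] := u0.
  by have [|/andP[-> /le_trans ->]] := pP (v := u); rewrite ?u0'.
rewrite clE; apply: (@functional_convex_le J setT 0 tau) => //.
- move=> a b c' /andP[/andP[/andP[a0 _] _] /eqP ca].
  move=> /andP[/andP[/andP[_ cb] ct] /eqP cc] /andP[ab bc]; apply/andP; split.
    by rewrite (lt_le_trans a0 ab) (le_trans bc cb) (le_trans bc ct).
  by rewrite eqn_leq -{1}cc -ca !cell_mono.
- by move=> v /andP[/andP[]].
Qed.

End left_ends.

(** Comparison of two monotone weights that are uniformly close: one may replace
    both of them by step functions along the cells, the error being controlled
    by the oscillation [e] inside the cells. *)
Lemma monotone_weight_close (f h : R -> R) (B zeta t : R) : 0 < B -> 0 <= zeta ->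
  monotone_weight f B -> monotone_weight h B ->
  (forall v, 0 <= v <= tau -> `|f v - h v| <= zeta) ->
  `|D (fun v => ray t v * f v) - D (fun v => ray t v * h v)|
    <= 2 * B * e + 2 ^+ k * zeta * e0.
Proof.
move=> B0 z0 wf wh fh; have [p pP] := cell_left_end.
have h1 := cellwise_le pP t B0 wf; have h2 := cellwise_le pP t B0 wh.
have h3 := cellwise_close pP t z0 fh.
move: h1 h2 h3; rewrite !ler_norml => /andP[a1 a2] /andP[b1 b2] /andP[c1 c2].
by apply/andP; split; lra.
Qed.

End oscillation.
End bounded_functional.

(** * The Duhamel expansion of the estimator *)

Section km_expansion.
Context d (T : measurableType d) (R : realType) (P : probability T R).
Variables (X C : {RV P >-> R}) (tau : R).
Hypothesis XC : independent X C.
Hypothesis F0 : df X 0 = 0.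
Hypothesis Htau : (P [set w | (Num.min (X w) (C w) <= tau)%R] < 1)%E.
Variables (n : nat) (xs cs : nat -> R).
Notation muX := (muX X).
Notation surv_after := (surv_after X).
Notation in_window := (in_window tau).
Notation hazard_density := (hazard_density X tau).
Notation H := (Hbar X C).
Notation score := (score X tau).
Notation compensate := (compensate X tau).
Notation tail_mass := (tail_mass X C tau).
Notation var_density := (var_density X C tau).
Let z i := Num.min (xs i) (cs i).
Let dl i := xs i <= cs i.
Notation Hb := (Hn_bar n z).
Notation Snn := (Sn n z dl).
Notation at_risk := (at_risk_after n z).

(** The distribution function of [X] stopped at [tau]; the increments of the
    means of all processes built from the failures are bounded by it. *)
Definition clock (t : R) : R := \int[muX]_u (in_window u * (u <= t)%R%:R).

(** The factor [surv P X] cancels the hazard density in the compensator and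
    leaves the monotone part [1 / (Sn Hb)] of the Duhamel weight to [f]. *)
Definition score_avg (f : R -> R) : R :=
  n%:R^-1 * \sum_(i < n) score (fun u => surv P X u * f u) (xs i, cs i).

Let bsurv f : bdm f -> bdm (fun u => surv P X u * f u).
Proof. by move=> bf; apply: bdmM => //; exact: bdm_survX. Qed.

Lemma score_avgD f g : bdm f -> bdm g ->
  score_avg (fun v => f v + g v) = score_avg f + score_avg g.
Proof.
move=> bf bg; rewrite /score_avg -mulrDr -big_split/=; congr (_ * _).
apply: eq_bigr => i _; rewrite -(scoreD Htau)//; try exact: bsurv.
by congr (score _ _); apply/funext => v; rewrite mulrDr.
Qed.

Lemma score_avgZ c f : bdm f -> score_avg (fun v => c * f v) = c * score_avg f.
Proof.
move=> bf; rewrite /score_avg mulrCA; congr (_ * _); rewrite mulr_sumr.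
apply: eq_bigr => i _; rewrite -(scoreZ Htau)//; last exact: bsurv.
by congr (score _ _); apply/funext => v; rewrite mulrCA.
Qed.

Lemma score_avg_cvg (f_ : nat -> R -> R) f B : (forall k, bdm (f_ k)) ->
  (forall k v, `|f_ k v| <= B) -> (forall v, f_ k v @[k --> \oo] --> f v) ->
  score_avg (f_ k) @[k --> \oo] --> score_avg f.
Proof.
move=> bf fB ff; apply: cvgMl_tmp; apply: cvg_big => [|i _]; first exact: add_continuous.
apply: cvgB => /=.
  by apply: cvgMl_tmp; apply: cvgMl_tmp; exact: ff.
have bw u : `|hazard_density u * surv P X u| <= 1 :> R.
  by rewrite (hazard_density_surv Htau) ger0_norm; have /andP[] := in_window01 tau u.
have [|||//] := @cvg_bint _ _ _ muX (fun k v => surv P X v * f_ k v * hazard_density v * (v <= z i)%R%:R)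
    (fun v => surv P X v * f v * hazard_density v * (v <= z i)%R%:R) B.
- move=> k; apply: bdm_meas; apply: bdmM; last exact: bdm_le_cst.
  by apply: bdmM; [exact: bsurv|exact: (bdm_hazard_density Htau)].
- move=> k v; rewrite normrM (le_trans (y := `|f_ k v|))//.
  rewrite -[leRHS]mulr1 ler_pM//; last by rewrite normr_nat lern1 leq_b1.
  by rewrite mulrC mulrA normrM ler_piMl.
- by move=> v; apply: cvgMr_tmp; apply: cvgMr_tmp; apply: cvgMl_tmp; exact: ff.
Qed.

Lemma df_int r : \int[muX]_u (u <= r)%R%:R = df X r.
Proof.
rewrite (_ : (fun _ => _) = \1_`]-oo, r]%classic); first by rewrite bint_indic.
by apply/funext => u; rewrite indicE mem_setE in_itv.
Qed.

Lemma clock_bounds t : 0 <= clock t < 1.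
Proof.
rewrite bint_ge0 => [|u]; last by rewrite mulr_ge0.
rewrite /= (le_lt_trans (y := df X tau))//; last first.
  rewrite -subr_gt0; exact: lt_le_trans (tail_mass_gt0 Htau) (tail_mass_surv_after X C (lexx tau)).
rewrite -df_int; apply: le_bint; last 1 first.
- move=> u; rewrite /in_window; case: (boolP (0 < u <= tau)) => [/andP[_ ->]|_].
    by rewrite mul1r lern1 leq_b1.
  by rewrite mul0r.
- by apply: bdmM; [exact: bdm_in_window|exact: bdm_le_cst].
- exact: bdm_le_cst.
Qed.

Lemma clock_nondecreasing s t : s <= t -> clock s <= clock t.
Proof.
move=> st; apply: cum_nondecreasing => //; first exact: bdm_in_window.
Qed.

Lemma clock_right_continuous t : clock x @[x --> t^'+] --> clock t.
Proof. by apply: cum_right_continuous; exact: bdm_in_window. Qed.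

Lemma score_avgE f : bdm f ->
  score_avg f = n%:R^-1 * \sum_(i < n) (in_window (z i) * (dl i)%:R * surv P X (z i) * f (z i))
    - \int[muX]_u (in_window u * f u * Hb u).
Proof.
move=> bf; rewrite /score_avg /score sumrB mulrBr; congr (_ - _).
  congr (_ * _); apply: eq_bigr => i _ /=; rewrite /z /dl.
  by case: (leP (xs i) (cs i)) => _; rewrite ?mulr0 ?mul0r ?mulr1 ?mulrA.
transitivity (\int[muX]_u (\sum_(i < n) n%:R^-1 * (in_window u * f u * (u <= z i)%R%:R))).
  rewrite bint_sum; last first.
    by move=> i; apply: bdmZ; apply: bdmM; [apply: bdmM => //; exact: bdm_in_window|exact: bdm_le_cst].
  rewrite mulr_sumr; apply: eq_bigr => i _; rewrite bintZ; last first.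
    by apply: bdmM; [apply: bdmM => //; exact: bdm_in_window|exact: bdm_le_cst].
  congr (_ * _); apply: eq_Rintegral => u _ /=.
  by rewrite -(hazard_density_surv Htau); ring.
by apply: eq_Rintegral => u _; rewrite /Hn_bar mulrCA !mulr_sumr; apply: eq_bigr => i _; ring.
Qed.

Section at_risk_lower_bound.
Variable c : R.
Hypothesis c0 : 0 < c.
Hypothesis c_at_risk : c <= at_risk tau.
Hypothesis c_tail_mass : c <= tail_mass.

Let at_risk_ge v : v <= tau -> c <= at_risk v.
Proof. by move=> vt; rewrite (le_trans c_at_risk)// at_risk_after_le. Qed.

Let Hb_ge v : v <= tau -> c <= Hb v.
Proof. by move=> /at_risk_ge/le_trans; apply; exact: at_risk_after_Hn_bar. Qed.

Let Sn_ge_c v : 0 <= v <= tau -> c <= Snn v.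
Proof. by move=> /andP[v0 /at_risk_ge/le_trans]; apply; exact: Sn_ge. Qed.

(** [jump_mass i] is the jump of 1/Sn at the i-th observation. *)
Definition jump_mass (i : nat) : R :=
  n%:R^-1 * ((0 < z i)%R && dl i)%:R * ((Hb (z i))^-1 * (Snn (z i))^-1).

Definition inv_km (v : R) : R := 1 + \sum_(i < n) (z i <= v)%R%:R * jump_mass i.

Definition km_weight (v : R) : R := in_window v * (inv_km v * (Hb v)^-1).

Lemma inv_kmE v : 0 <= v <= tau -> (Snn v)^-1 = inv_km v.
Proof.
move=> /andP[v0 vt]; rewrite Sn_inverse//; last exact: lt_le_trans (at_risk_ge vt).
rewrite /inv_km mulr_sumr; congr (1 + _); apply: eq_bigr => i _; rewrite /jump_mass.
by case: (0 < z i); case: (z i <= v); case: (dl i) => /=; ring.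
Qed.

Let jump_mass_ge0 i : 0 <= jump_mass i.
Proof.
rewrite /jump_mass; case: (ltP 0 (z i)) => [zi|_]; last by rewrite mulr0 mul0r.
rewrite mulr_ge0 ?mulr_ge0 ?invr_ge0 ?Hn_bar_ge0//.
by rewrite (le_trans _ (Sn_ge _ _ _ (ltW zi)))// at_risk_after_ge0.
Qed.

Let inv_km_mono s t : s <= t -> inv_km s <= inv_km t.
Proof.
move=> st; rewrite lerD2l ler_sum// => i _; rewrite ler_wpM2r// ler_nat.
by case: (leP (z i) s) => // /le_trans ->.
Qed.

Let bdm_inv_km : bdm inv_km.
Proof.
apply: bdmD; first exact: bdm_cst.
apply: bdm_sum => i; rewrite (_ : (fun v => _) = fun v => jump_mass i * (z i <= v)%R%:R).
  by apply: bdmZ; exact: bdm_ge_cst.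
by apply/funext => v; rewrite mulrC.
Qed.

Let inv_c : 0 <= c^-1. Proof. by rewrite invr_ge0 ltW. Qed.

Let B0 : 0 < c^-1 ^+ 2. Proof. by rewrite exprn_gt0// invr_gt0. Qed.

Let inI1 v : 0 < v <= tau -> in_window v = 1.
Proof. by move=> v0; rewrite /in_window v0. Qed.

Let inI0 v : ~~ (0 < v <= tau) -> in_window v = 0.
Proof. by move=> /negbTE v0; rewrite /in_window v0. Qed.

Let km_weight_bounds v : 0 <= km_weight v <= c^-1 ^+ 2.
Proof.
rewrite /km_weight; have [v0|/inI0 ->] := boolP (0 < v <= tau); last first.
  by rewrite mul0r lexx/= ltW.
have /andP[/ltW v0' vt] := v0; have v01 : 0 <= v <= tau by rewrite v0'.
rewrite inI1// mul1r -inv_kmE// mulr_ge0 ?invr_ge0 ?Hn_bar_ge0//=; last first.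
  exact: le_trans (ltW c0) (Sn_ge_c v01).
rewrite expr2 ler_pM ?invr_ge0 ?Hn_bar_ge0//.
- exact: le_trans (ltW c0) (Sn_ge_c v01).
- by rewrite lef_pV2 ?posrE ?Sn_ge_c// (lt_le_trans c0)// Sn_ge_c.
- by rewrite lef_pV2 ?posrE ?Hb_ge// (lt_le_trans c0)// Hb_ge.
Qed.

Lemma km_weight_monotone : monotone_weight tau km_weight (c^-1 ^+ 2).
Proof.
split.
- apply: (@bdm_bounded _ _ _ _ (c^-1 ^+ 2)); last first.
    by move=> v; have /andP[h0 h1] := km_weight_bounds v; rewrite ger0_norm.
  apply: measurable_funM; first exact: bdm_meas (bdm_in_window tau).
  apply: measurable_funM; first exact: bdm_meas bdm_inv_km.
  apply: measurable_inv_nonincreasing => //; first exact: Hn_bar_ge0.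
  exact: Hn_bar_nonincreasing.
- exact: km_weight_bounds.
- by move=> v /inI0 v0; rewrite /km_weight v0 mul0r.
move=> s t s0 st tt; have [sE|s0'] := eqVneq s 0.
  rewrite {1}/km_weight inI0 ?mul0r; last by rewrite sE ltxx.
  by have /andP[] := km_weight_bounds t.
have sp : 0 < s by rewrite lt_neqAle eq_sym s0'.
have is1 : in_window s = 1 by rewrite inI1// sp (le_trans st).
have it1 : in_window t = 1 by rewrite inI1// (lt_le_trans sp st).
rewrite /km_weight is1 it1.
have s01 : 0 <= s <= tau by rewrite s0 (le_trans st).
rewrite !mul1r ler_pM ?invr_ge0 ?Hn_bar_ge0 ?inv_km_mono//.
  by rewrite -inv_kmE// invr_ge0 (le_trans (ltW c0))// Sn_ge_c.
rewrite lef_pV2 ?posrE ?Hn_bar_nonincreasing// (lt_le_trans c0)// Hb_ge//.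
exact: le_trans tt.
Qed.

Let surv_after_Hbar_ge v : v <= tau -> c <= surv_after v /\ c <= H v.
Proof.
move=> vt; split; apply: (le_trans c_tail_mass); first exact: tail_mass_surv_after.
exact: tail_mass_Hbar.
Qed.

Lemma var_density_monotone : monotone_weight tau var_density (c^-1 ^+ 2).
Proof.
have kb v : 0 <= var_density v <= c^-1 ^+ 2.
  rewrite var_density_ge0; have [v0|/inI0 v0] := boolP (0 < v <= tau); last first.
    by rewrite /var_density v0 mul0r ltW.
  have /andP[_ vt] := v0; have [h1 h2] := surv_after_Hbar_ge vt.
  rewrite /var_density inI1// mul1r invfM expr2 ler_pM ?invr_ge0 ?surv_after_ge0 ?surv_ge0//.
    by rewrite lef_pV2 ?posrE// (lt_le_trans c0).
  by rewrite lef_pV2 ?posrE// (lt_le_trans c0).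
split => //; first exact: bdm_var_density.
  by move=> v /inI0 v0; rewrite /var_density v0 mul0r.
move=> s t s0 st tt; have [sE|s0'] := eqVneq s 0.
  rewrite {1}/var_density inI0 ?mul0r; last by rewrite sE ltxx.
  by have /andP[] := kb t.
have sp : 0 < s by rewrite lt_neqAle eq_sym s0'.
have is1 : in_window s = 1 by rewrite inI1// sp (le_trans st).
have it1 : in_window t = 1 by rewrite inI1// (lt_le_trans sp st).
rewrite /var_density is1 it1.
rewrite !mul1r lef_pV2 ?posrE ?(surv_after_Hbar_gt0 Htau) ?(le_trans st)//.
by rewrite ler_pM ?surv_after_ge0 ?surv_ge0 ?surv_after_nonincreasing ?Hbar_nonincreasing.
Qed.

Let bdm_le_I t : bdm (fun u : R => in_window u * (u <= t)%R%:R).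
Proof. by apply: bdmM; [exact: bdm_in_window|exact: bdm_le_cst]. Qed.

Let int_to (t : R) : 0 <= t <= tau -> \int[muX]_u (in_window u * (u <= t)%R%:R) = 1 - surv_after t.
Proof.
move=> /andP[t0 tt]; rewrite /surv_after opprB addrC subrK.
rewrite -[RHS]subr0 -F0 -!df_int -bintB; try exact: bdm_le_cst.
apply: eq_Rintegral => u _; rewrite /in_window; have [u0|u0] := leP u 0.
  by rewrite (le_trans u0 t0) subrr mul0r.
by case: (leP u t) => ut; rewrite ?(le_trans ut tt) ?mulr0 ?mulr1 subr0.
Qed.

Let int_from_to (a t : R) : 0 < a -> t <= tau ->
  \int[muX]_u (in_window u * ((u <= t)%R%:R * (a <= u)%R%:R)) =
  (a <= t)%R%:R * (surv P X a - surv_after t).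
Proof.
move=> a0 tt; have bl : bdm (fun u : R => (u <= t)%R%:R : R) by exact: bdm_le_cst.
have bg : bdm (fun u : R => (a <= u)%R%:R : R) by exact: bdm_ge_cst.
have [at_|ta] := leP a t; last first.
  rewrite mul0r -[RHS](mul0r (\int[muX]_u (u <= t)%R%:R)) -bintZ//.
  apply: eq_Rintegral => u _; rewrite mul0r.
  by have [ut|] := leP u t; [rewrite leNgt (le_lt_trans ut ta) !mulr0|rewrite mul0r mulr0].
have -> : surv P X a = \int[muX]_u (a <= u)%R%:R.
  rewrite (_ : (fun _ => _) = \1_`[a, +oo[%classic); last first.
    by apply/funext => u; rewrite indicE mem_setE in_itv /= andbT.
  rewrite bint_indic// /surv; congr (fine (P _)); apply/seteqP.
  by split=> w /=; rewrite in_itv /= andbT.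
have b1 : bdm (fun _ : R => 1 : R) by exact: bdm_cst.
transitivity (\int[muX]_u (a <= u)%R%:R + \int[muX]_u (u <= t)%R%:R - \int[muX]_u 1);
  last by rewrite pint_cst df_int mul1r /surv_after opprB addrA.
rewrite -bintD// -bintB//; last exact: bdmD.
apply: eq_Rintegral => u _; rewrite /in_window; have [au|ua] := leP a u.
  rewrite (lt_le_trans a0 au); have [ut|ut] := leP u t.
    by rewrite (le_trans ut tt) /= !mulr1 addrK.
  by rewrite mul0r mulr0 addr0 subrr.
by rewrite !mulr0 (le_trans (ltW ua) at_) add0r subrr.
Qed.

(** The Duhamel identity for the pair of survival functions 1 - F and Sn, in
    the form that expresses the Kaplan-Meier error through the martingale-type
    scores with the data-dependent weight 1/(Sn Hb). *)
Lemma duhamel t : 0 <= t <= tau ->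
  surv_after t - Snn t = Snn t * score_avg (fun v => ray t v * km_weight v).
Proof.
move=> t01; have /andP[t0 tt] := t01.
have [bw _ _ _] := km_weight_monotone.
have Snt : 0 < Snn t by rewrite (lt_le_trans c0)// Sn_ge_c.
suff -> : score_avg (fun v => ray t v * km_weight v) = surv_after t * inv_km t - 1.
  by rewrite -inv_kmE// mulrBr mulr1 mulrCA divff ?mulr1// gt_eqF.
rewrite score_avgE; last by apply: bdmM => //; exact: bdm_le_cst.
have -> : \int[muX]_u (in_window u * (ray t u * km_weight u) * Hb u) =
    1 - surv_after t + \sum_(i < n) jump_mass i * ((z i <= t)%R%:R * (surv P X (z i) - surv_after t)).
  rewrite -(int_to t01); transitivity (\int[muX]_u (in_window u * (u <= t)%R%:R +
      \sum_(i < n) jump_mass i * (in_window u * ((u <= t)%R%:R * (z i <= u)%R%:R)))).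
    apply: eq_Rintegral => u _; rewrite /ray /km_weight /inv_km.
    have [u0|/inI0 ->] := boolP (0 < u <= tau); last first.
      by rewrite !mul0r add0r big1// => i _; rewrite mul0r mulr0.
    have /andP[_ ut] := u0; have Hu : Hb u != 0 by rewrite gt_eqF// (lt_le_trans c0)// Hb_ge.
    rewrite inI1// !mul1r -!mulrA mulVf// mulr1 mulrDr mulr1 mulr_sumr; congr (_ + _).
    apply: eq_bigr => i _. ring.
  have bi i : bdm (fun u : R => in_window u * ((u <= t)%R%:R * (z i <= u)%R%:R)).
    by apply: bdmM; [exact: bdm_in_window|apply: bdmM; [exact: bdm_le_cst|exact: bdm_ge_cst]].
  rewrite bintD//; last by apply: bdm_sum => i; exact: bdmZ.
  congr (_ + _); rewrite bint_sum; last by move=> i; exact: bdmZ.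
  apply: eq_bigr => i _; rewrite bintZ//; have [zi|zi] := ltP 0 (z i).
    by rewrite int_from_to.
  by rewrite /jump_mass ltNge zi /= mulr0 !mul0r.
have -> : n%:R^-1 * \sum_(i < n) in_window (z i) * (dl i)%:R * surv P X (z i) *
      (ray t (z i) * km_weight (z i)) =
    \sum_(i < n) jump_mass i * ((z i <= t)%R%:R * surv P X (z i)).
  rewrite mulr_sumr; apply: eq_bigr => i _; rewrite /ray.
  have [zt|_] := leP (z i) t; last by rewrite !mul0r !mulr0.
  rewrite /km_weight /jump_mass.
  have [zi|zi] := boolP (0 < z i <= tau); last first.
    have -> : (0 < z i) = false by move: zi; rewrite (le_trans zt tt) andbT => /negbTE.
    by rewrite inI0//=; ring.
  have /andP[zi0 zit] := zi; rewrite inI1// zi0 -inv_kmE ?(ltW zi0)//=.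
  by ring.
have -> : surv_after t * inv_km t = surv_after t + \sum_(i < n) jump_mass i * ((z i <= t)%R%:R * surv_after t).
  rewrite /inv_km mulrDr mulr1 mulr_sumr; congr (_ + _); apply: eq_bigr => i _; ring.
have -> : \sum_(i < n) jump_mass i * ((z i <= t)%R%:R * surv P X (z i)) =
    \sum_(i < n) jump_mass i * ((z i <= t)%R%:R * (surv P X (z i) - surv_after t)) +
    \sum_(i < n) jump_mass i * ((z i <= t)%R%:R * surv_after t).
  by rewrite -big_split/=; apply: eq_bigr => i _; ring.
by ring.
Qed.

Lemma influence_avg t : n%:R^-1 * \sum_(i < n) influence X C tau t (xs i, cs i) =
  surv_after t * score_avg (fun v => ray t v * var_density v).
Proof.
have br : bdm (fun v => ray t v * var_density v).
  by apply: bdmM; [exact: bdm_le_cst|exact: (bdm_var_density XC Htau)].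
rewrite -score_avgZ// /score_avg; congr (_ * _); apply: eq_bigr => i _.
congr (score _ _); apply/funext => u; rewrite /score_weight /var_density /ray; ring.
Qed.

Section remainder.
Variables (k : nat) (e e0 eta : R).
Hypothesis e_ge0 : 0 <= e.
Hypothesis e0_ge0 : 0 <= e0.
Hypothesis eta_ge0 : 0 <= eta.
Hypothesis osc_cell : forall s t, cell clock k s = cell clock k t ->
  `|score_avg (ray t) - score_avg (ray s)| <= e.
Hypothesis osc_all : forall s t, `|score_avg (ray t) - score_avg (ray s)| <= e0.
Hypothesis Hb_close : forall v, 0 <= v <= tau -> `|Hb v - H v| <= eta.

Let survival_close t : 0 <= t <= tau -> `|surv_after t - Snn t| <= c^-1 ^+ 2 * e0.
Proof.
move=> t01; have /andP[t0 tt] := t01; rewrite duhamel// normrM.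
have S0 : 0 <= Snn t by rewrite (le_trans (ltW c0))// Sn_ge_c.
rewrite (le_trans (y := `|score_avg (fun v => ray t v * km_weight v)|))//.
  by rewrite ler_piMl// ger0_norm// Sn_le1.
exact: (monotone_weight_le score_avgD score_avgZ score_avg_cvg e0_ge0 osc_all
  t B0 km_weight_monotone).
Qed.

Let weight_close v : 0 <= v <= tau ->
  `|km_weight v - var_density v| <= c^-1 ^+ 4 * (c^-1 ^+ 2 * e0 + eta).
Proof.
move=> v01; have /andP[v0 vt] := v01.
have z0 : 0 <= c^-1 ^+ 4 * (c^-1 ^+ 2 * e0 + eta).
  by rewrite mulr_ge0 ?exprn_ge0// addr_ge0// mulr_ge0 ?exprn_ge0.
rewrite /km_weight /var_density; have [vI|/inI0 ->] := boolP (0 < v <= tau); last first.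
  by rewrite !mul0r subrr normr0.
rewrite inI1// !mul1r -inv_kmE//.
have hS := Sn_ge_c v01; have hH := Hb_ge vt; have [hp hh] := surv_after_Hbar_ge vt.
have S0 : 0 < Snn v := lt_le_trans c0 hS; have Hb0 : 0 < Hb v := lt_le_trans c0 hH.
have p0 : 0 < surv_after v := lt_le_trans c0 hp; have H0 : 0 < H v := lt_le_trans c0 hh.
have -> : (Snn v)^-1 * (Hb v)^-1 - (surv_after v * H v)^-1 =
    ((Snn v)^-1 * (Hb v)^-1 * ((surv_after v)^-1 * (H v)^-1)) *
    ((surv_after v - Snn v) * H v + Snn v * (H v - Hb v)).
  by field; rewrite !gt_eqF.
rewrite normrM ler_pM//.
  rewrite !normrM !ger0_norm ?invr_ge0 ?(ltW S0) ?(ltW Hb0) ?(ltW p0) ?(ltW H0)//.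
  have ci (x : R) : c <= x -> x^-1 <= c^-1.
    by move=> cx; rewrite lef_pV2 ?posrE// (lt_le_trans c0).
  rewrite (_ : c^-1 ^+ 4 = c^-1 * c^-1 * (c^-1 * c^-1)); last by ring.
  by rewrite !ler_pM ?mulr_ge0 ?invr_ge0 ?ci ?(ltW S0) ?(ltW Hb0) ?(ltW p0) ?(ltW H0).
apply: (le_trans (ler_normD _ _)); rewrite !normrM lerD//.
  rewrite -[leRHS]mulr1 ler_pM//; first exact: survival_close.
  by rewrite ger0_norm ?Hbar_le1// ltW.
rewrite -[leRHS]mul1r ler_pM//; first by rewrite ger0_norm ?Sn_le1// ltW.
by rewrite distrC Hb_close.
Qed.

(** The first term of the bound comes from the prefactor [Sn] in place of the
    true survival function, the others from the random weight in place of its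
    limit. *)
Lemma km_remainder t : 0 <= t <= tau ->
  `|kaplan_meier n z dl t - df X t - n%:R^-1 * \sum_(i < n) influence X C tau t (xs i, cs i)|
  <= (c^-1 ^+ 2 * e0) ^+ 2 + 2 * c^-1 ^+ 2 * e +
     2 ^+ k * (c^-1 ^+ 4 * (c^-1 ^+ 2 * e0 + eta)) * e0.
Proof.
move=> t01; set Dg := score_avg (fun v => ray t v * km_weight v).
set Dk := score_avg (fun v => ray t v * var_density v).
have z0 : 0 <= c^-1 ^+ 4 * (c^-1 ^+ 2 * e0 + eta).
  by rewrite mulr_ge0 ?exprn_ge0// addr_ge0// mulr_ge0 ?exprn_ge0.
have h1 : `|Dg| <= c^-1 ^+ 2 * e0.
  exact: (monotone_weight_le score_avgD score_avgZ score_avg_cvg e0_ge0 osc_all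
    t B0 km_weight_monotone).
have h2 : `|Dg - Dk| <= 2 * c^-1 ^+ 2 * e +
    2 ^+ k * (c^-1 ^+ 4 * (c^-1 ^+ 2 * e0 + eta)) * e0.
  exact: (monotone_weight_close score_avgD score_avgZ score_avg_cvg clock_bounds
    clock_nondecreasing clock_right_continuous e_ge0 e0_ge0 osc_cell osc_all
    t B0 z0 km_weight_monotone var_density_monotone weight_close).
have -> : kaplan_meier n z dl t - df X t - n%:R^-1 * \sum_(i < n) influence X C tau t (xs i, cs i) =
    - ((surv_after t - Snn t) * Dg) + surv_after t * (Dg - Dk).
  have e1 : kaplan_meier n z dl t - df X t = Snn t * Dg.
    by rewrite -duhamel// /Sn /surv_after; ring.
  by rewrite influence_avg e1 -/Dk; ring.
rewrite -[leRHS]addrA (le_trans (ler_normD _ _))// lerD//.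
  by rewrite normrN normrM [leRHS]expr2 ler_pM// survival_close.
by rewrite normrM ger0_norm ?surv_after_ge0// (le_trans _ h2)// ler_piMl// surv_after_le1.
Qed.

Lemma influence_avg_osc s t : 0 <= s -> s <= t -> t <= tau ->
  cell clock k s = cell clock k t ->
  `|n%:R^-1 * \sum_(i < n) influence X C tau t (xs i, cs i) -
    n%:R^-1 * \sum_(i < n) influence X C tau s (xs i, cs i)|
  <= c^-1 ^+ 2 * e + 2 ^- k * (c^-1 ^+ 2 * e0).
Proof.
move=> s0 st tt cst; rewrite !influence_avg.
set Dt := score_avg (fun v => ray t v * var_density v).
set Ds := score_avg (fun v => ray s v * var_density v).
have -> : surv_after t * Dt - surv_after s * Ds = surv_after s * (Dt - Ds) + (surv_after t - surv_after s) * Dt by ring.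
rewrite (le_trans (ler_normD _ _))// lerD// normrM.
  rewrite (ger0_norm (surv_after_ge0 X s)) -[leRHS]mul1r ler_pM ?surv_after_ge0 ?surv_after_le1//.
  exact: (monotone_weight_osc score_avgD score_avgZ score_avg_cvg
    clock_nondecreasing e_ge0 osc_cell B0 var_density_monotone st cst).
apply: ler_pM => //; last first.
  exact: (monotone_weight_le score_avgD score_avgZ score_avg_cvg e0_ge0 osc_all
    t B0 var_density_monotone).
have -> : surv_after t - surv_after s = clock s - clock t.
  by rewrite /clock !int_to ?s0 ?(le_trans st)// ?(le_trans s0)//; ring.
by rewrite distrC; exact: (cell_dist clock_bounds).
Qed.

End remainder.

End at_risk_lower_bound.

End km_expansion.

(** * Uniform bounds for the score process *)

Lemma ray_right_continuous (R : realType) (t v : R) : ray x v @[x --> t^'+] --> ray t v.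
Proof.
have [vt|tv] := leP v t.
  apply: cvg_near_cst; near=> x; rewrite /ray vt.
  have tx : t <= x by near: x; exact: nbhs_right_ge.
  by rewrite (le_trans vt tx).
apply: cvg_near_cst; near=> x; rewrite /ray (leNgt v t) tv.
have xv : x < v by near: x; exact: nbhs_right_lt.
by rewrite leNgt xv.
Unshelve. all: by end_near. Qed.

Definition min_rv d (T : measurableType d) (R : realType) (P : probability T R)
  (X C : {RV P >-> R}) (w : T) : R := Num.min (X w) (C w).

HB.instance Definition _ d (T : measurableType d) (R : realType) (P : probability T R)
    (X C : {RV P >-> R}) := isMeasurableFun.Build d _ T R (min_rv X C)
  (measurable_minr (@measurable_funPT _ _ _ _ X) (@measurable_funPT _ _ _ _ C)).

Section empirical_processes.
Context d (T : measurableType d) (R : realType) (P : probability T R).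
Variables (X C : {RV P >-> R}) (Xs Cs : nat -> {RV P >-> R}) (tau : R).
Hypothesis X_ge0 : forall w, 0 <= X w.
Hypothesis C_ge0 : forall w, 0 <= C w.
Hypothesis XC : independent X C.
Hypothesis XCs_iid : iid_copies P (fun w => (X w, C w)) (fun i w => (Xs i w, Cs i w)).
Hypothesis F0 : df X 0 = 0.
Hypothesis Htau : (P [set w | (Num.min (X w) (C w) <= tau)%R] < 1)%E.
Variables (b lam : nat -> R).
Hypothesis b_gt0 : forall n, (0 < n)%N -> 0 < b n.
Hypothesis b_0 : b n @[n --> \oo] --> 0.
Hypothesis lamE : forall n, lam n = n%:R * b n ^+ 2.
Hypothesis lam_infty : lam n @[n --> \oo] --> +oo.
Notation muX := (muX X).
Notation in_window := (in_window tau).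
Notation hazard_density := (hazard_density X tau).
Notation clock := (clock X tau).
Notation tail_mass := (tail_mass X C tau).
Notation score_avg n w := (score_avg X tau n (Xs^~ w) (Cs^~ w)).

Let Y w := (X w, C w).
Let Ys (i : nat) w := (Xs i w, Cs i w).
Let mY : measurable_fun setT Y. Proof. exact: measurable_fun_pair. Qed.
Let mYs i : measurable_fun setT (Ys i). Proof. exact: measurable_fun_pair. Qed.

Definition failure_process (t : R) (z : R * R) : R :=
  in_window z.1 * (z.1 <= z.2)%R%:R * (surv P X z.1 * ray t z.1).

Definition compensator (t : R) (z : R * R) : R := clock (Num.min t (Num.min z.1 z.2)).

(** The factor 1/2 keeps the mean away from 1, as the clock of a chaining must
    be. *)
Definition exit_process (t : R) (z : R * R) : R := 2^-1 * ray t (Num.min z.1 z.2).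

Let bray t : bdm (fun u : R => surv P X u * ray t u).
Proof. by apply: bdmM; [exact: bdm_survX|exact: bdm_le_cst]. Qed.

Lemma compensatorE t z :
  compensate X tau (fun u => surv P X u * ray t u) (Num.min z.1 z.2) = compensator t z.
Proof.
apply: eq_Rintegral => u _; rewrite /ray -(hazard_density_surv Htau u) (le_min u t) -mulnb natrM.
by ring.
Qed.

Lemma score_rayE t z : score X tau (fun u => surv P X u * ray t u) z =
  failure_process t z - compensator t z.
Proof. by rewrite /score compensatorE. Qed.

Let mean (t : R) : R := \int[muX]_x (in_window x * (surv P X x * surv P C x) * ray t x).

Let bh : bdm (fun x => in_window x * (surv P X x * surv P C x)).
Proof.
apply: bdmM; first exact: bdm_in_window.
by apply: bdmM; [exact: bdm_survX|exact: bdm_survC].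
Qed.

Let mean_rc t : mean x @[x --> t^'+] --> mean t.
Proof. exact: cum_right_continuous. Qed.

Let mean_clock s t : s <= t -> mean t - mean s <= clock t - clock s.
Proof.
move=> st; have bl r : bdm (fun u : R => in_window u * (u <= r)%R%:R).
  by apply: bdmM; [exact: bdm_in_window|exact: bdm_le_cst].
have bm r : bdm (fun x => in_window x * (surv P X x * surv P C x) * ray r x).
  by apply: bdmM => //; exact: bdm_le_cst.
rewrite /mean /clock -!bintB//; apply: le_bint; [exact: bdmB|exact: bdmB|].
move=> u; rewrite -!mulrBr; apply: ler_wpM2r.
  by rewrite subr_ge0 ler_nat; case: (leP u s) => // us; rewrite (le_trans us st).
rewrite ler_piMr// -[1]mulr1 ler_pM ?surv_ge0 ?surv_le1//.
Qed.

Let chain1 k (eps L : R) : 0 < eps -> 0 <= L ->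
  L + 1 <= (eps / 16) ^+ 2 * 2 ^+ k / 8 ->
  negl P lam L (fun n => [set w | exists s t, cell clock k s = cell clock k t /\
    eps * b n < `|dev Ys failure_process mean n s w - dev Ys failure_process mean n t w|]).
Proof.
apply: (uniform_chaining mY mYs XCs_iid) => //.
- move=> t; apply: bdm_meas; apply: bdmM.
    by apply: bdmM; [exact/bdm_fst/bdm_in_window|exact: bdm_le_fun].
  exact: (bdm_fst (bray t)).
- move=> t u; rewrite !mulr_ge0 ?surv_ge0//=.
  rewrite -[leRHS]mulr1 ler_pM ?mulr_ge0 ?surv_ge0//.
    by rewrite -[leRHS]mulr1 ler_pM// lern1 leq_b1.
  by rewrite -[leRHS]mulr1 ler_pM ?surv_ge0 ?surv_le1// lern1 leq_b1.
- move=> u s t st; rewrite ler_wpM2l ?mulr_ge0// ler_wpM2l ?surv_ge0// ler_nat.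
  by case: (leP u.1 s) => // us; rewrite (le_trans us st).
- by move=> u t; apply: cvgMl_tmp; apply: cvgMl_tmp; exact: ray_right_continuous.
- move=> t; rewrite (failure_mean tau XC (bray t)); apply: eq_Rintegral => x _.
  by ring.
- exact: (clock_bounds Htau).
- exact: clock_nondecreasing.
- exact: clock_right_continuous.
Qed.

Let chain2 k (eps L : R) : 0 < eps -> 0 <= L ->
  L + 1 <= (eps / 16) ^+ 2 * 2 ^+ k / 8 ->
  negl P lam L (fun n => [set w | exists s t, cell clock k s = cell clock k t /\
    eps * b n < `|dev Ys compensator mean n s w - dev Ys compensator mean n t w|]).
Proof.
apply: (uniform_chaining mY mYs XCs_iid) => //.
- move=> t; rewrite (_ : compensator t = (fun z : R * R =>
      compensate X tau (fun u => surv P X u * ray t u) (Num.min z.1 z.2))).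
    apply: measurableT_comp; first exact: bdm_meas (bdm_compensate Htau (bray t)).
    exact: measurable_minr.
  by apply/funext => z; rewrite compensatorE.
- by move=> t u; have /andP[-> /ltW ->] := clock_bounds Htau (Num.min t (Num.min u.1 u.2)).
- move=> u s t st; apply: clock_nondecreasing; rewrite le_min ge_min st /=.
  by rewrite ge_min lexx orbT.
- move=> u t; rewrite /compensator; set z := Num.min u.1 u.2.
  have [tz|zt] := ltP t z.
    have := @clock_right_continuous _ _ _ _ X tau t; apply: cvg_trans.
    apply: near_eq_cvg; near=> x; rewrite min_l//; near: x; exact: nbhs_right_le.
  apply: cvg_near_cst; near=> x; rewrite min_r//.
  by rewrite (le_trans zt)//; near: x; exact: nbhs_right_ge.
- move=> t; under eq_Rintegral => w _ do rewrite -compensatorE.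
  by rewrite (compensate_mean XC Htau (bray t)); apply: eq_Rintegral => x _; ring.
- exact: (clock_bounds Htau).
- exact: clock_nondecreasing.
- exact: clock_right_continuous.
Unshelve. all: by end_near. Qed.

Let Z : {RV P >-> R} := min_rv X C.
Let mean3 (t : R) : R := 2^-1 * df Z t.

Let mean3_bounds t : 0 <= mean3 t < 1.
Proof.
have h0 : 0 <= df Z t by exact: fine_ge0.
have h1 : df Z t <= 1 by rewrite -subr_ge0; exact: surv_after_ge0.
by rewrite /mean3; apply/andP; split; lra.
Qed.

Let df_mono s t : s <= t -> df Z s <= df Z t.
Proof. by move=> st; have := surv_after_nonincreasing Z st; rewrite /surv_after lerD2l lerN2. Qed.

Let df_rc t : df Z x @[x --> t^'+] --> df Z t.
Proof.
apply: fine_cvg; rewrite fineK ?fin_num_measure//.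
exact: cdf_right_continuous.
Qed.

Let chain3 (eps L : R) : 0 < eps -> 0 <= L -> L + 1 <= (eps / 16) ^+ 2 * 2 ^+ 0 / 8 ->
  negl P lam L (fun n => [set w | exists s t, cell mean3 0 s = cell mean3 0 t /\
    eps * b n < `|dev Ys exit_process mean3 n s w - dev Ys exit_process mean3 n t w|]).
Proof.
have mean3_mono s t : s <= t -> mean3 s <= mean3 t.
  by move=> st; rewrite ler_wpM2l ?invr_ge0// df_mono.
apply: (uniform_chaining mY mYs XCs_iid) => //.
- move=> t; apply: measurable_funM => //.
  apply: measurableT_comp; first exact: bdm_meas (bdm_le_cst _).
  exact: measurable_minr.
- move=> t u; rewrite /exit_process /ray.
  by case: (_ <= t); rewrite ?mulr0 ?mulr1 ?lexx ?ler01// invr_ge0 ler0n invf_le1//= ler1n.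
- move=> u s t st; rewrite ler_wpM2l ?invr_ge0// ler_nat.
  by case: (leP _ s) => // us; rewrite (le_trans us st).
- by move=> u t; apply: cvgMl_tmp; exact: ray_right_continuous.
- move=> t; rewrite /mean3 -(df_int Z t) -bintZ; last exact: bdm_le_cst.
  rewrite (bint_distribution Z)//.
  by apply: bdmZ; exact: bdm_le_cst.
- by move=> t; apply: cvgMl_tmp; exact: df_rc.
- by move=> t; apply: cvgMl_tmp; exact: df_rc.
Qed.

Let cell0 (m : R -> R) t : (forall s, 0 <= m s < 1) -> cell m 0 t = 0%N.
Proof. by move=> m01; have := cell_lt m01 0 t; rewrite expn0 ltnS leqn0 => /eqP. Qed.

Section at_sample_point.
Variables (n : nat) (w : T) (e : R).
Hypothesis n_gt0 : (0 < n)%N.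
Hypothesis exit_osc : forall s t,
  `|dev Ys exit_process mean3 n s w - dev Ys exit_process mean3 n t w| <= e.
Let z i := Num.min (Xs i w) (Cs i w).

Let emp (t : R) : R := n%:R^-1 * \sum_(i < n) ray t (z i).

Let n0 : n%:R != 0 :> R. Proof. by rewrite pnatr_eq0 -lt0n. Qed.

Let devE t : dev Ys exit_process mean3 n t w = 2^-1 * (emp t - df Z t).
Proof.
rewrite /dev /mean3 /emp mulrBr mulrCA; congr (_ * _ - _).
by rewrite mulr_sumr.
Qed.

(* At a negative time below the whole sample both distribution functions
   vanish, so the oscillation controls the deviation itself. *)
Let emp_close t : `|emp t - df Z t| <= 2 * e.
Proof.
pose s : R := - 1 - \sum_(i < n) `|z i|.
have sz (i : 'I_n) : s < z i.
  rewrite /s ltrBlDr; have h1 : `|z i| <= \sum_(i < n) `|z i|.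
    by rewrite (bigD1 i)//= lerDl sumr_ge0.
  have := ler_norm (- z i); rewrite normrN; lra.
have s0 : emp s = 0.
  by rewrite /emp big1 ?mulr0// => i _; rewrite /ray leNgt sz.
have F0' : df Z s = 0.
  transitivity (fine (P [set v | Z v <= s])) => //.
  rewrite (_ : [set v | _] = set0) ?measure0//.
  apply/seteqP; split=> // v /=; rewrite leNgt => /negP; apply.
  have S0 : 0 <= \sum_(i < n) `|z i| by exact: sumr_ge0.
  apply: (lt_le_trans (y := 0)); first by rewrite /s; lra.
  by rewrite /Z /min_rv le_min X_ge0 C_ge0.
have := exit_osc t s; rewrite !devE s0 F0' subrr mulr0 subr0 normrM ger0_norm ?invr_ge0//.
by rewrite ler_pdivrMl.
Qed.

Let sum1 : n%:R^-1 * \sum_(i < n) 1 = 1 :> R.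
Proof. by rewrite sumr_const card_ord mulVf. Qed.

Lemma at_risk_close : `|at_risk_after n z tau - tail_mass| <= 2 * e.
Proof.
have -> : at_risk_after n z tau = 1 - emp tau.
  rewrite -sum1 /emp -mulrBr -sumrB; congr (_ * _); apply: eq_bigr => i _.
  by rewrite /ray; case: ltP => _; rewrite ?subr0 ?subrr.
have -> : tail_mass = 1 - df Z tau by rewrite -[RHS]/(surv_after Z tau) surv_afterE.
rewrite (_ : 1 - emp tau - (1 - df Z tau) = df Z tau - emp tau); last by ring.
by rewrite distrC emp_close.
Qed.

Lemma Hn_bar_close v : `|Hn_bar n z v - Hbar X C v| <= 2 * e.
Proof.
have c1 : emp x @[x --> v^'-] --> 1 - Hn_bar n z v.
  have -> : 1 - Hn_bar n z v = n%:R^-1 * \sum_(i < n) (z i < v)%R%:R.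
    rewrite -{1}sum1 -mulrBr -sumrB; congr (_ * _); apply: eq_bigr => i _.
    by case: ltP => _; rewrite ?subr0 ?subrr.
  apply: cvgMl_tmp; apply: cvg_big => [|i _]; first exact: add_continuous.
  apply: cvg_near_cst; have [zv|vz] := ltP (z i) v.
    near=> x; have zx : z i <= x by near: x; exact: nbhs_left_ge.
    by rewrite /ray zx.
  near=> x; have xv : x < v by near: x; exact: nbhs_left_lt.
  by rewrite /ray leNgt (lt_le_trans xv vz).
have c2 : df Z x @[x --> v^'-] --> 1 - Hbar X C v.
  have b1 : bdm (fun _ : R => 1 : R) by exact: bdm_cst.
  have -> : 1 - Hbar X C v = \int[distribution P Z]_u (1 * (u < v)%R%:R).
    rewrite -[1 in LHS](pint_cst (distribution P Z)).
    have -> : Hbar X C v = \int[distribution P Z]_u (v <= u)%R%:R.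
      rewrite (_ : (fun _ => _) = \1_`[v, +oo[%classic); last first.
        by apply/funext => u; rewrite indicE mem_setE in_itv /= andbT.
      rewrite bint_indic// /Hbar /surv; congr (fine (P _)); apply/seteqP.
      by split=> w' /=; rewrite in_itv /= andbT.
    rewrite -bintB//; last exact: bdm_ge_cst.
    by apply: eq_Rintegral => u _; case: ltP => _; rewrite ?subr0 ?subrr ?mulr0 ?mulr1.
  have := @cum_left_limit _ (distribution P Z) _ b1 v; apply: cvg_trans.
  apply: near_eq_cvg; near=> x; rewrite -df_int.
  by apply: eq_Rintegral => u _; rewrite mul1r.
have : emp x - df Z x @[x --> v^'-] --> 1 - Hn_bar n z v - (1 - Hbar X C v).
  exact: cvgB.
move/cvg_norm/cvgr_to_le => /(_ (2 * e)).
rewrite (_ : 1 - Hn_bar n z v - (1 - Hbar X C v) = Hbar X C v - Hn_bar n z v).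
  by rewrite distrC; apply; apply: nearW => x; exact: emp_close.
by ring.
Unshelve. all: by end_near. Qed.

End at_sample_point.

Let score_avg_dev n w t : (0 < n)%N -> score_avg n w (ray t) =
  dev Ys failure_process mean n t w - dev Ys compensator mean n t w.
Proof.
move=> n0; rewrite /dev opprB addrA subrK -mulrBr -sumrB; congr (_ * _).
by apply: eq_bigr => i _; rewrite score_rayE.
Qed.

Let tail_mass_gt : 0 < tail_mass := tail_mass_gt0 Htau.

Lemma chaining_constant (M L : R) : 0 < M -> exists k : nat, L <= M * 2 ^+ k.
Proof.
move=> M0; exists (Num.truncn (L / M)).+1; rewrite -ler_pdivrMl// mulrC.
rewrite (le_trans (ltW (truncnS_gt _)))// -natrX ler_nat ltnW//.
exact: ltn_expl.
Qed.

Let large_constant (L : R) : 0 <= L ->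
  exists2 M : R, 0 < M & L <= (M / 16) ^+ 2 * 2 ^+ 0 / 8.
Proof.
move=> L0; have L1 : 1 <= L + 1 by rewrite lerDr.
exists (128 * (L + 1)); first by rewrite mulr_gt0// (lt_le_trans ltr01).
rewrite expr0 mulr1 (_ : _ / 8 = 8 * ((L + 1) * (L + 1))); last by field.
have : L + 1 <= (L + 1) * (L + 1) by rewrite ler_peMr// addr_ge0.
lra.
Qed.

(** The score average of a ray is the difference of two empirical processes of
    monotone functions with the same mean. *)
Lemma score_chain k (eps L : R) : 0 < eps -> 0 <= L ->
  L + 2 <= (eps / 16) ^+ 2 * 2 ^+ k / 8 ->
  negl P lam L (fun n => [set w | exists s t, cell clock k s = cell clock k t /\
    2 * (eps * b n) < `|score_avg n w (ray t) - score_avg n w (ray s)|]).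
Proof.
move=> eps0 L0 epsL; have L1 : 0 <= L + 1 by rewrite addr_ge0.
have {epsL}epsL : L + 1 + 1 <= (eps / 16) ^+ 2 * 2 ^+ k / 8 by lra.
have EU := neglU lam_infty ltr01 (chain1 eps0 L1 epsL) (chain2 eps0 L1 epsL).
apply: negl_sub EU; exists 1%N => // n /= n0 w [s [t [st h]]].
apply: contrapT => /not_orP[N1 N2].
have h1 : `|dev Ys failure_process mean n s w - dev Ys failure_process mean n t w|
    <= eps * b n.
  by rewrite leNgt; apply/negP => h1; apply: N1; exists s, t; split.
have h2 : `|dev Ys compensator mean n s w - dev Ys compensator mean n t w| <= eps * b n.
  by rewrite leNgt; apply/negP => h2; apply: N2; exists s, t; split.
move: h; rewrite !score_avg_dev// ltNge => /negP; apply.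
move: h1 h2; rewrite !ler_norml => /andP[a1 a2] /andP[b1 b2].
by apply/andP; split; lra.
Qed.

Let score_chain0 (M L : R) : 0 < M -> 0 <= L -> L + 2 <= (M / 16) ^+ 2 * 2 ^+ 0 / 8 ->
  negl P lam L (fun n => [set w | exists s t,
    2 * (M * b n) < `|score_avg n w (ray t) - score_avg n w (ray s)|]).
Proof.
move=> M0 L0 HM; apply: negl_sub (score_chain M0 L0 HM).
apply: nearW => n w [s [t st]]; exists s, t; split => //.
by rewrite !(cell0 _ (clock_bounds Htau)).
Qed.

(** The Kaplan-Meier error is, up to an event of arbitrarily large exponential
    order, the average of its influence functions. The linear part of the
    remainder is killed by the oscillation of the score process inside fine
    cells, the rest is quadratic in the deviations, which are of order b. *)
Lemma km_linearization (eps L : R) : 0 < eps -> 0 <= L ->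
  negl P lam L (fun n => [set w | exists t, 0 <= t <= tau /\
    eps * b n < `|censored_km Xs Cs n w t - df X t
      - n%:R^-1 * \sum_(i < n) influence X C tau t (Xs i w, Cs i w)|]).
Proof.
move=> eps0 L0; have L20 : 0 <= L + 2 by rewrite addr_ge0.
have [|M M0 HM] := @large_constant (L + 2 + 2); first by rewrite addr_ge0.
have HM1 : L + 2 + 1 <= (M / 16) ^+ 2 * 2 ^+ 0 / 8 by lra.
pose c := tail_mass / 2; have c0 : 0 < c by rewrite divr_gt0.
(* the weights are at most c^-2, so that cells in which the score oscillates by
   at most del * b contribute eps * b / 2 to the remainder *)
pose del := eps * c ^+ 2 / 8; have del0 : 0 < del by rewrite !mulr_gt0 ?exprn_gt0.
have [k Hk] : exists k, L + 2 + 2 <= (del / 16) ^+ 2 * 2 ^+ k / 8.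
  have d8 : 0 < (del / 16) ^+ 2 / 8 by rewrite divr_gt0// exprn_gt0// divr_gt0.
  by have [k Hk] := chaining_constant (L + 2 + 2) d8; exists k; rewrite mulrAC.
pose K := 4 * c^-1 ^+ 4 * M ^+ 2 +
  2 ^+ k * (c^-1 ^+ 4 * (c^-1 ^+ 2 * (2 * M) + 2 * M)) * (2 * M).
have ci0 : 0 <= c^-1 by rewrite invr_ge0 ltW.
have K0 : 0 <= K.
  have M0' := ltW M0.
  by rewrite addr_ge0// !(mulr_ge0, exprn_ge0, addr_ge0).
apply: negl_sub; last first.
  apply: (neglU lam_infty ltr01).
    by apply: (negl_le lam_infty _ (score_chain del0 L20 Hk)); lra.
  apply: (neglU lam_infty ltr01).
    by apply: (negl_le lam_infty _ (score_chain0 M0 L20 HM)); lra.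
  by apply: (negl_le lam_infty _ (chain3 M0 L20 HM1)); lra.
near=> n; move=> w [t [t01]].
have n0 : (0 < n)%N by near: n; exists 1%N.
have b0 := b_gt0 n0.
have bM : b n <= c / (2 * M).
  by near: n; apply: (cvgr_le _ b_0); rewrite divr_gt0// mulr_gt0.
have bK : b n <= eps / 2 / (K + 1).
  by near: n; apply: (cvgr_le _ b_0); rewrite !divr_gt0// ltr_wpDl.
apply: contraPP => /not_orP[N1 /not_orP[N3 N5]].
apply/negP; rewrite -leNgt.
have osc_cell s u : cell clock k s = cell clock k u ->
    `|score_avg n w (ray u) - score_avg n w (ray s)| <= 2 * (del * b n).
  by move=> su; rewrite leNgt; apply/negP => h; apply: N1; exists s, u; split.
have osc_all s u : `|score_avg n w (ray u) - score_avg n w (ray s)| <= 2 * (M * b n).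
  by rewrite leNgt; apply/negP => h; apply: N3; exists s, u.
have osc3 s u : `|dev Ys exit_process mean3 n s w - dev Ys exit_process mean3 n u w| <= M * b n.
  rewrite leNgt; apply/negP => h; apply: N5; exists s, u; split => //.
  by rewrite !cell0.
have cM : 2 * (M * b n) <= c.
  by rewrite mulrA mulrC -ler_pdivlMr// mulr_gt0.
have c_risk : c <= at_risk_after n (fun i => Num.min (Xs i w) (Cs i w)) tau.
  have := at_risk_close n0 osc3; rewrite ler_norml => /andP[h _].
  have tc : tail_mass = 2 * c by rewrite /c; field.
  by move: h cM; rewrite tc; lra.
have c_tail : c <= tail_mass by rewrite /c ler_pdivrMr// ler_peMr ?ltW//; lra.
have Mb0 : 0 <= 2 * (M * b n) by have := mulr_gt0 M0 b0; lra.
have db0 : 0 <= 2 * (del * b n) by have := mulr_gt0 del0 b0; lra.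
have := km_remainder XC F0 Htau c0 c_risk c_tail db0 Mb0 Mb0 osc_cell osc_all
  (fun v _ => Hn_bar_close n0 osc3 v) t01.
move/le_trans; apply.
have -> : (c^-1 ^+ 2 * (2 * (M * b n))) ^+ 2 + 2 * c^-1 ^+ 2 * (2 * (del * b n)) +
    2 ^+ k * (c^-1 ^+ 4 * (c^-1 ^+ 2 * (2 * (M * b n)) + 2 * (M * b n))) * (2 * (M * b n)) =
    K * b n * b n + eps / 2 * b n.
  by rewrite /K /del; field; rewrite gt_eqF.
have KK : K * b n <= eps / 2.
  have K1 : 0 < K + 1 by rewrite ltr_wpDl.
  move: bK; rewrite ler_pdivlMr// mulrDr mulr1; lra.
have := ler_wpM2r (ltW b0) KK; lra.
Unshelve. all: by end_near. Qed.

(** Inside a cell the influence average changes through its prefactor, which is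
    bounded by the clock, and through its last weight, which oscillates little. *)
Lemma score_oscillation (eps L : R) : 0 < eps -> 0 <= L ->
  exists k0 : nat, forall k, (k0 <= k)%N -> negl P lam L (fun n =>
    [set w | exists s t, [/\ 0 <= s, s <= t, t <= tau, cell clock k s = cell clock k t &
      eps * b n < `|n%:R^-1 * \sum_(i < n) influence X C tau t (Xs i w, Cs i w) -
                    n%:R^-1 * \sum_(i < n) influence X C tau s (Xs i w, Cs i w)|]]).
Proof.
move=> eps0 L0; have L10 : 0 <= L + 1 by rewrite addr_ge0.
have [|M M0 HM] := @large_constant (L + 1 + 2); first by rewrite addr_ge0.
pose del := eps * tail_mass ^+ 2 / 8.
have del0 : 0 < del by rewrite !mulr_gt0 ?exprn_gt0.
have d8 : 0 < (del / 16) ^+ 2 / 8 by rewrite divr_gt0// exprn_gt0// divr_gt0.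
have [k1 Hk1] := chaining_constant (L + 1 + 2) d8.
have [k2 Hk2] := chaining_constant (8 * M) (mulr_gt0 eps0 (exprn_gt0 2 tail_mass_gt)).
exists (maxn k1 k2) => k; rewrite geq_max => /andP[kk1 kk2].
have pow_le i : (i <= k)%N -> 2 ^+ i <= 2 ^+ k :> R by move=> ik; rewrite ler_eXn2l ?ltr1n.
have {Hk1}Hk : L + 1 + 2 <= (del / 16) ^+ 2 * 2 ^+ k / 8.
  rewrite mulrAC (le_trans Hk1)// ler_wpM2l ?pow_le//; exact: ltW.
have {Hk2}Hk2 : 8 * M <= eps * tail_mass ^+ 2 * 2 ^+ k.
  by rewrite (le_trans Hk2)// ler_wpM2l ?pow_le// mulr_ge0 ?exprn_ge0 ?ltW.
have EU := neglU lam_infty ltr01 (score_chain del0 L10 Hk) (score_chain0 M0 L10 HM).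
apply: negl_sub EU; exists 1%N => // n /= n0 w [s [t [s0 st tt cst]]].
have b0 := b_gt0 n0; apply: contraPP => /not_orP[N1 N3].
apply/negP; rewrite -leNgt.
have osc_cell r u : cell clock k r = cell clock k u ->
    `|score_avg n w (ray u) - score_avg n w (ray r)| <= 2 * (del * b n).
  by move=> ru; rewrite leNgt; apply/negP => h; apply: N1; exists r, u; split.
have osc_all r u : `|score_avg n w (ray u) - score_avg n w (ray r)| <= 2 * (M * b n).
  by rewrite leNgt; apply/negP => h; apply: N3; exists r, u.
have Mb0 : 0 <= 2 * (M * b n) by have := mulr_gt0 M0 b0; lra.
have db0 : 0 <= 2 * (del * b n) by have := mulr_gt0 del0 b0; lra.
have := influence_avg_osc XC F0 Htau tail_mass_gt (lexx _) db0 Mb0 osc_cell osc_all s0 st tt cst.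
move/le_trans; apply.
have p0 : 0 < 2 ^+ k :> R by rewrite exprn_gt0.
have -> : tail_mass^-1 ^+ 2 * (2 * (del * b n)) + 2 ^- k * (tail_mass^-1 ^+ 2 * (2 * (M * b n))) =
    eps * b n / 4 + 8 * M / (tail_mass ^+ 2 * 2 ^+ k) * b n / 4.
  by rewrite /del; field; rewrite !gt_eqF.
have h : 8 * M / (tail_mass ^+ 2 * 2 ^+ k) <= eps.
  by rewrite ler_pdivrMr ?mulr_gt0 ?exprn_gt0// mulrA.
have := ler_wpM2r (ltW b0) h; have := mulr_gt0 eps0 b0; lra.
Qed.

End empirical_processes.

(** * The moderate deviation principle *)

Section kaplan_meier_ldp.
Context d (T : measurableType d) (R : realType) (P : probability T R).
Variables (X C : {RV P >-> R}) (Xs Cs : nat -> {RV P >-> R}) (a : nat -> R) (tau : R).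
Hypothesis a_gt0 : forall n, (0 < n)%N -> 0 < a n.
Hypothesis a_infty : a n @[n --> \oo] --> +oo.
Hypothesis a_small : a n / Num.sqrt n%:R @[n --> \oo] --> (0 : R).
Hypothesis X_ge0 : forall w, 0 <= X w.
Hypothesis C_ge0 : forall w, 0 <= C w.
Hypothesis XC : independent X C.
Hypothesis XCs_iid : iid_copies P (fun w => (X w, C w)) (fun i w => (Xs i w, Cs i w)).
Hypothesis F0 : df X 0 = 0.
Hypothesis tau_gt0 : 0 < tau.
Hypothesis Htau : (P [set w | (Num.min (X w) (C w) <= tau)%R] < 1)%E.
Notation km_cov := (km_cov X C tau).
Notation clock := (clock X tau).
Notation tail_mass := (tail_mass X C tau).

Let tau_ge0 : 0 <= tau := ltW tau_gt0.
Let lam (n : nat) : R := a n ^+ 2.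
Let b (n : nat) : R := a n / Num.sqrt n%:R.
(* agrees with lam for n > 0 *)
Let lam1 (n : nat) : R := n%:R * b n ^+ 2.

Let b_gt0 n : (0 < n)%N -> 0 < b n.
Proof. by move=> n0; rewrite divr_gt0 ?a_gt0// sqrtr_gt0 ltr0n. Qed.

Let lam1E n : (0 < n)%N -> lam1 n = lam n.
Proof.
move=> n0; rewrite /lam1 /b expr_div_n sqr_sqrtr ?ler0n// mulrC divfK//.
by rewrite pnatr_eq0 -lt0n.
Qed.

Let lam_gt0 n : (0 < n)%N -> 0 < lam n.
Proof. by move=> /a_gt0 an; rewrite exprn_gt0. Qed.

Let lam_infty : lam n @[n --> \oo] --> +oo.
Proof.
apply/cvgryPge => M; have /cvgryPge/(_ (Num.max 1 M)) := a_infty.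
apply: filterS => n; rewrite ge_max => /andP[a1 aM].
by rewrite (le_trans aM)// /lam expr2 ler_peMl// (le_trans ler01).
Qed.

Let lam1_infty : lam1 n @[n --> \oo] --> +oo.
Proof.
have := lam_infty; apply: cvg_trans; apply: near_eq_cvg.
by exists 1%N => // n /= n0; rewrite lam1E.
Qed.

Let negl_lam L A : negl P lam1 L A -> negl P lam L A.
Proof.
move=> N; have n0 : \forall n \near \oo, (0 < n)%N by exists 1%N.
by apply: filterS2 N n0 => n [B [mB AB PB]] n0; exists B; split; rewrite // -lam1E.
Qed.

Let S (n : nat) (t : R) (w : T) : R :=
  (n%:R * b n)^-1 * \sum_(i < n) influence X C tau t (Xs i w, Cs i w).

Notation W := (km_deviation tau a X Xs Cs).

Let WE n w t : 0 <= t <= tau ->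
  W n w t = (b n)^-1 * (censored_km Xs Cs n w t - df X t).
Proof.
move=> t01; rewrite /km_deviation.
transitivity (Num.sqrt n%:R / a n *
  (to_skorokhod (cadlag_censored_km Xs Cs n w (tau := tau)) t -
   to_skorokhod (cadlag_df X (tau := tau)) t)) => //.
by rewrite !to_skorokhodE// /b invf_div.
Qed.

Let SE n w t : (0 < n)%N -> S n t w =
  (b n)^-1 * (n%:R^-1 * \sum_(i < n) influence X C tau t (Xs i w, Cs i w)).
Proof. by move=> n0; rewrite /S invfM mulrA (mulrC n%:R^-1). Qed.

Let mpair i : measurable_fun setT (fun w => (Xs i w, Cs i w)).
Proof. exact: measurable_fun_pair. Qed.

Let S_meas n t : 0 <= t <= tau -> measurable_fun setT (S n t).
Proof.
move=> _; apply: measurable_funM => //; apply: measurable_sum => i.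
apply: measurableT_comp (mpair i).
exact: bdm_meas (bdm_score Htau (bdm_influence_weight XC Htau t)).
Qed.

Let S_mgf l : times_in tau l -> forall e, 0 < e -> \forall n \near \oo,
  ((expR (lam n * (2^-1 * qf km_cov l l - e)))%:E <=
   \int[P]_w (expR (lam n * lev (fun t => S n t w) l))%:E <=
   (expR (lam n * (2^-1 * qf km_cov l l + e)))%:E)%E.
Proof.
move=> _ e e0; have bs := bdm_score Htau (bdm_wlev XC Htau l).
have mY : measurable_fun setT (fun w => (X w, C w)) by exact: measurable_fun_pair.
have n0 : \forall n \near \oo, (0 < n)%N by exists 1%N.
have b_near : \forall n \near \oo, 0 < b n by exists 1%N => // n /b_gt0.
have := mgf_asymptotics mY mpair XCs_iid bs (score_mean XC Htau (bdm_wlev XC Htau l))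
  (wlev_var XC Htau l) b_near a_small e0.
move=> H; apply: filterS2 n0 H => n n0; rewrite -/(b n) -/(lam1 n) lam1E//.
have E w : lam n * lev (fun t => S n t w) l =
    b n * \sum_(i < n) score X tau (wlev X C tau l) (Xs i w, Cs i w).
  have -> : lev (fun t => S n t w) l = (n%:R * b n)^-1 *
      \sum_(i < n) lev (fun t => influence X C tau t (Xs i w, Cs i w)) l.
    rewrite /lev exchange_big mulr_sumr; apply: eq_bigr => p _.
    by rewrite /S mulrCA -mulr_sumr.
  under eq_bigr => i _ do rewrite (influence_lev XC Htau).
  rewrite -lam1E// /lam1 mulrA; congr (_ * _).
  have := b_gt0 n0; move: (b n) => bn bn0; field.
  by rewrite gt_eqF//= pnatr_eq0 -lt0n.
move=> Hn; rewrite (eq_integral (fun w =>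
  (expR (b n * \sum_(i < n) score X tau (wlev X C tau l) (Xs i w, Cs i w)))%:E)) //.
by move=> w _; rewrite E.
Qed.

Let W_S t e L : 0 <= t <= tau -> 0 < e ->
  negl P lam L (fun n => [set w | e < `|W n w t - S n t w|]).
Proof.
move=> t01 e0; apply: negl_lam.
apply: (negl_le lam1_infty (L' := Num.max L 0)); first by rewrite le_max lexx.
have L0 : 0 <= Num.max L 0 by rewrite le_max lexx orbT.
apply: negl_sub (km_linearization X_ge0 C_ge0 XC XCs_iid F0 Htau b_gt0 a_small
  (fun=> erefl) lam1_infty e0 L0).
exists 1%N => // n n0 w; have {n0} n0 : (0 < n)%N := n0.
move=> h; have {h} : e < `|W n w t - S n t w| := h.
rewrite WE// SE// -mulrBr => h.
exists t; split => //; move: h; rewrite normrM gtr0_norm ?invr_gt0 ?b_gt0//.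
by rewrite ltr_pdivlMl ?b_gt0// mulrC.
Qed.

Let hazard_fun_clock s t : s <= t -> hazard_fun X tau t - hazard_fun X tau s <= tail_mass^-1 * (clock t - clock s).
Proof.
move=> st; have bI r : bdm (fun u : R => in_window tau u * (u <= r)%R%:R).
  by apply: bdmM; [exact: bdm_in_window|exact: bdm_le_cst].
have bH r : bdm (fun u : R => hazard_density X tau u * (u <= r)%R%:R).
  by apply: bdmM; [exact: (bdm_hazard_density Htau)|exact: bdm_le_cst].
rewrite !hazard_funE /clock -!bintB// -bintZ; last exact: bdmB.
apply: le_bint; [exact: bdmB|by apply: bdmZ; exact: bdmB|].
move=> u; rewrite -!mulrBr mulrA; apply: ler_wpM2r.
  by rewrite subr_ge0 ler_nat; case: (leP u s) => // us; rewrite (le_trans us st).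
have := hazard_density_le Htau u; rewrite /hazard_density /in_window; case: (0 < u <= tau).
  by rewrite mulr1.
by rewrite !mul0r mulr0.
Qed.

(** The left ends of the cells of a fine dyadic partition of the clock form a
    net for the Gaussian metric and control the oscillation of the process. *)
Let W_net e L : 0 < e -> exists k (p : 'I_k -> R) (pi : R -> 'I_k),
  gauss_net tau km_cov p pi e /\
  negl P lam L (fun n => [set w | exists t, 0 <= t <= tau /\
    e < `|W n w t - W n w (p (pi t))|]).
Proof.
move=> e0; pose L1 := Num.max L 0 + 1.
have L10 : 0 <= L1 by rewrite addr_ge0// le_max lexx orbT.
have e3 : 0 < e / 3 by rewrite divr_gt0.
have [k0 Hk0] := score_oscillation XC XCs_iid F0 Htau b_gt0 a_small (fun=> erefl)
  lam1_infty e3 L10.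
have t0 : 0 < tail_mass := tail_mass_gt0 Htau.
pose G := 2 * (tail_mass^-1 ^+ 2 * tail_mass^-1) * tail_mass^-1.
have [k1 Hk1] := chaining_constant G (exprn_gt0 2 e0).
pose k := maxn k0 k1.
have Gk : G * 2 ^- k <= e ^+ 2.
  rewrite ler_pdivrMr ?exprn_gt0// (le_trans Hk1)// ler_wpM2l ?sqr_ge0//.
  by rewrite ler_eXn2l ?ltr1n// leq_maxr.
have [p pP] := cell_left_end tau k (clock_bounds Htau)
  (@clock_nondecreasing _ _ _ _ X tau) (@clock_right_continuous _ _ _ _ X tau).
pose q (j : 'I_(2 ^ k)) : R := if 0 <= p j <= tau then p j else 0.
pose pi t : 'I_(2 ^ k) := Ordinal (cell_lt (clock_bounds Htau) k t).
have qP t : 0 <= t <= tau -> [/\ 0 <= q (pi t), q (pi t) <= t &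
    cell clock k (q (pi t)) = cell clock k t].
  move=> /[dup] t01 /pP[/andP[p0 pt] cp]; have /andP[_ tt] := t01.
  by rewrite /q /= p0 (le_trans pt tt).
exists (2 ^ k)%N, q, pi; split.
  split=> [j|t t01]; first by rewrite /q; case: ifP => //; rewrite lexx.
  have [q0 qt cq] := qP _ t01; have /andP[_ tt] := t01.
  rewrite (le_trans (gdist_le XC Htau q0 qt tt))// (le_trans _ Gk)//.
  rewrite /G -[leRHS]mulrA ler_wpM2l ?mulr_ge0 ?exprn_ge0 ?invr_ge0 ?(ltW t0)//.
  rewrite (le_trans (hazard_fun_clock qt))// ler_wpM2l ?invr_ge0 ?(ltW t0)//.
  by rewrite (le_trans (ler_norm _))// (cell_dist (clock_bounds Htau)).
apply: negl_lam; apply: (negl_le lam1_infty (L' := Num.max L 0)).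
  by rewrite le_max lexx.
have N1 := Hk0 k (leq_maxl _ _).
have N2 := km_linearization X_ge0 C_ge0 XC XCs_iid F0 Htau b_gt0 a_small
  (fun=> erefl) lam1_infty e3 L10.
apply: negl_sub (neglU lam1_infty ltr01 N1 N2).
exists 1%N => // n n0 w [t [t01 h]]; have {n0} n0 : (0 < n)%N := n0.
have [q0 qt cq] := qP _ t01; have /andP[t_ge0 tt] := t01.
have q01 : 0 <= q (pi t) <= tau by rewrite q0 (le_trans qt).
have b0 := b_gt0 n0; apply: contraPP h => /not_orP[M1 M2]; apply/negP; rewrite -leNgt.
rewrite !WE// -mulrBr normrM gtr0_norm ?invr_gt0// ler_pdivrMl// mulrC.
set x := censored_km Xs Cs n w t - df X t.
set y := censored_km Xs Cs n w (q (pi t)) - df X (q (pi t)).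
pose A t := n%:R^-1 * \sum_(i < n) influence X C tau t (Xs i w, Cs i w).
have h1 : `|A t - A (q (pi t))| <= e / 3 * b n.
  by rewrite leNgt; apply/negP => h; apply: M1; exists (q (pi t)), t.
have h2 s : 0 <= s <= tau ->
    `|censored_km Xs Cs n w s - df X s - A s| <= e / 3 * b n.
  by move=> s01; rewrite leNgt; apply/negP => h; apply: M2; exists s.
have := h2 _ t01; have := h2 _ q01; rewrite -/x -/y; move: h1.
rewrite !ler_norml => /andP[a1 a2] /andP[b1 b2] /andP[c1 c2].
by apply/andP; split; lra.
Qed.

Lemma km_ldp : LDP P W lam (km_rate X C).
Proof.
have -> : km_rate X C = gauss_rate km_cov :> (skorokhod tau -> _).
  by apply/funext => phi; exact: km_rateE.
apply: (gaussian_ldp lam_gt0 lam_infty _ _ _ S_meas S_mgf W_net W_S).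
- by move=> s t _ _; exact: km_cov_sym.
- by move=> l _; exact: km_cov_psd.
- by move=> s _; exact: km_cov_cadlag.
Qed.

Let W_norm n w : (0 < n)%N -> `|W n w| = Num.sqrt n%:R / a n *
  sup [set `|censored_km Xs Cs n w x - df X x| | x in `[0, tau]].
Proof.
move=> n0; rewrite /km_deviation normrZ ger0_norm; last first.
  by rewrite divr_ge0 ?sqrtr_ge0// ltW// a_gt0.
congr (_ * _); rewrite skorokhod_normE; congr sup.
apply: eq_imagel => t /=; rewrite in_itv /= => t01; congr `|_|.
transitivity (to_skorokhod (cadlag_censored_km Xs Cs n w (tau := tau)) t -
   to_skorokhod (cadlag_df X (tau := tau)) t) => //.
by rewrite !to_skorokhodE.
Qed.

Lemma km_sup_deviation r : 0 < r ->
  (((a n ^+ 2)^-1)%:E *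
    lne (P [set w | (r <= Num.sqrt n%:R / a n *
      sup [set `|censored_km Xs Cs n w x - df X x| | x in `[0, tau] ])%R]))%E
    @[n --> \oo] -->
  (if km_sigma2 tau X C == 0 then -oo%E
   else (- (r ^+ 2 / (2 * km_sigma2 tau X C)))%:E).
Proof.
move=> r0; have mW n : measurable [set w | r <= `|W n w|].
  apply: measurable_le_set => //; apply: measurable_skorokhod_norm => // t t01.
  under eq_fun do rewrite WE//.
  apply: measurable_funM => //; apply: measurable_funB => //.
  by apply: measurable_censored_km; have /andP[] := t01.
have GB t : 0 <= t <= tau -> km_cov t t <= tail_mass^-1 ^+ 2 * tail_mass^-1.
  by move=> /andP[t0 _]; exact: km_cov_diag_le.
rewrite km_sigma2E//.
have := gaussian_sup_norm lam_gt0 lam_infty (fun s t _ _ => km_cov_sym X C tau s t)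
  (fun l _ => km_cov_psd XC Htau l) (fun s _ => km_cov_cadlag XC Htau s)
  S_meas S_mgf W_net W_S tau_ge0 GB r0 mW.
apply: cvg_trans; apply: near_eq_cvg; exists 1%N => // n /= n0.
congr (_ * lne (P _))%E; apply/seteqP.
by split=> w /=; rewrite W_norm.
Qed.

End kaplan_meier_ldp.

Theorem theorem4p4 (d : measure_display) (T : measurableType d) (R : realType)
    (P : probability T R) (X C : {RV P >-> R}) (Xs Cs : nat -> {RV P >-> R})
    (a : nat -> R) (tau : R)
    (a_gt0 : forall n, (0 < n)%N -> 0 < a n)
    (a_infty : a n @[n --> \oo] --> +oo)
    (a_small : a n / Num.sqrt n%:R @[n --> \oo] --> (0 : R))
    (X_ge0 : forall w, 0 <= X w) (C_ge0 : forall w, 0 <= C w)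
    (XC_indep : independent X C)
    (XCs_iid : iid_copies P (fun w => (X w, C w)) (fun i w => (Xs i w, Cs i w)))
    (F0 : df X 0 = 0)
    (tau_gt0 : 0 < tau)
    (Htau : (P [set w | (Num.min (X w) (C w) <= tau)%R] < 1)%E) :
  LDP P (km_deviation tau a X Xs Cs) (fun n => a n ^+ 2) (km_rate X C)
  /\
  forall r : R, 0 < r ->
    (((a n ^+ 2)^-1)%:E *
      lne (P [set w | (r <= Num.sqrt n%:R / a n *
        sup [set `|censored_km Xs Cs n w x - df X x| | x in `[0, tau] ])%R]))%E
      @[n --> \oo] -->
    (if km_sigma2 tau X C == 0 then -oo%E
     else (- (r ^+ 2 / (2 * km_sigma2 tau X C)))%:E).
Proof.
split; first exact: km_ldp.
by move=> r r0; exact: km_sup_deviation.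
Qed.
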